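(* Let $K$ and $K'$ be regular Cantor sets with Hausdorff dimensions $d$ and $d'$, respectively, such that $K$ is of class $C^2$ and non essentially affine. Let $f$ be a $C^1$ map from a neighbourhood of $K\times K'$ to $\mathbb{R}$ such that, at some point of $K\times K'$, the gradient of $f$ is not parallel to either of the two coordinate axes (i.e. both partial derivatives of $f$ are nonzero at that point). Then $$HD(f(K\times K'))=\min\{1,\,d+d'\},$$ where $HD$ denotes Hausdorff dimension.
   Context: Regular Cantor sets. Let $\mathbf{A}$ be a finite alphabet and $\Sigma\subset\mathbf{A}^{\mathbb{Z}}$ a subshift of finite type defined by a transition set $\mathcal{B}\subset\mathbf{A}^2$ (the bi-infinite sequences all of whose consecutive pairs lie in $\mathcal{B}$); $\Sigma$ is always assumed to be mixing and to use all letters of $\mathbf{A}$. For $a\in\mathbf{A}$ put $I(a)=[0,1]\times\{a\}$. Let $r\in(1,+\infty]$. A $C^r$ map $g$ is expanding of type $\Sigma$ if its domain is a finite disjoint union $\bigsqcup_{(a_0,a_1)\in\mathcal{B}}I(a_0,a_1)$, where each $I(a_0,a_1)$ is a compact subinterval of $I(a_0)$, and if for each $(a_0,a_1)\in\mathcal{B}$ the restriction of $g$ to $I(a_0,a_1)$ is a $C^r$-diffeomorphism onto $I(a_1)$ with $|Dg(t)|>1$ for every $t\in I(a_0,a_1)$. The regular Cantor set (of class $C^r$) defined by $g$ is $$K=\bigcap_{n\ge 0}g^{-n}\Big(\bigsqcup_{(a_0,a_1)\in\mathcal{B}}I(a_0,a_1)\Big).$$ A regular Cantor set without specified class is one of class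 $C^r$ for some $r>1$. The intervals $I(a)$ may equivalently be placed as disjoint compact intervals of the real line by affine identifications. $K'$ is defined in the same way by an expanding map $g'$ with its own alphabet and subshift. A regular Cantor set $K$ of class $C^2$ is non essentially affine if the expanding map $g$ which defines it cannot be $C^2$-conjugated to a map whose second derivative is identically zero on the (corresponding) Cantor set; that is, there is no $C^2$ change of coordinates $\varphi$ such that $(\varphi\circ g\circ\varphi^{-1})''=0$ at all points of $\varphi(K)$. *)

(* Defs.v *)
From HB Require Import structures.
From mathcomp Require Import all_boot all_order all_algebra.
From mathcomp Require Import all_classical all_reals all_analysis.
Set Implicit Arguments.
Unset Strict Implicit.
Unset Printing Implicit Defensive.
Import Order.TTheory GRing.Theory Num.Theory.
Import numFieldNormedType.Exports.
Local Open Scope classical_set_scope.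
Local Open Scope ring_scope.

(** * Hausdorff dimension of subsets of the line *)

Definition diam (R : realType) (U : set R) : \bar R :=
  ereal_sup [set z | exists x y, [/\ U x, U y & z = `|x - y|%:E]].

(* [0 `^ 0 = 1], so the empty set is singled out to cost [0] also when [s = 0]. *)
Definition hausdorff_cost (R : realType) (s : R) (U : set R) : \bar R :=
  if `[< U = set0 >] then 0%E else poweR (diam U) s.

(* Finite covers are included, as sequences that are eventually empty. *)
Definition hausdorff_content (R : realType) (s delta : R) (E : set R) : \bar R :=
  ereal_inf [set c | exists U : (set R)^nat,
    [/\ E `<=` \bigcup_n U n,
        forall n, (diam (U n) <= delta%:E)%E &
        c = (\sum_(0 <= n <oo) hausdorff_cost s (U n))%E]].

Definition hausdorff_measure (R : realType) (s : R) (E : set R) : \bar R :=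
  ereal_sup [set hausdorff_content s delta E | delta in [set d : R | 0 < d]].

Definition HD (R : realType) (E : set R) : \bar R :=
  ereal_inf [set s%:E | s in [set s : R | 0 <= s /\ hausdorff_measure s E = 0%E]].

(** * Calculus on a nondegenerate interval [D], one-sided at its endpoints *)

Definition quotient_in (R : realType) (f : R -> R) (x y : R) : R :=
  (f y - f x) / (y - x).

Definition derivable_in (R : realType) (D : set R) (f : R -> R) (x : R) : Prop :=
  cvg (quotient_in f x y @[y --> within D x^']).

Definition derive_in (R : realType) (D : set R) (f : R -> R) : R -> R :=
  fun x => lim (quotient_in f x y @[y --> within D x^']).

Definition derivn_in (R : realType) (D : set R) (n : nat) (f : R -> R) : R -> R :=
  iter n (derive_in D) f.

Definition Cn_in (R : realType) (D : set R) (n : nat) (f : R -> R) : Prop :=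
  (forall k x, (k < n)%N -> D x -> derivable_in D (derivn_in D k f) x) /\
  {within D, continuous (derivn_in D n f)}.

(* For [r = n + s] with [0 < s < 1], the [n]-th derivative is [s]-Hoelder. *)
Definition Cr_in (R : realType) (D : set R) (r : \bar R) (f : R -> R) : Prop :=
  (forall n, (n%:R%:E <= r)%E -> Cn_in D n f) /\
  (forall n (s : R), 0 < s < 1 -> r = (n%:R + s)%:E ->
     exists C : R, forall x y, D x -> D y ->
       `|derivn_in D n f x - derivn_in D n f y| <= C * `|x - y| `^ s).

Definition Cr_diffeo_inv (R : realType) (r : \bar R) (D E : set R)
    (f finv : R -> R) : Prop :=
  [/\ f @` D = E, forall x, D x -> finv (f x) = x,
      Cr_in D r f & Cr_in E r finv].

Definition Cr_diffeo (R : realType) (r : \bar R) (D E : set R) (f : R -> R) : Prop :=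
  exists finv, Cr_diffeo_inv r D E f finv.

Definition C1_on_open (R : realType) (U : set (R * R)) (f : R * R -> R) : Prop :=
  (forall z, U z -> differentiable f z) /\
  (forall v z, U z -> {for z, continuous ('D_v f)}).

(** * Subshifts of finite type *)

Definition topologically_mixing (T : topologicalType) (S : set T) (h : T -> T) : Prop :=
  forall U V : set T, open U -> open V -> S `&` U !=set0 -> S `&` V !=set0 ->
    exists N : nat, forall n : nat, (N <= n)%N ->
      S `&` U `&` (iter n h) @^-1` V !=set0.

Definition full_shift (A : finType) : topologicalType :=
  {ptws int -> discrete_topology A}.

Definition shift_map (A : finType) (x : full_shift A) : full_shift A :=
  fun i => x (i + 1).

Definition subshift (A : finType) (B : {set A * A}) : set (full_shift A) :=
  [set x | forall i : int, ((x i : A), (x (i + 1) : A)) \in B].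

Definition mixing_subshift (A : finType) (B : {set A * A}) : Prop :=
  (forall a : A, exists2 x, subshift B x & exists i, x i = a) /\
  topologically_mixing (subshift B) (@shift_map A).

(** * Regular Cantor sets *)

(* A point [(a, t)] of [A * R] with [0 <= t <= 1] is the point [t] of [I(a)];
   [I(a0, a1)] is [[lend a0 a1, rend a0 a1]] inside [I(a0)].  Only the values of
   [emap] on the union of the [I(a0, a1)], [(a0, a1) \in B], matter. *)
Record expanding_map (R : realType) (A : finType) (B : {set A * A})
    (r : \bar R) := ExpandingMap {
  lend : A -> A -> R ;
  rend : A -> A -> R ;
  emap : A * R -> A * R ;
  expanding_sub : forall a0 a1, (a0, a1) \in B ->
    0 <= lend a0 a1 /\ lend a0 a1 <= rend a0 a1 /\ rend a0 a1 <= 1 ;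
  expanding_disj : forall a0 a1 b1, (a0, a1) \in B -> (a0, b1) \in B ->
    a1 != b1 ->
    `[lend a0 a1, rend a0 a1] `&` `[lend a0 b1, rend a0 b1] = set0 ;
  expanding_letter : forall a0 a1 t, (a0, a1) \in B ->
    t \in `[lend a0 a1, rend a0 a1] -> (emap (a0, t)).1 = a1 ;
  expanding_diffeo : forall a0 a1, (a0, a1) \in B ->
    Cr_diffeo r `[lend a0 a1, rend a0 a1] `[0, 1] (fun t => (emap (a0, t)).2) ;
  expanding_gt1 : forall a0 a1 t, (a0, a1) \in B ->
    t \in `[lend a0 a1, rend a0 a1] ->
    1 < `|derive_in `[lend a0 a1, rend a0 a1] (fun u => (emap (a0, u)).2) t|
}.

Definition expanding_dom (R : realType) (A : finType) (B : {set A * A})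
    (r : \bar R) (g : expanding_map B r) : set (A * R) :=
  [set z | exists2 a1, (z.1, a1) \in B & z.2 \in `[lend g z.1 a1, rend g z.1 a1]].

Definition cantor_of (R : realType) (A : finType) (B : {set A * A})
    (r : \bar R) (g : expanding_map B r) : set (A * R) :=
  \bigcap_n (iter n (emap g)) @^-1` (expanding_dom g).

(* The change of coordinates is [(a, t) |-> (a, phi a t)], with inverse
   [(a, x) |-> (a, psi a x)]; it carries [I(a0, a1)] to the interval
   [phi a0 @` I(a0, a1)], on which the conjugated map is of class C^2. *)
Definition essentially_affine (R : realType) (A : finType) (B : {set A * A})
    (g : expanding_map B (2%:E : \bar R)) : Prop :=
  exists phi psi : A -> R -> R,
    (forall a, Cr_diffeo_inv 2%:E `[0, 1] (phi a @` `[0, 1]) (phi a) (psi a)) /\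
    (forall a0 a1 t, (a0, a1) \in B -> t \in `[lend g a0 a1, rend g a0 a1] ->
       cantor_of g (a0, t) ->
       derivn_in (phi a0 @` `[lend g a0 a1, rend g a0 a1]) 2
         (fun x => phi a1 (emap g (a0, psi a0 x)).2) (phi a0 t) = 0).

(* Affine identification of the [I(a)] with disjoint intervals of the line. *)
Record placement (R : realType) (A : finType) := Placement {
  offset : A -> R ;
  scale : A -> R ;
  place : A * R -> R := fun z => offset z.1 + scale z.1 * z.2 ;
  scale_neq0 : forall a, scale a != 0 ;
  place_disj : forall a b t u, a != b -> t \in `[0, 1] -> u \in `[0, 1] ->
    place (a, t) <> place (b, u)
}.

Definition regular_cantor (R : realType) (A : finType) (B : {set A * A})
    (r : \bar R) (g : expanding_map B r) (p : placement R A) : set R :=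
  place p @` cantor_of g.

(* Main.v *)
Require Import Defs.
From mathcomp Require Import all_boot all_order all_algebra.
From mathcomp Require Import all_classical all_reals all_analysis.
From mathcomp Require Import ring lra zify.
Import Order.TTheory GRing.Theory Num.Theory.
Import numFieldNormedType.Exports.
Local Open Scope classical_set_scope.
Local Open Scope ring_scope.

(* Upper bound: near a point [f] is Lipschitz, and products of cylinders of comparable
   lengths cover [K x K'] economically; a product of cylinders whose image had no good
   cover would contain a nested sequence of such products, shrinking to a point near
   which [f] is Lipschitz.

   Lower bound: for [s < d] and [s' < d'] with [s + s' < 1], the words from a letter to
   itself of a large length [n] form a finite system with weights proportional to
   [|I_w| ^ s].  A context is a map [[0, 1] -> R] of bounded distortion, such as the
   parametrization of a cylinder.  As a scale [exp (i / m)] varies, the proportion of pairs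
   of cylinders of relative size [e] of two contexts [k] and [k'] which collide under
   [exp (i / m) * k + k'] is [O(e ^ (s + s'))] on average, by transversality.
   Since [K] is not essentially affine, there are two loops [v1], [v2] whose log-derivatives
   differ by a function with a monotonicity bound.  Words built from [v1], [v2] and from
   two other words [b1], [b2] in the patterns [v1 b1 v2 b2] and [v1 b2 v2 b1] then give
   branches that are almost proportional, but by a factor different from [1]; replacing one
   pattern by the other step by step changes the scale of a context almost continuously
   while keeping its shape.  Hence all scales occur among the descendants of each context,
   and the maximum principle for the superharmonic sum of the collision kernel along the
   tree of words bounds the number of collisions for every pair of contexts.  An energy
   estimate turns this into about [theta ^ (- t0)] pairs of cylinders of size [theta x] with
   images separated by [theta x], for each [t0 < s + s'].  Near a point where both partial
   derivatives are nonzero, [f] is a small perturbation of [A x + B y]; iterating the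
   selection gives a tree of pairs of cylinders whose images force dimension [t0]. *)
Set Implicit Arguments.
Unset Strict Implicit.
Unset Printing Implicit Defensive.

(** * Finite weighted families and collision counting *)

(** Marstrand-type arguments control the projections [A x + B y] for almost every ratio [A / B],
    while here the ratio is prescribed. Dilating a context of [K] amounts to changing that ratio, so
    the nonlinearity of [K] serves to trade an average over ratios for an average over words inside
    one fixed pair of Cantor sets. A bound for typical contexts would still not be enough: the
    selection of separated pairs is iterated at every pair that it has produced, so it must hold
    with the same [theta] and the same number of pairs for all contexts. This is why contexts form a
    class closed under the branches with one distortion constant, and why the energy is bounded at
    each context by a maximum principle. Returning to one letter makes words freely concatenable, so
    that independent choices of words replace Gibbs measures; exponents below the dimension are
    still reached, because long loops have large cylinder sums. Class C^2 of [K] makes the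
    log-derivatives of its branches Lipschitz, which the comparison of twisted loops needs. No
    measure is built on the image: a cover that is too cheap is passed on from a node of a tree to
    one of its children. *)

Section FiniteDistributions.
Variable R : realType.

(* A value may occur several times; its weights then add up. *)
Definition dist (T : Type) := seq (R * T).

Definition Ed (T : Type) (d : dist T) (phi : T -> R) : R :=
  \sum_(z <- d) z.1 * phi z.2.

Definition dscale (T : Type) (c : R) (d : dist T) : dist T :=
  [seq (c * z.1, z.2) | z <- d].

Definition dbind (T U : Type) (d : dist T) (f : T -> dist U) : dist U :=
  flatten [seq dscale z.1 (f z.2) | z <- d].

Definition dnonneg (T : Type) (d : dist T) := all (fun z : R * T => 0 <= z.1) d.

Definition dprob (T : Type) (d : dist T) := dnonneg d /\ Ed d (fun=> 1) = 1.

Lemma Ed_cons (T : Type) (z : R * T) (d : dist T) phi :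
  Ed (z :: d) phi = z.1 * phi z.2 + Ed d phi.
Proof. by rewrite /Ed big_cons. Qed.

Lemma Ed_nil (T : Type) (phi : T -> R) : Ed [::] phi = 0.
Proof. by rewrite /Ed big_nil. Qed.

Lemma Ed_cat (T : Type) (d1 d2 : dist T) phi : Ed (d1 ++ d2) phi = Ed d1 phi + Ed d2 phi.
Proof. by rewrite /Ed big_cat. Qed.

Lemma Ed_scale (T : Type) c (d : dist T) phi : Ed (dscale c d) phi = c * Ed d phi.
Proof.
rewrite /Ed /dscale big_map big_distrr /=; apply: eq_bigr => z _ /=.
by rewrite mulrA.
Qed.

Lemma Ed_bind (T U : Type) (d : dist T) (f : T -> dist U) phi :
  Ed (dbind d f) phi = Ed d (fun x => Ed (f x) phi).
Proof.
elim: d => [|z d IH]; first by rewrite /dbind /= !Ed_nil.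
by rewrite /dbind /= Ed_cat -/(dbind d f) IH Ed_cons Ed_scale.
Qed.

Lemma EdD (T : Type) (d : dist T) phi psi :
  Ed d (fun x => phi x + psi x) = Ed d phi + Ed d psi.
Proof. by rewrite /Ed -big_split; apply: eq_bigr => z _; rewrite mulrDr. Qed.

Lemma EdZ (T : Type) (d : dist T) c phi : Ed d (fun x => c * phi x) = c * Ed d phi.
Proof. by rewrite /Ed big_distrr /=; apply: eq_bigr => z _; rewrite mulrCA. Qed.

Lemma Ed_sum (T : Type) (I : Type) (r : seq I) (d : dist T) (phi : I -> T -> R) :
  Ed d (fun x => \sum_(i <- r) phi i x) = \sum_(i <- r) Ed d (phi i).
Proof. by rewrite /Ed exchange_big /=; apply: eq_bigr => z _; rewrite big_distrr. Qed.

Lemma Ed_swap (T U : Type) (d : dist T) (e : dist U) (phi : T -> U -> R) :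
  Ed d (fun x => Ed e (phi x)) = Ed e (fun y => Ed d (phi^~ y)).
Proof.
rewrite /Ed; under eq_bigr do rewrite big_distrr /=.
rewrite exchange_big; apply: eq_bigr => y _; rewrite big_distrr /=.
by apply: eq_bigr => x _; rewrite mulrCA.
Qed.

Lemma eq_Ed (T : eqType) (d : dist T) phi psi :
  {in d, forall z, phi z.2 = psi z.2} -> Ed d phi = Ed d psi.
Proof. by move=> h; apply: eq_big_seq => z zd; rewrite h. Qed.

Lemma le_Ed (T : eqType) (d : dist T) phi psi : dnonneg d ->
  {in d, forall z, phi z.2 <= psi z.2} -> Ed d phi <= Ed d psi.
Proof.
move=> /allP d0 h; rewrite /Ed !big_seq; apply: ler_sum => z zd.
by apply: ler_wpM2l; [apply: d0 | apply: h].
Qed.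

Lemma Ed_cst (T : Type) (d : dist T) c : dprob d -> Ed d (fun=> c) = c.
Proof.
move=> [_ d1]; have -> : (fun _ : T => c) = (fun x : T => c * 1).
  by apply/funext => x; rewrite mulr1.
by rewrite EdZ d1 mulr1.
Qed.

Lemma dnonneg_scale (T : Type) c (d : dist T) : 0 <= c -> dnonneg d -> dnonneg (dscale c d).
Proof.
move=> c0; rewrite /dnonneg /dscale all_map; apply: sub_all => z /= z0.
exact: mulr_ge0.
Qed.

Lemma dnonneg_bind (T U : Type) (d : dist T) (f : T -> dist U) :
  dnonneg d -> (forall x, dnonneg (f x)) -> dnonneg (dbind d f).
Proof.
move=> + hf; elim: d => //= z d IH /andP[z0 d0].
by rewrite /dnonneg /dbind /= all_cat; apply/andP; split; [apply: dnonneg_scale | apply: IH].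
Qed.

Lemma dprob_bind (T U : Type) (d : dist T) (f : T -> dist U) :
  dprob d -> (forall x, dprob (f x)) -> dprob (dbind d f).
Proof.
move=> [d0 d1] hf; split; first by apply: dnonneg_bind => // x; case: (hf x).
rewrite Ed_bind; have -> : (fun x => Ed (f x) (fun=> 1)) = (fun=> 1).
  by apply/funext => x; case: (hf x).
exact: d1.
Qed.

Lemma dprob_ret (T : Type) (x : T) : dprob [:: (1, x)].
Proof. by split; rewrite /dnonneg /= ?ler01 // Ed_cons Ed_nil /= mulr1 addr0. Qed.

Lemma mem_dscale (T : eqType) c (d : dist T) y : y \in dscale c d ->
  exists2 z, z \in d & y = (c * z.1, z.2).
Proof. by move=> /mapP[z zd ->]; exists z. Qed.

Lemma mem_dbind (T U : eqType) (d : dist T) (f : T -> dist U) y : y \in dbind d f ->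
  exists z z', [/\ z \in d, z' \in f z.2 & y.2 = z'.2].
Proof.
move=> /flatten_mapP[z zd /mem_dscale[z' z'f ->]].
by exists z, z'.
Qed.

(** Jensen's inequality: the tangent line of [expR] at the mean [q] lies below [expR], and averaging
    it gives [expR q]. *)
Lemma expR_Ed (T : eqType) (d : dist T) phi : dprob d ->
  expR (Ed d phi) <= Ed d (fun x => expR (phi x)).
Proof.
move=> pd; set q := Ed d phi.
have h x : expR q * (1 - q) + expR q * phi x <= expR (phi x).
  rewrite -mulrDr -[in leRHS](subrK q (phi x)) expRD mulrC ler_wpM2r ?expR_ge0 //.
  by apply: le_trans (expR_ge1Dx _); rewrite addrAC addrA addrAC.
have -> : expR q = Ed d (fun x => expR q * (1 - q) + expR q * phi x).
  rewrite (EdD _ (fun=> _)) Ed_cst // (_ : Ed d _ = expR q * q); last exact: EdZ.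
  by rewrite -mulrDr subrK mulr1.
by apply: le_Ed => //; case: pd.
Qed.

Section Collisions.
Variables (T J : eqType) (idx : T -> J).

(** Weight of the pairs of independent draws that fall on the same index. By [collision_mass] it is
    the inner product of the two vectors of masses, a discrete energy. *)
Definition collision (d1 d2 : dist T) : R :=
  Ed d1 (fun x => Ed d2 (fun y => (idx x == idx y)%:R)).

Definition mass (d : dist T) j : R := Ed d (fun x => (idx x == j)%:R).

Lemma collision_mass (S : seq J) d1 d2 : uniq S ->
  {in d1, forall z, idx z.2 \in S} ->
  collision d1 d2 = \sum_(j <- S) mass d1 j * mass d2 j.
Proof.
move=> uS hS; transitivity (Ed d1 (fun x => \sum_(j <- S) mass d2 j * (idx x == j)%:R)).
  apply: eq_Ed => z zd; rewrite (bigD1_seq (idx z.2)) ?hS //= eqxx mulr1.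
  rewrite big1 ?addr0; last by move=> j; rewrite eq_sym => /negPf ->; rewrite mulr0.
  by apply: eq_Ed => y _; rewrite eq_sym.
rewrite Ed_sum; apply: eq_bigr => j _.
by rewrite EdZ mulrC.
Qed.

(** AM-GM on the masses, index by index. Mixed energies are thereby bounded by diagonal ones, to
    which an induction along a tree applies. *)
Lemma collision_amgm d1 d2 :
  collision d1 d2 <= (collision d1 d1 + collision d2 d2) / 2.
Proof.
pose S := undup ([seq idx z.2 | z <- d1] ++ [seq idx z.2 | z <- d2]).
have uS : uniq S by rewrite undup_uniq.
have h1 : {in d1, forall z, idx z.2 \in S}.
  by move=> z zd; rewrite mem_undup mem_cat map_f.
have h2 : {in d2, forall z, idx z.2 \in S}.
  by move=> z zd; rewrite mem_undup mem_cat (map_f (fun z => idx z.2) zd) orbT.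
rewrite !(collision_mass _ uS) // -big_split /= ler_pdivlMr // mulr_suml.
apply: ler_sum => j _; have := sqr_ge0 (mass d1 j - mass d2 j).
set a := mass d1 j; set b := mass d2 j; nra.
Qed.

Lemma collision_scale w d :
  collision (dscale w d) (dscale w d) = w ^+ 2 * collision d d.
Proof.
rewrite /collision Ed_scale expr2 -mulrA; congr (_ * _); rewrite -[RHS]EdZ.
by apply: eq_Ed => c _; rewrite Ed_scale.
Qed.

Lemma collision_bind (U : eqType) (d : dist U) f :
  collision (dbind d f) (dbind d f) =
  Ed d (fun c => Ed d (fun c' => collision (f c) (f c'))).
Proof.
rewrite /collision Ed_bind; apply: eq_Ed => c _.
rewrite [RHS](Ed_swap d (f c.2) (fun c' x => Ed (f c') (fun y => (idx x == idx y)%:R))).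
by apply: eq_Ed => x _; rewrite Ed_bind.
Qed.

Lemma sqr_sum_seq (S : seq J) (a : J -> R) :
  (\sum_(j <- S) a j) ^+ 2 <= (size S)%:R * \sum_(j <- S) a j ^+ 2.
Proof.
elim: S => [|j S IH]; first by rewrite !big_nil mul0r expr0n.
rewrite !big_cons /=; move: IH; set s := \sum_(_ <- _) _; set q := \sum_(_ <- _) _.
case: S @s @q => [|j' S] s q IH.
  by rewrite /s /q !big_nil !addr0 mul1r.
set n : R := (size (j' :: S))%:R in IH *.
have n0 : 0 < n by rewrite /n ltr0n.
have -> : (size (j' :: S)).+1%:R = n + 1 :> R by rewrite /n -natr1.
(* Inductive step of Cauchy-Schwarz: after multiplication by [n], the cross term is controlled by
   the square of [n * a j - s]. *)
have : n * (2 * a j * s) <= n * (n * a j ^+ 2 + q).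
  have := sqr_ge0 (n * a j - s); nra.
rewrite ler_pM2l //; nra.
Qed.

(** Second moment method: Cauchy-Schwarz over the indices that are hit, so that a small energy
    forces many distinct indices. *)
Lemma count_collision d : (Ed d (fun=> 1)) ^+ 2 <=
  (size (undup [seq idx z.2 | z <- d]))%:R * collision d d.
Proof.
set S := undup _; have uS : uniq S by rewrite undup_uniq.
have hS : {in d, forall z, idx z.2 \in S} by move=> z zd; rewrite mem_undup map_f.
rewrite (collision_mass _ uS) //.
have -> : Ed d (fun=> 1) = \sum_(j <- S) mass d j.
  rewrite -Ed_sum; apply: eq_Ed => z zd; rewrite (bigD1_seq (idx z.2)) ?hS //= eqxx.
  by rewrite big1 ?addr0 // => j; rewrite eq_sym => /negPf ->.
by apply: le_trans (sqr_sum_seq _ _) _.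
Qed.

End Collisions.

(* Trees whose level-[i] nodes [v] have children distributed as [ch i v].  Leaves are
   weighted by [expR ((1 - D / m) / 2)] at every ancestor: as [y * expR (1 - y) <= 1]
   this keeps the collision energy below the product of the [m i], whereas Jensen's
   inequality bounds the total mass from below in terms of the mean values of [D]. *)
Section LeafCount.
Variables (T J : eqType) (idx : T -> J) (ch : nat -> T -> dist T).
Variables (m : nat -> R) (close : nat -> T -> T -> bool) (N : nat).
Hypothesis ch_prob : forall i v, dprob (ch i v).
Hypothesis m_gt0 : forall i, 0 < m i.

Definition crowding i v : R :=
  Ed (ch i v) (fun c => Ed (ch i v) (fun c' => (close i c c')%:R)).

Fixpoint leaves (i n : nat) (v : T) : dist T :=
  if n is n'.+1 then
    dscale (expR ((1 - crowding i v / m i) / 2)) (dbind (ch i v) (leaves i.+1 n'))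
  else [:: (1, v)].

(** Logarithm of the lower bound that Jensen's inequality gives for the mass of the leaves: the
    exponents of the weights, each averaged over its level. *)
Fixpoint excess (i n : nat) (v : T) : R :=
  if n is n'.+1 then (1 - crowding i v / m i) / 2 + Ed (ch i v) (excess i.+1 n')
  else 0.

Variable P : nat -> T -> Prop.
Hypothesis P_ch : forall i v z, P i v -> z \in ch i v -> P i.+1 z.2.
Hypothesis separated : forall i n v c c' x y, (i.+1 + n = N)%N -> P i v ->
  c \in ch i v -> c' \in ch i v -> ~~ close i c.2 c'.2 ->
  x \in leaves i.+1 n c.2 -> y \in leaves i.+1 n c'.2 -> idx x.2 != idx y.2.

Lemma mem_leavesS i n v z : z \in leaves i n.+1 v ->
  exists c z', [/\ c \in ch i v, z' \in leaves i.+1 n c.2 & z.2 = z'.2].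
Proof. by move=> /mem_dscale[y /mem_dbind[c [z' [? ? e]]] ->]; exists c, z'. Qed.

Lemma leaves_mass i n v : expR (excess i n v) <= Ed (leaves i n v) (fun=> 1).
Proof.
elim: n i v => [|n IH] i v /=; first by rewrite expR0 Ed_cons Ed_nil /= mulr1 addr0.
rewrite Ed_scale Ed_bind expRD ler_wpM2l ?expR_ge0 //.
apply: le_trans (expR_Ed _ (ch_prob i v)) _.
by apply: le_Ed => [|z _]; [case: (ch_prob i v) | apply: IH].
Qed.

Lemma leaves_collision i n v : (i + n = N)%N -> P i v ->
  collision idx (leaves i n v) (leaves i n v) <= \prod_(i <= j < N) m j.
Proof.
elim: n i v => [|n IH] i v hN Pv.
  rewrite -hN addn0 big_geq //= /collision !Ed_cons !Ed_nil /= eqxx.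
  by rewrite !mulr1 !addr0.
have iN : (i < N)%N by rewrite -hN addnS ltnS leq_addr.
rewrite big_ltn //=; set w := expR _; set Q := \prod_(_ <= _ < _) _.
have hN' : (i.+1 + n = N)%N by rewrite -hN addnS.
have d0 : dnonneg (ch i v) by case: (ch_prob i v).
have Q0 : 0 <= Q by apply: prodr_ge0 => j _; apply/ltW/m_gt0.
pose L := leaves i.+1 n.
have -> : collision idx (dscale w (dbind (ch i v) L)) (dscale w (dbind (ch i v) L)) =
    w ^+ 2 * Ed (ch i v) (fun c => Ed (ch i v) (fun c' => collision idx (L c) (L c'))).
  by rewrite collision_scale collision_bind.
have hE : Ed (ch i v) (fun c => Ed (ch i v) (fun c' => collision idx (L c) (L c'))) <=
    Q * crowding i v.
  rewrite /crowding -EdZ; apply: le_Ed => // c cin; rewrite -EdZ.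
  apply: le_Ed => // c' c'in.
  (* Children that are not [close] have no leaf index in common. For close ones AM-GM reduces to the
     energies of single children, at most [Q] by induction. *)
  case: (boolP (close i c.2 c'.2)) => [_|ncl].
    rewrite mulr1; apply: le_trans (collision_amgm _ _ _) _.
    have := IH i.+1 c.2 hN' (P_ch Pv cin); have := IH i.+1 c'.2 hN' (P_ch Pv c'in).
    by rewrite -/L -/Q; lra.
  rewrite mulr0 /collision [leLHS](_ : _ = 0) //.
  rewrite /Ed big_seq big1 // => x xin; rewrite big_seq big1 ?mulr0 // => y yin.
  by rewrite (negPf (separated hN' Pv cin c'in ncl xin yin)) mulr0.
apply: le_trans (_ : w ^+ 2 * (Q * crowding i v) <= _).
  by rewrite ler_wpM2l // sqr_ge0.
rewrite mulrCA [m i * Q]mulrC ler_wpM2l // expr2 -expRD -splitr.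
have hy : expR (1 - crowding i v / m i) * (crowding i v / m i) <= 1.
  set y := crowding i v / m i.
  have -> : 1 - y = - (y - 1) by rewrite opprB.
  rewrite expRN ler_pdivrMl ?expR_gt0 // mulr1.
  by apply: le_trans (expR_ge1Dx _); rewrite addrC subrK.
by move: hy; rewrite mulrA ler_pdivrMr ?m_gt0 // mul1r.
Qed.

Lemma leaf_count v : P 0 v -> 0 <= excess 0 N v ->
  1 <= (size (undup [seq idx z.2 | z <- leaves 0 N v]))%:R * \prod_(0 <= j < N) m j.
Proof.
move=> Pv e0; have := leaves_collision (add0n N) Pv.
set d := leaves 0 N v => hc.
have h1 : 1 <= Ed d (fun=> 1).
  by apply: le_trans (leaves_mass _ _ _); rewrite -expR0 ler_expR.
have := count_collision idx d; move=> hcc.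
apply: le_trans (_ : (Ed d (fun=> 1)) ^+ 2 <= _); first by rewrite expr2; nra.
by apply: le_trans hcc _; rewrite ler_wpM2l.
Qed.

End LeafCount.

End FiniteDistributions.

(** * Transfer operators and steerable systems *)

Section TransferOperator.
Variables (R : realType) (V : finType) (p : V -> R) (S : Type) (act : V -> S -> S).

Fixpoint transfer (n : nat) (phi : S -> R) (s : S) : R :=
  if n is n'.+1 then \sum_v p v * transfer n' phi (act v s) else phi s.

(** Truncated Green potential: the expected sum of [phi] over the first [J] states of the random
    walk driven by [p]. *)
Fixpoint potential (J : nat) (phi : S -> R) (s : S) : R :=
  if J is J'.+1 then phi s + \sum_v p v * potential J' phi (act v s) else 0.

Fixpoint acts (w : seq V) (s : S) : S :=
  if w is v :: w' then acts w' (act v s) else s.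

Definition weight (w : seq V) : R := \prod_(v <- w) p v.

Hypothesis p_gt0 : forall v, 0 < p v.
Hypothesis p_sum : \sum_v p v = 1.

Lemma weight_gt0 w : 0 < weight w.
Proof. by rewrite /weight; apply: prodr_gt0. Qed.

Lemma weight_lbound : exists2 c : R, 0 < c & forall n w, size w = n -> c ^+ n <= weight w.
Proof.
have p1 v : p v <= 1.
  by rewrite -p_sum (bigD1 v) //= lerDl sumr_ge0 // => u _; apply/ltW.
exists (\prod_v p v) => [|n w <-]; first exact: prodr_gt0.
elim: w => [|v w IH]; first by rewrite expr0 /weight big_nil.
have P0 : 0 <= \prod_u p u by apply: prodr_ge0 => u _; apply/ltW.
rewrite /weight big_cons exprS; apply: ler_pM => //; first exact: exprn_ge0.
rewrite (bigD1 v) //= ler_piMr ?(ltW (p_gt0 v)) //.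
by apply: prodr_ile1 => u _; rewrite (ltW (p_gt0 u)) p1.
Qed.

Lemma average_le (a : V -> R) c : (forall v, a v <= c) -> \sum_v p v * a v <= c.
Proof.
move=> h; rewrite -[leRHS]mul1r -p_sum mulr_suml; apply: ler_sum => v _.
by rewrite ler_wpM2l // ltW.
Qed.

Section Invariant.
Variable P : S -> Prop.
Hypothesis P_act : forall v s, P s -> P (act v s).

Lemma P_acts w s : P s -> P (acts w s).
Proof. by elim: w s => //= v w IH s Ps; apply/IH/P_act. Qed.

Lemma transfer_le n phi psi s : (forall s, P s -> phi s <= psi s) -> P s ->
  transfer n phi s <= transfer n psi s.
Proof.
move=> h; elim: n s => [|n IH] s Ps /=; first exact: h.
by apply: ler_sum => v _; rewrite ler_wpM2l ?(ltW (p_gt0 _)) //; apply/IH/P_act.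
Qed.

Lemma transfer_ub n phi c s : (forall s, P s -> phi s <= c) -> P s ->
  transfer n phi s <= c.
Proof.
move=> h; elim: n s => [|n IH] s Ps /=; first exact: h.
by apply: average_le => v; apply/IH/P_act.
Qed.

Lemma transfer_ge0 n phi s : (forall s, P s -> 0 <= phi s) -> P s ->
  0 <= transfer n phi s.
Proof.
move=> h; elim: n s => [|n IH] s Ps /=; first exact: h.
by apply: sumr_ge0 => v _; rewrite mulr_ge0 ?(ltW (p_gt0 _)) //; apply/IH/P_act.
Qed.

Lemma potential_ge0 J phi s : (forall s, P s -> 0 <= phi s) -> P s ->
  0 <= potential J phi s.
Proof.
move=> h; elim: J s => [|J IH] s Ps //=; apply: addr_ge0; first exact: h.
by apply: sumr_ge0 => v _; rewrite mulr_ge0 ?(ltW (p_gt0 _)) //; apply/IH/P_act.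
Qed.

Lemma potential_mono J J' phi s : (forall s, P s -> 0 <= phi s) -> P s ->
  (J <= J')%N -> potential J phi s <= potential J' phi s.
Proof.
move=> h; elim: J J' s => [|J IH] J' s Ps JJ' /=; first exact: potential_ge0.
case: J' JJ' => // J' JJ' /=; rewrite lerD2l; apply: ler_sum => v _.
by rewrite ler_wpM2l ?(ltW (p_gt0 _)) //; apply: IH => //; apply: P_act.
Qed.

(** Meant for contexts far above the window where [phi] lives: their potential is harmonic for [n]
    steps. *)
Lemma potential_transfer n J phi s :
  (forall w, (size w < n)%N -> phi (acts w s) = 0) ->
  potential (n + J) phi s = transfer n (potential J phi) s.
Proof.
elim: n s => [|n IH] s h //=.
rewrite (h [::]) // add0r; apply: eq_bigr => v _; rewrite IH // => w hw.
exact: (h (v :: w)).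
Qed.

Lemma potential_stable J phi s : (forall w, size w = J -> phi (acts w s) = 0) ->
  potential J.+1 phi s = potential J phi s.
Proof.
elim: J s => [|J IH] s h /=.
  by rewrite (h [::]) // big1 ?addr0 // => v _; rewrite mulr0.
congr (_ + _); apply: eq_bigr => v _; rewrite -/(potential J.+1 phi _) IH // => w hw.
by apply: (h (v :: w)); rewrite /= hw.
Qed.

(** Green potentials are superharmonic. The truncation does no harm because [phi] vanishes on
    generation [J], so that the potentials of the children do not change when [J] is lowered by
    one. *)
Lemma potential_superharmonic J phi s : (forall w, size w = J -> phi (acts w s) = 0) ->
  (forall s, P s -> 0 <= phi s) -> P s ->
  \sum_v p v * potential J phi (act v s) <= potential J phi s.
Proof.
move=> + phi0; case: J => [|J] h Ps.
  by rewrite big1 // => v _; rewrite mulr0.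
rewrite [leRHS]/= (eq_bigr (fun v => p v * potential J phi (act v s))); last first.
  move=> v _; rewrite potential_stable // => w hw.
  by apply: (h (v :: w)); rewrite /= hw.
by rewrite lerDr phi0.
Qed.

Lemma transfer_words_ub n phi s c : (forall w, size w = n -> phi (acts w s) <= c) ->
  transfer n phi s <= c.
Proof.
elim: n s => [|n IH] s h; first exact: (h [::]).
by apply: average_le => v; apply: IH => w hw; apply: (h (v :: w)); rewrite /= hw.
Qed.

(** Quantitative maximum principle: one descendant below the common bound [c] pulls the average down
    by its weight times its deficit. *)
Lemma transfer_word n phi s c w : (forall w, size w = n -> phi (acts w s) <= c) ->
  size w = n -> transfer n phi s <= c - weight w * (c - phi (acts w s)).
Proof.
elim: n s w => [|n IH] s w h; first by move/size0nil => -> /=; rewrite /weight big_nil; lra.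
case: w => // v w [hw] /=; rewrite (bigD1 v) //= /weight big_cons -/(weight w).
have h1 : transfer n phi (act v s) <= c - weight w * (c - phi (acts w (act v s))).
  by apply: IH => // w' hw'; apply: (h (v :: w')); rewrite /= hw'.
have h2 : \sum_(u | u != v) p u * transfer n phi (act u s) <= \sum_(u | u != v) p u * c.
  apply: ler_sum => u _; rewrite ler_wpM2l ?(ltW (p_gt0 u)) //.
  by apply: transfer_words_ub => w' hw'; apply: (h (u :: w')); rewrite /= hw'.
have : \sum_(u | u != v) p u * c = (1 - p v) * c.
  by rewrite -mulr_suml -p_sum [in RHS](bigD1 v) //= [p v + _]addrC addrK.
by have := p_gt0 v; nra.
Qed.

Section Window.
Variables (sz : S -> R) (lam lo hi : R) (nw : nat).
Hypothesis lam_ge0 : 0 <= lam.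
Hypothesis lam_le1 : lam <= 1.
Hypothesis sz_ge0 : forall s, P s -> 0 <= sz s.
Hypothesis sz_act : forall v s, P s -> sz (act v s) <= lam * sz s.
Hypothesis lam_nw : lam ^+ nw * hi < lo.

(** Each step shrinks [sz] by the factor [lam], so a path meets the window at most [nw] times, and
    each visit costs at most [b]. The bound is therefore independent of [J]. *)
Lemma potential_bound J phi b s : 0 <= b ->
  (forall s, P s -> lo <= sz s <= hi -> phi s <= b) ->
  (forall s, P s -> ~~ (lo <= sz s <= hi) -> phi s <= 0) -> P s ->
  potential J phi s <= b * nw%:R.
Proof.
move=> b0 hin hout.
have small n : forall J s, P s -> lam ^+ n * sz s < lo -> potential J phi s <= b * n%:R.
  elim: n => [|n IH] K t Pt.
    rewrite expr0 mul1r mulr0; elim: K t Pt => [|K IHK] t Pt hlo //=.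
    have tl : phi t <= 0 by apply: hout => //; rewrite leNgt hlo.
    have : \sum_v p v * potential K phi (act v t) <= 0; last by lra.
    apply: average_le => v; apply: IHK; first exact: P_act.
    apply: le_lt_trans (sz_act v Pt) _; apply: le_lt_trans hlo.
    by rewrite ler_piMl ?sz_ge0.
  move=> hlo; case: K => [|K] /=; first by rewrite mulr_ge0.
  have h1 : phi t <= b.
    by case: (boolP (lo <= sz t <= hi)) => h; [apply: hin|apply: le_trans b0; apply: hout].
  have h2 : \sum_v p v * potential K phi (act v t) <= b * n%:R.
    apply: average_le => v; apply: IH; first exact: P_act.
    apply: le_lt_trans hlo; rewrite exprSr -mulrA ler_wpM2l ?exprn_ge0 //.
    exact: sz_act.
  by rewrite -natr1; lra.
elim: J s => [|J IH] s Ps /=; first by rewrite mulr_ge0.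
(* Above the window nothing is collected, and the walk goes down one step. Once [sz s <= hi], at
   most [nw] steps are left before the window is passed. *)
have [hs|hs] := leP (sz s) hi.
  apply: (small nw J.+1 s Ps); apply: le_lt_trans lam_nw.
  by rewrite ler_wpM2l ?exprn_ge0.
have h1 : phi s <= 0 by apply: hout => //; rewrite [sz s <= hi]leNgt hs andbF.
have : \sum_v p v * potential J phi (act v s) <= b * nw%:R; last by lra.
by apply: average_le => v; apply/IH/P_act.
Qed.

End Window.
End Invariant.

Lemma transfer_sum n (I : Type) (r : seq I) (phi : I -> S -> R) s :
  transfer n (fun s => \sum_(i <- r) phi i s) s = \sum_(i <- r) transfer n (phi i) s.
Proof.
elim: n s => [|n IH] s //=; under eq_bigr do rewrite IH big_distrr /=.
by rewrite exchange_big.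
Qed.

Lemma transferZ n c phi s : transfer n (fun s => c * phi s) s = c * transfer n phi s.
Proof.
elim: n s => [|n IH] s //=; rewrite big_distrr /=; apply: eq_bigr => v _.
by rewrite IH mulrCA.
Qed.

Lemma potential_sum J (I : Type) (r : seq I) (phi : I -> S -> R) s :
  potential J (fun s => \sum_(i <- r) phi i s) s = \sum_(i <- r) potential J (phi i) s.
Proof.
elim: J s => [|J IH] s /=; first by rewrite big1.
rewrite big_split /=; congr (_ + _); under eq_bigr do rewrite IH big_distrr /=.
by rewrite exchange_big.
Qed.

Lemma potentialB J phi psi s :
  potential J (fun s => phi s - psi s) s = potential J phi s - potential J psi s.
Proof.
elim: J s => [|J IH] s /=; first by rewrite subr0.
under eq_bigr do rewrite IH mulrBr.
by rewrite sumrB; lra.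
Qed.

End TransferOperator.

(** Potentials are transported by a semiconjugacy [g]. This compares two contexts moved by the same
    letters, and a context with its dilations. *)
Lemma potential_map (R : realType) (V : finType) (p : V -> R) (S S' : Type)
    (act : V -> S -> S) (act' : V -> S' -> S') (g : S -> S') J phi s :
  (forall v s, act' v (g s) = g (act v s)) ->
  potential p act' J phi (g s) = potential p act J (phi \o g) s.
Proof.
move=> h; elim: J s => [|J IH] s //=; congr (_ + _); apply: eq_bigr => v _.
by rewrite h IH.
Qed.

Section Systems.
Variable R : realType.

Definition width (k : R -> R) : R := `|k 1 - k 0|.

(* [ctx] is a class of embeddings of [[0, 1]] of bounded distortion, stable under
   precomposition by the branches and under dilation.  By [wt_le] the weights are
   adapted to the exponent [sdim] uniformly over all contexts. *)
Record system := System {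
  letter : finType ;
  br : letter -> R -> R ;
  wt : letter -> R ;
  ctx : (R -> R) -> Prop ;
  sdim : R ;
  cmax : R ;
  cmin : R ;
  cgap : R ;
  br01 : forall v x, 0 <= x <= 1 -> 0 <= br v x <= 1 ;
  ctx_br : forall k v, ctx k -> ctx (k \o br v) ;
  ctx_scale : forall k c, 0 < c -> ctx k -> ctx (fun x => c * k x) ;
  width_gt0 : forall k, ctx k -> 0 < width k ;
  ctx_width : forall k x y, ctx k -> 0 <= x <= 1 -> 0 <= y <= 1 ->
    `|k x - k y| <= width k ;
  cmin_gt0 : 0 < cmin ;
  cmin_le1 : cmin <= 1 ;
  cmax_gt0 : 0 < cmax ;
  cmax_lt1 : cmax < 1 ;
  width_le : forall k v, ctx k -> width (k \o br v) <= cmax * width k ;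
  width_ge : forall k v, ctx k -> cmin * width k <= width (k \o br v) ;
  cgap_gt0 : 0 < cgap ;
  ctx_gap : forall k u v x y, ctx k -> u != v -> 0 <= x <= 1 -> 0 <= y <= 1 ->
    cgap * width k <= `|k (br u x) - k (br v y)| ;
  wt_gt0 : forall v, 0 < wt v ;
  wt_sum : \sum_v wt v = 1 ;
  sdim_ge0 : 0 <= sdim ;
  wt_le : forall k v, ctx k ->
    wt v * width k `^ sdim <= width (k \o br v) `^ sdim
}.

Definition step (s : system) (v : letter s) (k : R -> R) : R -> R := k \o br v.
Definition tr (s : system) n phi k := transfer (@wt s) (@step s) n phi k.
Definition descend (s : system) (w : seq (letter s)) (k : R -> R) := acts (@step s) w k.
Definition dilate (c : R) (k : R -> R) : R -> R := fun x => c * k x.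

(** Only increments are compared, so translates count as equal, and the error is relative, so it is
    inherited by compositions with the same branches. *)
Definition relclose (delta : R) (k1 k2 : R -> R) : Prop :=
  forall x y, 0 <= x <= 1 -> 0 <= y <= 1 ->
    `|(k1 x - k1 y) - (k2 x - k2 y)| <= delta * `|k1 x - k1 y|.

(* All the dilations of a single context by factors in [[1, e]] occur, up to a small
   relative error, among the descendants of [k] at a common generation. *)
Definition steerable (s : system) : Prop :=
  forall m delta, (0 < m)%N -> 0 < delta -> exists n, forall k, ctx s k ->
    exists2 k0, ctx s k0 & forall j, (j < m)%N -> exists2 w : seq (letter s),
      size w = n & relclose delta (dilate (expR (j%:R / m%:R)) k0) (descend w k).

Section OneSystem.
Variable s : system.

Lemma ctx_step (v : letter s) k : ctx s k -> ctx s (step v k).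
Proof. exact: ctx_br. Qed.

Lemma ctx_descend (w : seq (letter s)) k : ctx s k -> ctx s (descend w k).
Proof. by apply: P_acts => v k'; apply: ctx_step. Qed.

Lemma width_descend_ge (w : seq (letter s)) k : ctx s k -> cmin s ^+ size w * width k <= width (descend w k).
Proof.
elim: w k => [|v w IH] k ck /=; first by rewrite expr0 mul1r.
apply: le_trans (IH _ (ctx_step v ck)); rewrite exprSr -mulrA.
by rewrite ler_wpM2l ?exprn_ge0 ?(ltW (cmin_gt0 s)) // width_ge.
Qed.

Lemma width_descend_le (w : seq (letter s)) k : ctx s k -> width (descend w k) <= cmax s ^+ size w * width k.
Proof.
elim: w k => [|v w IH] k ck /=; first by rewrite expr0 mul1r.
apply: le_trans (IH _ (ctx_step v ck)) _; rewrite exprSr -mulrA.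
by rewrite ler_wpM2l ?exprn_ge0 ?(ltW (cmax_gt0 s)) // width_le.
Qed.

Lemma descend01 w x : 0 <= x <= 1 -> 0 <= descend (s := s) w id x <= 1.
Proof.
have h : forall w k, (forall x, 0 <= x <= 1 -> 0 <= k x <= 1) ->
   forall x, 0 <= x <= 1 -> 0 <= descend (s := s) w k x <= 1.
  by elim=> [|v w' IH] k hk //= y hy; apply: IH => // z hz; apply/hk/br01.
exact: h.
Qed.

Lemma descend_comp w k : descend (s := s) w k = k \o descend (s := s) w id.
Proof.
elim: w k => [|v w IH] k //; rewrite -[LHS]/(descend w (step v k)) IH.
by rewrite [descend (v :: w) id](IH (step v id)).
Qed.

(** Ball condition of exponent [sdim s] for the random point obtained from [0] by [n] branches. By
    induction: a ball that is small against the gaps meets one branch only, and [wt_le] is what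
    passes from the width of that branch to the width of [k]. *)
Lemma frostman : exists2 C : R, 1 <= C & forall n k (c r : R), ctx s k ->
  cmax s ^+ n * width k <= r ->
  tr s n (fun k : R -> R => (`|k 0 - c| <= r)%R%:R) k <= C * (r / width k) `^ sdim s.
Proof.
pose d := sdim s; have d0 : 0 <= d := sdim_ge0 s.
have g0 := cgap_gt0 s.
(* A ball that is not small against the gaps is estimated trivially by [1]; with this constant the
   right-hand side is then at least [1]. *)
pose C := Num.max 1 ((4 / cgap s) `^ d).
have C1 : 1 <= C by rewrite le_max lexx.
have CE : (4 / cgap s) `^ d <= C by rewrite le_max lexx orbT.
exists C => // n; elim: n => [|n IH] k c r ck hr.
  have w0 := width_gt0 ck.
  apply: le_trans (_ : 1 <= _); first by rewrite /tr /= lern1 leq_b1.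
  have h : 1 <= (r / width k) `^ d.
    rewrite -[leLHS](powRr0 (r / width k)) // ler_powR //.
    by rewrite ler_pdivlMr // mul1r; rewrite expr0 mul1r in hr.
  by rewrite -[leLHS]mulr1 ler_pM.
have w0 := width_gt0 ck.
have r0 : 0 < r.
  by apply: lt_le_trans hr; rewrite mulr_gt0 // exprn_gt0 // cmax_gt0.
have tr1 m k' : tr s m (fun k0 : R -> R => (`|k0 0 - c| <= r)%R%:R) k' <= 1.
  apply: (@transfer_ub _ _ _ _ _ (@wt_gt0 s) (@wt_sum s) (fun=> True)) => // t _.
  by rewrite lern1 leq_b1.
have [big|small] := leP (cgap s * width k) (4 * r).
  apply: le_trans (tr1 _ _) _; apply: le_trans (_ : C * (cgap s / 4) `^ d <= _).
    rewrite -[leLHS](_ : (4 / cgap s) `^ d * (cgap s / 4) `^ d = 1).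
      by rewrite ler_wpM2r ?powR_ge0.
    rewrite -powRM ?divr_ge0 ?(ltW g0) // mulrA divfK ?gt_eqF // divff ?powR1 //.
  rewrite ler_wpM2l //; first by apply: le_trans C1.
  rewrite ge0_ler_powR ?nnegrE ?divr_ge0 ?(ltW g0) ?(ltW r0) ?(ltW w0) //.
  by rewrite ler_pdivlMr // mulrAC ler_pdivrMr // [leRHS]mulrC.
(* the ball meets the image of at most one branch *)
case: (pselect (exists v : letter s, tr s n (fun k : R -> R => (`|k 0 - c| <= r)%R%:R) (step v k) != 0)); last first.
  move=> h; rewrite /tr /= big1 ?mulr_ge0 ?powR_ge0 ?(le_trans _ C1) // => v _.
  case: (eqVneq (tr s n (fun k : R -> R => (`|k 0 - c| <= r)%R%:R) (step v k)) 0) => [|h'].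
    by rewrite /tr => ->; rewrite mulr0.
  by case: h; exists v.
(* A nonzero average forces the ball to contain a point of the image of the branch [v]. *)
have meets (v : letter s) m : forall k', (forall x, 0 <= x <= 1 -> exists2 y, 0 <= y <= 1 & k' x = k (br v y)) ->
    tr s m (fun k : R -> R => (`|k 0 - c| <= r)%R%:R) k' != 0 ->
    exists2 y, 0 <= y <= 1 & `|k (br v y) - c| <= r.
  elim: m => [|m IHm] k' hk'; rewrite /tr /=.
    have [y hy ->] := hk' 0 ltac:(by rewrite lexx ler01).
    by case: (boolP (_ <= r)) => [h _|]; [exists y | rewrite eqxx].
  move=> /eqP hne; apply: contrapT => hno; apply: hne; rewrite big1 // => u _.
  have := IHm (step u k'); rewrite /tr; case: eqVneq => [-> _|_ H]; first by rewrite mulr0.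
  case: hno; apply: H => // x hx; have [y hy e] := hk' _ (br01 u hx); by exists y.
move=> [v hv].
have [y hy hyc] : exists2 y, 0 <= y <= 1 & `|k (br v y) - c| <= r.
  by apply: (meets v n (step v k)) => // x hx; exists x.
rewrite /tr /= (bigD1 v) //= big1 ?addr0; last first.
  move=> u uv; case: (eqVneq (tr s n (fun k : R -> R => (`|k 0 - c| <= r)%R%:R) (step u k)) 0) => [|h'].
    by rewrite /tr => ->; rewrite mulr0.
  have [z hz hzc] : exists2 y, 0 <= y <= 1 & `|k (br u y) - c| <= r.
    by apply: (meets u n (step u k)) => // x hx; exists x.
  have := ctx_gap ck uv hz hy.
  have : `|k (br u z) - k (br v y)| <= r + r.
    apply: le_trans (lerD hzc hyc).
    by rewrite -[_ - k (br v y)](subrKA c) [`|k (br v y) - c|]distrC ler_normD.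
  by move: small; lra.
have cv := ctx_step v ck; have wv := width_gt0 cv.
have hIH : tr s n (fun k : R -> R => (`|k 0 - c| <= r)%R%:R) (step v k) <= C * (r / width (step v k)) `^ d.
  apply: IH => //; apply: le_trans hr; rewrite exprSr -mulrA.
  by rewrite ler_wpM2l ?exprn_ge0 ?(ltW (cmax_gt0 s)) // width_le.
apply: le_trans (_ : wt v * (C * (r / width (step v k)) `^ d) <= _).
  by rewrite ler_wpM2l ?(ltW (wt_gt0 v)).
rewrite mulrCA ler_wpM2l ?(le_trans ler01 C1) //.
rewrite !powRM ?invr_ge0 ?(ltW r0) ?(ltW w0) ?(ltW wv) // mulrCA ler_wpM2l ?powR_ge0 //.
have h := wt_le v ck; rewrite -/d -/(step v k) in h.
have wk : 0 < width k `^ d by rewrite powR_gt0.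
have wvk : 0 < width (step v k) `^ d by rewrite powR_gt0.
rewrite -!powR_inv1 ?(ltW w0) ?(ltW wv) // -!powRrM !mulN1r !powRN.
by rewrite ler_pdivrMr // mulrC ler_pdivlMr.
Qed.

Lemma relclose_width delta k1 k2 : relclose delta k1 k2 ->
  `|width k1 - width k2| <= delta * width k1.
Proof.
move=> h; apply: le_trans (h 1 0 _ _); rewrite ?ler01 ?lexx //.
exact: ler_dist_dist.
Qed.

Lemma relclose_step delta k1 k2 (v : letter s) : relclose delta k1 k2 -> relclose delta (step v k1) (step v k2).
Proof. by move=> h x y hx hy; apply: h; apply: br01. Qed.

(* Replaces an equidistribution theorem.  If [M] bounds the potential of large contexts,
   then by steering one of the descendants at a fixed generation, hence of weight bounded
   below, has potential about [nw * beta], the average over the dilations; superharmonicity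
   improves [M] by a fixed amount as long as [M] exceeds [2 * nw * beta]. *)
Lemma mixing (Lip beta lo hi : R) (nw m : nat) : steerable s ->
  0 < Lip -> 0 < beta -> 0 < lo -> lo <= hi -> (0 < m)%N ->
  cmax s ^+ nw * (2 * hi) < lo / 4 ->
  exists X : R, forall phi : (R -> R) -> R,
    (forall k, ctx s k -> 0 <= phi k <= 1) ->
    (forall k, ctx s k -> ~~ (lo <= width k <= hi) -> phi k = 0) ->
    (forall k1 k2 delta, ctx s k1 -> ctx s k2 -> delta <= 1 / 2 -> relclose delta k1 k2 ->
       phi k2 <= phi k1 + Lip * delta) ->
    (forall k, ctx s k ->
       \sum_(i < m) phi (dilate (expR (i%:R / m%:R)) k) <= m%:R * beta) ->
    forall J k, ctx s k -> X <= width k ->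
      potential (@wt s) (@step s) J phi k <= 2 * nw%:R * beta.
Proof.
move=> hst L0 b0 lo0 lohi m0 hnw.
have cM0 := cmax_gt0 s; have cM1 := cmax_lt1 s; have cm0 := cmin_gt0 s.
have nw0 : (0 < nw)%N.
  by case: nw hnw => //; rewrite expr0 mul1r; lra.
have N0 : 0 < nw%:R :> R by rewrite ltr0n.
have hnw' : cmax s ^+ nw * hi < lo / 4.
  by apply: le_lt_trans hnw; rewrite ler_wpM2l ?exprn_ge0 ?(ltW cM0) //; lra.
(* Up to this relative error [phi] changes by at most [beta / 2], and widths change by a factor at
   most two. *)
pose delta := Num.min (1 / 2) (beta / (2 * Lip)).
have d0 : 0 < delta by rewrite lt_min [0 < beta / _]divr_gt0 ?mulr_gt0 // andbT; lra.
have dh : delta <= 1 / 2 by rewrite ge_min lexx.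
have dL : Lip * delta <= beta / 2.
  apply: le_trans (_ : Lip * (beta / (2 * Lip)) <= _).
    by rewrite ler_wpM2l ?(ltW L0) // ge_min lexx orbT.
  by rewrite invfM mulrCA [Lip * _]mulrCA divff ?gt_eqF // mulr1.
have [n0 hn0] := hst m delta m0 d0.
have [pm pm0 hpm] := weight_lbound (@wt_gt0 s) (@wt_sum s).
(* Gain of one round of improvement: the least weight of a word of length [n0], times the deficit
   [nw * beta / 2] that is tolerated below. *)
pose eta := pm ^+ n0 * (nw%:R * beta / 2).
have eta0 : 0 < eta by rewrite mulr_gt0 ?exprn_gt0 // divr_gt0 ?mulr_gt0.
(* Bound reached after [i] rounds for contexts wider than [X i], starting from the trivial bound
   [nw]. The thresholds grow by [cmin s ^- n0], so that descendants at generation [n0] of a context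
   above [X i.+1] are still above [X i]. *)
pose bound i := Num.max (nw%:R - i%:R * eta) (2 * nw%:R * beta).
pose X i := (hi + 1) / cmin s ^+ (n0 * i).
pose H J phi k := potential (@wt s) (@step s) J phi k.
have hX i : X i.+1 * cmin s ^+ n0 = X i.
  rewrite /X mulnS exprD invfM -!mulrA [_ * cmin s ^+ n0]mulrC [_ * (_ * _^-1)]mulrA.
  by rewrite mulVf ?mul1r // expf_neq0 ?gt_eqF.
have main : forall phi,
    (forall k, ctx s k -> 0 <= phi k <= 1) ->
    (forall k, ctx s k -> ~~ (lo <= width k <= hi) -> phi k = 0) ->
    (forall k1 k2 delta, ctx s k1 -> ctx s k2 -> delta <= 1 / 2 -> relclose delta k1 k2 ->
       phi k2 <= phi k1 + Lip * delta) ->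
    (forall k, ctx s k ->
       \sum_(i < m) phi (dilate (expR (i%:R / m%:R)) k) <= m%:R * beta) ->
    forall i J k, ctx s k -> X i <= width k -> H J phi k <= bound i.
  move=> phi phi01 phiW phiL phiA.
  have wS : forall (v : letter s) k, ctx s k -> width (step v k) <= cmax s * width k.
    by move=> v k; apply: width_le.
  have wge0 k : ctx s k -> 0 <= width k by move=> ck; apply: ltW (width_gt0 ck).
  have phi0 k : ctx s k -> 0 <= phi k by move=> /phi01/andP[].
  have Hn J k : ctx s k -> H J phi k <= nw%:R.
    move=> ck; rewrite -[leRHS]mul1r.
    apply: (potential_bound (@wt_gt0 s) (@wt_sum s) ctx_step (ltW cM0) (ltW cM1) wge0 wS (lo := lo) (hi := hi)) => //.
    - by apply: lt_trans hnw' _; lra.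
    - by move=> k' /phi01/andP[].
    - by move=> k' ck' /phiW -> //.
  elim=> [|i IH] J k ck hk.
    by rewrite le_max mul0r subr0 Hn.
  rewrite leNgt; apply/negP => hlt.
  have cw (w : seq (letter s)) : size w = n0 -> ctx s (descend w k) /\ X i <= width (descend w k).
    move=> hw; split; first exact: ctx_descend.
    apply: le_trans (width_descend_ge w ck); rewrite hw -hX mulrC.
    by rewrite ler_wpM2l ?exprn_ge0 ?(ltW cm0).
  (* Such contexts stay above the window for [n0] generations, hence their potential is an average
     over generation [n0]. Enlarging [J] by [n0] beforehand is allowed by monotonicity. *)
  have Hk : H J phi k <= transfer (@wt s) (@step s) n0 (H J phi) k.
    apply: le_trans (potential_mono (@wt_gt0 s) ctx_step phi0 ck (leq_addl n0 J)) _.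
    rewrite potential_transfer // => w hw; apply: phiW; first exact: ctx_descend.
    rewrite negb_and; apply/orP; right; rewrite -ltNge.
    apply: lt_le_trans (width_descend_ge w ck).
    apply: lt_le_trans (_ : cmin s ^+ size w * X i.+1 <= _); last first.
      by rewrite ler_wpM2l ?exprn_ge0 ?(ltW cm0).
    apply: lt_le_trans (_ : cmin s ^+ n0 * X i.+1 <= _); last first.
      rewrite ler_wpM2r //; last by apply: ler_wiXn2l; rewrite ?(ltW cm0) ?cmin_le1 // ltnW.
      by rewrite /X divr_ge0 ?exprn_ge0 ?(ltW cm0) //; lra.
    rewrite mulrC hX /X ltr_pdivlMr ?exprn_gt0 //.
    apply: le_lt_trans (_ : hi * 1 < _); last by rewrite mulr1; lra.
    by rewrite ler_wpM2l ?exprn_ile1 ?(ltW cm0) ?cmin_le1 //; lra.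
  (* If the improved bound fails at [k], no descendant at generation [n0] is far below [bound i], in
     particular none of those that imitate the dilations of [k0]. Their mean is about [nw * beta],
     so [bound i] was already small. *)
  have hM : bound i <= 2 * nw%:R * beta.
    have [k0 ck0 hk0] := hn0 k ck.
    have hj (j : 'I_m) : bound i - nw%:R * beta / 2 - nw%:R * beta / 2 <=
        H J phi (dilate (expR (j%:R / m%:R)) k0).
      have [w hw clw] := hk0 j (ltn_ord j).
      have [cdw Xw] := cw w hw.
      have cdil : ctx s (dilate (expR (j%:R / m%:R)) k0) by apply: ctx_scale; rewrite ?expR_gt0.
      have h1 : H J phi k <= bound i - weight (@wt s) w * (bound i - H J phi (descend w k)).
        apply: le_trans Hk _; apply: (transfer_word (@wt_gt0 s) (@wt_sum s)) => // w' hw'.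
        by have [? ?] := cw w' hw'; apply: IH.
      have h2 : bound i - H J phi k < eta.
        move: hlt; rewrite /bound gt_max -natr1 mulrDl mul1r => /andP[hl1 hl2].
        by rewrite ltrBlDl gt_max; apply/andP; split; lra.
      have h3 : bound i - H J phi (descend w k) <= nw%:R * beta / 2.
        have hwp := hpm n0 w hw.
        have hp0 : 0 < pm ^+ n0 by rewrite exprn_gt0.
        set z := bound i - H J phi (descend w k) in h1 *.
        have [z0|z0] := leP z 0; first by apply: le_trans z0 _; rewrite divr_ge0 ?mulr_ge0 ?(ltW b0).
        rewrite -(ler_pM2l hp0) -/eta; apply: ltW; apply: le_lt_trans h2.
        by nra.
      (* Both contexts are moved by the same letters, and the difference of the two values of [phi]
         is at most [beta / 2] at each visit of a window widened to allow for the relative error. *)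
      have h4 : H J phi (descend w k) - H J phi (dilate (expR (j%:R / m%:R)) k0) <= nw%:R * beta / 2.
        set k1 := dilate _ _ in clw cdil *; set k2 := descend w k in clw cdw *.
        pose act2 (v : letter s) (kk : (R -> R) * (R -> R)) := (step v kk.1, step v kk.2).
        pose P2 (kk : (R -> R) * (R -> R)) := [/\ ctx s kk.1, ctx s kk.2 & relclose delta kk.1 kk.2].
        have e1 : H J phi k1 = potential (@wt s) act2 J (phi \o fst) (k1, k2).
          exact: (@potential_map R _ (@wt s) _ _ act2 (@step s) fst J phi (k1, k2)).
        have e2 : H J phi k2 = potential (@wt s) act2 J (phi \o snd) (k1, k2).
          exact: (@potential_map R _ (@wt s) _ _ act2 (@step s) snd J phi (k1, k2)).
        rewrite e1 e2 -potentialB.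
        have hP2 v kk : P2 kk -> P2 (act2 v kk).
          by case=> *; split; [apply: ctx_step|apply: ctx_step|apply: relclose_step].
        have -> : nw%:R * beta / 2 = beta / 2 * nw%:R by lra.
        apply: (potential_bound (@wt_gt0 s) (@wt_sum s) hP2 (ltW cM0) (ltW cM1) (sz := fun kk => width kk.1) (lo := lo / 4) (hi := 2 * hi)) => //.
        - by move=> kk [h _ _]; apply: wge0.
        - by move=> v kk [h _ _]; apply: wS.
        - by rewrite divr_ge0 ?(ltW b0).
        - move=> kk [c1 c2 c12] _ /=; have := phiL _ _ _ c1 c2 dh c12; lra.
        - move=> kk [c1 c2 c12] hn /=.
          rewrite (phiW kk.2 c2) ?sub0r ?oppr_le0 ?phi0 //.
          apply: contra hn => /andP[a1 a2].
          have := relclose_width c12; rewrite ler_norml => /andP[q1 q2].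
          have := wge0 _ c1; move: q1 q2; move: (width kk.1) (width kk.2) a1 a2 => x y *.
          have : delta * x <= x / 2 by nra.
          by move=> ?; apply/andP; split; lra.
      by lra.
    (* Here the averaged assumption on [phi] enters. The dilation factors are at most [4], which
       lowers the bottom of the window to [lo / 4]. *)
    have hsum : \sum_(j < m) H J phi (dilate (expR (j%:R / m%:R)) k0) <= m%:R * (beta * nw%:R).
      have -> : \sum_(j < m) H J phi (dilate (expR (j%:R / m%:R)) k0) =
          potential (@wt s) (@step s) J (fun k => \sum_(j < m) phi (dilate (expR (j%:R / m%:R)) k)) k0.
        rewrite potential_sum; apply: eq_bigr => j _.
        exact: (@potential_map R _ (@wt s) _ _ (@step s) (@step s) (dilate _)).
      rewrite mulrA.
      apply: (potential_bound (@wt_gt0 s) (@wt_sum s) ctx_step (ltW cM0) (ltW cM1) wge0 wS (lo := lo / 4) (hi := hi)) => //.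
      - by rewrite mulr_ge0 // (ltW b0).
      - by move=> k' ck' _; apply: phiA.
      - move=> k' ck' hn; rewrite big1 // => j _; apply: phiW.
          by apply: ctx_scale; rewrite ?expR_gt0.
        apply: contra hn; rewrite /width /dilate -mulrBr normrM ger0_norm ?expR_ge0 //.
        have e1 : 1 <= expR (j%:R / m%:R) :> R.
          by rewrite -[leLHS]expR0 ler_expR divr_ge0.
        have e2 : expR (j%:R / m%:R) <= 4 :> R.
          apply: le_trans (_ : expR 1 <= _).
            by rewrite ler_expR ler_pdivrMr ?ltr0n // mul1r ler_nat ltnW.
          have h12 : 1 / 2 <= expR (- (1 / 2)) :> R by apply: le_trans (expR_ge1Dx _); lra.
          have h1 : expR (1 / 2) * expR (- (1 / 2)) = 1 :> R by rewrite -expRD subrr expR0.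
          have -> : (1 : R) = 1 / 2 + 1 / 2 by lra.
          rewrite expRD; have := expR_gt0 (1 / 2 : R); nra.
        have := wge0 _ ck'; rewrite -/(width k'); move: (width k') => x x0 /andP[a1 a2].
        by apply/andP; split; nra.
    have : m%:R * (bound i - nw%:R * beta / 2 - nw%:R * beta / 2) <= m%:R * (beta * nw%:R).
      apply: le_trans hsum.
      rewrite -[leLHS](_ : \sum_(j < m) (bound i - nw%:R * beta / 2 - nw%:R * beta / 2) = _).
        by apply: ler_sum.
      by rewrite sumr_const card_ord [RHS]mulr_natl.
    rewrite ler_pM2l ?ltr0n //; lra.
  move: hlt; rewrite ltNge => /negP; apply.
  apply: le_trans Hk _; apply: le_trans (_ : 2 * nw%:R * beta <= _); last by rewrite le_max lexx orbT.
  apply: le_trans hM; apply: (transfer_words_ub (@wt_gt0 s) (@wt_sum s)) => w hw.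
  by have [? ?] := cw w hw; apply: IH.
(* After enough rounds only the second term of [bound] is left. *)
have [i hi0] : exists i : nat, nw%:R - i%:R * eta <= 0.
  exists (Num.truncn (nw%:R / eta)).+1.
  have := truncnS_gt (nw%:R / eta); rewrite ltr_pdivrMr //; lra.
exists (X i) => phi h1 h2 h3 h4 J k ck hk.
have := main phi h1 h2 h3 h4 i J k ck hk; rewrite /H /bound => /le_trans; apply.
by rewrite ge_max lexx andbT; apply: le_trans hi0 _; rewrite !mulr_ge0 ?(ltW b0).
Qed.

End OneSystem.
End Systems.

(** * Transversality *)

Lemma transfer_map (R : realType) (V : finType) (p : V -> R) (S S' : Type)
    (act : V -> S -> S) (act' : V -> S' -> S') (g : S -> S') n phi s :
  (forall v s, act' v (g s) = g (act v s)) ->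
  transfer p act' n phi (g s) = transfer p act n (phi \o g) s.
Proof.
move=> h; elim: n s => [|n IH] s //=; apply: eq_bigr => v _.
by rewrite h IH.
Qed.

Section RandomPoints.
Variables (R : realType) (s : system R).

(** Substitute, at generation [n], for integration against the Bernoulli measure of weights [wt] on
    the limit set. *)
Definition pt n (f : R -> R) : R := tr s n (fun a : R -> R => f (a 0)) id.

Let unit_map (a : R -> R) := forall x, 0 <= x <= 1 -> 0 <= a x <= 1.

Let unit_step v a : unit_map a -> unit_map (step (s := s) v a).
Proof. by move=> ha x hx; apply/ha/br01. Qed.

Let unit_id : unit_map id. Proof. by []. Qed.

Let mem0 : 0 <= (0 : R) <= 1. Proof. by rewrite lexx ler01. Qed.

Lemma tr_pt n f k : tr s n (fun a : R -> R => f (a 0)) k = pt n (f \o k).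
Proof.
rewrite /pt /tr; exact: (@transfer_map R _ (@wt _ s) _ _ (@step _ s) (@step _ s) (fun a => k \o a)
  n (fun a : R -> R => f (a 0)) id).
Qed.

Lemma ptS n f : pt n.+1 f = \sum_(v : letter s) wt v * pt n (f \o br v).
Proof. by rewrite {1}/pt /tr /=; apply: eq_bigr => v _; rewrite -tr_pt. Qed.

Lemma pt_le n f g : (forall x, 0 <= x <= 1 -> f x <= g x) -> pt n f <= pt n g.
Proof.
move=> h; apply: (transfer_le (@wt_gt0 _ s) unit_step) unit_id => a ha.
exact/h/ha/mem0.
Qed.

Lemma pt_ub n f c : (forall x, 0 <= x <= 1 -> f x <= c) -> pt n f <= c.
Proof.
move=> h; apply: (transfer_ub (@wt_gt0 _ s) (@wt_sum _ s) unit_step) unit_id => a ha.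
exact/h/ha/mem0.
Qed.

Lemma pt_ge0 n f : (forall x, 0 <= x <= 1 -> 0 <= f x) -> 0 <= pt n f.
Proof.
move=> h; apply: (transfer_ge0 (@wt_gt0 _ s) unit_step) unit_id => a ha.
exact/h/ha/mem0.
Qed.

Lemma ptZ n c f : pt n (fun x => c * f x) = c * pt n f.
Proof. by rewrite /pt /tr transferZ. Qed.

Lemma ptZ2 n c f : pt n (fun x => pt n (fun y => c * f x y)) = c * pt n (fun x => pt n (f x)).
Proof. by rewrite -ptZ; congr pt; apply/funext => x; rewrite ptZ. Qed.

Lemma pt_sum n (I : Type) (r : seq I) (f : I -> R -> R) :
  pt n (fun x => \sum_(i <- r) f i x) = \sum_(i <- r) pt n (f i).
Proof. by rewrite /pt /tr transfer_sum. Qed.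

Lemma ptD n f g : pt n (fun x => f x + g x) = pt n f + pt n g.
Proof.
have -> : (fun x => f x + g x) = (fun x => \sum_(h <- [:: f; g]) h x).
  by apply/funext => x; rewrite !big_cons big_nil addr0.
by rewrite pt_sum !big_cons big_nil addr0.
Qed.

Lemma pt_cst n c : pt n (fun=> c) = c.
Proof.
apply/le_anti/andP; split; first exact: pt_ub.
rewrite -lerN2; apply: le_trans (_ : pt n (fun=> - c) <= _); last exact: pt_ub.
by have := ptZ n (-1) (fun=> c); rewrite !mulN1r => ->.
Qed.

Lemma pt_frostman : exists2 C : R, 1 <= C & forall n k (c r : R), ctx s k ->
  cmax s ^+ n * width k <= r ->
  pt n (fun x => (`|k x - c| <= r)%R%:R) <= C * (r / width k) `^ sdim s.
Proof.
have [C C1 hC] := frostman s; exists C => // n k c r ck hr.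
by have := hC n k c r ck hr; rewrite (tr_pt n (fun y => (`|y - c| <= r)%R%:R)).
Qed.

End RandomPoints.

Section Kernels.
Variable R : realType.

Lemma ltr_powR2 (x y : R) : x < y -> 2 `^ x < 2 `^ y :> R.
Proof.
move=> xy; have l2 : 0 < ln 2 :> R by apply: ln_gt0; lra.
have n2 : (2 : R) != 0 by rewrite pnatr_eq0.
by rewrite /powR (negPf n2) ltr_expR ltr_pM2r.
Qed.

Lemma powR_scaled (z q a b : R) l : 0 < z -> 0 < q ->
  (z ^+ l * q) `^ b * (z ^+ l * q) `^ a = q `^ (a + b) * (z `^ (a + b)) ^+ l.
Proof.
move=> z0 q0; have zl : 0 < z ^+ l by rewrite exprn_gt0.
have nz : z ^+ l * q != 0 by rewrite mulf_neq0 // lt0r_neq0.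
rewrite -powRD ?nz ?implybT // [b + a]addrC powRM ?(ltW zl) ?(ltW q0) // [LHS]mulrC.
congr (_ * _); rewrite -[z ^+ l]powR_mulrn ?(ltW z0) // -powRrM [l%:R * _]mulrC powRrM.
by rewrite powR_mulrn ?powR_ge0.
Qed.

Definition clamp (x : R) : R := Num.max 0 (Num.min 1 x).

Lemma clamp01 x : 0 <= clamp x <= 1.
Proof. by rewrite /clamp le_max lexx /= ge_max ler01 ge_min lexx. Qed.

Lemma clamp_eq1 x : 1 <= x -> clamp x = 1.
Proof. by move=> h; rewrite /clamp (min_idPl h) (max_idPr ler01). Qed.

Lemma clamp_eq0 x : x <= 0 -> clamp x = 0.
Proof.
move=> h; rewrite /clamp (min_idPr _); last exact: le_trans h ler01.
exact: (max_idPl h).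
Qed.

Lemma clamp_lip x y : `|clamp x - clamp y| <= `|x - y|.
Proof.
have le_lip (a b : R) : a <= b -> clamp b - clamp a <= b - a /\ clamp a <= clamp b.
  move=> ab; rewrite /clamp; split.
    rewrite /Num.max /Num.min; case: (ltP 1 b) => hb; case: (ltP 1 a) => ha;
      case: ltP => h1; case: ltP => h2; lra.
  rewrite /Num.max /Num.min; case: (ltP 1 b) => hb; case: (ltP 1 a) => ha;
      case: ltP => h1; case: ltP => h2; lra.
have [xy|/ltW yx] := leP x y.
  have [h1 h2] := le_lip _ _ xy.
  by rewrite distrC [leRHS]distrC !ger0_norm ?subr_ge0.
have [h1 h2] := le_lip _ _ yx.
by rewrite !ger0_norm ?subr_ge0.
Qed.

(** A Lipschitz substitute for the indicator of [|z| <= 1], so that overlaps depend continuously on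
    the context, as [mixing] requires. *)
Definition kern (z : R) : R := clamp (2 - `|z|).

Lemma kern01 z : 0 <= kern z <= 1. Proof. exact: clamp01. Qed.

Lemma kern_ge0 z : 0 <= kern z. Proof. by case/andP: (kern01 z). Qed.

Lemma kern_le1 z : kern z <= 1. Proof. by case/andP: (kern01 z). Qed.

Lemma kern_eq1 z : `|z| <= 1 -> kern z = 1.
Proof. by move=> h; apply: clamp_eq1; lra. Qed.

Lemma kern_neq0 z : kern z != 0 -> `|z| < 2.
Proof. by apply: contra_neqT; rewrite -leNgt => h; apply: clamp_eq0; lra. Qed.

Lemma kern_lip y z : `|kern y - kern z| <= `|y - z|.
Proof.
apply: le_trans (clamp_lip _ _) _.
have -> : 2 - `|y| - (2 - `|z|) = `|z| - `|y| by lra.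
by rewrite distrC; apply: ler_dist_dist.
Qed.

Lemma sum_initial_segment n (d : R) : 0 <= d ->
  \sum_(j < n) (j%:R <= d)%R%:R <= 1 + d.
Proof.
move=> d0; suff : \sum_(j < n) (j%:R <= d)%R%:R <= Num.min n%:R (1 + d).
  by rewrite le_min => /andP[].
elim: n => [|n IH]; first by rewrite big_ord0 le_min lexx addr_ge0.
rewrite big_ord_recr /=; move: IH; rewrite !le_min -natr1 => /andP[h1 h2].
by case: (boolP (n%:R <= d)) => h; rewrite ?h ?(negPf h) /=; apply/andP; split; lra.
Qed.

(** Vanishing last terms are dropped by induction; afterwards every nonzero term has its index
    within [d] of the last one. *)
Lemma sum_clustered n (a : nat -> R) d : 0 <= d ->
  (forall i, (i < n)%N -> 0 <= a i <= 1) ->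
  (forall i j, (j <= i < n)%N -> a i != 0 -> a j != 0 -> (i - j)%N%:R <= d) ->
  \sum_(i < n) a i <= 1 + d.
Proof.
move=> d0; elim: n => [|n IH] a01 ha; first by rewrite big_ord0 addr_ge0.
have [an0|an0] := eqVneq (a n) 0.
  rewrite big_ord_recr /= an0 addr0; apply: IH => [i hi|i j /andP[ji hi]].
    by apply: a01; rewrite ltnS ltnW.
  by apply: ha; rewrite ji ltnS ltnW.
apply: le_trans (sum_initial_segment n.+1 d0).
rewrite [leRHS](reindex_inj rev_ord_inj) /=; apply: ler_sum => i _.
rewrite subSS; have /andP[a0 a1] := a01 i (ltn_ord i).
have [-> //|ai0] := eqVneq (a i) 0.
by rewrite (ha n i) // -ltnS ltn_ord ltnSn.
Qed.

Lemma expR_le4 : expR 1 <= 4 :> R.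
Proof.
have h12 : 1 / 2 <= expR (- (1 / 2)) :> R by apply: le_trans (expR_ge1Dx _); lra.
have h1 : expR (1 / 2) * expR (- (1 / 2)) = 1 :> R by rewrite -expRD subrr expR0.
have -> : (1 : R) = 1 / 2 + 1 / 2 by lra.
rewrite expRD; have := expR_gt0 (1 / 2 : R); nra.
Qed.

(* Transversality: as the scale [expR (i / m)] varies, [expR (i / m) * X + Y] stays within
   [2 * e] of [0] for a proportion [O(e / |X|)] of the indices, and only if [|Y| = O(|X| + e)]. *)
Lemma transversal (X Y e : R) (m L : nat) : 0 < e -> `|X| <= 2 ^+ L * e -> (2 ^ L <= m)%N ->
  \sum_(i < m) kern ((expR (i%:R / m%:R) * X + Y) / e) <=
  m%:R * \sum_(l < L.+1) 9 / 2 ^+ l * ((`|X| <= 2 ^+ l * e)%R%:R * (`|Y| <= 6 * 2 ^+ l * e)%R%:R).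
Proof.
move=> e0 hXL hm.
have m0 : (0 < m)%N by apply: leq_trans hm; rewrite expn_gt0.
have mR : 0 < m%:R :> R by rewrite ltr0n.
pose a i := kern ((expR (i%:R / m%:R) * X + Y) / e).
have exl : exists l, `|X| <= 2 ^+ l * e by exists L.
(* Dyadic size of [X] relative to [e]. Only the term of index [l] on the right is used; the others
   are nonnegative. *)
pose l := ex_minn exl.
have [hl hmin] : `|X| <= 2 ^+ l * e /\ forall j, `|X| <= 2 ^+ j * e -> (l <= j)%N.
  by rewrite /l; case: ex_minnP.
have lL : (l < L.+1)%N by rewrite ltnS; apply: hmin.
have terms0 (j : 'I_L.+1) : 0 <= 9 / 2 ^+ j * ((`|X| <= 2 ^+ j * e)%R%:R * (`|Y| <= 6 * 2 ^+ j * e)%R%:R) :> R.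
  by rewrite !mulr_ge0 ?invr_ge0 ?exprn_ge0.
have [h0|] := pselect (forall i, (i < m)%N -> a i = 0).
  rewrite [leLHS]big1 => [|i _]; last exact: h0.
  by rewrite mulr_ge0 // sumr_ge0.
move=> /existsNP[i0 /not_implyP[hi0 /eqP ai0]].
have eb i : (i < m)%N -> (1 : R) <= expR (i%:R / m%:R : R) <= (4 : R).
  move=> hi; apply/andP; split; first by rewrite -[leLHS]expR0 ler_expR divr_ge0.
  apply: le_trans expR_le4; rewrite ler_expR ler_pdivrMr // mul1r ler_nat; exact: ltnW.
have near0 i : a i != 0 -> `|expR (i%:R / m%:R) * X + Y| <= 2 * e.
  by move/kern_neq0; rewrite normrM [`|e^-1|]ger0_norm ?invr_ge0 ?(ltW e0) // ltr_pdivrMr // => /ltW.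
have p2 : 1 <= 2 ^+ l :> R by rewrite exprn_ege1 // ler1n.
(* At an index with nonzero kernel, [|Y| <= 2 * e + 4 * |X|] because the scales are at most [4];
   hence the factor [6]. *)
have hY : `|Y| <= 6 * 2 ^+ l * e.
  have h1 := near0 _ ai0; have /andP[e1 e4] := eb i0 hi0.
  have h2 : `|Y| <= `|expR (i0%:R / m%:R) * X + Y| + `|expR (i0%:R / m%:R) * X|.
    have {1}-> : Y = (expR (i0%:R / m%:R) * X + Y) - expR (i0%:R / m%:R) * X by rewrite addrAC subrr add0r.
    exact: ler_normB.
  have h3 : `|expR (i0%:R / m%:R) * X| <= 4 * (2 ^+ l * e).
    by rewrite normrM ger0_norm ?expR_ge0 // ler_pM ?expR_ge0.
  by nra.
apply: le_trans (_ : m%:R * (9 / 2 ^+ l) <= _); last first.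
  rewrite ler_pM2l // (bigD1 (Ordinal lL)) //= hl hY !mulr1 lerDl sumr_ge0 //.
have [l0|l0] := posnP l.
  rewrite l0 expr0 divr1; apply: le_trans (_ : \sum_(i < m) 1 <= _).
    by apply: ler_sum => i _; case/andP: (kern01 ((expR (i%:R / m%:R) * X + Y) / e)).
  by rewrite sumr_const card_ord mulr_natr -mulr_natr; nra.
have hX : 2 ^+ l * e < 2 * `|X|.
  rewrite -(prednK l0) exprS -mulrA ltr_pM2l // ltNge; apply/negP => /hmin.
  by rewrite -ltnS (prednK l0) ltnn.
have pl : 0 < 2 ^+ l :> R by rewrite exprn_gt0.
(* As [2 ^ l <= m], the summand [1] is at most [m / 2 ^ l]; together with [8] this gives the
   constant [9]. *)
apply: le_trans (_ : 1 + 8 * m%:R / 2 ^+ l <= _); last first.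
  have : 2 ^+ l <= m%:R :> R.
    rewrite -natrX ler_nat; apply: leq_trans hm; rewrite leq_exp2l //.
  move=> h; have e1 : (1 : R) <= m%:R / 2 ^+ l by rewrite ler_pdivlMr // mul1r.
  rewrite -[8 * _ / _]mulrA [leRHS]mulrCA; lra.
apply: (@sum_clustered m a).
- by rewrite !mulr_ge0 ?invr_ge0 ?(ltW pl).
- by move=> i _; apply: kern01.
move=> i j /andP[ji im] ai aj.
have h1 := near0 _ ai; have h2 := near0 _ aj.
set x := expR (i%:R / m%:R) in h1; set y := expR (j%:R / m%:R) in h2.
(* The exponential has slope at least one on the positive half-line, so distinct indices give scales
   at least [(i - j) / m] apart, while both scales bring the expression within [2 * e] of zero. *)
have xy : (i - j)%N%:R / m%:R <= x - y.
  have y1 : 1 <= y by case/andP: (eb j (leq_ltn_trans ji im)).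
  have -> : x = y * expR ((i - j)%N%:R / m%:R).
    by rewrite /x /y -expRD -mulrDl natrB // addrC subrK.
  have := expR_ge1Dx ((i - j)%N%:R / m%:R : R).
  have : 0 <= (i - j)%N%:R / m%:R :> R by rewrite divr_ge0.
  set u := _ / _; set v := expR u; nra.
have : (x - y) * `|X| <= 4 * e.
  have u0 : 0 <= (i - j)%N%:R / m%:R :> R by rewrite divr_ge0.
  rewrite -[x - y]ger0_norm ?(le_trans u0) // -normrM mulrBl.
  have -> : x * X - y * X = (x * X + Y) - (y * X + Y) by lra.
  by apply: le_trans (ler_normB _ _) _; lra.
rewrite ler_pdivlMr // => h4.
have h5 : (i - j)%N%:R / m%:R * 2 ^+ l <= 8 :> R.
  have u0 : 0 <= (i - j)%N%:R / m%:R :> R by rewrite divr_ge0.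
  move: xy u0 hX h4; set u := _ / m%:R => xy u0 hX h4; rewrite -(ler_pM2r e0) -mulrA.
  have ha : u * (2 ^+ l * e) <= u * (2 * `|X|) by rewrite ler_wpM2l // ltW.
  have hb : u * `|X| <= (x - y) * `|X| by rewrite ler_wpM2r.
  lra.
by move: h5; rewrite mulrAC ler_pdivrMr.
Qed.

Lemma geometric_sum_le (q : R) n : 0 <= q < 1 -> \sum_(l < n) q ^+ l <= (1 - q)^-1.
Proof.
move=> /andP[q0 q1]; have p : 0 < 1 - q by lra.
rewrite -[leRHS]mul1r ler_pdivlMr //.
have := subrX1 q n => h; have : 0 <= q ^+ n by rewrite exprn_ge0.
by nra.
Qed.

End Kernels.

(** * Averages over dilations of the collision energy of a projection *)

Section Marstrand.
Variables (R : realType) (s1 s2 : system R) (A B : R).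
Hypothesis A0 : A != 0.
Hypothesis B0 : B != 0.
Hypothesis t_lt1 : sdim s1 + sdim s2 < 1.

(** Smoothed probability that two independent random pairs of points have projections within [e] of
    each other: the energy at scale [e] of the product measure under [A x + B y]. *)
Definition overlap n (e : R) (k k' : R -> R) : R :=
  pt s1 n (fun x => pt s1 n (fun y => pt s2 n (fun u => pt s2 n (fun v =>
    kern ((A * (k x - k y) + B * (k' u - k' v)) / e))))).

Lemma overlap01 n e k k' : 0 <= overlap n e k k' <= 1.
Proof.
apply/andP; split.
  do 4! (apply: pt_ge0 => ? _).
  exact: kern_ge0.
do 4! (apply: pt_ub => ? _).
exact: kern_le1.
Qed.

Lemma overlap_close n e k1 k2 k' delta : 0 < e -> 0 <= delta -> ctx s1 k1 ->
  relclose delta k1 k2 -> overlap n e k2 k' <= overlap n e k1 k' + `|A| * width k1 / e * delta.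
Proof.
move=> e0 d0 c1 c12; rewrite -[X in _ <= _ + X](pt_cst s1 n) -ptD.
apply: pt_le => x hx; rewrite -[X in _ <= _ + X](pt_cst s1 n) -ptD.
apply: pt_le => y hy; rewrite -[X in _ <= _ + X](pt_cst s2 n) -ptD.
apply: pt_le => u hu; rewrite -[X in _ <= _ + X](pt_cst s2 n) -ptD.
apply: pt_le => v hv; rewrite -lerBlDl; apply: le_trans (ler_norm _) _.
apply: le_trans (kern_lip _ _) _.
rewrite -mulrBl normrM [`|e^-1|]ger0_norm ?invr_ge0 ?(ltW e0) //.
rewrite [leRHS]mulrAC ler_pM2r ?invr_gt0 // opprD addrACA subrr addr0 -mulrBr normrM -mulrA.
rewrite ler_wpM2l // distrC; apply: le_trans (c12 x y hx hy) _.
by rewrite mulrC ler_wpM2r // (ctx_width c1).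
Qed.

(** Transversality reduces the average to a sum over dyadic distances. The ball conditions of the
    two systems make its [l]-th term a multiple of [(2 ^ l * q) ^ (d1 + d2) / 2 ^ l], a geometric
    series of ratio [rho < 1] because [d1 + d2 < 1]. *)
Lemma overlap_dilate_average (c c' : R) : 0 < c -> exists2 C : R, 0 < C &
  forall q : R, 0 < q -> exists L, forall n m, (L <= n)%N -> (2 ^ L <= m)%N ->
    forall x k k', 0 < x -> ctx s1 k -> ctx s2 k' ->
      c * x <= width k <= c' * x -> c * x <= width k' <= c' * x ->
      \sum_(i < m) overlap n (q * x) (dilate (expR (i%:R / m%:R)) k) k' <=
      m%:R * (C * q `^ (sdim s1 + sdim s2)).
Proof.
move=> c0; set d1 := sdim s1; set d2 := sdim s2.
have d10 : 0 <= d1 := sdim_ge0 s1.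
have d20 : 0 <= d2 := sdim_ge0 s2.
have [C1 C11 hC1] := pt_frostman s1; have [C2 C21 hC2] := pt_frostman s2.
have a0 : 0 < `|A| by rewrite normr_gt0.
have b0 : 0 < `|B| by rewrite normr_gt0.
pose rho : R := 2 `^ (d1 + d2) / 2.
have rho01 : 0 <= rho < 1.
  rewrite /rho divr_ge0 ?powR_ge0 //= ltr_pdivrMr // mul1r -[ltRHS]powRr1 //.
  exact: ltr_powR2.
pose K := C1 * (`|A| * c)^-1 `^ d1 * (C2 * (6 / (`|B| * c)) `^ d2).
have K0 : 0 < K.
  have p1 : 0 < C1 by apply: lt_le_trans C11.
  have p2 : 0 < C2 by apply: lt_le_trans C21.
  rewrite mulr_gt0 // mulr_gt0 // powR_gt0 // ?invr_gt0 ?mulr_gt0 //.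
  by rewrite invr_gt0 mulr_gt0.
exists (9 * K / (1 - rho)) => [|q q0].
  case/andP: rho01 => _ h; apply: divr_gt0; last by rewrite subr_gt0.
  by apply: mulr_gt0; rewrite ?ltr0n.
(* [L0] dyadic levels cover all differences [A * (k y - k z)]; [L1] and [L2] make the cylinders of
   generation [n] finer than the scale [q * x], as the ball condition demands. *)
have [L0 hL0] : exists L, `|A| * `|c'| <= 2 ^+ L * q.
  have [L hL] : exists L : nat, `|A| * `|c'| / q <= L%:R.
    by exists (Num.truncn (`|A| * `|c'| / q)).+1; apply/ltW/truncnS_gt.
  exists L; rewrite -ler_pdivrMr //; apply: le_trans hL _.
  by rewrite -natrX ler_nat ltnW // ltn_expl.
have small (cm : R) : 0 < cm < 1 -> forall y : R, 0 < y -> exists L, forall n, (L <= n)%N -> cm ^+ n <= y.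
  move=> /andP[h0 h1] y y0.
  have /cvgrPdist_le /(_ y y0) [L _ hL] := @cvg_expr R cm ltac:(by rewrite ger0_norm // ltW).
  exists L => n hn; have := hL n hn; rewrite /= sub0r normrN ger0_norm // exprn_ge0 // ltW //.
have [L1 hL1] := small (cmax s1) ltac:(by rewrite cmax_gt0 cmax_lt1) (q / (`|A| * (`|c'| + 1)))
  ltac:(by rewrite divr_gt0 ?mulr_gt0 // ltr_wpDl).
have [L2 hL2] := small (cmax s2) ltac:(by rewrite cmax_gt0 cmax_lt1) (q / (`|B| * (`|c'| + 1)))
  ltac:(by rewrite divr_gt0 ?mulr_gt0 // ltr_wpDl).
pose L := maxn L0 (maxn L1 L2).
exists L => n m hn hm x k k' x0 ck ck' /andP[wk1 wk2] /andP[wk1' wk2'].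
have e0 : 0 < q * x by rewrite mulr_gt0.
have w0 := width_gt0 ck; have w0' := width_gt0 ck'.
have c'0 : c' <= `|c'| by apply: ler_norm.
have hLA : `|A| * (`|c'| * x) <= 2 ^+ L * (q * x).
  rewrite !mulrA ler_pM2r //; apply: le_trans hL0 _; rewrite ler_pM2r //.
  by rewrite ler_weXn2l ?ler1n // leq_maxl.
have f1 l : 0 <= l%:R :> R -> pt s1 n (fun y => pt s1 n (fun z => (`|A * (k y - k z)| <= 2 ^+ l * (q * x))%R%:R)) <=
    C1 * (`|A| * c)^-1 `^ d1 * (2 ^+ l * q) `^ d1.
  move=> _; apply: pt_ub => y hy.
  rewrite (_ : (fun z => _) = (fun z => (`|k z - k y| <= 2 ^+ l * (q * x) / `|A|)%R%:R)); last first.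
    by apply/funext => z; rewrite normrM distrC ler_pdivlMr // mulrC.
  have p1 : 1 <= 2 ^+ l :> R by rewrite exprn_ege1 // ler1n.
  apply: le_trans (hC1 n k (k y) _ ck _) _.
    rewrite ler_pdivlMr //.
    apply: le_trans (_ : q / (`|A| * (`|c'| + 1)) * width k * `|A| <= _).
      rewrite !ler_pM2r //; apply: hL1; apply: leq_trans hn.
      by rewrite leq_max leq_maxl orbT.
    apply: le_trans (_ : q * x <= _); last by rewrite ler_peMl // (ltW e0).
    have c'1 : 0 < `|c'| + 1 by rewrite ltr_wpDl.
    have -> : q / (`|A| * (`|c'| + 1)) * width k * `|A| = q * (width k / (`|c'| + 1)).
      by field; rewrite !gt_eqF.
    by rewrite ler_pM2l // ler_pdivrMr //; nra.
  rewrite -[leRHS]mulrA; apply: ler_wpM2l; first exact: le_trans ler01 C11.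
  rewrite -powRM ?invr_ge0 ?mulr_ge0 ?exprn_ge0 ?(ltW a0) ?(ltW c0) ?(ltW q0) //.
  rewrite ge0_ler_powR ?nnegrE ?divr_ge0 ?mulr_ge0 ?invr_ge0 ?mulr_ge0 ?exprn_ge0 ?(ltW a0) ?(ltW c0) ?(ltW q0) ?(ltW x0) ?(ltW w0) //.
  have h : x / width k <= c^-1 by rewrite ler_pdivrMr // ler_pdivlMl.
  have -> : 2 ^+ l * (q * x) / `|A| / width k = `|A|^-1 * (2 ^+ l * q) * (x / width k).
    by field; rewrite !gt_eqF.
  have -> : (`|A| * c)^-1 * (2 ^+ l * q) = `|A|^-1 * (2 ^+ l * q) * c^-1.
    by field; rewrite !gt_eqF.
  by rewrite ler_wpM2l // !mulr_ge0 ?invr_ge0 ?exprn_ge0 ?(ltW q0) ?(ltW a0).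
have f2 l : 0 <= l%:R :> R -> pt s2 n (fun y => pt s2 n (fun z => (`|B * (k' y - k' z)| <= 6 * 2 ^+ l * (q * x))%R%:R)) <=
    C2 * (6 / (`|B| * c)) `^ d2 * (2 ^+ l * q) `^ d2.
  move=> _; apply: pt_ub => y hy.
  rewrite (_ : (fun z => _) = (fun z => (`|k' z - k' y| <= 6 * 2 ^+ l * (q * x) / `|B|)%R%:R)); last first.
    by apply/funext => z; rewrite normrM distrC ler_pdivlMr // mulrC.
  have p1 : 1 <= 6 * 2 ^+ l :> R.
    have : 1 <= 2 ^+ l :> R by rewrite exprn_ege1 // ler1n.
    lra.
  apply: le_trans (hC2 n k' (k' y) _ ck' _) _.
    rewrite ler_pdivlMr //.
    apply: le_trans (_ : q / (`|B| * (`|c'| + 1)) * width k' * `|B| <= _).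
      rewrite !ler_pM2r //; apply: hL2; apply: leq_trans hn.
      by rewrite !leq_max leqnn !orbT.
    apply: le_trans (_ : q * x <= _); last by rewrite ler_peMl // (ltW e0).
    have c'1 : 0 < `|c'| + 1 by rewrite ltr_wpDl.
    have -> : q / (`|B| * (`|c'| + 1)) * width k' * `|B| = q * (width k' / (`|c'| + 1)).
      by field; rewrite !gt_eqF.
    by rewrite ler_pM2l // ler_pdivrMr //; nra.
  rewrite -[leRHS]mulrA; apply: ler_wpM2l; first exact: le_trans ler01 C21.
  rewrite -powRM ?divr_ge0 ?mulr_ge0 ?exprn_ge0 ?(ltW b0) ?(ltW c0) ?(ltW q0) //.
  rewrite ge0_ler_powR ?nnegrE ?divr_ge0 ?mulr_ge0 ?invr_ge0 ?mulr_ge0 ?exprn_ge0 ?(ltW b0) ?(ltW c0) ?(ltW q0) ?(ltW x0) ?(ltW w0') //.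
  have h : x / width k' <= c^-1 by rewrite ler_pdivrMr // ler_pdivlMl.
  have -> : 6 * 2 ^+ l * (q * x) / `|B| / width k' = 6 / `|B| * (2 ^+ l * q) * (x / width k').
    by field; rewrite !gt_eqF.
  have -> : 6 / (`|B| * c) * (2 ^+ l * q) = 6 / `|B| * (2 ^+ l * q) * c^-1.
    by field; rewrite !gt_eqF.
  by rewrite ler_wpM2l // !mulr_ge0 ?invr_ge0 ?exprn_ge0 ?(ltW q0) ?(ltW b0).
have -> : \sum_(i < m) overlap n (q * x) (dilate (expR (i%:R / m%:R)) k) k' =
    pt s1 n (fun y => pt s1 n (fun z => pt s2 n (fun u => pt s2 n (fun v =>
      \sum_(i < m) kern ((expR (i%:R / m%:R) * (A * (k y - k z)) + B * (k' u - k' v)) / (q * x)))))).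
  rewrite /overlap -pt_sum; congr pt; apply/funext => y; rewrite -pt_sum; congr pt.
  apply/funext => z; rewrite -pt_sum; congr pt; apply/funext => u; rewrite -pt_sum; congr pt.
  apply/funext => v; apply: eq_bigr => i _; congr (kern ((_ + _) / _)).
  by rewrite /dilate -mulrBr mulrCA.
pose ind1 l y z : R := (`|A * (k y - k z)| <= 2 ^+ l * (q * x))%R%:R.
pose ind2 l u v : R := (`|B * (k' u - k' v)| <= 6 * 2 ^+ l * (q * x))%R%:R.
apply: le_trans (_ : pt s1 n (fun y => pt s1 n (fun z => pt s2 n (fun u => pt s2 n (fun v =>
   \sum_(l < L.+1) (m%:R * (9 / 2 ^+ l) * ind1 l y z) * ind2 l u v)))) <= _).
  apply: pt_le => y hy; apply: pt_le => z hz; apply: pt_le => u hu; apply: pt_le => v hv.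
  apply: le_trans (transversal _ e0 _ hm) _.
    rewrite normrM; apply: le_trans hLA; rewrite ler_wpM2l //.
    apply: le_trans (ctx_width ck hy hz) _; apply: le_trans wk2 _.
    by rewrite ler_pM2r.
  by rewrite mulr_sumr; apply: ler_sum => l _; rewrite /ind1 /ind2 !mulrA lexx.
rewrite (_ : pt s1 n _ = \sum_(l < L.+1) m%:R * (9 / 2 ^+ l) *
    (pt s2 n (fun u => pt s2 n (ind2 l u)) * pt s1 n (fun y => pt s1 n (ind1 l y)))); last first.
  rewrite (_ : (fun y => _) = (fun y => \sum_(l < L.+1) m%:R * (9 / 2 ^+ l) * pt s2 n (fun u => pt s2 n (ind2 l u)) * pt s1 n (ind1 l y))); last first.
    apply/funext => y; rewrite (_ : (fun z => _) = (fun z => \sum_(l < L.+1) m%:R * (9 / 2 ^+ l) * pt s2 n (fun u => pt s2 n (ind2 l u)) * ind1 l y z)).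
      by rewrite pt_sum; apply: eq_bigr => l _; rewrite ptZ.
    apply/funext => z.
    transitivity (pt s2 n (fun u => \sum_(l < L.+1) pt s2 n (fun v => m%:R * (9 / 2 ^+ l) * ind1 l y z * ind2 l u v))).
      by congr pt; apply/funext => u; rewrite pt_sum.
    by rewrite pt_sum; apply: eq_bigr => l _; rewrite ptZ2 mulrAC.
  by rewrite pt_sum; apply: eq_bigr => l _; rewrite ptZ -!mulrA.

apply: le_trans (_ : \sum_(l < L.+1) m%:R * (9 * K * q `^ (d1 + d2)) * rho ^+ l <= _).
  apply: ler_sum => l _; rewrite -!mulrA ler_wpM2l // ler_wpM2l //.
  apply: le_trans (_ : (2 ^+ l)^-1 * (C2 * (6 / (`|B| * c)) `^ d2 * (2 ^+ l * q) `^ d2 *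
     (C1 * (`|A| * c)^-1 `^ d1 * (2 ^+ l * q) `^ d1)) <= _).
    rewrite ler_pM2l ?invr_gt0 ?exprn_gt0 // ler_pM ?f1 ?f2 //.
      by apply: pt_ge0 => ? _; apply: pt_ge0 => ? _; rewrite ler0n.
    by apply: pt_ge0 => ? _; apply: pt_ge0 => ? _; rewrite ler0n.
  have e1 : (2 ^+ l * q) `^ d2 * (2 ^+ l * q) `^ d1 = q `^ (d1 + d2) * (2 `^ (d1 + d2)) ^+ l.
    by rewrite powR_scaled // ltr0n.
  rewrite [(_ * _ * (2 ^+ l * q) `^ d2) * _]mulrACA e1 /rho expr_div_n /K.
  by rewrite le_eqVlt; apply/orP; left; apply/eqP; ring.
rewrite -mulr_sumr -[leLHS]mulrA ler_wpM2l //.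
rewrite (_ : 9 * K / (1 - rho) * q `^ (d1 + d2) = 9 * K * q `^ (d1 + d2) * (1 - rho)^-1); last first.
  by rewrite mulrAC.
apply: ler_wpM2l (geometric_sum_le L.+1 rho01).
by rewrite mulr_ge0 ?powR_ge0 // mulr_ge0 // (ltW K0).
Qed.

End Marstrand.

(** * Stopping at a scale *)

Section Levels.
Variables (R : realType).

Section OneTree.
(** Mean value of [phi] over the descendants after [n] generations. Crowding will be controlled in
    this mean only. *)
Fixpoint level (T : Type) (ch : nat -> T -> dist R T) (i n : nat) (phi : T -> R) (v : T) : R :=
  if n is n'.+1 then Ed (ch i v) (level ch i.+1 n' phi) else phi v.

Variables (T : eqType) (ch : nat -> T -> dist R T).
Hypothesis ch_prob : forall i v, dprob (ch i v).

Variable P : nat -> T -> Prop.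
Hypothesis P_ch : forall i v z, P i v -> z \in ch i v -> P i.+1 z.2.

Lemma level_le i n phi psi v : (forall a, P (i + n) a -> phi a <= psi a) ->
  P i v -> level ch i n phi v <= level ch i n psi v.
Proof.
elim: n i v => [|n IH] i v h Pv /=; first by apply: h; rewrite addn0.
apply: le_Ed => [|z zin]; first by case: (ch_prob i v).
by apply: IH => [a Pa|]; [apply: h; rewrite addnS | apply: P_ch zin].
Qed.

Lemma level_cst i n c v : level ch i n (fun=> c) v = c.
Proof.
elim: n i v => [|n IH] i v //=.
have -> : level ch i.+1 n (fun=> c) = (fun=> c) by apply/funext => z; apply: IH.
exact: Ed_cst.
Qed.

Lemma level_ub i n phi c v : (forall a, P (i + n) a -> phi a <= c) ->
  P i v -> level ch i n phi v <= c.
Proof. by move=> h Pv; rewrite -[leRHS](level_cst i n c v); apply: level_le. Qed.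

Lemma level_super i n H v : (forall i v, P i v -> Ed (ch i v) H <= H v) -> P i v ->
  level ch i n H v <= H v.
Proof.
move=> hH; elim: n i v => [|n IH] i v Pv //=.
apply: le_trans (hH i v Pv); apply: le_Ed => [|z zin]; first by case: (ch_prob i v).
by apply: IH; apply: P_ch zin.
Qed.

(** The exponents are affine in the crowding, so the excess depends on the mean crowding of each
    level alone. *)
Lemma excess_level (m : nat -> R) (cl : nat -> T -> T -> bool) i n v :
  excess ch m cl i n v =
  \sum_(l < n) (1 - level ch i l (crowding ch cl (i + l)) v / m (i + l)%N) / 2.
Proof.
elim: n i v => [|n IH] i v /=; first by rewrite big_ord0.
rewrite big_ord_recl /= addn0; congr (_ + _).
have -> : excess ch m cl i.+1 n = (fun v => \sum_(l < n)
    (1 / 2 + (- (m (i.+1 + l)%N)^-1 / 2) * level ch i.+1 l (crowding ch cl (i.+1 + l)) v)).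
  by apply/funext => z; rewrite IH; apply: eq_bigr => l _; ring.
rewrite Ed_sum; apply: eq_bigr => l _.
rewrite (EdD _ (fun=> _)) Ed_cst // EdZ /bump /= add1n addnS addSn.
rewrite add0n; ring.
Qed.

End OneTree.

Lemma level_Ed (T U : Type) (ch : nat -> T -> dist R T) (d : dist R U) F j n b :
  level ch j n (fun x => Ed d (F^~ x)) b = Ed d (fun a => level ch j n (F a) b).
Proof.
elim: n j b => [|n IH] j b //=; rewrite Ed_swap.
by congr Ed; apply/funext => x; rewrite IH.
Qed.

Section Pairs.
Variables (T T' : eqType).

Definition dtimes (d : dist R T) (d' : dist R T') : dist R (T * T')%type :=
  dbind d (fun a => [seq (z.1, (a, z.2)) | z <- d']).

Lemma Ed_dtimes d d' phi : Ed (dtimes d d') phi = Ed d (fun a => Ed d' (fun b => phi (a, b))).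
Proof.
rewrite Ed_bind; congr Ed; apply/funext => a.
by rewrite /Ed big_map.
Qed.

Lemma dprob_dtimes d d' : dprob d -> dprob d' -> dprob (dtimes d d').
Proof.
move=> hd [h0 h1]; apply: dprob_bind => // a; split.
  by rewrite /dnonneg all_map.
by move: h1; rewrite /Ed big_map.
Qed.

Lemma mem_dtimes d d' z : z \in dtimes d d' ->
  exists a b, [/\ a \in d, b \in d' & z.2 = (a.2, b.2)].
Proof.
move=> /mem_dbind[a [y [ad /mapP[b bd ->] ->]]].
by exists a, b.
Qed.

Variables (ch : nat -> T -> dist R T) (ch' : nat -> T' -> dist R T').

(** The two words grow independently, so one of them can be frozen while the other is averaged. *)
Lemma level_pair i n phi (v : T * T') :
  level (fun i v => dtimes (ch i v.1) (ch' i v.2)) i n phi v =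
  level ch' i n (fun b => level ch i n (fun a => phi (a, b)) v.1) v.2.
Proof.
elim: n i v => [|n IH] i v /=; first by case: v.
rewrite Ed_dtimes Ed_swap; congr Ed; apply/funext => b.
by rewrite level_Ed; congr Ed; apply/funext => a; rewrite IH.
Qed.

End Pairs.
End Levels.

Section Stopping.
Variables (R : realType) (s : system R) (k0 : R -> R).
Hypothesis k0_ctx : ctx s k0.

(** Words are prolonged until the width first drops to [y]. The argument [n] is fuel, and
    [stopd_spec] tells when it suffices. *)
Fixpoint stopd (n : nat) (y : R) (w : seq (letter s)) : dist R (seq (letter s)) :=
  if n is n'.+1 then
    if width (descend w k0) <= y then [:: (1, w)]
    else dbind [seq (wt v, rcons w v) | v <- enum (letter s)] (stopd n' y)
  else [:: (1, w)].

Lemma descend_cat (w u : seq (letter s)) k : descend (w ++ u) k = descend u (descend w k).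
Proof. by elim: w k => [|v w IH] k //=; rewrite /descend /= -/(descend (w ++ u) _) IH. Qed.

Lemma descend_rcons (w : seq (letter s)) v k : descend (rcons w v) k = step v (descend w k).
Proof. by rewrite -cats1 descend_cat. Qed.

Lemma letters_prob (w : seq (letter s)) : dprob [seq (wt v, rcons w v) | v <- enum (letter s)].
Proof.
split; first by rewrite /dnonneg all_map; apply/allP => v _ /=; apply/ltW/wt_gt0.
rewrite /Ed big_map big_enum /= -[RHS](wt_sum s); apply: eq_bigr => v _; exact: mulr1.
Qed.

Lemma stopd_prob n y w : dprob (stopd n y w).
Proof.
elim: n w => [|n IH] w /=; first exact: dprob_ret.
case: ifP => _; first exact: dprob_ret.
by apply: dprob_bind => //; apply: letters_prob.
Qed.

Lemma Ed_letters (w : seq (letter s)) phi :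
  Ed [seq (wt v, rcons w v) | v <- enum (letter s)] phi = \sum_v wt v * phi (rcons w v).
Proof. by rewrite /Ed big_map big_enum. Qed.

(** Optional stopping for a function that is superharmonic on contexts of width at most [W]. *)
Lemma stopd_super n y H W w :
  (forall k, ctx s k -> width k <= W -> \sum_(v : letter s) wt v * H (step v k) <= H k) ->
  width (descend w k0) <= W ->
  Ed (stopd n y w) (fun w => H (descend w k0)) <= H (descend w k0).
Proof.
move=> hH; elim: n w => [|n IH] w hw /=; first by rewrite Ed_cons Ed_nil /= mul1r addr0.
case: ifP => _; first by rewrite Ed_cons Ed_nil /= mul1r addr0.
rewrite Ed_bind Ed_letters; apply: le_trans (hH _ (ctx_descend w k0_ctx) hw).
apply: ler_sum => v _; rewrite ler_wpM2l ?(ltW (wt_gt0 v)) //.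
rewrite -descend_rcons; apply: IH; rewrite descend_rcons.
apply: le_trans hw; apply: le_trans (width_le v (ctx_descend w k0_ctx)) _.
by rewrite ler_piMl ?(ltW (width_gt0 (ctx_descend w k0_ctx))) // (ltW (cmax_lt1 s)).
Qed.

Lemma stopd_spec n y w z : z \in stopd n y w ->
  cmax s ^+ n * width (descend w k0) <= y -> cmin s * y <= width (descend w k0) ->
  cmin s * y <= width (descend z.2 k0) <= y /\ exists u, z.2 = w ++ u.
Proof.
elim: n w z => [|n IH] w z /=.
  rewrite inE => /eqP -> /=; rewrite expr0 mul1r => h1 h2; rewrite h1 h2.
  by split => //; exists [::]; rewrite cats0.
case: ifP => [h1|/negbT h1].
  by rewrite inE => /eqP -> /= _ h2; rewrite h1 h2; split => //; exists [::]; rewrite cats0.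
move=> /mem_dbind[_ [z' [/mapP[v _ ->] /= hz' ->]]] hn h2.
have cw := ctx_descend w k0_ctx.
have [] := IH _ _ hz'.
- apply: le_trans hn; rewrite descend_rcons exprSr -mulrA.
  by rewrite ler_wpM2l ?exprn_ge0 ?(ltW (cmax_gt0 s)) // width_le.
- rewrite descend_rcons; apply: le_trans (width_ge v cw).
  by rewrite ler_wpM2l ?(ltW (cmin_gt0 s)) // ltW // ltNge.
by move=> h3 [u hu]; split=> //; exists (v :: u); rewrite hu cat_rcons.
Qed.

(** A random point of generation [n] falls into the cylinder of one stopped word, chosen with the
    stopping probabilities; so a bound of [f] at the word by [g] on its whole cylinder can be
    averaged. *)
Lemma stopd_pt n y f g w :
  (forall u xi, w ++ u \in [seq z.2 | z <- stopd n y w] -> 0 <= xi <= 1 ->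
     f (w ++ u) <= g (descend u id xi)) ->
  Ed (stopd n y w) f <= pt s n g.
Proof.
elim: n w g => [|n IH] w g h.
  rewrite Ed_cons Ed_nil /= mul1r addr0 /pt /tr /=.
  by have := h [::] 0; rewrite cats0; apply; rewrite ?lexx ?ler01 // inE.
rewrite /=; move: h; rewrite /=; case: ifP => hst h.
  rewrite Ed_cons Ed_nil /= mul1r addr0 -[leLHS](pt_cst s n.+1); apply: pt_le => xi hxi.
  by have := h [::] xi; rewrite cats0; apply => //; rewrite inE.
rewrite Ed_bind Ed_letters ptS; apply: ler_sum => v _.
rewrite ler_wpM2l ?(ltW (wt_gt0 v)) //; apply: IH => u xi hu hxi.
rewrite -cats1 -catA; have := h (v :: u) xi; rewrite /= descend_comp => H; apply: H => //.
move/mapP: hu => [z zin zE]; apply/mapP; exists (wt v * z.1, z.2).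
  apply/flatten_mapP; exists (wt v, rcons w v); first by apply/mapP; exists v; rewrite ?mem_enum.
  by apply/mapP; exists z.
by rewrite /= -zE cat_rcons.
Qed.

End Stopping.

(** * Separated families of cylinders *)

Lemma expr_small (R : realType) (c y : R) : 0 < c < 1 -> 0 < y ->
  exists L, forall n, (L <= n)%N -> c ^+ n <= y.
Proof.
move=> /andP[h0 h1] y0.
have /cvgrPdist_le /(_ y y0) [L _ hL] := @cvg_expr R c ltac:(by rewrite ger0_norm // ltW).
exists L => n hn; have := hL n hn.
by rewrite /= sub0r normrN ger0_norm // exprn_ge0 // ltW.
Qed.

Lemma powR_lt1 (R : realType) (q a : R) : 0 <= q < 1 -> 0 < a -> q `^ a < 1.
Proof.
move=> /andP[q0 q1] a0; have <- : 1 `^ a = 1 :> R by rewrite powR1.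
by rewrite gt0_ltr_powR ?nnegrE.
Qed.

Lemma powR_le1 (R : realType) (q a : R) : 0 <= q -> q <= 1 -> 0 <= a -> q `^ a <= 1.
Proof.
move=> q0 q1 a0; have <- : 1 `^ a = 1 :> R by rewrite powR1.
by rewrite ge0_ler_powR ?nnegrE.
Qed.

Lemma powR_small (R : realType) (K a : R) : 0 < a -> exists2 q0 : R, 0 < q0 &
  forall q, 0 < q <= q0 -> K * q `^ a <= 1.
Proof.
move=> a0; pose K1 := `|K| + 1; have K10 : 0 < K1 by rewrite ltr_wpDl.
exists (K1^-1 `^ a^-1) => [|q /andP[q0 hq]]; first by rewrite powR_gt0 // invr_gt0.
apply: le_trans (_ : K1 * q `^ a <= _).
  by rewrite ler_wpM2r ?powR_ge0 // (le_trans (ler_norm K)) // lerDl.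
rewrite -ler_pdivlMl // mulr1; apply: le_trans (_ : (K1^-1 `^ a^-1) `^ a <= _).
  by rewrite ge0_ler_powR ?nnegrE ?(ltW a0) ?(ltW q0) ?powR_ge0.
by rewrite -powRrM mulVf ?gt_eqF // powRr1 // invr_ge0 ltW.
Qed.

Lemma descend_near (R : realType) (s : system R) k (w : seq (letter s)) y : ctx s k ->
  width (descend w k) <= y -> forall u, `|descend (w ++ u) k 0 - descend w k 0| <= y.
Proof.
move=> ck hy u; rewrite descend_cat descend_comp /=; apply: le_trans hy.
have m0 : 0 <= (0 : R) <= 1 by rewrite lexx ler01.
exact: ctx_width (ctx_descend w ck) (descend01 u m0) m0.
Qed.

Lemma inj_of_uniq_map (T J : eqType) (f : T -> J) (r : seq T) : uniq [seq f x | x <- r] ->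
  {in r &, injective f}.
Proof.
elim: r => //= a r IH /andP[na u] x y; rewrite !inE => /orP[/eqP->|xr] /orP[/eqP->|yr] // e.
- by rewrite e (map_f f yr) in na.
- by rewrite -e (map_f f xr) in na.
exact: IH.
Qed.

(* Keeping only the even, or only the odd, values of [f] loses a factor two. *)
Lemma sparse_selection (T : eqType) (f : T -> int) (r : seq T) : exists r' : seq T,
  [/\ uniq r', {subset r' <= r}, (size (undup [seq f x | x <- r]) <= 2 * size r')%N &
   {in r' &, forall u v, u != v -> f u + 1 < f v \/ f v + 1 < f u}].
Proof.
have sel (S : seq int) : {subset S <= [seq f x | x <- r]} ->
    exists2 r' : seq T, {subset r' <= r} & [seq f x | x <- r'] = S.
  elim: S => [|j S IH] h; first by exists [::].
  have [r' h1 h2] := IH (fun i hi => h i (mem_behead (s := j :: S) hi)).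
  have /mapP[x xr ->] := h j (mem_head _ _).
  by exists (x :: r') => [y|/=]; rewrite ?h2 // inE => /orP[/eqP -> //|]; apply: h1.
pose S := undup [seq f x | x <- r]; pose ev (j : int) := (2 %| j)%Z.
have [b hb] : exists b, (size S <= 2 * size [seq j <- S | ev j == b])%N.
  have := count_predC ev S; rewrite -!size_filter => hc.
  have [h|h] := leqP (size S) (2 * size [seq j <- S | ev j]).
    by exists true; rewrite (eq_filter (a2 := ev)) // => j; case: (ev j).
  exists false; rewrite (eq_filter (a2 := predC ev)); last by move=> j /=; case: (ev j).
  rewrite -hc mul2n -addnn leq_add2r; move: h; rewrite -hc mul2n -addnn ltn_add2l.
  exact: ltnW.
have [|r' h1 h2] := sel [seq j <- S | ev j == b].
  by move=> j; rewrite mem_filter => /andP[_]; rewrite mem_undup.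
have um : uniq [seq f x | x <- r'] by rewrite h2 filter_uniq // undup_uniq.
exists r'; split => //; first exact: map_uniq um.
  by rewrite (leq_trans hb) // -h2 size_map.
move=> u v ur vr; have hb' x : x \in r' -> ev (f x) = b.
  by move=> xr; have := map_f f xr; rewrite h2 mem_filter => /andP[/eqP].
move=> uv; have hne : f u <> f v by move=> e; case/eqP: uv; apply: (inj_of_uniq_map um).
by move: (hb' u ur) (hb' v vr); rewrite /ev => e1 e2; lia.
Qed.

Section PairTree.
Variables (R : realType) (s1 s2 : system R) (A B : R) (k k' : R -> R) (x q : R) (n1 : nat).
Hypothesis ck : ctx s1 k.
Hypothesis ck' : ctx s2 k'.
Hypothesis x0 : 0 < x.
Hypothesis q0 : 0 < q.

Definition cmin2 := Num.min (cmin s1) (cmin s2).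
Hypothesis qc : q <= cmin2.
Hypothesis n1_1 : cmax s1 ^+ n1 <= q.
Hypothesis n1_2 : cmax s2 ^+ n1 <= q.

Definition scale_of i : R := q ^+ i * x.
Definition children1 i (w : seq (letter s1)) := stopd k n1 (scale_of i.+1) w.
Definition children2 i (w : seq (letter s2)) := stopd k' n1 (scale_of i.+1) w.
Definition children i (v : seq (letter s1) * seq (letter s2)) := dtimes (children1 i v.1) (children2 i v.2).
Definition fits1 i (w : seq (letter s1)) := cmin2 * scale_of i <= width (descend w k) <= scale_of i.
Definition fits2 i (w : seq (letter s2)) := cmin2 * scale_of i <= width (descend w k') <= scale_of i.
Definition fits_both i (v : seq (letter s1) * seq (letter s2)) : Prop := fits1 i v.1 /\ fits2 i v.2.
Definition proj_pair (v : seq (letter s1) * seq (letter s2)) : R :=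
  A * descend v.1 k 0 + B * descend v.2 k' 0.
Definition coef_sum : R := `|A| + `|B|.
(** Below a node the projection moves by at most [coef_sum * scale_of i.+1]. Two nodes cost
    [2 * coef_sum] and a common cell costs [2 * coef_sum + 1], so nodes further apart than this
    share no cell. *)
Definition colliding i (c c' : seq (letter s1) * seq (letter s2)) :=
  `|proj_pair c - proj_pair c'| <= (4 * coef_sum + 1) * scale_of i.+1.

Lemma cmin2_gt0 : 0 < cmin2. Proof. by rewrite lt_min !cmin_gt0. Qed.
Lemma cmin2_le1 : cmin2 <= 1. Proof. by rewrite ge_min cmin_le1. Qed.
Lemma q_le1 : q <= 1. Proof. exact: le_trans qc cmin2_le1. Qed.
Lemma xs_gt0 i : 0 < scale_of i. Proof. by rewrite mulr_gt0 // exprn_gt0. Qed.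
Lemma xsS i : scale_of i.+1 = q * scale_of i. Proof. by rewrite /scale_of exprS mulrA. Qed.
Lemma xs_le i j : (i <= j)%N -> scale_of j <= scale_of i.
Proof. by move=> ij; rewrite ler_pM2r // ler_wiXn2l // ?(ltW q0) ?q_le1. Qed.
Lemma E0_ge0 : 0 <= coef_sum. Proof. by rewrite addr_ge0. Qed.

Lemma ch_prob i v : dprob (children i v).
Proof. by apply: dprob_dtimes; apply: stopd_prob. Qed.

Lemma ch1_spec i w z : fits1 i w -> z \in children1 i w -> fits1 i.+1 z.2 /\ exists u, z.2 = w ++ u.
Proof.
move=> /andP[h1 h2] hz.
have [] := stopd_spec ck hz.
- apply: le_trans (_ : q * scale_of i <= _); last by rewrite -xsS.
  by rewrite ler_pM ?exprn_ge0 ?(ltW (cmax_gt0 s1)) // (ltW (width_gt0 (ctx_descend w ck))).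
- apply: le_trans h1; rewrite xsS; apply: le_trans (_ : 1 * (cmin2 * scale_of i) <= _); last by rewrite mul1r.
  by rewrite ler_pM ?(ltW (cmin_gt0 s1)) ?cmin_le1 ?ler_pM2r ?xs_gt0 // mulr_ge0 ?(ltW q0) ?(ltW (xs_gt0 i)).
move=> /andP[h3 h4] hu; split => //; rewrite /fits1 h4 andbT; apply: le_trans h3.
by rewrite ler_pM2r ?xs_gt0 // ge_min lexx.
Qed.

Lemma ch2_spec i w z : fits2 i w -> z \in children2 i w -> fits2 i.+1 z.2 /\ exists u, z.2 = w ++ u.
Proof.
move=> /andP[h1 h2] hz.
have [] := stopd_spec ck' hz.
- apply: le_trans (_ : q * scale_of i <= _); last by rewrite -xsS.
  by rewrite ler_pM ?exprn_ge0 ?(ltW (cmax_gt0 s2)) // (ltW (width_gt0 (ctx_descend w ck'))).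
- apply: le_trans h1; rewrite xsS; apply: le_trans (_ : 1 * (cmin2 * scale_of i) <= _); last by rewrite mul1r.
  by rewrite ler_pM ?(ltW (cmin_gt0 s2)) ?cmin_le1 ?ler_pM2r ?xs_gt0 // mulr_ge0 ?(ltW q0) ?(ltW (xs_gt0 i)).
move=> /andP[h3 h4] hu; split => //; rewrite /fits2 h4 andbT; apply: le_trans h3.
by rewrite ler_pM2r ?xs_gt0 // ge_min lexx orbT.
Qed.

Lemma P_ch i v z : fits_both i v -> z \in children i v -> fits_both i.+1 z.2.
Proof.
move=> [h1 h2] /mem_dtimes[a [b [ain bin ->]]].
by split; [case: (ch1_spec h1 ain) | case: (ch2_spec h2 bin)].
Qed.

Lemma pt_shift1 i w u xi : fits1 i (w ++ u) -> 0 <= xi <= 1 ->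
  `|descend w k (descend u id xi) - descend (w ++ u) k 0| <= scale_of i.
Proof.
move=> /andP[_ h] hxi.
have -> : descend w k (descend u id xi) = descend (w ++ u) k xi.
  by rewrite descend_cat [in RHS]descend_comp.
by apply: le_trans h; apply: ctx_width (ctx_descend _ ck) _ _; rewrite ?lexx ?ler01.
Qed.

Lemma pt_shift2 i w u xi : fits2 i (w ++ u) -> 0 <= xi <= 1 ->
  `|descend w k' (descend u id xi) - descend (w ++ u) k' 0| <= scale_of i.
Proof.
move=> /andP[_ h] hxi.
have -> : descend w k' (descend u id xi) = descend (w ++ u) k' xi.
  by rewrite descend_cat [in RHS]descend_comp.
by apply: le_trans h; apply: ctx_width (ctx_descend _ ck') _ _; rewrite ?lexx ?ler01.
Qed.

(** Replacing each of the four words by a random point of its cylinder moves the difference of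
    projections by at most [2 * coef_sum] scales, which turns the factor [4] of [colliding] into
    [6]. *)
Lemma crowding_overlap i v : fits_both i v ->
  crowding children colliding i v <= overlap s1 s2 A B n1 ((6 * coef_sum + 1) * scale_of i.+1) (descend v.1 k) (descend v.2 k').
Proof.
case: v => w w' [/= h1 h2]; rewrite /crowding /children /= Ed_dtimes.
rewrite (_ : (fun a => _) = (fun a => Ed (children1 i w) (fun a' => Ed (children2 i w') (fun b =>
   Ed (children2 i w') (fun b' => (colliding i (a, b) (a', b'))%:R))))); last first.
  apply/funext => a; rewrite [RHS]Ed_swap; congr Ed; apply/funext => b.
  by rewrite Ed_dtimes.
have in1 u : w ++ u \in [seq z.2 | z <- stopd k n1 (scale_of i.+1) w] -> fits1 i.+1 (w ++ u).
  by move=> /mapP[z zin ->]; case: (ch1_spec h1 zin).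
have in2 u : w' ++ u \in [seq z.2 | z <- stopd k' n1 (scale_of i.+1) w'] -> fits2 i.+1 (w' ++ u).
  by move=> /mapP[z zin ->]; case: (ch2_spec h2 zin).
apply: stopd_pt => u1 xi1 /in1 hu1 hxi1; apply: stopd_pt => u2 xi2 /in1 hu2 hxi2.
apply: stopd_pt => u3 xi3 /in2 hu3 hxi3; apply: stopd_pt => u4 xi4 /in2 hu4 hxi4.
case: (boolP (colliding _ _ _)) => [hc|_]; last exact: kern_ge0.
have E6 : 0 < (6 * coef_sum + 1) * scale_of i.+1 by rewrite mulr_gt0 ?xs_gt0 // ltr_wpDl // mulr_ge0 // E0_ge0.
rewrite kern_eq1 // normrM [`|_^-1|]ger0_norm ?invr_ge0 ?(ltW E6) // ler_pdivrMr // mul1r.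
have a1 := pt_shift1 hu1 hxi1; have a2 := pt_shift1 hu2 hxi2.
have a3 := pt_shift2 hu3 hxi3; have a4 := pt_shift2 hu4 hxi4.
move: hc; rewrite /colliding /proj_pair /=.
move: a1 a2 a3 a4; set X1 := descend w k _; set X2 := descend w k _; set Y1 := descend w' k' _.
set Y2 := descend w' k' _; set Z1 := descend _ k 0; set Z2 := descend _ k 0.
set W1 := descend _ k' 0; set W2 := descend _ k' 0 => a1 a2 a3 a4 hc.
have -> : A * (X1 - X2) + B * (Y1 - Y2) = (A * Z1 + B * W1 - (A * Z2 + B * W2)) +
   (A * ((X1 - Z1) - (X2 - Z2)) + B * ((Y1 - W1) - (Y2 - W2))) by ring.
apply: le_trans (ler_normD _ _) _.
have b1 : `|A * ((X1 - Z1) - (X2 - Z2))| <= `|A| * (2 * scale_of i.+1).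
  by rewrite normrM ler_wpM2l //; apply: le_trans (ler_normB _ _) _; lra.
have b2 : `|B * ((Y1 - W1) - (Y2 - W2))| <= `|B| * (2 * scale_of i.+1).
  by rewrite normrM ler_wpM2l //; apply: le_trans (ler_normB _ _) _; lra.
have b3 := ler_normD (A * ((X1 - Z1) - (X2 - Z2))) (B * ((Y1 - W1) - (Y2 - W2))).
by move: hc; rewrite /coef_sum; lra.
Qed.

Variables (m : nat -> R) (N : nat).

Lemma leaves_spec i n v z : fits_both i v -> z \in leaves children m colliding i n v ->
  fits_both (i + n) z.2 /\ exists u u', z.2 = (v.1 ++ u, v.2 ++ u').
Proof.
elim: n i v z => [|n IH] i v z Pv.
  rewrite /= inE => /eqP -> /=; rewrite addn0; split => //.
  by exists [::], [::]; rewrite !cats0; case: (v).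
move=> /mem_leavesS[c [z' [cin z'in ->]]].
have [h1 [u [u' e]]] := IH _ _ _ (P_ch Pv cin) z'in; rewrite addnS -addSn; split => //.
move: cin => /mem_dtimes[a [b [ain bin cE]]]; rewrite e cE /=.
have [_ [u1 ->]] := ch1_spec Pv.1 ain; have [_ [u2 ->]] := ch2_spec Pv.2 bin.
by exists (u1 ++ u), (u2 ++ u'); rewrite !catA.
Qed.

Lemma pr_leaf i n c z : fits_both i c -> z \in leaves children m colliding i n c ->
  `|proj_pair z.2 - proj_pair c| <= coef_sum * scale_of i.
Proof.
move=> Pc /(leaves_spec Pc)[_ [u [u' ->]]]; rewrite /proj_pair /=.
have a1 := descend_near ck (andP Pc.1).2 u.
have a2 := descend_near ck' (andP Pc.2).2 u'.
set X := descend _ k 0 in a1 *; set Z := descend _ k 0 in a1 *.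
set Y := descend _ k' 0 in a2 *; set W := descend _ k' 0 in a2 *.
have -> : A * X + B * Y - (A * Z + B * W) = A * (X - Z) + B * (Y - W) by ring.
apply: le_trans (ler_normD _ _) _; rewrite !normrM /coef_sum mulrDl.
by apply: lerD; rewrite ler_wpM2l.
Qed.

(** Points of non-adjacent cells are at least one mesh apart. The mesh exceeds [2 * coef_sum] scales
    by one scale, which is what remains when both points move inside their products of cylinders. *)
Definition cell_index (v : seq (letter s1) * seq (letter s2)) : int :=
  Num.floor (proj_pair v / ((2 * coef_sum + 1) * scale_of N)).

Lemma mesh_gt0 : 0 < (2 * coef_sum + 1) * scale_of N.
Proof. by rewrite mulr_gt0 ?xs_gt0 // ltr_wpDl // mulr_ge0 // E0_ge0. Qed.

Lemma idx_eq v v' : cell_index v = cell_index v' -> `|proj_pair v - proj_pair v'| < (2 * coef_sum + 1) * scale_of N.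
Proof.
move=> e; have M0 := mesh_gt0.
have f1 := floor_itv (proj_pair v / ((2 * coef_sum + 1) * scale_of N)).
have f2 := floor_itv (proj_pair v' / ((2 * coef_sum + 1) * scale_of N)).
move: f1 f2; rewrite -/(cell_index v) -/(cell_index v') e; set M := (2 * coef_sum + 1) * scale_of N in M0 *.
rewrite intrD mulr1z => /andP[f1 f2] /andP[f3 f4].
move: f1 f2 f3 f4; rewrite ler_pdivlMr // ltr_pdivrMr // ler_pdivlMr // ltr_pdivrMr // mulrDl mul1r.
by set a := _%:~R * _; move=> *; rewrite ltr_norml; apply/andP; split; lra.
Qed.

Lemma idx_far v v' : (cell_index v + 1 < cell_index v') -> (2 * coef_sum + 1) * scale_of N <= proj_pair v' - proj_pair v.
Proof.
move=> e; have M0 := mesh_gt0.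
have f1 := floor_itv (proj_pair v / ((2 * coef_sum + 1) * scale_of N)).
have f2 := floor_itv (proj_pair v' / ((2 * coef_sum + 1) * scale_of N)).
move: f1 f2; rewrite -/(cell_index v) -/(cell_index v') => /andP[f1 f2] /andP[f3 f4].
have e' : (cell_index v + 1 + 1)%:~R <= (cell_index v')%:~R :> R by rewrite ler_int lezD1.
move: f2 f3 e'; set M := (2 * coef_sum + 1) * scale_of N in M0 *.
rewrite ltr_pdivrMr // ler_pdivlMr // !intrD !mulr1z => f2 f3 e'.
by nra.
Qed.

Lemma ch_separated i n v c c' y z : (i.+1 + n = N)%N -> fits_both i v ->
  c \in children i v -> c' \in children i v -> ~~ colliding i c.2 c'.2 ->
  y \in leaves children m colliding i.+1 n c.2 -> z \in leaves children m colliding i.+1 n c'.2 ->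
  cell_index y.2 != cell_index z.2.
Proof.
move=> hN Pv cin c'in ncl yin zin; apply/eqP => /idx_eq e.
have h1 := pr_leaf (P_ch Pv cin) yin; have h2 := pr_leaf (P_ch Pv c'in) zin.
move: ncl; rewrite /colliding -ltNge ltNge => /negP; apply.
have hx : scale_of N <= scale_of i.+1 by apply: xs_le; rewrite -hN leq_addr.
have E := E0_ge0.
have hx' : (2 * coef_sum + 1) * scale_of N <= (2 * coef_sum + 1) * scale_of i.+1 by rewrite ler_wpM2l // addr_ge0 // mulr_ge0.
have -> : proj_pair c.2 - proj_pair c'.2 = (proj_pair y.2 - proj_pair z.2) - ((proj_pair y.2 - proj_pair c.2) - (proj_pair z.2 - proj_pair c'.2)) by ring.
apply: le_trans (ler_normB _ _) _.
have := ler_normB (proj_pair y.2 - proj_pair c.2) (proj_pair z.2 - proj_pair c'.2).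
by move: e; lra.
Qed.

End PairTree.

(** Lipschitz cutoff, equal to [1] on [[c, 1]] and to [0] outside [[c / 2, 2]]; it gives the overlap
    the bounded window that [potential_bound] needs. *)
Definition bump (R : realType) (c z : R) : R := clamp (2 - z) * clamp (2 * z / c - 1).

Section Bump.
Variables (R : realType) (c : R).
Hypothesis c0 : 0 < c.

Lemma bump01 z : 0 <= bump c z <= 1.
Proof.
have /andP[a0 a1] := clamp01 (2 - z); have /andP[b0 b1] := clamp01 (2 * z / c - 1).
by rewrite mulr_ge0 //= mulr_ile1.
Qed.

Lemma bump_eq1 z : c <= z <= 1 -> bump c z = 1.
Proof.
move=> /andP[h1 h2]; rewrite /bump !clamp_eq1 ?mulr1 //; last lra.
have : 1 <= z / c by rewrite ler_pdivlMr // mul1r.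
by rewrite -mulrA; lra.
Qed.

Lemma bump_eq0 z : ~~ (c / 2 <= z <= 2) -> bump c z = 0.
Proof.
rewrite negb_and -!ltNge => /orP[h|h]; rewrite /bump.
  rewrite [clamp (2 * z / c - 1)]clamp_eq0 ?mulr0 //.
  have : z / c <= 1 / 2 by rewrite ler_pdivrMr //; lra.
  by rewrite -mulrA; lra.
by rewrite clamp_eq0 ?mul0r //; lra.
Qed.

Lemma bump_lip y z : `|bump c y - bump c z| <= (1 + 2 / c) * `|y - z|.
Proof.
rewrite /bump; set a := clamp (2 - y); set a' := clamp (2 - z).
set b := clamp (_ * y / c - 1); set b' := clamp (_ * z / c - 1).
have -> : a * b - a' * b' = (a - a') * b + a' * (b - b') by ring.
have /andP[b0 b1] : 0 <= b <= 1 by apply: clamp01.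
have /andP[a0 a1] : 0 <= a' <= 1 by apply: clamp01.
have h1 : `|a - a'| <= `|y - z|.
  apply: le_trans (clamp_lip _ _) _; rewrite (_ : 2 - y - (2 - z) = z - y); last by ring.
  by rewrite distrC.
have h2 : `|b - b'| <= 2 / c * `|y - z|.
  apply: le_trans (clamp_lip _ _) _.
  rewrite (_ : 2 * y / c - 1 - (2 * z / c - 1) = 2 / c * (y - z)); last by ring.
  by rewrite normrM ger0_norm // divr_ge0 // ltW.
apply: le_trans (ler_normD _ _) _; rewrite !normrM (ger0_norm b0) (ger0_norm a0) mulrDl mul1r.
by apply: lerD; [apply: le_trans h1; rewrite ler_piMr | apply: le_trans h2; rewrite ler_piMl].
Qed.

End Bump.

(** * Selection of separated pairs of cylinders at one scale *)

Section Horizon.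
Variables (R : realType) (s1 s2 : system R) (A B : R).
Hypothesis A0 : A != 0.
Hypothesis B0 : B != 0.
Hypothesis t_lt1 : sdim s1 + sdim s2 < 1.
Hypothesis hst : steerable s1.

Let c := cmin2 s1 s2.
Let t := sdim s1 + sdim s2.
Let E6 := 6 * coef_sum A B + 1.

Let c0 : 0 < c. Proof. exact: cmin2_gt0. Qed.
Let c1 : c <= 1. Proof. exact: cmin2_le1. Qed.
Let E60 : 0 < E6. Proof. by rewrite ltr_wpDl // mulr_ge0 // E0_ge0. Qed.

(** The overlap at scale [x] as a function of the first context, normalised to width about one; the
    second context is a parameter. The threshold found by [mixing] is the same for all [x] and [kb],
    hence serves at every node. *)
Definition scaled_overlap (n1 : nat) (q x : R) (kb : R -> R) (kp : R -> R) : R :=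
  bump c (width kp) * overlap s1 s2 A B n1 (E6 * q * x) (dilate x kp) kb.

Lemma width_dilate (a : R) kp : 0 <= a -> width (dilate a kp) = a * width kp.
Proof. by move=> a0; rewrite /width /dilate -mulrBr normrM ger0_norm. Qed.

Lemma phi01 n1 q x kb kp : 0 <= scaled_overlap n1 q x kb kp <= 1.
Proof.
have /andP[a0 a1] := bump01 c (width kp).
have /andP[b0 b1] := overlap01 s1 s2 A B n1 (E6 * q * x) (dilate x kp) kb.
by rewrite mulr_ge0 //= mulr_ile1.
Qed.

Lemma phi_window n1 q x kb kp : ~~ (c / 2 <= width kp <= 2) -> scaled_overlap n1 q x kb kp = 0.
Proof. by move=> h; rewrite /scaled_overlap bump_eq0 ?mul0r. Qed.

(** If [k2] is outside the window its value is [0]. Otherwise [width k1 <= 4] because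
    [delta <= 1 / 2], and both the cutoff and the overlap vary at most linearly in [delta]. *)
Lemma phi_lip n1 q x kb k1 k2 delta : 0 < q -> 0 < x -> ctx s1 k1 -> ctx s1 k2 ->
  delta <= 1 / 2 -> relclose delta k1 k2 ->
  scaled_overlap n1 q x kb k2 <= scaled_overlap n1 q x kb k1 + (4 * (1 + 2 / c) + 4 * `|A| / (E6 * q)) * delta.
Proof.
move=> q0 x0 ck1 ck2 dh cl.
have w1 := width_gt0 ck1; have w2 := width_gt0 ck2.
have hw := relclose_width cl.
have d0 : 0 <= delta by have := le_trans (normr_ge0 _) hw; rewrite pmulr_lge0.
set L1 := 1 + 2 / c; set L2 := `|A| / (E6 * q).
have L10 : 0 <= L1 by rewrite addr_ge0 // divr_ge0 // ltW.
have L20 : 0 <= L2 by rewrite divr_ge0 // mulr_ge0 // ltW.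
have -> : 4 * `|A| / (E6 * q) = 4 * L2 by rewrite mulrA.
have [big|small] := boolP (c / 2 <= width k2 <= 2); last first.
  rewrite phi_window // addr_ge0 //; first by case/andP: (phi01 n1 q x kb k1).
  by rewrite mulr_ge0 // addr_ge0 // mulr_ge0.
have w14 : width k1 <= 4.
  case/andP: big => _ h2; move: hw; rewrite ler_norml => /andP[_ h3].
  by have : delta * width k1 <= 1 / 2 * width k1 by [rewrite ler_wpM2r // ltW]; lra.
rewrite /scaled_overlap; set f1 := overlap _ _ _ _ _ _ (dilate x k1) _; set f2 := overlap _ _ _ _ _ _ _ _.
have /andP[u0 u1] : 0 <= f1 <= 1 by apply: overlap01.
have /andP[v0 v1] : 0 <= f2 <= 1 by apply: overlap01.
have /andP[b10 b11] := bump01 c (width k1); have /andP[b20 b21] := bump01 c (width k2).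
have h1 : `|bump c (width k1) - bump c (width k2)| <= L1 * (4 * delta).
  apply: le_trans (bump_lip c0 _ _) _; rewrite ler_wpM2l //; apply: le_trans hw _.
  by rewrite mulrC ler_wpM2r.
have h2 : f2 <= f1 + 4 * L2 * delta.
  have cl' : relclose delta (dilate x k1) (dilate x k2).
    move=> y z hy hz; rewrite /dilate -!mulrBr !normrM [`|x|]ger0_norm ?(ltW x0) //.
    by rewrite mulrCA ler_wpM2l ?(ltW x0) //; apply: cl.
  have e0 : 0 < E6 * q * x by rewrite !mulr_gt0.
  apply: le_trans (@overlap_close R s1 s2 A B n1 _ _ _ kb _ e0 d0 (ctx_scale x0 ck1) cl') _.
  rewrite lerD2l ler_wpM2r // -[fun _ => _]/(dilate x k1) width_dilate ?(ltW x0) //.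
  rewrite (_ : `|A| * (x * width k1) / (E6 * q * x) = L2 * width k1); last first.
    by rewrite /L2; field; rewrite !gt_eqF.
  by rewrite mulrC ler_wpM2r.
move: h1; rewrite ler_norml => /andP[h3 h4].
set b1 := bump c (width k1) in b10 b11 h3 h4 *; set b2 := bump c (width k2) in b20 b21 h3 h4 *.
have h5 : b2 * f2 <= b2 * (f1 + 4 * L2 * delta) by rewrite ler_wpM2l.
have h6 : b2 * f1 <= (b1 + L1 * (4 * delta)) * f1 by rewrite ler_wpM2r //; lra.
have h7 : L1 * (4 * delta) * f1 <= L1 * (4 * delta) by rewrite ler_piMr // !mulr_ge0.
have h8 : b2 * (4 * L2 * delta) <= 4 * L2 * delta by rewrite ler_piMl // mulr_ge0 // mulr_ge0.
by lra.
Qed.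

Lemma phi_average : exists2 C : R, 0 < C & forall q, 0 < q -> exists L, forall n m,
  (L <= n)%N -> (2 ^ L <= m)%N -> forall x kb kp, 0 < x -> ctx s2 kb ->
  c * x <= width kb <= x -> ctx s1 kp ->
  \sum_(i < m) scaled_overlap n q x kb (dilate (expR (i%:R / m%:R)) kp) <= m%:R * (C * q `^ t).
Proof.
have c80 : 0 < c / 8 by rewrite divr_gt0.
have [C C0 hC] := overlap_dilate_average A0 B0 t_lt1 2 c80.
exists (C * E6 `^ t) => [|q q0]; first by rewrite mulr_gt0 ?powR_gt0.
have Eq0 : 0 < E6 * q by rewrite mulr_gt0.
have [L hL] := hC _ Eq0; exists L => n m hn hm x kb kp x0 ckb /andP[wb1 wb2] ckp.
have m0 : (0 < m)%N by apply: leq_trans hm; rewrite expn_gt0.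
rewrite -mulrA -powRM ?(ltW E60) ?(ltW q0) //.
have wp := width_gt0 ckp.
have [h|h] := pselect (forall i : 'I_m, scaled_overlap n q x kb (dilate (expR (i%:R / m%:R)) kp) = 0).
  by rewrite big1 => [|i _]; rewrite ?h // !mulr_ge0 ?powR_ge0 // ltW.
(* Some dilation by a factor in [[1, 4]] has width in [[c / 2, 2]], so the context itself has width
   in [[c / 8, 2]]; without such a dilation all terms vanish. *)
have {h} /andP[w1 w2] : c / 8 <= width kp <= 2.
  move: h => /existsNP[i hi]; case: (boolP (c / 2 <= width (dilate (expR (i%:R / m%:R)) kp) <= 2)) => [|h]; last first.
    by case: hi; rewrite phi_window.
  have e1 : 1 <= expR (i%:R / m%:R) :> R by rewrite -[leLHS]expR0 ler_expR divr_ge0.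
  have e4 : expR (i%:R / m%:R) <= 4 :> R.
    by apply: le_trans (expR_le4 R); rewrite ler_expR ler_pdivrMr ?ltr0n // mul1r ler_nat ltnW.
  rewrite width_dilate ?expR_ge0 // => /andP[h1 h2].
  by apply/andP; split; nra.
apply: le_trans (hL n m hn hm x (dilate x kp) kb x0 (ctx_scale x0 ckp) ckb _ _).
- apply: ler_sum => i _; rewrite /scaled_overlap.
  rewrite (_ : dilate x (dilate _ kp) = dilate (expR (i%:R / m%:R)) (dilate x kp)); last first.
    by apply/funext => y; rewrite /dilate mulrCA.
  rewrite ler_piMl //; first by case/andP: (overlap01 s1 s2 A B n (E6 * q * x) (dilate (expR (i%:R / m%:R)) (dilate x kp)) kb).
  by case/andP: (bump01 c (width (dilate (expR (i%:R / m%:R)) kp))).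
- by rewrite width_dilate ?(ltW x0) // [x * _]mulrC !ler_pM2r // w1 w2.
by rewrite (le_trans _ wb1) ?(le_trans wb2) //; [lra|rewrite ler_pM2r //; lra].
Qed.

Section OneLevel.
Variables (q : R) (n1 m nw l J : nat) (X Cq x : R) (k k' : R -> R).
Hypothesis q0 : 0 < q.
Hypothesis qc : q <= c.
Hypothesis n1_1 : cmax s1 ^+ n1 <= q.
Hypothesis n1_2 : cmax s2 ^+ n1 <= q.
Hypothesis x0 : 0 < x.
Hypothesis ck : ctx s1 k.
Hypothesis ck' : ctx s2 k'.
Hypothesis wk : c * x <= width k <= x.
Hypothesis wk' : c * x <= width k' <= x.
Hypothesis Xl : X * q ^+ l <= c.
Hypothesis Jl : cmax s1 ^+ J.+1 < c / 2 * q ^+ l.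
Hypothesis mixed : forall y kb, 0 < y -> ctx s2 kb -> c * y <= width kb <= y ->
  forall J kp, ctx s1 kp -> X <= width kp ->
    potential (@wt _ s1) (@step _ s1) J (scaled_overlap n1 q y kb) kp <= Cq.

Let tree := @children R s1 s2 k k' x q n1.
Let near := @colliding R s1 s2 A B k k' x q.
Let good := @fits_both R s1 s2 k k' x q.
Let root : seq (letter s1) * seq (letter s2) := ([::], [::]).

Lemma root_good : good 0 root.
Proof. by rewrite /good /fits_both /fits1 /fits2 /= /scale_of expr0 mul1r. Qed.

(** For a frozen second word the crowding is at most the overlap, hence at most its potential, at
    the normalised first context. The potential is superharmonic, so its mean over level [l] is at
    most its value at the root; and the root, measured in units of [q ^ l * x], is wide enough for
    the bound of [mixing]. *)
Lemma crowding_level : level tree 0 l (crowding tree near l) root <= Cq.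
Proof.
have y0 : 0 < scale_of x q l by apply: xs_gt0.
set y := scale_of x q l in y0.
pose g kp := dilate y^-1 kp : R -> R.
have treeP i v z : good i v -> z \in tree i v -> good i.+1 z.2.
  by move=> h zin; apply: P_ch zin.
apply: le_trans (level_le (phi := crowding tree near l)
   (psi := fun v => scaled_overlap n1 q y (descend v.2 k') (g (descend v.1 k))) _ treeP _ root_good) _.
- by move=> i v; apply: ch_prob.
- move=> v; rewrite add0n => Pv.
  apply: le_trans (crowding_overlap A B ck ck' x0 q0 qc n1_1 n1_2 Pv) _.
  have gk : dilate y (g (descend v.1 k)) = descend v.1 k.
    by apply/funext => z; rewrite /dilate mulVKf // gt_eqF.
  rewrite /scaled_overlap gk xsS mulrA [_ * q * _]mulrAC -/y bump_eq1 ?mul1r //.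
  rewrite width_dilate ?invr_ge0 ?(ltW y0) // mulrC ler_pdivlMr // ler_pdivrMr // mul1r.
  by case: Pv.
rewrite level_pair /=.
have tree2 i v z : @fits2 R s1 s2 k' x q i v -> z \in children2 k' x q n1 i v -> @fits2 R s1 s2 k' x q i.+1 z.2.
  by move=> h zin; case: (@ch2_spec _ s1 _ _ _ _ _ ck' x0 q0 qc n1_2 _ _ _ h zin).
have tree1 i v z : @fits1 R s1 s2 k x q i v -> z \in children1 k x q n1 i v -> @fits1 R s1 s2 k x q i.+1 z.2.
  by move=> h zin; case: (@ch1_spec _ _ s2 _ _ _ _ ck x0 q0 qc n1_1 _ _ _ h zin).
apply: (@level_ub R _ (children2 k' x q n1) _ _ tree2) => [i v|b|]; first exact: stopd_prob.
  rewrite add0n => Pb.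
  have cb : ctx s2 (descend b k') by apply: ctx_descend.
  pose H (w : seq (letter s1)) := potential (@wt _ s1) (@step _ s1) J.+1 (scaled_overlap n1 q y (descend b k') \o g) (descend w k).
  have ph0 kp : 0 <= scaled_overlap n1 q y (descend b k') kp by case/andP: (phi01 n1 q y (descend b k') kp).
  apply: le_trans (level_le (psi := H) _ tree1 _ (root_good).1) _.
  - by move=> i v; apply: stopd_prob.
  - move=> w _; rewrite /H /= lerDl sumr_ge0 // => v _; rewrite mulr_ge0 ?(ltW (wt_gt0 _)) //.
    apply: (@potential_ge0 _ _ _ _ _ (@wt_gt0 _ s1) (ctx s1)) => //.
    + by move=> v' s; apply: ctx_step.
    + by move=> s _; apply: ph0.
    + by apply: ctx_step; apply: ctx_descend.
  apply: le_trans (level_super (H := H) _ tree1 _ _ (root_good).1) _.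
  - by move=> i v; apply: stopd_prob.
  - move=> i w Pw; apply: (@stopd_super R s1 k ck _ _ (fun kp => potential (@wt _ s1) (@step _ s1) J.+1 (scaled_overlap n1 q y (descend b k') \o g) kp) x) => [kp ckp wkp|].
      apply: (@potential_superharmonic _ _ (@wt _ s1) _ _ (ctx s1)) => //; last by move=> s _; apply: ph0.
      (* After [J.+1] letters all widths are below the window belonging to this level, so the
         truncated potential is superharmonic. *)
      move=> u su /=; apply: phi_window; rewrite negb_and -ltNge; apply/orP; left.
      rewrite width_dilate ?invr_ge0 ?(ltW y0) // ltr_pdivrMl //.
      apply: le_lt_trans (width_descend_le u ckp) _; rewrite su.
        apply: le_lt_trans (_ : cmax s1 ^+ J.+1 * x < _).
          by rewrite ler_wpM2l // exprn_ge0 // ltW // cmax_gt0.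
        by rewrite [ltRHS]mulrC /y /scale_of mulrA ltr_pM2r.
    by case/andP: Pw => _ h; apply: le_trans h _; rewrite -[leRHS]mul1r ler_wpM2r ?(ltW x0) // exprn_ile1 ?(ltW q0) // (le_trans qc).
  rewrite /H /= -/(potential (@wt _ s1) (@step _ s1) J.+1 (scaled_overlap n1 q y (descend b k') \o g) k).
  rewrite -(@potential_map _ _ _ _ _ (@step _ s1) (@step _ s1) g) //.
  apply: mixed => //; first by rewrite /g; apply: ctx_scale; rewrite ?invr_gt0.
  rewrite width_dilate ?invr_ge0 ?(ltW y0) // mulrC ler_pdivlMr //.
  case/andP: wk => h _; apply: le_trans h; rewrite /y /scale_of mulrA.
  by rewrite ler_pM2r.
by have [] := root_good.
Qed.

End OneLevel.

(** One step of the final construction. The selected pairs satisfy at scale [theta * x] the width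
    conditions imposed at scale [x], so the step can be repeated. *)
Definition horizon (t0 theta : R) (M : nat) : Prop :=
  forall k k' x, ctx s1 k -> ctx s2 k' -> 0 < x ->
    c * x <= width k <= x -> c * x <= width k' <= x ->
  exists r : seq (seq (letter s1) * seq (letter s2)), [/\ uniq r, size r = M,
    forall v, v \in r -> c * (theta * x) <= width (descend v.1 k) <= theta * x /\
                        c * (theta * x) <= width (descend v.2 k') <= theta * x &
    {in r &, forall v v', v != v' -> forall y1 y2 z1 z2, 0 <= y1 <= 1 -> 0 <= y2 <= 1 ->
      0 <= z1 <= 1 -> 0 <= z2 <= 1 ->
      theta * x <= `|A * (descend v.1 k y1 - descend v'.1 k y2) +
                     B * (descend v.2 k' z1 - descend v'.2 k' z2)|}].

Lemma horizon_exists (t0 theta0 : R) : 0 < t0 -> t0 < t -> 0 < theta0 ->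
  exists theta M, [/\ 0 < theta < theta0, 1 <= M%:R * theta `^ t0 & horizon t0 theta M].
Proof.
move=> t00 t0t th0; have c00 := c0; have c11 := c1; have E00 := E60.
have [C C0 hC] := phi_average.
have cM0 := cmax_gt0 s1; have cM1 := cmax_lt1 s1.
have [nw hnw] := @expr_small R (cmax s1) (c / 40) ltac:(by rewrite cM0) ltac:(by rewrite divr_gt0).
have nw4 : cmax s1 ^+ nw * (2 * 2) < c / 2 / 4.
  by have := hnw nw (leqnn _); lra.
(* Two losses of exponent: from [t] to [t1] for the constants of the overlap bound, and from [t1] to
   [t0] for the first [l] levels and a factor [4]. *)
pose t1 := (t0 + t) / 2.
have t1t : 0 < t - t1 by rewrite /t1; lra.
have t01 : 0 < t1 - t0 by rewrite /t1; lra.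
have t10 : 0 < t1 by lra.
have [q1 q10 hq1] := powR_small (2 * nw%:R * C) t1t.
pose q := Num.min q1 (c / 2).
have q0 : 0 < q by rewrite lt_min q10 divr_gt0.
have qc : q <= c by apply: le_trans (_ : c / 2 <= _); [rewrite ge_min lexx orbT|lra].
have q_lt1 : q < 1 by apply: le_lt_trans (_ : c / 2 < _); [rewrite ge_min lexx orbT|lra].
have {hq1} hq : 2 * nw%:R * (C * q `^ t) <= q `^ t1.
  rewrite (_ : t = (t - t1) + t1); last by ring.
  rewrite powRD; last by rewrite (gt_eqF q0) implybT.
  rewrite !mulrA -[leRHS]mul1r ler_wpM2r ?powR_ge0 //.
  by apply: hq1; rewrite q0 ge_min lexx.
have [L hL] := hC q q0.
have [na hna] := expr_small (c := cmax s1) ltac:(by rewrite cM0) q0.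
have [nb hnb] := expr_small (c := cmax s2) ltac:(by rewrite cmax_gt0 cmax_lt1) q0.
pose n1 := (L + na + nb)%N.
have n1_1 : cmax s1 ^+ n1 <= q by apply: hna; rewrite /n1 -addnA addnCA leq_addr.
have n1_2 : cmax s2 ^+ n1 <= q by apply: hnb; rewrite /n1 leq_addl.
pose Lip := 4 * (1 + 2 / c) + 4 * `|A| / (E6 * q).
have Lip0 : 0 < Lip.
  rewrite ltr_wpDr ?mulr_gt0 //; last by rewrite ltr_wpDr // divr_ge0 // ltW.
  by rewrite divr_ge0 // mulr_ge0 // ltW.
have beta0 : 0 < C * q `^ t by rewrite mulr_gt0 // powR_gt0.
have c20 : 0 < c / 2 by rewrite divr_gt0.
have c22 : c / 2 <= 2 by lra.
have m0 : (0 < 2 ^ L)%N by rewrite expn_gt0.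
have [X hX] := mixing hst Lip0 beta0 c20 c22 m0 nw4.
have mixed y kb : 0 < y -> ctx s2 kb -> c * y <= width kb <= y ->
  forall J kp, ctx s1 kp -> X <= width kp ->
    potential (@wt _ s1) (@step _ s1) J (scaled_overlap n1 q y kb) kp <= q `^ t1.
  move=> y0 ckb wkb J kp ckp wkp; apply: le_trans hq.
  apply: hX => //.
  - by move=> a _; apply: phi01.
  - by move=> a _; apply: phi_window.
  - by move=> k1 k2 delta h1 h2 h3 h4; apply: phi_lip.
  - by move=> a ca; apply: hL => //; rewrite /n1 -addnA leq_addr.
have q01 : 0 < q < 1 by rewrite q0.
have X10 : 0 < c / (`|X| + 1) by rewrite divr_gt0 // ltr_wpDl.
(* From level [l] on, the root is wide in the units of the level and the potential bound applies. *)
have [l hl] := expr_small q01 X10.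
have Xl i : (l <= i)%N -> X * q ^+ i <= c.
  move=> /hl; rewrite ler_pdivlMr ?ltr_wpDl // mulrC => h; apply: le_trans h.
  by rewrite ler_wpM2r ?exprn_ge0 ?(ltW q0) // (le_trans (ler_norm X)) // lerDl.
pose w := q `^ (t1 - t0).
have w01 : 0 < w < 1 by rewrite powR_gt0 //= powR_lt1 // (ltW q0).
have wl0 : 0 < q `^ (t0 * l%:R) / 4 by rewrite divr_gt0 ?powR_gt0.
have [n2 hn2] := expr_small w01 wl0.
have th2 : 0 < theta0 / 2 by rewrite divr_gt0.
have [n3 hn3] := expr_small q01 th2.
pose n := (n2 + n3)%N; pose N := (l + n)%N; pose theta := q ^+ N.
have theta_gt0 : 0 < theta by rewrite exprn_gt0.
have thlt : theta < theta0.
  by apply: le_lt_trans (_ : theta0 / 2 < _); [apply: hn3; rewrite /N /n addnA leq_addl|lra].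
have thle1 : theta <= 1 by rewrite exprn_ile1 // ltW.
(* On the first [l] levels only the trivial bound [1] on the crowding is available; [n2] makes the
   remaining levels compensate for it. *)
pose m i := if (i < l)%N then 1 else q `^ t1.
have m_gt0 i : 0 < m i by rewrite /m; case: ifP => // _; rewrite powR_gt0.
have prod_m : \prod_(0 <= j < N) m j = (q `^ t1) ^+ n.
  rewrite (big_cat_nat (n := l)) ?leq_addr //= [X in X * _]big_nat_cond.
  rewrite [X in X * _]big1 ?mul1r => [|i /andP[/andP[_ h] _]]; last by rewrite /m h.
  rewrite big_nat_cond (eq_bigr (fun=> q `^ t1)) => [|i /andP[/andP[h _] _]]; last first.
    by rewrite /m ltnNge h.
  by rewrite -big_nat_cond prodr_const_nat /N addKn.
pose M := (Num.truncn (theta `^ (- t0))).+1.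
have hM1 : theta `^ (- t0) < M%:R by apply: truncnS_gt.
have hM2 : M%:R <= 2 * theta `^ (- t0).
  have h1 : (Num.truncn (theta `^ (- t0)))%:R <= theta `^ (- t0) by rewrite truncn_le // powR_ge0.
  have h2 : 1 <= theta `^ (- t0).
    rewrite powRN -invr1 lef_pV2 ?posrE ?powR_gt0 // powR_le1 ?(ltW theta_gt0) //; exact: ltW.
  by rewrite /M -natr1; lra.
exists theta, M; split; first by rewrite theta_gt0.
  have := hM1; rewrite powRN -div1r ltr_pdivrMr ?powR_gt0 //; exact: ltW.
move=> k k' x ck ck' x0 wk wk'.
pose tree := @children R s1 s2 k k' x q n1.
pose near := @colliding R s1 s2 A B k k' x q.
pose good := @fits_both R s1 s2 k k' x q.
pose root : seq (letter s1) * seq (letter s2) := ([::], [::]).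
have good0 : good 0 root by apply: root_good.
have lev i : level tree 0 i (crowding tree near i) root <= m i.
  rewrite /m; case: ltnP => hi.
    rewrite -[leRHS](level_cst (fun i v => @ch_prob R s1 s2 k k' x q n1 i v) 0 i 1 root).
    apply: (level_le (fun i v => @ch_prob R s1 s2 k k' x q n1 i v) (P := good)) => //.
    - by move=> i' v z h1 h2; apply: P_ch h2.
    move=> v _; rewrite -[leRHS](Ed_cst 1 (@ch_prob R s1 s2 k k' x q n1 i v)).
    apply: le_Ed => [|a _]; first by case: (@ch_prob R s1 s2 k k' x q n1 i v).
    rewrite -[leRHS](Ed_cst 1 (@ch_prob R s1 s2 k k' x q n1 i v)).
    by apply: le_Ed => [|b _]; [case: (@ch_prob R s1 s2 k k' x q n1 i v)|rewrite lern1 leq_b1].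
  have [J hJ] := @expr_small R (cmax s1) (c / 4 * q ^+ i) ltac:(by rewrite cM0)
     ltac:(by rewrite mulr_gt0 ?exprn_gt0 ?divr_gt0).
  apply: (@crowding_level q n1 i J X _ x k k') => //; first exact: Xl.
  apply: le_lt_trans (hJ J.+1 (leqnSn _)) _; rewrite ltr_pM2r ?exprn_gt0 //; lra.
have ex0 : 0 <= excess tree m near 0 N root.
  rewrite (excess_level (fun i v => @ch_prob R s1 s2 k k' x q n1 i v)).
  apply: sumr_ge0 => i _; rewrite divr_ge0 // subr_ge0 ler_pdivrMr // mul1r; exact: lev.
have cnt : 1 <= (size (undup [seq cell_index A B k k' x q N z.2 | z <- leaves tree m near 0 N root]))%:R *
    \prod_(0 <= j < N) m j.
  apply: (@leaf_count R _ _ (@cell_index R s1 s2 A B k k' x q N) tree m near N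
    (fun i v => @ch_prob R s1 s2 k k' x q n1 i v) m_gt0 good) => //.
    by move=> i v z h zin; apply: (P_ch ck ck' x0 q0 qc n1_1 n1_2 h zin).
  by move=> i n' v z z' y y' hN'; apply: ch_separated.
rewrite prod_m in cnt.
set d := leaves tree m near 0 N root in cnt.
pose lv := [seq z.2 | z <- d].
have [r [ur rsub rsz rsep]] := sparse_selection (@cell_index R s1 s2 A B k k' x q N) lv.
have hsz : (M <= size r)%N.
  have hpow : (q `^ t1) ^+ n = theta `^ t0 * (w ^+ n / q `^ (t0 * l%:R)).
    rewrite /w /theta -!powR_mulrn ?powR_ge0 ?(ltW q0) // -!powRrM.
    rewrite -powRN -!powRD ?(gt_eqF q0) ?implybT //; congr (_ `^ _).
    by rewrite /N natrD; ring.
  have hw : w ^+ n / q `^ (t0 * l%:R) <= 1 / 4.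
    by rewrite ler_pdivrMr ?powR_gt0 // (le_trans (hn2 n _)) ?leq_addr //; lra.
  have hsz2 : (size (undup [seq cell_index A B k k' x q N z.2 | z <- d]))%:R <= 2 * (size r)%:R :> R.
    by rewrite -natrM ler_nat; move: rsz; rewrite /lv -map_comp.
  have pth : 0 < theta `^ t0 by rewrite powR_gt0.
  have h5 : 1 <= 2 * (size r)%:R * (theta `^ t0 * (1 / 4)) :> R.
    apply: le_trans cnt _; apply: ler_pM => //; first by rewrite exprn_ge0 // powR_ge0.
    by rewrite hpow ler_wpM2l // powR_ge0.
  have h6 : 2 * theta `^ (- t0) <= (size r)%:R.
    by rewrite powRN -[leLHS]/(_ / _) ler_pdivrMr //; clear - h5; lra.
  by rewrite -(ler_nat R) (le_trans hM2).
have lvin v : v \in r -> exists2 z, z \in d & v = z.2.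
  by move=> /rsub /mapP[z zd ->]; exists z.
have Pv v : v \in r -> good N v.
  by move=> /lvin[z zd ->]; case: (leaves_spec ck ck' x0 q0 qc n1_1 n1_2 good0 zd).
have xsN : scale_of x q N = theta * x by [].
exists (take M r); split.
- by rewrite take_uniq.
- by rewrite size_takel.
- by move=> v /mem_take /Pv[h1 h2]; move: h1 h2; rewrite /fits1 /fits2 xsN.
move=> v v' /mem_take vr /mem_take v'r vv' y1 y2 z1 z2 hy1 hy2 hz1 hz2.
have [e1 e2] := Pv v vr; have [e3 e4] := Pv v' v'r.
have u01 : 0 <= (0 : R) <= 1 by rewrite lexx ler01.
have b1 : `|descend v.1 k y1 - descend v.1 k 0| <= scale_of x q N.
  by case/andP: e1 => _; apply: le_trans; apply: ctx_width (ctx_descend _ ck) _ _.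
have b2 : `|descend v'.1 k y2 - descend v'.1 k 0| <= scale_of x q N.
  by case/andP: e3 => _; apply: le_trans; apply: ctx_width (ctx_descend _ ck) _ _.
have b3 : `|descend v.2 k' z1 - descend v.2 k' 0| <= scale_of x q N.
  by case/andP: e2 => _; apply: le_trans; apply: ctx_width (ctx_descend _ ck') _ _.
have b4 : `|descend v'.2 k' z2 - descend v'.2 k' 0| <= scale_of x q N.
  by case/andP: e4 => _; apply: le_trans; apply: ctx_width (ctx_descend _ ck') _ _.
have far : (2 * coef_sum A B + 1) * scale_of x q N <= `|proj_pair A B k k' v - proj_pair A B k k' v'|.
  case: (rsep v v' vr v'r vv') => /(idx_far x0 q0) h.
    by rewrite distrC (le_trans h) // ler_norm.
  by rewrite (le_trans h) // ler_norm.
move: far; rewrite -xsN /proj_pair /coef_sum; move: b1 b2 b3 b4.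
set X1 := descend v.1 k y1; set X2 := descend v'.1 k y2; set Y1 := descend v.2 k' z1.
set Y2 := descend v'.2 k' z2; set X10' := descend v.1 k 0; set X20 := descend v'.1 k 0.
set Y10 := descend v.2 k' 0; set Y20 := descend v'.2 k' 0; set xx := scale_of x q N => b1 b2 b3 b4 far.
have a1 : `|A * (X1 - X10' - (X2 - X20)) + B * (Y1 - Y10 - (Y2 - Y20))| <= 2 * (`|A| + `|B|) * xx.
  apply: le_trans (ler_normD _ _) _; rewrite !normrM.
  have hx : `|X1 - X10' - (X2 - X20)| <= 2 * xx.
    by apply: le_trans (ler_normB _ _) _; rewrite mulr_natl mulr2n; exact: lerD b1 b2.
  have hy : `|Y1 - Y10 - (Y2 - Y20)| <= 2 * xx.
    by apply: le_trans (ler_normB _ _) _; rewrite mulr_natl mulr2n; exact: lerD b3 b4.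
  have := ler_wpM2l (normr_ge0 A) hx; have := ler_wpM2l (normr_ge0 B) hy; clear; lra.
have := ler_normB (A * (X1 - X2) + B * (Y1 - Y2)) (A * (X1 - X10' - (X2 - X20)) + B * (Y1 - Y10 - (Y2 - Y20))).
rewrite (_ : A * (X1 - X2) + B * (Y1 - Y2) - (A * (X1 - X10' - (X2 - X20)) + B * (Y1 - Y10 - (Y2 - Y20)))
  = A * X10' + B * Y10 - (A * X20 + B * Y20)); last by ring.
by clear - a1 far; lra.
Qed.

End Horizon.

(** * Hausdorff dimension *)

Lemma dependent_path (T : Type) (G : T -> Prop) (S : T -> T -> Prop) x0 : G x0 ->
  (forall x, G x -> exists y, S x y /\ G y) ->
  exists p : nat -> T, p 0%N = x0 /\ forall n, G (p n) /\ S (p n) (p n.+1).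
Proof.
move=> G0 h; have h' x : exists y, G x -> S x y /\ G y.
  have [gx|ngx] := pselect (G x); last by exists x.
  by have [y hy] := h x gx; exists y.
have [f hf] := choice h'; exists (fun n => iter n f x0); split => // n.
have Gn : G (iter n f x0) by elim: n => // n IH; case: (hf _ IH).
by split => //; case: (hf _ Gn).
Qed.

Section HausdorffDimension.
Variable R : realType.
Local Open Scope ereal_scope.

Lemma hausdorff_cost_ge0 (s : R) (U : set R) : 0 <= hausdorff_cost s U.
Proof. by rewrite /hausdorff_cost; case: ifP => // _; apply: poweR_ge0. Qed.

Lemma diam_ge (U : set R) x y : U x -> U y -> (`|x - y|)%:E <= diam U.
Proof. by move=> Ux Uy; apply: ereal_sup_ubound; exists x, y. Qed.

Lemma diam_le (U : set R) (d : R) : (forall x y, U x -> U y -> (`|x - y| <= d)%R) ->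
  diam U <= d%:E.
Proof. by move=> h; apply: ge_ereal_sup => _ [x [y [Ux Uy ->]]]; rewrite lee_fin h. Qed.

Lemma content_le (s d1 : R) (E : set R) (U : (set R)^nat) : E `<=` \bigcup_n U n ->
  (forall n, diam (U n) <= d1%:E) ->
  hausdorff_content s d1 E <= \sum_(0 <= n <oo) hausdorff_cost s (U n).
Proof. by move=> h1 h2; apply: ereal_inf_lbound; exists U. Qed.

Lemma content_ge0 (s d1 : R) (E : set R) : 0 <= hausdorff_content s d1 E.
Proof.
apply: le_ereal_inf_tmp => _ [U [_ _ ->]]; apply: nneseries_ge0 => n _ _.
exact: hausdorff_cost_ge0.
Qed.

Lemma HD_ge0 (E : set R) : 0 <= HD E.
Proof. by apply: le_ereal_inf_tmp => _ [s [s0 _] <-]; rewrite lee_fin. Qed.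

Lemma HD_le_covers (s : R) (E : set R) : (0 <= s)%R ->
  (forall d e : R, (0 < d)%R -> (0 < e)%R -> exists r : seq (set R * R),
    [/\ forall u, u \in r -> (0 <= u.2 <= d)%R /\ forall x y, u.1 x -> u.1 y -> (`|x - y| <= u.2)%R,
        forall x, E x -> exists2 u, u \in r & u.1 x &
        (\sum_(u <- r) u.2 `^ s <= e)%R]) ->
  HD E <= s%:E.
Proof.
move=> s0 h; apply: ereal_inf_lbound; exists s => //; split => //.
apply/eqP; rewrite eq_le; apply/andP; split; last first.
  apply: le_trans (content_ge0 s 1 E) _; apply: ereal_sup_ubound.
  by exists 1%R => //=.
apply: ge_ereal_sup => _ [d /= d0 <-]; apply/lee_addgt0Pr => e e0; rewrite add0e.
have [r [hr hE hs]] := h d e d0 e0.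
pose U n := (nth (set0, 0%R) r n).1.
have hin n : (n < size r)%N -> nth (set0, 0%R) r n \in r by move=> ?; apply: mem_nth.
apply: le_trans (@content_le s d E U _ _) _.
- move=> x /hE[u ur ux]; exists (index u r) => //.
  by rewrite /U nth_index.
- move=> n; rewrite /U; have [nr|nr] := ltnP n (size r).
    have [/andP[_ h1] h2] := hr _ (hin n nr).
    by apply: diam_le => x y Ux Uy; apply: le_trans h1; apply: h2.
  by rewrite nth_default //; apply: diam_le.
have z0 : forall n, (size r <= n)%N -> true -> hausdorff_cost s (U n) = 0.
  move=> n nr _; rewrite /hausdorff_cost ifT // /U nth_default //.
  exact/asboolP.
rewrite (nneseries_split 0 (size r)); last by move=> k _; apply: hausdorff_cost_ge0.
rewrite [X in _ + X]eseries0 ?adde0; last by move=> k hk _; rewrite z0 //; move: hk; rewrite add0n.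
rewrite add0n; apply: le_trans (_ : (\sum_(u <- r) u.2 `^ s)%:E <= _); last by rewrite lee_fin.
rewrite [in leRHS](big_nth (set0, 0%R)) -sumEFin.
rewrite [leLHS]big_nat [leRHS]big_nat; apply: lee_sum => n /andP[_ nr].
have [/andP[h0 h1] h2] := hr _ (hin n nr).
rewrite /hausdorff_cost; case: ifP => [_|/asboolPn]; first by rewrite lee_fin powR_ge0.
rewrite -/(U n) => /eqP/set0P[x Ux].
have dl : diam (U n) <= ((nth (set0, 0%R) r n).2)%:E by apply: diam_le; apply: h2.
have dg : 0 <= diam (U n) by apply: le_trans (diam_ge Ux Ux); rewrite lee_fin.
move: dl dg; case: (diam (U n)) => [w| |] //; rewrite !lee_fin => dl dg.
by rewrite ge0_ler_powR.
Qed.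

Lemma HD_le_lim (E : set R) (s : R) : (forall s', (s < s')%R -> HD E <= s'%:E) -> HD E <= s%:E.
Proof.
move=> h; apply/lee_addgt0Pr => e e0; rewrite -EFinD; apply: h.
by rewrite ltrDl.
Qed.

(** * Mass distribution on trees *)

Section Tree.
Variables (N : eqType) (ch : N -> seq N) (P : N -> Prop) (img : N -> set R) (W : N -> R).
Variables (E : set R) (s C rho : R) (root : N).
Hypothesis C0 : (0 <= C)%R.
Hypothesis rho01 : (0 <= rho < 1)%R.
Hypothesis P_root : P root.
Hypothesis P_ch : forall v v', P v -> v' \in ch v -> P v'.
Hypothesis ch_uniq : forall v, P v -> uniq (ch v).
Hypothesis W_gt0 : forall v, P v -> (0 < W v)%R.
Hypothesis W_sum : forall v, P v -> (W v <= \sum_(v' <- ch v) W v')%R.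
Hypothesis W_rho : forall v v', P v -> v' \in ch v -> (W v' <= rho * W v)%R.
Hypothesis img_ch : forall v v', P v -> v' \in ch v -> img v' `<=` img v.
Hypothesis img_gap : forall v v1 v2 x y, P v -> v1 \in ch v -> v2 \in ch v -> v1 != v2 ->
  img v1 x -> img v2 y -> (W v <= C * `|x - y| `^ s)%R.
Hypothesis limit_point : forall p : nat -> N, p 0%N = root ->
  (forall n, P (p n) /\ p n.+1 \in ch (p n)) -> exists2 z, E z & forall n, img (p n) z.

(** Suppose the sets that hit a node cost less than its weight. By [img_gap] none of them meets two
    children, so the cost splits among the children and some child is again too cheap. Weights tend
    to [0] along the resulting path, whereas a set containing its limit point keeps a fixed positive
    cost. *)
Lemma tree_no_cover (U : (set R)^nat) (c : nat -> R) : E `<=` \bigcup_n U n ->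
  (forall n, 0 < c n)%R -> (forall n x y, U n x -> U n y -> (C * `|x - y| `^ s <= c n)%R) ->
  ~ \sum_(0 <= n <oo) (c n)%:E < (W root)%:E.
Proof.
move=> EU c0 hc hlt.
pose hit n v := `[< exists2 x, U n x & img v x >].
pose cost n v : \bar R := if hit n v then (c n)%:E else 0.
have cost0 n v : 0 <= cost n v by rewrite /cost; case: ifP => // _; rewrite lee_fin ltW.
pose S v := \sum_(0 <= n <oo) cost n v.
pose G v := P v /\ S v < (W v)%:E.
have term n v : cost n v <= S v.
  have := @nneseries_lim_ge R (fun n => cost n v) xpredT 0 n.+1 (fun k _ _ => cost0 k v).
  apply: le_trans; rewrite big_nat_recr //= leeDr //.
  by apply: sume_ge0 => k _; apply: cost0.
have Groot : G root.
  split => //; apply: le_lt_trans hlt; apply: lee_nneseries => // n _.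
  by rewrite /cost; case: ifP => // _; rewrite lee_fin ltW.
have Gstep v : G v -> exists v', v' \in ch v /\ G v'.
  move=> [Pv hv]; apply: contrapT => hno.
  have h1 v' : v' \in ch v -> (W v')%:E <= S v'.
    move=> v'v; rewrite leNgt; apply/negP => hlt'; apply: hno; exists v'.
    by split => //; split => //; apply: P_ch v'v.
  have h2 : \sum_(v' <- ch v) S v' <= S v.
    rewrite -nneseries_sum => [|v' n _]; last exact: cost0.
    apply: lee_nneseries => [n _ _|n _]; first by apply: sume_ge0 => v' _; apply: cost0.
    have [/hasP[v1 v1v hit1]|nohit] := boolP (has (hit n) (ch v)); last first.
      rewrite big_seq big1 ?cost0 // => v' v'v; rewrite /cost ifF //.
      by apply: contraNF nohit => hv'; apply/hasP; exists v'.
    rewrite (bigD1_seq v1) ?ch_uniq //= big_seq_cond big1 ?adde0 => [|v2 /andP[v2v v21]].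
      rewrite /cost hit1; case: ifP => // /negP; case.
      move/asboolP: hit1 => [x Ux vx]; apply/asboolP; exists x => //.
      exact: img_ch vx.
    rewrite /cost; case: ifP => // /asboolP[y Uy v2y]; exfalso.
    move/asboolP: hit1 => [x Ux v1x].
    have hW : (W v <= c n)%R.
      apply: le_trans (hc n x y Ux Uy); apply: (img_gap Pv v1v v2v) => //.
      by rewrite eq_sym.
    have := term n v; rewrite /cost ifT; last first.
      by apply/asboolP; exists x => //; apply: (img_ch Pv v1v).
    by rewrite leNgt (lt_le_trans hv) // lee_fin.
  have h3 : (W v)%:E <= \sum_(v' <- ch v) S v'.
    apply: le_trans (_ : \sum_(v' <- ch v) (W v')%:E <= _).
      by rewrite sumEFin lee_fin W_sum.
    by rewrite !big_seq; apply: lee_sum.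
  by have := lt_le_trans hv h3; rewrite ltNge h2.
have [p [p0 hp]] := dependent_path Groot Gstep.
have [z Ez hz] := limit_point p0 (fun n => conj (hp n).1.1 (hp n).2).
have [n _ Uz] := EU z Ez.
have hW k : (W (p k) <= rho ^+ k * W root)%R.
  elim: k => [|k IH]; first by rewrite expr0 mul1r p0.
  have [[Pk _] hk] := hp k; apply: le_trans (W_rho Pk hk) _.
  by rewrite exprS -mulrA ler_wpM2l //; case/andP: rho01.
have Wr := W_gt0 P_root.
have [rho0|rho0] := eqVneq rho 0%R.
  have := hW 1%N; rewrite expr1 rho0 mul0r leNgt W_gt0 //.
  by case: (hp 1%N) => [[]].
have r01 : (0 < rho < 1)%R by case/andP: rho01 => h1 ->; rewrite lt_neqAle eq_sym rho0 h1.
have [k hk] := @expr_small R rho (c n / W root) r01 ltac:(by rewrite divr_gt0 ?c0).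
have h1 : (W (p k) <= c n)%R.
  apply: le_trans (hW k) _; rewrite -ler_pdivlMr //; exact: hk.
have [[Pk Sk] _] := hp k.
have := term n (p k); rewrite /cost ifT; last by apply/asboolP; exists z.
by rewrite leNgt (lt_le_trans Sk) // lee_fin.
Qed.

(** If [s0 < s] were admissible, there would be covers by sets of diameter at most [1] with
    arbitrarily small cost for [s0], and for such sets the cost for [s] is no larger. *)
Lemma tree_dim : s%:E <= HD E.
Proof.
apply: le_ereal_inf_tmp => _ [s0 [s00 hH] <-]; rewrite lee_fin leNgt; apply/negP => s0s.
have Wr := W_gt0 P_root.
pose C1 := (C + 1)%R; have C10 : (0 < C1)%R by rewrite ltr_wpDl.
have e0 : (0 < W root / (4 * C1))%R by rewrite divr_gt0 ?mulr_gt0.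
have : hausdorff_content s0 1 E < (W root / (4 * C1))%:E.
  apply: le_lt_trans (_ : 0 < _); last by rewrite lte_fin.
  by rewrite -hH; apply: ereal_sup_ubound; exists 1%R => //=.
move=> /ereal_inf_lt[_ [U [EU dU ->]] hsum].
pose A n := (C1)%:E * hausdorff_cost s0 (U n).
have A0 n : 0 <= A n by rewrite mule_ge0 ?hausdorff_cost_ge0 // lee_fin ltW.
have fincost n : hausdorff_cost s0 (U n) \is a fin_num.
  rewrite /hausdorff_cost; case: ifP => // _; have := dU n.
  rewrite ge0_fin_numE ?poweR_ge0 // => h; apply: poweR_lty.
  by apply: le_lt_trans h _; rewrite ltry.
(* The summable second term keeps the costs positive even for sets of diameter zero. Each of the two
   parts sums to at most a quarter of [W root]. *)
pose c n := (C1 * fine (hausdorff_cost s0 (U n)) + W root / 4 / (2 ^ n.+1)%:R)%R.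
have w4 : (0 <= W root / 4)%R by rewrite divr_ge0 // ltW.
apply: (@tree_no_cover U c) => //.
- move=> n; rewrite ltr_wpDl ?divr_gt0 ?ltr0n ?expn_gt0 //.
  by rewrite mulr_ge0 ?(ltW C10) // fine_ge0 // hausdorff_cost_ge0.
- move=> n x y Ux Uy; rewrite ler_wpDr ?divr_ge0 ?(ltW Wr) //.
  apply: ler_pM; rewrite ?powR_ge0 // ?lerDl //.
  rewrite -lee_fin fineK // /hausdorff_cost ifF; last first.
    by apply/asboolP => U0; move: Ux; rewrite U0.
  have := diam_ge Ux Uy; have := dU n; case: (diam (U n)) => [w| |] //.
  rewrite !lee_fin => w1 wx; have w0 : (0 <= w)%R by apply: le_trans wx.
  apply: le_trans (_ : w `^ s <= _)%R.
    by rewrite ge0_ler_powR ?nnegrE // (le_trans s00) // ltW.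
  rewrite (_ : s = (s - s0) + s0)%R; last by rewrite subrK.
  have [->|wn0] := eqVneq w 0%R.
    rewrite powR0; first exact: powR_ge0.
    by rewrite subrK gt_eqF // (le_lt_trans s00).
  rewrite powRD; last by rewrite wn0 implybT.
  by rewrite ler_piMl ?powR_ge0 // powR_le1 // subr_ge0 ltW.
have h1 : \sum_(0 <= n <oo) (c n)%:E <= \sum_(0 <= n <oo) A n + (W root / 4)%:E.
  apply: le_trans (epsilon_trick xpredT A0 w4); apply: lee_nneseries => n _.
    move=> _; rewrite lee_fin /c; apply: addr_ge0; last by rewrite divr_ge0.
    by rewrite mulr_ge0 ?(ltW C10) // fine_ge0 // hausdorff_cost_ge0.
  by rewrite /A /c EFinD EFinM fineK.
apply: le_lt_trans h1 _; rewrite /A nneseriesZl => [|n _]; last exact: hausdorff_cost_ge0.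
apply: (@le_lt_trans _ _ ((C1)%:E * (W root / (4 * C1))%:E + (W root / 4)%:E)).
  by apply: leeD => //; rewrite lee_pmul2l ?ltW // lte_fin.
rewrite -EFinM -EFinD lte_fin (_ : C1 * _ = W root / 4)%R; first lra.
by field; rewrite gt_eqF.
Qed.

End Tree.
End HausdorffDimension.

(** * Bounded distortion and cylinders *)

Section LogDerivatives.
Variable R : realType.

(* [L] plays the role of [ln |k'|]: by the mean value theorem a C^1 map whose
   derivative has an [al]-Hoelder logarithm satisfies this property. *)
Definition dlog (al C e : R) (L k : R -> R) : Prop :=
  forall x y, 0 <= x <= 1 -> 0 <= y <= 1 -> exists r,
    [/\ k y - k x = e * expR r * (y - x), `|r - L x| <= C * `|y - x| `^ al &
        `|r - L y| <= C * `|y - x| `^ al].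

Lemma dlogW al C C' e L k : C <= C' -> dlog al C e L k -> dlog al C' e L k.
Proof.
move=> CC h x y hx hy; have [r [h1 h2 h3]] := h x y hx hy; exists r; split => //.
  by apply: le_trans h2 _; rewrite ler_wpM2r ?powR_ge0.
by apply: le_trans h3 _; rewrite ler_wpM2r ?powR_ge0.
Qed.

Lemma dlog_comp al C1 C2 e1 e2 L1 L2 rho h k : 0 <= al -> 0 <= C2 -> 0 <= rho ->
  (forall x, 0 <= x <= 1 -> 0 <= h x <= 1) ->
  (forall x y, 0 <= x <= 1 -> 0 <= y <= 1 -> `|h y - h x| <= rho * `|y - x|) ->
  dlog al C1 e1 L1 h -> dlog al C2 e2 L2 k ->
  dlog al (C1 + C2 * rho `^ al) (e2 * e1) (fun x => L2 (h x) + L1 x) (k \o h).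
Proof.
move=> al0 C20 rho0 h01 hrho dh dk x y hx hy.
have [r1 [a1 a2 a3]] := dh x y hx hy.
have [r2 [b1 b2 b3]] := dk _ _ (h01 x hx) (h01 y hy).
have hp : C2 * `|h y - h x| `^ al <= C2 * rho `^ al * `|y - x| `^ al.
  rewrite -mulrA -powRM // ler_wpM2l // ge0_ler_powR ?nnegrE ?mulr_ge0 //.
  exact: hrho.
exists (r2 + r1); split.
- by rewrite /= b1 a1 expRD; ring.
- rewrite (_ : r2 + r1 - _ = (r2 - L2 (h x)) + (r1 - L1 x)); last by ring.
  by apply: le_trans (ler_normD _ _) _; rewrite mulrDl; lra.
rewrite (_ : r2 + r1 - _ = (r2 - L2 (h y)) + (r1 - L1 y)); last by ring.
by apply: le_trans (ler_normD _ _) _; rewrite mulrDl; lra.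
Qed.

Lemma dlog_affine al C e L k c d : c != 0 -> dlog al C e L k ->
  dlog al C (Num.sg c * e) (fun x => ln `|c| + L x) (fun x => d + c * k x).
Proof.
move=> c0 h x y hx hy; have [r [h1 h2 h3]] := h x y hx hy.
exists (ln `|c| + r); split.
- rewrite (_ : _ - _ = c * (k y - k x)); last by ring.
  by rewrite h1 {1}(numEsg c) expRD lnK ?posrE ?normr_gt0 //; ring.
- by rewrite (_ : _ - _ = r - L x); last by ring.
by rewrite (_ : _ - _ = r - L y); last by ring.
Qed.

Lemma dlog_id al : dlog al 0 1 (fun=> 0) id.
Proof.
by move=> x y _ _; exists 0; rewrite expR0 !mul1r subr0 normr0 mul0r; split.
Qed.

Section OneMap.
Variables (al C e : R) (L k : R -> R).
Hypothesis al0 : 0 <= al.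
Hypothesis C0 : 0 <= C.
Hypothesis e1 : `|e| = 1.
Hypothesis dk : dlog al C e L k.

Lemma sign_sqr : e * e = 1.
Proof. by rewrite -expr2 -(real_normK (num_real e)) e1 expr1n. Qed.

Lemma dlog_incr x y : 0 <= x -> x <= y -> y <= 1 -> 0 <= e * (k y - k x).
Proof.
move=> x0 xy y1; have hx : 0 <= x <= 1 by rewrite x0 (le_trans xy).
have hy : 0 <= y <= 1 by rewrite (le_trans x0).
have [r [-> _ _]] := dk hx hy.
by rewrite !mulrA sign_sqr mul1r mulr_ge0 ?expR_ge0 // subr_ge0.
Qed.

Lemma dlog_norm x y : 0 <= x -> x <= y -> y <= 1 -> `|k y - k x| = e * (k y - k x).
Proof.
move=> x0 xy y1; have h := dlog_incr x0 xy y1.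
by rewrite -[RHS](ger0_norm h) normrM e1 mul1r.
Qed.

Lemma dlog_width x y : 0 <= x <= 1 -> 0 <= y <= 1 -> `|k x - k y| <= width k.
Proof.
wlog xy : x y / x <= y.
  move=> h hx hy; have [xy|/ltW yx] := leP x y; first exact: h.
  by rewrite distrC; apply: h.
move=> /andP[x0 x1] /andP[y0 y1]; rewrite distrC dlog_norm // /width dlog_norm //.
have := dlog_incr (lexx 0) x0 x1; have := dlog_incr y0 y1 (lexx 1).
by rewrite !mulrBr; lra.
Qed.

Lemma dlog_osc x y : 0 <= x <= 1 -> 0 <= y <= 1 -> `|L y - L x| <= 2 * C * `|y - x| `^ al.
Proof.
move=> hx hy; have [r [_ h2 h3]] := dk hx hy.
rewrite (_ : L y - L x = (r - L x) - (r - L y)); last by ring.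
by apply: le_trans (ler_normB _ _) _; lra.
Qed.

Lemma powR_dist_le1 x y : 0 <= x <= 1 -> 0 <= y <= 1 -> `|y - x| `^ al <= 1.
Proof.
move=> /andP[x0 x1] /andP[y0 y1]; apply: powR_le1 => //.
by rewrite ler_norml; apply/andP; split; lra.
Qed.

Lemma dlog_width_gt0 : 0 < width k.
Proof.
have m0 : 0 <= (0 : R) <= 1 by rewrite lexx ler01.
have m1 : 0 <= (1 : R) <= 1 by rewrite lexx ler01.
have [r [h _ _]] := dk m0 m1.
by rewrite /width h subr0 mulr1 normrM e1 mul1r ger0_norm ?expR_gt0 ?expR_ge0.
Qed.

(** The logarithms of the slopes over [[0, 1]] and over [[x, y]] differ by at most [4 * C]: one [C]
    for each slope and [2 * C] for the oscillation of [L] between [0] and [x]. *)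
Lemma dlog_distortion x y : 0 <= x <= 1 -> 0 <= y <= 1 ->
  expR (- (4 * C)) * width k * `|x - y| <= `|k x - k y| <= expR (4 * C) * width k * `|x - y|.
Proof.
move=> hx hy.
have m0 : 0 <= (0 : R) <= 1 by rewrite lexx ler01.
have m1 : 0 <= (1 : R) <= 1 by rewrite lexx ler01.
have le1 u v : 0 <= u <= 1 -> 0 <= v <= 1 -> C * `|v - u| `^ al <= C.
  by move=> hu hv; rewrite ler_piMr // powR_dist_le1.
have [r0 [h0 h0a _]] := dk m0 m1; have [r [h ha _]] := dk hx hy.
have osc := dlog_osc m0 hx.
have b1 := le1 _ _ m0 m1; have b2 := le1 _ _ hx hy.
have b3 := le1 _ _ m0 hx.
have rr : `|r - r0| <= 4 * C.
  rewrite (_ : r - r0 = (r - L x) + (L x - L 0) - (r0 - L 0)); last by ring.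
  apply: le_trans (ler_normB _ _) _.
  by have := ler_normD (r - L x) (L x - L 0); lra.
rewrite [`|k x - _|]distrC h [`|x - y|]distrC /width h0 subr0 mulr1 !normrM e1 !mul1r.
rewrite !(ger0_norm (expR_ge0 _)) -!expRD.
move: rr; rewrite ler_norml => /andP[r1 r2].
by apply/andP; split; rewrite ler_wpM2r // ler_expR; lra.
Qed.

End OneMap.
End LogDerivatives.

(** Inverse branches from [I(c)] onto [I(a, c)] with uniform constants: [ild] is the log-derivative,
    [isg] the orientation, [bal] and [bC] the Hoelder data. The cylinder estimates see the expanding
    map through this record only. *)
Record branches (R : realType) (A : finType) (B : {set A * A}) := Branches {
  ibr : A -> A -> R -> R ;
  ild : A -> A -> R -> R ;
  isg : A -> A -> R ;
  bal : R ;
  bC : R ;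
  blam : R ;
  blmin : R ;
  bgap : R ;
  bal_gt0 : 0 < bal ;
  bC_ge0 : 0 <= bC ;
  blam_gt0 : 0 < blam ;
  blam_lt1 : blam < 1 ;
  blmin_gt0 : 0 < blmin ;
  bgap_gt0 : 0 < bgap ;
  isg1 : forall a c, `|isg a c| = 1 ;
  ibr01 : forall a c x, (a, c) \in B -> 0 <= x <= 1 -> 0 <= ibr a c x <= 1 ;
  ibr_dlog : forall a c, (a, c) \in B -> dlog bal bC (isg a c) (ild a c) (ibr a c) ;
  ibr_le : forall a c x y, (a, c) \in B -> 0 <= x <= 1 -> 0 <= y <= 1 ->
    `|ibr a c x - ibr a c y| <= blam * `|x - y| ;
  ibr_ge : forall a c x y, (a, c) \in B -> 0 <= x <= 1 -> 0 <= y <= 1 ->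
    blmin * `|x - y| <= `|ibr a c x - ibr a c y| ;
  ibr_gap : forall a c c' x y, (a, c) \in B -> (a, c') \in B -> c != c' ->
    0 <= x <= 1 -> 0 <= y <= 1 -> bgap <= `|ibr a c x - ibr a c' y|
}.

Section Words.
Variables (R : realType) (A : finType) (B : {set A * A}) (b : branches R B).

Definition adm (a : A) (s : seq A) := path (fun a c => (a, c) \in B) a s.

(* For an admissible [s], [hp a s] maps [[0, 1]] onto the cylinder of [a :: s],
   [Lp a s] is the logarithm of [|(hp a s)'|] and [sp a s] the orientation. *)
Fixpoint hp (a : A) (s : seq A) (x : R) : R :=
  if s is c :: s' then ibr b a c (hp c s' x) else x.
Fixpoint Lp (a : A) (s : seq A) (x : R) : R :=
  if s is c :: s' then ild b a c (hp c s' x) + Lp c s' x else 0.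
Fixpoint sp (a : A) (s : seq A) : R :=
  if s is c :: s' then isg b a c * sp c s' else 1.

(* [sum_j bC * blam ^ (j * bal)]: the Hoelder constant common to all the [Lp a s]. *)
Definition bCs : R := bC b / (1 - blam b `^ bal b).

Let l0 := blam_gt0 b.
Let l1 := blam_lt1 b.
Let a0 := bal_gt0 b.
Let c0 := bC_ge0 b.

Lemma lamal : 0 < 1 - blam b `^ bal b.
Proof. by rewrite subr_gt0 powR_lt1 // (ltW l0). Qed.

Lemma bCs_ge0 : 0 <= bCs.
Proof. by rewrite divr_ge0 // ltW // lamal. Qed.

Lemma bCsE : bC b + bCs * blam b `^ bal b = bCs.
Proof. by rewrite /bCs; field; rewrite gt_eqF // lamal. Qed.

Lemma sp1 a s : `|sp a s| = 1.
Proof. by elim: s a => [|c s IH] a /=; rewrite ?normr1 // normrM isg1 IH mulr1. Qed.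

Lemma hp_cat a s1 s2 x : hp a (s1 ++ s2) x = hp a s1 (hp (last a s1) s2 x).
Proof. by elim: s1 a => //= c s1 IH a; rewrite IH. Qed.

Lemma Lp_cat a s1 s2 x : Lp a (s1 ++ s2) x = Lp a s1 (hp (last a s1) s2 x) + Lp (last a s1) s2 x.
Proof. by elim: s1 a => [|c s1 IH] a /=; rewrite ?add0r // IH hp_cat addrA. Qed.

Lemma sp_cat a s1 s2 : sp a (s1 ++ s2) = sp a s1 * sp (last a s1) s2.
Proof. by elim: s1 a => [|c s1 IH] a /=; rewrite ?mul1r // IH mulrA. Qed.

Lemma adm_cat a s1 s2 : adm a (s1 ++ s2) = adm a s1 && adm (last a s1) s2.
Proof. exact: cat_path. Qed.

Lemma hp01 a s x : adm a s -> 0 <= x <= 1 -> 0 <= hp a s x <= 1.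
Proof. by elim: s a => //= c s IH a /andP[ac cs] hx; apply: ibr01 => //; apply: IH. Qed.

Lemma hp_le a s x y : adm a s -> 0 <= x <= 1 -> 0 <= y <= 1 ->
  `|hp a s x - hp a s y| <= blam b ^+ size s * `|x - y|.
Proof.
elim: s a => [|c s IH] a /=; first by rewrite expr0 mul1r.
move=> /andP[ac cs] hx hy; apply: le_trans (ibr_le b ac (hp01 cs hx) (hp01 cs hy)) _.
by rewrite exprS -mulrA ler_wpM2l ?(ltW l0) //; apply: IH.
Qed.

Lemma hp_ge a s x y : adm a s -> 0 <= x <= 1 -> 0 <= y <= 1 ->
  blmin b ^+ size s * `|x - y| <= `|hp a s x - hp a s y|.
Proof.
elim: s a => [|c s IH] a /=; first by rewrite expr0 mul1r.
move=> /andP[ac cs] hx hy; apply: le_trans (ibr_ge b ac (hp01 cs hx) (hp01 cs hy)).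
by rewrite exprS -mulrA ler_wpM2l ?(ltW (blmin_gt0 b)) //; apply: IH.
Qed.

(** All contexts share the constant [bCs]. It is the fixed point of the recursion that a composition
    with one branch induces on such constants ([bCsE]), so the class is stable. *)
Definition bctx (k : R -> R) : Prop := exists e L, `|e| = 1 /\ dlog (bal b) bCs e L k.

Lemma dlog_step e L k a c : (a, c) \in B -> dlog (bal b) bCs e L k ->
  dlog (bal b) bCs (e * isg b a c) (fun x => L (ibr b a c x) + ild b a c x) (k \o ibr b a c).
Proof.
move=> ac dk; rewrite -bCsE; apply: dlog_comp dk => //; rewrite ?(ltW a0) ?bCs_ge0 ?(ltW l0) //.
- by move=> x; apply: ibr01.
- by move=> x y hx hy; rewrite ibr_le.
exact: ibr_dlog.
Qed.

Lemma dlog_word e L k a s : adm a s -> dlog (bal b) bCs e L k ->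
  dlog (bal b) bCs (e * sp a s) (fun x => L (hp a s x) + Lp a s x) (k \o hp a s).
Proof.
elim/last_ind: s e L k => [|s c IH] e L k.
  by move=> _; rewrite /= mulr1; under eq_fun do rewrite addr0.
rewrite /adm rcons_path => /andP[as_ sc] dk; have := dlog_step sc (IH _ _ _ as_ dk).
rewrite -cats1 sp_cat /= mulr1 mulrA.
rewrite (_ : (fun x => L (hp a (s ++ [:: c]) x) + _) =
   (fun x => L (hp a s (ibr b (last a s) c x)) + Lp a s (ibr b (last a s) c x) + ild b (last a s) c x)); last first.
  by apply/funext => x; rewrite hp_cat Lp_cat /= addr0 addrA.
by rewrite (_ : k \o hp a (s ++ [:: c]) = (k \o hp a s) \o ibr b (last a s) c) //; apply/funext => x; rewrite /= hp_cat.
Qed.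

Lemma dlog_hp a s : adm a s -> dlog (bal b) bCs (sp a s) (Lp a s) (hp a s).
Proof.
move=> as_; have := dlog_word as_ (dlogW bCs_ge0 (dlog_id (bal b))).
by rewrite mul1r; under eq_fun do rewrite add0r.
Qed.

Lemma bctx_hp a s : adm a s -> bctx (hp a s).
Proof. by move=> h; exists (sp a s), (Lp a s); rewrite sp1; split => //; apply: dlog_hp. Qed.

Lemma bctx_comp k a s : adm a s -> bctx k -> bctx (k \o hp a s).
Proof.
move=> as_ [e [L [e1 dk]]]; exists (e * sp a s), (fun x => L (hp a s x) + Lp a s x).
by rewrite normrM e1 sp1 mulr1; split => //; apply: dlog_word.
Qed.

Lemma bctx_affine k c d : c != 0 -> bctx k -> bctx (fun x => d + c * k x).
Proof.
move=> cn0 [e [L [e1 dk]]]; exists (Num.sg c * e), (fun x => ln `|c| + L x).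
by rewrite normrM e1 mulr1 normr_sg cn0; split => //; apply: dlog_affine.
Qed.

Lemma bctx_distortion k x y : bctx k -> 0 <= x <= 1 -> 0 <= y <= 1 ->
  expR (- (4 * bCs)) * width k * `|x - y| <= `|k x - k y| <= expR (4 * bCs) * width k * `|x - y|.
Proof.
by move=> [e [L [e1 dk]]] hx hy; apply: (dlog_distortion (ltW a0) bCs_ge0 e1 dk).
Qed.

Lemma hp_gap a s s' x y : adm a s -> adm a s' -> size s = size s' -> s != s' ->
  0 <= x <= 1 -> 0 <= y <= 1 -> bgap b * blmin b ^+ size s <= `|hp a s x - hp a s' y|.
Proof.
elim: s s' a => [|c s IH] [|c' s'] // a /= /andP[ac cs] /andP[ac' cs'] [ss].
have [eqc|cc'] := eqVneq c c'; last first.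
  move=> _ hx hy; apply: le_trans (ibr_gap b ac ac' cc' (hp01 cs hx) (hp01 cs' hy)).
  rewrite ler_piMr ?(ltW (bgap_gt0 b)) // exprn_ile1 ?(ltW (blmin_gt0 b)) //.
  have m0 : 0 <= (0 : R) <= 1 by rewrite lexx ler01.
  have m1 : 0 <= (1 : R) <= 1 by rewrite lexx ler01.
  have := le_trans (ibr_ge b ac m1 m0) (ibr_le b ac m1 m0).
  by rewrite subr0 normr1 !mulr1 => h; apply: le_trans h (ltW l1).
rewrite -eqc in cs' *; rewrite eqseq_cons eqxx /= => ss' hx hy.
apply: le_trans (ibr_ge b ac (hp01 cs hx) (hp01 cs' hy)).
by rewrite exprS mulrCA ler_wpM2l ?(ltW (blmin_gt0 b)) //; apply: IH.
Qed.

End Words.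

Lemma finite_lbound (R : realType) (V : finType) (f : V -> R) : (forall v, 0 < f v) ->
  exists2 c : R, 0 < c & forall v, c <= f v.
Proof.
move=> f0; have : exists2 c : R, 0 < c & forall v, v \in enum V -> c <= f v.
  elim: (enum V) => [|u r [c c0 hc]]; first by exists 1.
  exists (Num.min c (f u)); first by rewrite lt_min c0 f0.
  by move=> v; rewrite inE ge_min => /orP[/eqP ->|/hc ->] //; rewrite lexx orbT.
by move=> [c c0 hc]; exists c => // v; apply: hc; rewrite mem_enum.
Qed.

(** * The system of loops at one letter *)

Section CantorSystem.
Variables (R : realType) (A : finType) (B : {set A * A}) (b : branches R B).
Variables (o : A) (n : nat) (s : R).

(** Words that return to [o] can be concatenated without restriction, which replaces the subshift by
    a full shift. *)
Definition loop := {w : n.-tuple A | adm B o w && (last o w == o)}.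
Definition loop_word (v : loop) : seq A := tval (val v).

Lemma loop_adm (v : loop) : adm B o (loop_word v).
Proof. by case/andP: (valP v). Qed.

Lemma loop_last (v : loop) : last o (loop_word v) = o.
Proof. by case/andP: (valP v) => _ /eqP. Qed.

Lemma loop_size (v : loop) : size (loop_word v) = n.
Proof. exact: size_tuple. Qed.

Definition distortion : R := expR (- (4 * bCs b)).
(** With the factor [distortion], the summand bounds from below the relative width of a loop in
    every context. Once the sum is at least [1], normalising it yields weights that satisfy
    [wt_le]. *)
Definition loop_sum : R := \sum_(v : loop) (distortion * width (hp b o (loop_word v))) `^ s.

Hypothesis s_ge0 : 0 <= s.
Hypothesis contracting : expR (4 * bCs b) * blam b ^+ n < 1.
Hypothesis large_sum : 1 <= loop_sum.

Let cbr (v : loop) : R -> R := hp b o (loop_word v).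
Let cwt (v : loop) : R := (distortion * width (cbr v)) `^ s / loop_sum.

Let width_word (v : loop) : blmin b ^+ n <= width (cbr v) <= blam b ^+ n.
Proof.
have m0 : 0 <= (0 : R) <= 1 by rewrite lexx ler01.
have m1 : 0 <= (1 : R) <= 1 by rewrite lexx ler01.
have h1 := hp_le b (loop_adm v) m1 m0; have h2 := hp_ge b (loop_adm v) m1 m0.
by move: h1 h2; rewrite subr0 normr1 !mulr1 loop_size => -> ->.
Qed.

Let w0 (v : loop) : 0 < width (cbr v).
Proof. by case/andP: (width_word v) => h _; apply: lt_le_trans h; rewrite exprn_gt0 // blmin_gt0. Qed.

Let d0 : 0 < distortion. Proof. exact: expR_gt0. Qed.

Let pos0 : 0 <= (0 : R) <= 1. Proof. by rewrite lexx ler01. Qed.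
Let pos1 : 0 <= (1 : R) <= 1. Proof. by rewrite lexx ler01. Qed.

Let cbr01 v x : 0 <= x <= 1 -> 0 <= cbr v x <= 1.
Proof. by move=> hx; apply: hp01 => //; apply: loop_adm. Qed.

Let cctx_br k v : bctx b k -> bctx b (k \o cbr v).
Proof. by move=> ck; apply: bctx_comp => //; apply: loop_adm. Qed.

Let cctx_scale k c : 0 < c -> bctx b k -> bctx b (fun x => c * k x).
Proof.
move=> c0 ck; have := bctx_affine 0 (lt0r_neq0 c0) ck.
by under eq_fun do rewrite add0r.
Qed.

Let cwidth_gt0 k : bctx b k -> 0 < width k.
Proof. by move=> [e [L [e1 dk]]]; apply: dlog_width_gt0 e1 dk. Qed.

Let cctx_width k x y : bctx b k -> 0 <= x <= 1 -> 0 <= y <= 1 -> `|k x - k y| <= width k.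
Proof. by move=> [e [L [e1 dk]]]; apply: dlog_width e1 dk _ _. Qed.

Let cminV : R := Num.min 1 (distortion * blmin b ^+ n).

Let cmin0 : 0 < cminV.
Proof. by rewrite lt_min ltr01 mulr_gt0 // exprn_gt0 // blmin_gt0. Qed.

Let cmin1 : cminV <= 1.
Proof. by rewrite ge_min lexx. Qed.

Let cmax0 : 0 < expR (4 * bCs b) * blam b ^+ n.
Proof. by rewrite mulr_gt0 ?expR_gt0 // exprn_gt0 // blam_gt0. Qed.

Let cwidth_le k v : bctx b k -> width (k \o cbr v) <= expR (4 * bCs b) * blam b ^+ n * width k.
Proof.
move=> ck; have /andP[_ h] := bctx_distortion ck (cbr01 v pos1) (cbr01 v pos0).
apply: le_trans h _; rewrite [leRHS]mulrAC ler_wpM2l ?mulr_ge0 ?expR_ge0 ?(ltW (cwidth_gt0 ck)) //.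
by case/andP: (width_word v).
Qed.

Let cwidth_low k v : bctx b k -> distortion * width k * width (cbr v) <= width (k \o cbr v).
Proof. by move=> ck; have /andP[h _] := bctx_distortion ck (cbr01 v pos1) (cbr01 v pos0). Qed.

Let cwidth_ge k v : bctx b k -> cminV * width k <= width (k \o cbr v).
Proof.
move=> ck; have wk := cwidth_gt0 ck; apply: le_trans (cwidth_low v ck).
rewrite mulrAC ler_pM2r // ge_min; apply/orP; right.
by rewrite ler_pM2l //; case/andP: (width_word v).
Qed.

Let cgap0 : 0 < distortion * (bgap b * blmin b ^+ n).
Proof. by rewrite !mulr_gt0 ?bgap_gt0 // exprn_gt0 // blmin_gt0. Qed.

Let cctx_gap k u v x y : bctx b k -> u != v -> 0 <= x <= 1 -> 0 <= y <= 1 ->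
  distortion * (bgap b * blmin b ^+ n) * width k <= `|k (cbr u x) - k (cbr v y)|.
Proof.
move=> ck uv hx hy; have /andP[h _] := bctx_distortion ck (cbr01 u hx) (cbr01 v hy).
apply: le_trans h; rewrite mulrAC ler_wpM2l ?mulr_ge0 ?(ltW d0) ?(ltW (cwidth_gt0 ck)) //.
rewrite -(loop_size u); apply: hp_gap (loop_adm u) (loop_adm v) _ _ hx hy.
  by rewrite !loop_size.
by apply: contraNN uv => /eqP h'; apply/eqP/val_inj/val_inj.
Qed.

Let sum0 : 0 < loop_sum. Proof. exact: lt_le_trans large_sum. Qed.

Let cwt_gt0 v : 0 < cwt v.
Proof. by rewrite divr_gt0 // powR_gt0 // mulr_gt0. Qed.

Let cwt_sum : \sum_v cwt v = 1.
Proof. by rewrite -mulr_suml divff // gt_eqF. Qed.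

Let cwt_le k v : bctx b k -> cwt v * width k `^ s <= width (k \o cbr v) `^ s.
Proof.
move=> ck; have wk := cwidth_gt0 ck.
apply: le_trans (_ : (distortion * width (cbr v)) `^ s * width k `^ s <= _).
  rewrite ler_wpM2r ?powR_ge0 // ler_pdivrMr // ler_peMr ?powR_ge0 //.
rewrite -powRM ?mulr_ge0 ?(ltW d0) ?(ltW (w0 v)) ?(ltW wk) //.
apply: ge0_ler_powR; rewrite ?nnegrE ?mulr_ge0 ?(ltW d0) ?(ltW (w0 v)) ?(ltW wk) //; last first.
  by rewrite mulrAC; apply: cwidth_low.
by rewrite ltW // cwidth_gt0 //; apply: cctx_br.
Qed.

Definition cantor_system : system R := @System R _ cbr cwt (bctx b) s
  (expR (4 * bCs b) * blam b ^+ n) cminV (distortion * (bgap b * blmin b ^+ n))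
  cbr01 cctx_br cctx_scale cwidth_gt0 cctx_width cmin0 cmin1 cmax0 contracting
  cwidth_le cwidth_ge cgap0 cctx_gap cwt_gt0 cwt_sum s_ge0 cwt_le.

Definition spell (w : seq loop) : seq A := flatten [seq loop_word v | v <- w].

Lemma spell_adm w : adm B o (spell w) /\ last o (spell w) = o.
Proof.
elim: w => [|v w [IH1 IH2]] //=; rewrite /spell /= adm_cat last_cat loop_last.
by rewrite loop_adm.
Qed.

Lemma descend_spell (w : seq loop) k x : 
  @descend R cantor_system w k x = k (hp b o (spell w) x).
Proof.
elim: w k => [|v w IH] k //=; rewrite /spell /= hp_cat loop_last -/(spell w).
by rewrite /descend /= -/(@descend R cantor_system w _) IH.
Qed.

End CantorSystem.

(** * Steering by twisted loops *)

Section Proportional.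
Variable R : realType.

(** Logarithmic form of proportionality: the increments have ratio [expR l] up to a factor
    [expR eps] either way. Logarithms and errors both add up under composition of such
    comparisons. *)
Definition near_scaled (eps l : R) (k1 k2 : R -> R) : Prop :=
  forall x y, 0 <= x <= 1 -> 0 <= y <= 1 -> exists r,
    k1 x - k1 y = expR r * (k2 x - k2 y) /\ `|r - l| <= eps.

Lemma near_trans e1 e2 l1 l2 k1 k2 k3 : near_scaled e1 l1 k1 k2 -> near_scaled e2 l2 k2 k3 ->
  near_scaled (e1 + e2) (l1 + l2) k1 k3.
Proof.
move=> h1 h2 x y hx hy; have [r1 [a1 b1]] := h1 x y hx hy; have [r2 [a2 b2]] := h2 x y hx hy.
exists (r1 + r2); rewrite a1 a2 expRD mulrA; split => //.
rewrite (_ : r1 + r2 - _ = (r1 - l1) + (r2 - l2)); last by ring.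
by apply: le_trans (ler_normD _ _) _; apply: lerD.
Qed.

Lemma near_sym e l k1 k2 : near_scaled e l k1 k2 -> near_scaled e (- l) k2 k1.
Proof.
move=> h x y hx hy; have [r [a1 b1]] := h x y hx hy; exists (- r); split.
  by rewrite a1 mulrA -expRD addNr expR0 mul1r.
by rewrite -opprB normrN opprK addrC.
Qed.

Lemma near_comp e l k1 k2 h : (forall x, 0 <= x <= 1 -> 0 <= h x <= 1) ->
  near_scaled e l k1 k2 -> near_scaled e l (k1 \o h) (k2 \o h).
Proof. by move=> h01 hn x y hx hy; apply: hn; apply: h01. Qed.

Lemma near_refl k : near_scaled 0 0 k k.
Proof. by move=> x y _ _; exists 0; rewrite expR0 mul1r subrr normr0. Qed.

Lemma near_sign e l k1 k2 c : near_scaled e l k1 k2 ->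
  near_scaled e l (fun x => c * k1 x) (fun x => c * k2 x).
Proof.
move=> h x y hx hy; have [r [a1 b1]] := h x y hx hy; exists r; split => //.
by rewrite -!mulrBr a1 mulrCA.
Qed.

Lemma nearW e e' l k1 k2 : e <= e' -> near_scaled e l k1 k2 -> near_scaled e' l k1 k2.
Proof.
by move=> ee h x y hx hy; have [r [a1 b1]] := h x y hx hy; exists r; split=> //; apply: le_trans ee.
Qed.

Lemma near_shift e d l l' k1 k2 : `|l - l'| <= d -> near_scaled e l k1 k2 ->
  near_scaled (e + d) l' k1 k2.
Proof.
move=> ll h x y hx hy; have [r [a1 b1]] := h x y hx hy; exists r; split => //.
rewrite (_ : r - l' = (r - l) + (l - l')); last by ring.
by apply: le_trans (ler_normD _ _) _; apply: lerD.
Qed.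

Lemma expR_sub1 (u : R) : `|u| <= 1 / 2 -> `|expR u - 1| <= 2 * `|u|.
Proof.
move=> hu; have h1 := expR_ge1Dx u; have h2 := expR_ge1Dx (- u).
have E : expR u * expR (- u) = 1 by rewrite -expRD subrr expR0.
have e0 := expR_gt0 u.
have hu1 := ler_norm u; have hu2 := ler_norm (- u); rewrite normrN in hu2.
rewrite ler_norml; apply/andP; split; first lra.
have : expR u * (1 - u) <= 1 by rewrite -[leRHS]E ler_wpM2l // ltW.
by case: (lerP 0 u) => u0; [rewrite ger0_norm //; move: hu; rewrite ger0_norm // => hu|rewrite ltr0_norm //]; nra.
Qed.

Lemma near_relclose e l y k1 k0 delta : near_scaled e l k1 k0 -> delta <= 1 ->
  e + `|l - y| <= delta / 2 -> relclose delta (dilate (expR y) k0) k1.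
Proof.
move=> hn d1 he u v hu hv; have [r [a1 b1]] := hn u v hu hv.
rewrite /dilate a1 -mulrBr -mulrBl !normrM mulrA ler_wpM2r //.
have hr : `|r - y| <= delta / 2.
  rewrite (_ : r - y = (r - l) + (l - y)); last by ring.
  by apply: le_trans (ler_normD _ _) _; apply: le_trans he; rewrite lerD2r.
have hh : `|r - y| <= 1 / 2 by lra.
rewrite (_ : expR y - expR r = - (expR y * (expR (r - y) - 1))); last first.
  by rewrite mulrBr mulr1 -expRD [y + _]addrC subrK opprB.
rewrite normrN normrM mulrC ler_wpM2r //; apply: le_trans (expR_sub1 hh) _; move: hr; set u' := `|r - y|; lra.
Qed.

(** On the small image of [h] the log-derivative of [k] is almost constant, so [k] acts there like
    an affine map of slope [e * expR (L p)]. *)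
Lemma near_flat C e L k h p rho : 0 <= C -> dlog 1 C e L k ->
  (forall x, 0 <= x <= 1 -> 0 <= h x <= 1) -> 0 <= p <= 1 ->
  (forall x, 0 <= x <= 1 -> `|h x - p| <= rho) ->
  near_scaled (4 * C * rho) (L p) (k \o h) (fun x => e * h x).
Proof.
move=> C0 dk h01 hp0 hr x y hx hy; have [r [a1 _ a3]] := dk _ _ (h01 y hy) (h01 x hx).
exists r; split; first by rewrite /= a1; ring.
have [r' [_ b2 b3]] := dk _ _ (h01 x hx) hp0.
move: a3 b2 b3; rewrite !powRr1 // => a3 b2 b3.
have q1 := hr x hx; have q2 := hr y hy; rewrite distrC in q1.
have q3 : `|h x - h y| <= 2 * rho.
  rewrite (_ : h x - h y = - (p - h x) - (h y - p)); last by ring.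
  by apply: le_trans (ler_normB _ _) _; rewrite normrN; lra.
have q4 : C * `|h x - h y| <= C * (2 * rho) by apply: ler_wpM2l.
have q5 : C * `|p - h x| <= C * rho by apply: ler_wpM2l.
rewrite (_ : r - L p = (r - L (h x)) + ((r' - L p) - (r' - L (h x)))); last by ring.
apply: le_trans (ler_normD _ _) _.
by have := ler_normB (r' - L p) (r' - L (h x)); lra.
Qed.

Lemma discrete_ivt (t : nat -> R) (n : nat) (d y : R) : t 0%N = 0 ->
  (forall i, (i < n)%N -> t i.+1 <= t i + d) -> 0 <= d -> 0 <= y <= t n ->
  exists2 i, (i <= n)%N & `|t i - y| <= d.
Proof.
move=> t0 ht d0 /andP[y0 yn]; have ex : exists i, y <= t i by exists n.
case: (ex_minnP ex) => i hi hmin; have iN : (i <= n)%N by apply: hmin.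
exists i => //; rewrite ger0_norm ?subr_ge0 //.
case: i hi hmin iN => [|i] hi hmin iN; first by rewrite t0 in hi *; lra.
have : t i < y by rewrite ltNge; apply/negP => /hmin; rewrite ltnn.
by have := ht i iN; lra.
Qed.

End Proportional.

Section Steering.
Variables (R : realType) (A : finType) (B : {set A * A}) (b : branches R B).
Variables (o : A) (n : nat) (s : R).
Hypothesis s_ge0 : 0 <= s.
Hypothesis contracting : expR (4 * bCs b) * blam b ^+ n < 1.
Hypothesis large_sum : 1 <= loop_sum b o n s.
Hypothesis al1 : bal b = 1.
Variables (v1 v2 : loop B o n) (eta : R).
Hypothesis eta_gt0 : 0 < eta.
Hypothesis eta_lam : 8 * bCs b * blam b ^+ n <= eta.
Hypothesis twist : forall x y, 0 <= x -> x <= y -> y <= 1 ->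
  eta * (y - x) <= (Lp b o (loop_word v1) y - Lp b o (loop_word v1) x) -
                   (Lp b o (loop_word v2) y - Lp b o (loop_word v2) x).

Let word := seq (loop B o n).
Let H (w : word) := hp b o (spell w).
Let L (w : word) := Lp b o (spell w).
Let S (w : word) := sp b o (spell w).
Let C := bCs b.
Let lam := blam b ^+ n.

Let C0 : 0 <= C. Proof. exact: bCs_ge0. Qed.
Let C20 : 0 <= 2 * C. Proof. by apply: mulr_ge0 => //; exact: C0. Qed.
Let lam_ge0 : 0 <= lam. Proof. by rewrite exprn_ge0 // ltW // blam_gt0. Qed.
Let lam_lt1 : lam < 1.
Proof.
apply: le_lt_trans contracting; rewrite ler_peMl //.
by rewrite -[leLHS]expR0 ler_expR mulr_ge0.
Qed.

Let spellD (w w' : word) : spell (w ++ w') = spell w ++ spell w'.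
Proof. by rewrite /spell map_cat flatten_cat. Qed.

Let Hcat (w w' : word) : H (w ++ w') = H w \o H w'.
Proof. by apply/funext => x; rewrite /H spellD hp_cat (spell_adm w).2. Qed.

Let Hx (w w' : word) x : H (w ++ w') x = H w (H w' x).
Proof. by rewrite Hcat. Qed.

Let Lcat (w w' : word) x : L (w ++ w') x = L w (H w' x) + L w' x.
Proof. by rewrite /L /H spellD Lp_cat (spell_adm w).2. Qed.

Let Scat (w w' : word) : S (w ++ w') = S w * S w'.
Proof. by rewrite /S spellD sp_cat (spell_adm w).2. Qed.

Let H01 (w : word) x : 0 <= x <= 1 -> 0 <= H w x <= 1.
Proof. by apply: hp01; case: (spell_adm w). Qed.

Let size_spell (w : word) : size (spell w) = (n * size w)%N.
Proof.
elim: w => [|v w IH]; first by rewrite muln0.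
by rewrite /spell /= size_cat loop_size -/(spell w) IH mulnS.
Qed.

Let Hle (w : word) x y : 0 <= x <= 1 -> 0 <= y <= 1 ->
  `|H w x - H w y| <= lam ^+ size w * `|x - y|.
Proof.
move=> hx hy; rewrite /lam -exprM -size_spell; apply: hp_le => //; by case: (spell_adm w).
Qed.

Let dist1 (x y : R) : 0 <= x <= 1 -> 0 <= y <= 1 -> `|x - y| <= 1.
Proof. by move=> /andP[x0 x1] /andP[y0 y1]; rewrite ler_norml; apply/andP; split; lra. Qed.

Let dH (w : word) : dlog 1 C (S w) (L w) (H w).
Proof. by rewrite -al1; apply: dlog_hp; case: (spell_adm w). Qed.

Let osc e LL k x y : dlog 1 C e LL k -> 0 <= x <= 1 -> 0 <= y <= 1 ->
  `|LL y - LL x| <= 2 * C * `|y - x|.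
Proof. by move=> dk hx hy; have := dlog_osc dk hx hy; rewrite powRr1. Qed.

Section Block.
Variables (b1 b2 z : word).
Hypothesis b12 : size b1 = size b2.
Let p0 := H z 0.
Let x1 := H b1 p0.
Let x2 := H b2 p0.
Let eps := lam ^+ size z.

Let pos0 : 0 <= (0 : R) <= 1. Proof. by rewrite lexx ler01. Qed.
Let p01 : 0 <= p0 <= 1. Proof. exact: H01. Qed.

Let small (w : word) x : 0 <= x <= 1 -> `|H w (H z x) - H w p0| <= eps.
Proof.
move=> hx; apply: le_trans (Hle _ (H01 z hx) p01) _.
apply: le_trans (_ : 1 * `|H z x - p0| <= _).
  by rewrite ler_wpM2r // exprn_ile1 // ltW.
rewrite mul1r; apply: le_trans (Hle _ hx pos0) _.
rewrite -[leRHS]mulr1; apply: ler_wpM2l; [exact: exprn_ge0 | exact: dist1].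
Qed.

Let small0 x : 0 <= x <= 1 -> `|H z x - p0| <= eps.
Proof. exact: (@small [::]). Qed.

(** The word [z] contracts so strongly that whatever follows it looks like the point [p0]. Its two
    copies decouple [c] from [c']: up to a small error the derivative of the block is a product of
    factors that see only one of them. *)
Definition block (c c' : word) : word := [:: v1] ++ c ++ z ++ [:: v2] ++ c' ++ z.

(** Three uses of [near_flat] cost [4 * C * eps] each, and moving the base point of [L c] to [p0]
    costs [2 * C * eps]; hence [14]. *)
Lemma block_near e LL k (c c' : word) : `|e| = 1 -> dlog 1 C e LL k ->
  near_scaled (14 * C * eps)
    (LL (H [:: v1] (H c p0)) + L [:: v1] (H c p0) + L c p0 + L (z ++ [:: v2]) (H c' p0) + L c' p0)
    (k \o H (block c c')) (fun x => e * S [:: v1] * (S c * S z * S [:: v2]) * S c' * H z x).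
Proof.
move=> e1 dk.
have dk1 : dlog 1 C (e * S [:: v1]) (fun x => LL (H [:: v1] x) + L [:: v1] x) (k \o H [:: v1]).
  by rewrite -al1; apply: dlog_word; rewrite ?al1 //; case: (spell_adm [:: v1]).
have n1' : near_scaled (4 * C * eps)
   (LL (H [:: v1] (H c p0)) + L [:: v1] (H c p0)) ((k \o H [:: v1]) \o H (c ++ z))
   (fun x => e * S [:: v1] * H (c ++ z) x).
  apply: (near_flat C0 dk1 (fun x => @H01 (c ++ z) x) (H01 c p01)) => x hx.
  by rewrite Hx; apply: small.
have m1 := near_comp (fun x => @H01 ([:: v2] ++ c' ++ z) x) n1'.
have n2 : near_scaled (4 * C * eps) (L (c ++ z ++ [:: v2]) (H c' p0))
   (H (c ++ z ++ [:: v2]) \o H (c' ++ z)) (fun x => S (c ++ z ++ [:: v2]) * H (c' ++ z) x).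
  apply: (near_flat C0 (dH _) (fun x => @H01 (c' ++ z) x) (H01 c' p01)) => x hx.
  by rewrite Hx; apply: small.
have n3 : near_scaled (4 * C * eps) (L c' p0) (H c' \o H z) (fun x => S c' * H z x).
  exact: (near_flat C0 (dH c') (fun x => @H01 z x) p01 small0).
have E1 : (fun x => e * S [:: v1] * H (c ++ z) x) \o H ([:: v2] ++ c' ++ z) =
   (fun x => e * S [:: v1] * (H (c ++ z ++ [:: v2]) \o H (c' ++ z)) x).
  by apply/funext => x; rewrite /comp !Hx.
have E2 : ((k \o H [:: v1]) \o H (c ++ z)) \o H ([:: v2] ++ c' ++ z) = k \o H (block c c').
  by apply/funext => x; rewrite /block /comp !Hx.
move: m1; rewrite E1 E2 => m1.
have n4 : near_scaled (4 * C * eps + 4 * C * eps) (L (c ++ z ++ [:: v2]) (H c' p0) + L c' p0)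
    (fun x => e * S [:: v1] * (H (c ++ z ++ [:: v2]) \o H (c' ++ z)) x)
    (fun x => e * S [:: v1] * (S (c ++ z ++ [:: v2]) * (S c' * H z x))).
  apply: near_sign; apply: near_trans n2 _; apply: near_sign.
  by rewrite (_ : H (c' ++ z) = H c' \o H z) // Hcat.
have := near_trans m1 n4.
rewrite (_ : (fun x => e * S [:: v1] * (S (c ++ z ++ [:: v2]) * (S c' * H z x))) =
   (fun x => e * S [:: v1] * (S c * S z * S [:: v2]) * S c' * H z x)); last first.
  by apply/funext => x; rewrite !Scat; ring.
have d1 : `|L c (H (z ++ [:: v2]) (H c' p0)) - L c p0| <= 2 * C * eps.
  apply: le_trans (osc (dH c) p01 (H01 _ (H01 _ p01))) _; apply: ler_wpM2l => //.
  by rewrite Hx; apply: small0; do 2!apply: H01.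
move=> hn; apply: nearW (near_shift (d := 2 * C * eps) _ hn); first by lra.
by rewrite Lcat; apply: le_trans d1; rewrite le_eqVlt; apply/orP; left; apply/eqP; congr `|_|; ring.
Qed.

(** Exchanging [b1] and [b2] changes neither [L b1 p0 + L b2 p0] nor the product of signs. What
    remains is the increment of [L [:: v1] - L [:: v2]] from [x2] to [x1], at least
    [eta * (x1 - x2)] by [twist]. The outer context and [z] see the two points only after a
    contraction by [lam], and [eta_lam] keeps their influence below half of that. *)
Lemma block_ratio : x2 <= x1 -> forall k, bctx b k -> exists tau,
  [/\ eta / 2 * (x1 - x2) <= tau, tau <= 4 * C * (x1 - x2) &
      near_scaled (28 * C * eps) tau (k \o H (block b1 b2)) (k \o H (block b2 b1))].
Proof.
move=> x21 k [e [LL [e1 dk]]]; rewrite al1 -/C in dk.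
have X1 : 0 <= x1 <= 1 by apply: H01.
have X2 : 0 <= x2 <= 1 by apply: H01.
have dk1 : dlog 1 C (e * S [:: v1]) (fun x => LL (H [:: v1] x) + L [:: v1] x) (k \o H [:: v1]).
  by rewrite -al1; apply: dlog_word; rewrite ?al1 //; case: (spell_adm [:: v1]).
have m1 := block_near b1 b2 e1 dk; have m2 := block_near b2 b1 e1 dk.
move: m2; rewrite (_ : (fun x => e * S [:: v1] * (S b2 * S z * S [:: v2]) * S b1 * H z x) =
   (fun x => e * S [:: v1] * (S b1 * S z * S [:: v2]) * S b2 * H z x)); last first.
  by apply/funext => x; ring.
move=> m2; have m3 := near_trans m1 (near_sym m2).
have q1 := osc dk1 X2 X1; have q2 := osc (dH (z ++ [:: v2])) X2 X1.
rewrite [`|x1 - x2|]ger0_norm ?subr_ge0 // in q1; rewrite [`|x1 - x2|]ger0_norm ?subr_ge0 // in q2.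
have w1 : `|LL (H [:: v1] x1) - LL (H [:: v1] x2)| <= 2 * C * (lam * (x1 - x2)).
  apply: le_trans (osc dk (H01 _ X2) (H01 _ X1)) _; apply: ler_wpM2l => //.
  by have := Hle [:: v1] X1 X2; rewrite [size _]/= expr1 [`|x1 - x2|]ger0_norm ?subr_ge0.
have w2 : `|L z (H [:: v2] x1) - L z (H [:: v2] x2)| <= 2 * C * (lam * (x1 - x2)).
  apply: le_trans (osc (dH z) (H01 _ X2) (H01 _ X1)) _; apply: ler_wpM2l => //.
  by have := Hle [:: v2] X1 X2; rewrite [size _]/= expr1 [`|x1 - x2|]ger0_norm ?subr_ge0.
have sp1w (v : loop B o n) : spell [:: v] = loop_word v by rewrite /spell /= cats0.
have tw : eta * (x1 - x2) <= (L [:: v1] x1 - L [:: v1] x2) - (L [:: v2] x1 - L [:: v2] x2).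
  by rewrite /L !sp1w; apply: twist => //; [case/andP: X2|case/andP: X1].
exists (LL (H [:: v1] x1) + L [:: v1] x1 + L b1 p0 + L (z ++ [:: v2]) x2 + L b2 p0 -
  (LL (H [:: v1] x2) + L [:: v1] x2 + L b2 p0 + L (z ++ [:: v2]) x1 + L b1 p0)).
split.
- rewrite !Lcat; move: w1 w2; rewrite !ler_norml => /andP[w1a w1b] /andP[w2a w2b].
  have : 8 * C * lam * (x1 - x2) <= eta * (x1 - x2) by rewrite ler_wpM2r ?subr_ge0.
  by lra.
- by move: q1 q2; rewrite !ler_norml => /andP[q1a q1b] /andP[q2a q2b]; lra.
by apply: nearW m3; lra.
Qed.

End Block.

Let npow (i : nat) (w : word) : word := flatten (nseq i w).

Let npowS i w : npow i.+1 w = w ++ npow i w. Proof. by []. Qed.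

Let size_npow i w : size (npow i w) = (i * size w)%N.
Proof. by elim: i => //= i IH; rewrite npowS size_cat IH mulSn. Qed.

(** Blocks are replaced from the right end. Those on the left are part of the context of the
    exchange, and those on the right are a precomposition, which does not enlarge the error; so each
    step adds only [e0]. *)
Lemma blocks_climb (u u' : word) (t0 d e0 : R) : size u = size u' -> 0 < t0 ->
  (forall k, bctx b k -> exists tau, [/\ t0 <= tau, tau <= d &
      near_scaled e0 tau (k \o H u) (k \o H u')]) ->
  forall N k, bctx b k -> exists t : nat -> R, [/\ t 0%N = 0,
    forall i, (i < N)%N -> t i + t0 <= t i.+1 <= t i + d &
    forall i, (i <= N)%N ->
      near_scaled (i%:R * e0) (t i) (k \o H (npow (N - i) u' ++ npow i u)) (k \o H (npow N u'))].
Proof.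
move=> su t00 hstep N k ck.
have hstep' (k' : R -> R) : exists tau, bctx b k' -> [/\ t0 <= tau, tau <= d &
      near_scaled e0 tau (k' \o H u) (k' \o H u')].
  have [ck'|nck'] := pselect (bctx b k'); last by exists 0.
  by have [tau h] := hstep k' ck'; exists tau.
have [f hf] := choice hstep'.
pose tau i := f (k \o H (npow (N - i.+1) u')).
have htau i : [/\ t0 <= tau i, tau i <= d & near_scaled e0 (tau i)
    ((k \o H (npow (N - i.+1) u')) \o H u) ((k \o H (npow (N - i.+1) u')) \o H u')].
  by apply: hf; apply: bctx_comp => //; case: (spell_adm (npow (N - i.+1) u')).
exists (fun i => \sum_(j < i) tau j); split; first by rewrite big_ord0.
- by move=> i _; rewrite big_ord_recr /= !lerD2l; case: (htau i) => -> ->.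
elim=> [_|i IH iN].
  rewrite big_ord0 mul0r subn0 (_ : npow N u' ++ npow 0 u = npow N u') ?cats0 //.
  exact: near_refl.
have [_ _ h1] := htau i; have h2 := near_comp (fun x => @H01 (npow i u) x) h1.
have E1 : ((k \o H (npow (N - i.+1) u')) \o H u) \o H (npow i u) =
   k \o H (npow (N - i.+1) u' ++ npow i.+1 u).
  by apply/funext => x; rewrite /comp npowS !Hx.
have E2 : ((k \o H (npow (N - i.+1) u')) \o H u') \o H (npow i u) =
   k \o H (npow (N - i) u' ++ npow i u).
  apply/funext => x; rewrite /comp -!Hx; congr (k (H (_ ++ _) x)).
  rewrite (_ : (N - i = (N - i.+1) + 1)%N); last by rewrite addn1 subnSK.
  by rewrite /npow nseqD flatten_cat /= cats0.
rewrite E1 E2 in h2; rewrite big_ord_recr /=.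
have := near_trans h2 (IH (ltnW iN)); rewrite [tau i + _]addrC; apply: nearW.
by rewrite -natr1 mulrDl mul1r addrC.
Qed.

Lemma cantor_steerable : steerable (cantor_system s_ge0 contracting large_sum).
Proof.
move=> m delta m0 d0; pose d1 := Num.min delta 1.
have d10 : 0 < d1 by rewrite lt_min d0 ltr01.
have d1le : d1 <= 1 by rewrite ge_min lexx orbT.
have n_gt0 : (0 < n)%N.
  by rewrite lt0n; apply/eqP => n0; move: lam_lt1; rewrite /lam n0 expr0 ltxx.
have lam01 : 0 < lam < 1 by rewrite lam_lt1 andbT exprn_gt0 // blam_gt0.
have lamX i : 0 <= lam ^+ i by exact: exprn_ge0.
have v12 : loop_word v1 != loop_word v2.
  apply/eqP => e; have := twist (lexx 0) ler01 (lexx 1).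
  by rewrite e subrr subr0 mulr1; apply/negP; rewrite -ltNge.
have C10 : 0 < 4 * C + 1 by rewrite ltr_wpDl // mulr_ge0 //; exact: C0.
(* Order of the choices: [l] brings the two base points so close that a step is finer than [delta];
   they remain at distance at least [D], so a step gains at least [t0] and [N] steps climb past [1];
   finally [q] makes the error of [N] steps negligible. The bound [t0] does not depend on [z], so
   there is no circularity. *)
have [l hl] := @expr_small R lam (d1 / 8 / (4 * C + 1)) lam01 ltac:(by rewrite !divr_gt0).
pose pre := nseq l v1; pose ba := pre ++ [:: v1]; pose bb := pre ++ [:: v2].
pose D := bgap b * blmin b ^+ (n * l.+1).
have D0 : 0 < D by rewrite mulr_gt0 ?bgap_gt0 // exprn_gt0 // blmin_gt0.
have sba : size ba = l.+1 by rewrite size_cat size_nseq addn1.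
have sbb : size bb = l.+1 by rewrite size_cat size_nseq addn1.
pose t0 := eta / 2 * D; have t00 : 0 < t0 by rewrite mulr_gt0 // divr_gt0.
pose N := (Num.truncn t0^-1).+1.
have N0 : 0 < N%:R :> R by rewrite ltr0n.
have Nt : 1 <= N%:R * t0.
  by rewrite -ler_pdivrMr // div1r ltW // truncnS_gt.
have C280 : 0 < N%:R * (28 * C + 1) by rewrite mulr_gt0 // ltr_wpDl // mulr_ge0 //; exact: C0.
have [q hq] := @expr_small R lam (d1 / 8 / (N%:R * (28 * C + 1))) lam01 ltac:(by rewrite !divr_gt0).
pose z := nseq q v1.
have sz : size z = q by rewrite size_nseq.
pose p := H z 0.
have p01 : 0 <= p <= 1 by apply: H01; rewrite lexx ler01.
have gapD : D <= `|H ba p - H bb p|.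
  rewrite /D -sba -size_spell; apply: hp_gap => //.
  - by case: (spell_adm ba).
  - by case: (spell_adm bb).
  - by rewrite !size_spell sba sbb.
  by rewrite !spellD eqseq_cat // eqxx /= /spell /= !cats0.
have gapU : 4 * C * `|H ba p - H bb p| <= d1 / 8.
  apply: le_trans (_ : 4 * C * lam ^+ l <= _).
    apply: ler_wpM2l; first by apply: mulr_ge0 => //; exact: C0.
    rewrite !Hx.
    have hv v : 0 <= H [:: v] p <= 1 by apply: H01.
    have := Hle pre (hv v1) (hv v2); rewrite size_nseq => h; apply: le_trans h _.
    rewrite -[leRHS]mulr1; apply: ler_wpM2l; [exact: lamX|exact: dist1].
  have := hl l (leqnn l); rewrite ler_pdivlMr // => h; apply: le_trans h.
  rewrite mulrC; apply: ler_wpM2l; [exact: lamX|by rewrite lerDl].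
have epsU : N%:R * (28 * C * lam ^+ q) <= d1 / 8.
  have := hq q (leqnn q); rewrite ler_pdivlMr // => h; apply: le_trans h.
  rewrite mulrA mulrC; apply: ler_wpM2l; first exact: lamX.
  by apply: ler_wpM2l; [exact: ltW|rewrite lerDl].
have sblk c c' : size (block z c c') = (1 + (size c + (size z + (1 + (size c' + size z)))))%N.
  by rewrite /block !size_cat.
(* Which of the two patterns has the larger scale depends on the order of the two base points. *)
have [u [u' [suu hstep]]] : exists u u' : word, size u = size u' /\
    (forall k, bctx b k -> exists tau, [/\ t0 <= tau, tau <= d1 / 8 &
      near_scaled (28 * C * lam ^+ q) tau (k \o H u) (k \o H u')]).
  have [h|/ltW h] := leP (H bb p) (H ba p).
    exists (block z ba bb), (block z bb ba); split.
      by rewrite !sblk sba sbb.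
    move=> k ck; have [tau [h1 h2 h3]] := block_ratio (z := z) h ck.
    exists tau; rewrite -sz; split => //.
    + apply: le_trans h1; rewrite /t0 ler_wpM2l ?divr_ge0 ?(ltW eta_gt0) //.
      by apply: le_trans gapD _; rewrite ger0_norm ?subr_ge0.
    by apply: le_trans h2 _; apply: le_trans gapU; rewrite [in leRHS]ger0_norm ?subr_ge0.
  exists (block z bb ba), (block z ba bb); split.
    by rewrite !sblk sba sbb.
  move=> k ck; have [tau [h1 h2 h3]] := block_ratio (z := z) h ck.
  exists tau; rewrite -sz; split => //.
  + apply: le_trans h1; rewrite /t0 ler_wpM2l ?divr_ge0 ?(ltW eta_gt0) //.
    by apply: le_trans gapD _; rewrite distrC ger0_norm ?subr_ge0.
  by apply: le_trans h2 _; apply: le_trans gapU; rewrite distrC [in leRHS]ger0_norm ?subr_ge0.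
exists (N * size u)%N => k ck.
have [t [h0 ht hn]] := blocks_climb suu t00 hstep N ck.
exists (k \o H (npow N u')).
  by apply: bctx_comp => //; case: (spell_adm (npow N u')).
move=> j jm.
have tge i : (i <= N)%N -> i%:R * t0 <= t i.
  elim: i => [|i IH] iN; first by rewrite mul0r h0.
  have /andP[h1 _] := ht i iN; have := IH (ltnW iN).
  by rewrite -natr1 mulrDl mul1r; lra.
have [i iN hi] : exists2 i, (i <= N)%N & `|t i - j%:R / m%:R| <= d1 / 8.
  apply: (discrete_ivt h0); first by move=> i iN; case/andP: (ht i iN).
    by rewrite divr_ge0 // ltW.
  rewrite divr_ge0 //=; apply: le_trans (tge N (leqnn N)); apply: le_trans Nt.
  by rewrite ler_pdivrMr ?ltr0n // mul1r ler_nat ltnW.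
exists (npow (N - i) u' ++ npow i u).
  by rewrite size_cat !size_npow suu -mulnDl subnK.
have -> : @descend R (cantor_system s_ge0 contracting large_sum) (npow (N - i) u' ++ npow i u) k =
   k \o H (npow (N - i) u' ++ npow i u).
  by apply/funext => x; rewrite descend_spell.
have rc : relclose d1 (dilate (expR (j%:R / m%:R)) (k \o H (npow N u'))) (k \o H (npow (N - i) u' ++ npow i u)).
  apply: (near_relclose (hn i iN)) => //.
  have : i%:R * (28 * C * lam ^+ q) <= N%:R * (28 * C * lam ^+ q).
    apply: ler_wpM2r; [apply: mulr_ge0; [apply: mulr_ge0 => //; exact: C0|exact: lamX]|by rewrite ler_nat].
  by lra.
move=> x y hx hy; apply: le_trans (rc x y hx hy) _; rewrite ler_wpM2r //.
by rewrite ge_min lexx.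
Qed.

End Steering.

(** * Calculus on an interval and inverse branches *)

Section Calculus.
Variable R : realType.

(* At an isolated point of [D] every [l] qualifies; see [limit_pt]. *)
Definition hasd (D : set R) (f : R -> R) (x l : R) : Prop :=
  forall e, 0 < e -> exists2 d, 0 < d & forall y, D y -> `|y - x| < d ->
    `|f y - f x - l * (y - x)| <= e * `|y - x|.

Definition cont_on (D : set R) (f : R -> R) : Prop :=
  forall x, D x -> forall e, 0 < e -> exists2 d, 0 < d & forall y, D y -> `|y - x| < d ->
    `|f y - f x| <= e.

Lemma near_withinP (D : set R) (x : R) (Q : R -> Prop) :
  (\forall y \near within D x^', Q y) <->
  exists2 d, 0 < d & forall y, D y -> y != x -> `|y - x| < d -> Q y.
Proof.
split.
  rewrite /within /= => /nbhs_ballP[d /= d0 hd]; exists d => // y Dy yx yd.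
  by apply: (hd y) => //; rewrite /ball /= distrC.
move=> [d d0 hd]; rewrite /within /=; apply/nbhs_ballP; exists d => //= y.
by rewrite /ball /= distrC => yd yx Dy; apply: hd.
Qed.

Lemma hasd_quotient (D : set R) f x l :
  hasd D f x l <-> quotient_in f x y @[y --> within D x^'] --> l.
Proof.
split=> [h|h].
  apply/cvgrPdist_le => e e0; have [d d0 hd] := h e e0.
  apply/near_withinP; exists d => // y Dy yx yd.
  have n0 : y - x != 0 by rewrite subr_eq0.
  rewrite /quotient_in (_ : l - _ = - ((f y - f x - l * (y - x)) / (y - x))); last by field.
  by rewrite normrN normrM normfV ler_pdivrMr ?normr_gt0 // hd.
move=> e e0; move/cvgrPdist_le: h => /(_ e e0) /near_withinP[d d0 hd].
exists d => // y Dy yd; have [->|yx] := eqVneq y x; first by rewrite !subrr mulr0 subrr normr0 mulr0.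
have n0 : y - x != 0 by rewrite subr_eq0.
have := hd y Dy yx yd; rewrite /quotient_in.
rewrite (_ : l - _ = - ((f y - f x - l * (y - x)) / (y - x))); last by field.
by rewrite normrN normrM normfV ler_pdivrMr ?normr_gt0.
Qed.

Lemma derivable_in_hasd (D : set R) f x : derivable_in D f x -> hasd D f x (derive_in D f x).
Proof. by move=> h; apply/hasd_quotient. Qed.

Definition limit_pt (D : set R) (x : R) : Prop :=
  forall d, 0 < d -> exists2 y, D y & y != x /\ `|y - x| < d.

Lemma hasd_derive_in (D : set R) f x l : limit_pt D x -> hasd D f x l ->
  derivable_in D f x /\ derive_in D f x = l.
Proof.
move=> lp /hasd_quotient h.
have pf : ProperFilter (within D x^').
  apply: Build_ProperFilter => /near_withinP[d d0 hd].
  by have [y Dy [yx yd]] := lp d d0; apply: hd Dy yx yd.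
have e : derive_in D f x = l by apply: cvg_lim => //.
by split => //; rewrite /derivable_in -/(derive_in D f x) e.
Qed.

Lemma hasdW (D D' : set R) f x l : D' `<=` D -> hasd D f x l -> hasd D' f x l.
Proof. by move=> s h e e0; have [d d0 hd] := h e e0; exists d => // y /s; apply: hd. Qed.

Lemma eq_hasd (D : set R) f f' x l : (forall y, D y -> f y = f' y) -> D x ->
  hasd D f x l -> hasd D f' x l.
Proof.
move=> ff Dx h e e0; have [d d0 hd] := h e e0; exists d => // y Dy yd.
by rewrite -!ff //; apply: hd.
Qed.

Lemma hasd_cont (D : set R) f x l : hasd D f x l ->
  forall e, 0 < e -> exists2 d, 0 < d & forall y, D y -> `|y - x| < d -> `|f y - f x| <= e.
Proof.
move=> h e e0; have [d d0 hd] := h 1 ltr01.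
have k0 : 0 < `|l| + 1 by rewrite ltr_wpDl.
exists (Num.min d (e / (`|l| + 1))); first by rewrite lt_min d0 divr_gt0.
move=> y Dy; rewrite lt_min => /andP[yd ye]; have := hd y Dy yd; rewrite mul1r => h1.
rewrite (_ : f y - f x = (f y - f x - l * (y - x)) + l * (y - x)); last by ring.
apply: le_trans (ler_normD _ _) _; rewrite normrM.
move: ye; rewrite ltr_pdivlMr // mulrDr mulr1 [_ * `|l|]mulrC; lra.
Qed.

Lemma hasd_cont_on (D : set R) f df : (forall x, D x -> hasd D f x (df x)) -> cont_on D f.
Proof. by move=> h x Dx; apply: hasd_cont (h x Dx). Qed.

Lemma hasdD (D : set R) f g x l m : hasd D f x l -> hasd D g x m ->
  hasd D (fun y => f y + g y) x (l + m).
Proof.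
move=> hf hg e e0; have e20 : 0 < e / 2 by rewrite divr_gt0.
have [d1 d10 h1] := hf _ e20; have [d2 d20 h2] := hg _ e20.
exists (Num.min d1 d2); first by rewrite lt_min d10.
move=> y Dy; rewrite lt_min => /andP[y1 y2]; have a1 := h1 y Dy y1; have a2 := h2 y Dy y2.
rewrite (_ : _ - _ = (f y - f x - l * (y - x)) + (g y - g x - m * (y - x))); last by ring.
by apply: le_trans (ler_normD _ _) _; lra.
Qed.

Lemma hasdZ (D : set R) f x l c : hasd D f x l -> hasd D (fun y => c * f y) x (c * l).
Proof.
move=> hf e e0; have c0 : 0 < `|c| + 1 by rewrite ltr_wpDl.
have [d d0 h] := hf (e / (`|c| + 1)) ltac:(by rewrite divr_gt0).
exists d => // y Dy yd; have := h y Dy yd.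
rewrite (_ : c * f y - c * f x - c * l * (y - x) = c * (f y - f x - l * (y - x))); last by ring.
rewrite normrM => h1; apply: le_trans (_ : (`|c| + 1) * (e / (`|c| + 1) * `|y - x|) <= _).
  by apply: ler_pM => //; rewrite lerDl.
by rewrite mulrA [(_ + 1) * _]mulrC divfK // gt_eqF.
Qed.

Lemma hasd_comp (D E : set R) f h x l m : D x -> (forall y, D y -> E (h y)) ->
  hasd D h x l -> hasd E f (h x) m -> hasd D (f \o h) x (m * l).
Proof.
move=> Dx DE hh hf e e0.
pose e1 := Num.min 1 (e / (2 * (`|m| + 1))).
have m0 : 0 < `|m| + 1 by rewrite ltr_wpDl.
have e10 : 0 < e1 by rewrite lt_min ltr01 divr_gt0 // mulr_gt0.
have l0 : 0 < 2 * (`|l| + 1) by rewrite mulr_gt0 // ltr_wpDl.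
have [d1 d10 h1] := hf (e / (2 * (`|l| + 1))) ltac:(by rewrite divr_gt0).
have [d2 d20 h2] := hh e1 e10; have [d3 d30 h3] := hasd_cont hh (e := d1 / 2) ltac:(by rewrite divr_gt0).
exists (Num.min d2 d3); first by rewrite lt_min d20.
move=> y Dy; rewrite lt_min => /andP[y2 y3]; have a2 := h2 y Dy y2.
have hd : `|h y - h x| < d1 by apply: le_lt_trans (h3 y Dy y3) _; lra.
have a1 := h1 (h y) (DE y Dy) hd.
have hl : `|h y - h x| <= (`|l| + 1) * `|y - x|.
  rewrite (_ : h y - h x = (h y - h x - l * (y - x)) + l * (y - x)); last by ring.
  apply: le_trans (ler_normD _ _) _; rewrite normrM mulrDl mul1r addrC lerD2l.
  by apply: le_trans a2 _; rewrite ler_piMl // ge_min lexx.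
rewrite (_ : _ - _ = (f (h y) - f (h x) - m * (h y - h x)) + m * (h y - h x - l * (y - x))); last by rewrite /=; ring.
apply: le_trans (ler_normD _ _) _; rewrite normrM.
have b1 : e / (2 * (`|l| + 1)) * `|h y - h x| <= e / 2 * `|y - x|.
  apply: le_trans (_ : e / (2 * (`|l| + 1)) * ((`|l| + 1) * `|y - x|) <= _).
    by rewrite ler_wpM2l // divr_ge0 ?ltW.
  rewrite (_ : _ / _ * _ = e / 2 * `|y - x|) //; field.
  by rewrite gt_eqF // ltr_wpDl.
have b2 : `|m| * `|h y - h x - l * (y - x)| <= e / 2 * `|y - x|.
  apply: le_trans (_ : (`|m| + 1) * (e / (2 * (`|m| + 1)) * `|y - x|) <= _).
    apply: ler_pM => //; first by rewrite lerDl.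
    by apply: le_trans a2 _; rewrite ler_wpM2r // ge_min lexx orbT.
  rewrite (_ : _ * (_ * _) = e / 2 * `|y - x|) //; field.
  by rewrite gt_eqF.
lra.
Qed.

Lemma is_derive_hasd (D : set R) (f : R -> R) (x l : R) : is_derive x (1 : R) f l -> hasd D f x l.
Proof.
move=> [h1 h2]; apply: (@hasdW setT) => //.
have h3 : (fun h => h^-1 *: (f (h *: (1 : R) + x) - f x)) @ 0^' --> l by rewrite -h2; exact: h1.
move=> e e0; move/cvgrPdist_le: h3 => /(_ e e0); rewrite /dnbhs /within /= => /nbhs_ballP[d /= d0 hd].
exists d => // y _ yd; have [->|yx] := eqVneq y x; first by rewrite !subrr mulr0 subrr normr0 mulr0.
have n0 : y - x != 0 by rewrite subr_eq0.
have := hd (y - x) _ n0; rewrite /ball /= sub0r normrN => /(_ yd).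
rewrite /GRing.scale /= mulr1 subrK.
rewrite (_ : l - _ = - ((f y - f x - l * (y - x)) / (y - x))); last by field.
by rewrite normrN normrM normfV ler_pdivrMr ?normr_gt0.
Qed.

Lemma hasd_is_derive (D : set R) (f : R -> R) (x l d0 : R) : 0 < d0 -> (forall y, `|y - x| < d0 -> D y) ->
  hasd D f x l -> is_derive x (1 : R) f l.
Proof.
move=> d00 hD h.
have h3 : (fun h => h^-1 *: (f (h *: (1 : R) + x) - f x)) @ 0^' --> l.
  apply/cvgrPdist_le => e e0; have [d dp hd] := h e e0.
  rewrite /dnbhs; apply/nbhs_ballP; exists (Num.min d d0) => /=; first by rewrite lt_min dp.
  move=> y; rewrite /ball /= sub0r normrN lt_min => /andP[y1 y2] yn0.
  rewrite /GRing.scale /= mulr1.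
  have := hd (y + x); rewrite addrK => /(_ _ y1) h4.
  have {}h4 := h4 (hD _ _); rewrite addrK in h4; have {}h4 := h4 y2.
  rewrite (_ : l - _ = - ((f (y + x) - f x - l * y) / y)); last by field.
  by rewrite normrN normrM normfV ler_pdivrMr ?normr_gt0.
by split; [apply/cvg_ex; exists l | apply: cvg_lim].
Qed.

Lemma cont_on_within (D : set R) f : cont_on D f -> {within D, continuous f}.
Proof.
move=> h; apply/subspace_continuousP => x Dx; apply/cvgrPdist_le => e e0.
have [d d0 hd] := h x Dx e e0; rewrite /within /=; apply/nbhs_ballP; exists d => //= y.
by rewrite /ball /= distrC => yd Dy; rewrite distrC; apply: hd.
Qed.

Lemma within_cont_on (D : set R) f : {within D, continuous f} -> cont_on D f.
Proof.
move=> /subspace_continuousP h x Dx e e0; have := h x Dx => /cvgrPdist_le /(_ e e0).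
rewrite /within /= => /nbhs_ballP[d /= d0 hd]; exists d => // y Dy yd.
by rewrite distrC; apply: (hd y) => //; rewrite /ball /= distrC.
Qed.

Lemma itv_mem (a b x : R) : (`[a, b]%classic : set R) x <-> a <= x <= b.
Proof. by rewrite /= in_itv. Qed.

Lemma hasd_mvt (a b : R) f df : a < b -> (forall x, a <= x <= b -> hasd `[a, b] f x (df x)) ->
  exists2 c, a <= c <= b & f b - f a = df c * (b - a).
Proof.
move=> ab h; have [||c cab hc] := @MVT R f df a b ab.
- move=> x; rewrite in_itv /= => /andP[ax xb].
  apply: (@hasd_is_derive `[a, b] _ _ _ (Num.min (x - a) (b - x))).
  + by rewrite lt_min !subr_gt0 ax.
  + move=> y; rewrite lt_min !ltr_norml => /andP[/andP[h1 h2] /andP[h3 h4]].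
    by apply/itv_mem; apply/andP; split; lra.
  by apply: h; rewrite !ltW.
- apply: cont_on_within => x /itv_mem hx; apply: hasd_cont (h x hx).
by exists c => //; move: cab; rewrite in_itv /= => /andP[h1 h2]; rewrite !ltW.
Qed.

Lemma hasd_mvt_sym (l r u v : R) f df : (forall x, l <= x <= r -> hasd `[l, r] f x (df x)) ->
  l <= u <= r -> l <= v <= r ->
  exists2 c, Num.min u v <= c <= Num.max u v & f v - f u = df c * (v - u).
Proof.
move=> h /andP[u1 u2] /andP[v1 v2].
have sub a b x : l <= a -> b <= r -> a <= x <= b -> hasd `[a, b] f x (df x).
  move=> la br /andP[ax xb]; apply: (@hasdW `[l, r]); last by apply: h; lra.
  by move=> y /itv_mem hy; apply/itv_mem; lra.
have [uv|vu|->] := ltgtP u v.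
- have [|c hc1 hc2] := @hasd_mvt u v f df uv; first by move=> x; apply: sub.
  by exists c => //; rewrite ?min_l ?max_r ?ltW.
- have [|c hc1 hc2] := @hasd_mvt v u f df vu; first by move=> x; apply: sub.
  by exists c => //; rewrite -[LHS]opprB hc2; ring.
by exists v; rewrite ?minxx ?maxxx ?lexx // !subrr mulr0.
Qed.

Lemma min_max_dist (u v c : R) : Num.min u v <= c <= Num.max u v -> `|c - u| <= `|v - u|.
Proof.
have [uv|vu] := leP u v; rewrite ?min_l ?max_r ?min_r ?max_l ?(ltW vu) // => /andP[h1 h2].
  by rewrite !ger0_norm ?subr_ge0 // lerD2r.
by rewrite !ler0_norm ?subr_le0 ?(ltW vu) // !opprB lerD2l lerN2.
Qed.

Lemma min_max_sub (l r u v c : R) : Num.min u v <= c <= Num.max u v ->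
  l <= u <= r -> l <= v <= r -> l <= c <= r.
Proof.
move=> /andP[h1 h2] /andP[u1 u2] /andP[v1 v2]; apply/andP; split.
  by apply: le_trans h1; rewrite le_min u1.
by apply: le_trans h2 _; rewrite ge_max u2.
Qed.

Lemma cont_on_bounded (a b : R) f : a <= b -> cont_on `[a, b] f ->
  exists M, forall x, a <= x <= b -> `|f x| <= M.
Proof.
move=> ab h; have cn : cont_on `[a, b] (fun x => `|f x|).
  move=> x Dx e e0; have [d d0 hd] := h x Dx e e0; exists d => // y Dy yd.
  by apply: le_trans (ler_dist_dist _ _) _; apply: hd.
have [c _ hc] := EVT_max ab (cont_on_within cn).
by exists `|f c| => x hx; apply: hc; rewrite in_itv.
Qed.

Lemma cont_on_min (a b : R) f : a <= b -> cont_on `[a, b] f ->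
  exists2 c, a <= c <= b & forall x, a <= x <= b -> f c <= f x.
Proof.
move=> ab h; have [c hc1 hc2] := EVT_min ab (cont_on_within h).
by exists c; [rewrite in_itv in hc1|move=> x hx; apply: hc2; rewrite in_itv].
Qed.

Lemma cont_on_sign (a b : R) f x y : cont_on `[a, b] f -> (forall t, a <= t <= b -> f t != 0) ->
  a <= x <= b -> a <= y <= b -> (0 < f x) = (0 < f y).
Proof.
wlog xy : x y / x <= y.
  by move=> hw hc h0 hx hy; case/orP: (le_total x y) => [|] h; [|symmetry]; apply: hw.
move=> hc h0 /andP[ax xb] /andP[ay yb]; apply/idP/idP => hp; rewrite ltNge; apply/negP => hn.
- have cxy : {within `[x, y], continuous f}.
    apply: cont_on_within => t /itv_mem ht e e0.
    have [|d d0 hd] := hc t _ e e0; first by apply/itv_mem; lra.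
    by exists d => // u /itv_mem hu; apply: hd; apply/itv_mem; lra.
  have [|c] := IVT (v := 0) xy cxy.
    by rewrite ge_min hn orbT le_max ltW.
  by rewrite in_itv /= => /andP[c1 c2] fc; have := h0 c; rewrite fc eqxx => /(_ _) h; have : false by apply: h; lra.
have cxy : {within `[x, y], continuous f}.
  apply: cont_on_within => t /itv_mem ht e e0.
  have [|d d0 hd] := hc t _ e e0; first by apply/itv_mem; lra.
  by exists d => // u /itv_mem hu; apply: hd; apply/itv_mem; lra.
have [|c] := IVT (v := 0) xy cxy.
  by rewrite ge_min hn le_max (ltW hp) orbT.
by rewrite in_itv /= => /andP[c1 c2] fc; have := h0 c; rewrite fc eqxx => /(_ _) h; have : false by apply: h; lra.
Qed.

Lemma ln_lip (x y : R) : 1 <= x -> 1 <= y -> `|ln x - ln y| <= `|x - y|.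
Proof.
have one (u v : R) : 1 <= v -> v <= u -> ln u - ln v <= u - v.
  move=> v1 vu; have v0 : 0 < v by lra.
  have u0 : 0 < u by lra.
  rewrite -ln_div ?posrE // (_ : u / v = 1 + (u - v) / v); last by field; rewrite gt_eqF.
  have w0 : 0 <= (u - v) / v by rewrite divr_ge0 ?subr_ge0 // ltW.
  apply: le_trans (le_ln1Dx _) _; first by lra.
  by rewrite ler_pdivrMr // ler_peMr // subr_ge0.
move=> x1 y1; have [xy|yx] := leP x y.
  have h : 0 <= ln y - ln x by rewrite subr_ge0 ler_ln ?posrE //; lra.
  by rewrite distrC [`|x - y|]distrC !ger0_norm ?subr_ge0 //; [apply: one|lra].
have h : 0 <= ln x - ln y by rewrite subr_ge0 ler_ln ?posrE ?ltW //; lra.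
by rewrite !ger0_norm ?subr_ge0 ?(ltW yx) //; [apply: one => //; exact: ltW|lra].
Qed.

End Calculus.

Lemma finite_uniform (R : realType) (V : finType) (P : V -> R -> Prop) :
  (forall v c c', 0 < c' -> c' <= c -> P v c -> P v c') ->
  (forall v, exists2 c, 0 < c & P v c) -> exists2 c, 0 < c & forall v, P v c.
Proof.
move=> hP h; have h' v : exists c, 0 < c /\ P v c by have [c c0 hc] := h v; exists c.
have [f hf] := choice h'.
have [c c0 hc] := finite_lbound (fun v => (hf v).1).
by exists c => // v; apply: hP c0 (hc v) (hf v).2.
Qed.

Section FromExpandingMap.
Variables (R : realType) (A : finType) (B : {set A * A}) (r : \bar R) (g : expanding_map B r).
Hypothesis r1 : (1%:E < r)%E.

Definition edom (a c : A) : set R := `[lend g a c, rend g a c]%classic.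
Definition efun (a c : A) (t : R) : R := (emap g (a, t)).2.
Definition eder (a c : A) : R -> R := derive_in (edom a c) (efun a c).
(** The minimum of [1] and [r - 1]: the Hoelder exponent of the derivatives on the intervals
    [I(a, c)]. For [r >= 2] it comes from a bounded second derivative, otherwise from the fractional
    part of [Cr_in]. *)
Definition holder_exp : R := if (2%:E <= r)%E then 1 else fine r - 1.

Lemma holder_exp_gt0 : 0 < holder_exp.
Proof.
rewrite /holder_exp; case: ifP => // /negbT; rewrite -ltNge; move: r1.
by case: (r) => [x| |] //=; rewrite !lte_fin subr_gt0.
Qed.

Lemma edge_inverse a c : (a, c) \in B -> exists h : R -> R,
  (forall x, 0 <= x <= 1 -> lend g a c <= h x <= rend g a c /\ efun a c (h x) = x) /\
  (forall t, lend g a c <= t <= rend g a c -> 0 <= efun a c t <= 1 /\ h (efun a c t) = t).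
Proof.
move=> ac; have [h [him hinv _ _]] := expanding_diffeo g ac; exists h; split.
  move=> x hx; have : (`[0, 1]%classic : set R) x by apply/itv_mem.
  by rewrite -him => -[t Dt <-]; rewrite hinv //; split => //; apply/itv_mem.
move=> t ht; have Dt : edom a c t by apply/itv_mem.
split; last exact: hinv.
have : (`[0, 1]%classic : set R) (efun a c t) by rewrite -him; exists t.
by move=> /itv_mem.
Qed.

Lemma edge_Cn a c n : (a, c) \in B -> ((n%:R : R)%:E <= r)%E -> Cn_in (edom a c) n (efun a c).
Proof. by move=> ac nr; have [h [_ _ [hC _] _]] := expanding_diffeo g ac; apply: hC. Qed.

Lemma edge_hasd a c t : (a, c) \in B -> lend g a c <= t <= rend g a c ->
  hasd (edom a c) (efun a c) t (eder a c t).
Proof.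
move=> ac ht; have [h _] := edge_Cn (n := 1) ac (ltW r1).
by apply: derivable_in_hasd; apply: (h 0%N) => //; apply/itv_mem.
Qed.

Lemma edge_cont a c : (a, c) \in B -> cont_on (edom a c) (eder a c).
Proof. by move=> ac; have [_ h] := edge_Cn (n := 1) ac (ltW r1); apply: within_cont_on. Qed.

Lemma edge_le a c : (a, c) \in B -> lend g a c <= rend g a c.
Proof. by move=> ac; have [_ [h _]] := expanding_sub g ac. Qed.

Lemma edge_gt1 a c t : (a, c) \in B -> lend g a c <= t <= rend g a c -> 1 < `|eder a c t|.
Proof. by move=> ac ht; apply: expanding_gt1 => //; rewrite in_itv. Qed.

Lemma edge_hasd2 a c t : (a, c) \in B -> (2%:E <= r)%E -> lend g a c <= t <= rend g a c ->
  hasd (edom a c) (eder a c) t (derive_in (edom a c) (eder a c) t).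
Proof.
move=> ac r2 ht; have [h _] := edge_Cn (n := 2) ac r2.
by apply: derivable_in_hasd; apply: (h 1%N) => //; apply/itv_mem.
Qed.

Lemma edge_cont2 a c : (a, c) \in B -> (2%:E <= r)%E ->
  cont_on (edom a c) (derive_in (edom a c) (eder a c)).
Proof. by move=> ac r2; have [_ h] := edge_Cn (n := 2) ac r2; apply: within_cont_on. Qed.

Lemma edge_holder a c : (a, c) \in B -> exists H, forall x y,
  lend g a c <= x <= rend g a c -> lend g a c <= y <= rend g a c ->
  `|eder a c x - eder a c y| <= H * `|x - y| `^ holder_exp.
Proof.
move=> ac; rewrite /holder_exp; case: ifP => [r2|/negbT].
  have [M hM] := cont_on_bounded (edge_le ac) (edge_cont2 ac r2).
  exists M => x y hx hy; rewrite powRr1 //.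
  have [t ht ->] := hasd_mvt_sym (fun t => edge_hasd2 ac r2 (t := t)) hy hx.
  by rewrite normrM ler_wpM2r // hM // (min_max_sub ht).
rewrite -ltNge => r2; have [h [_ _ [_ hC] _]] := expanding_diffeo g ac.
have rE : r = (fine r)%:E.
  by rewrite fineK // fin_real // (lt_trans _ r1) ?ltNyr //= (lt_trans r2) ?ltry.
have [||C hC'] := hC 1%N (fine r - 1).
- by move: r1 r2; rewrite rE !lte_fin /= => ? ?; lra.
- by rewrite [LHS]rE; congr (_%:E); rewrite /= addrC subrK.
by exists C => x y hx hy; apply: hC'; apply/itv_mem.
Qed.

(** All these estimates weaken as [c0] decreases, so the least of finitely many constants serves
    every edge. *)
Lemma edge_uniform : exists2 c0, 0 < c0 & forall a c, (a, c) \in B ->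
  (forall t, lend g a c <= t <= rend g a c -> 1 + c0 <= `|eder a c t| <= c0^-1) /\
  (forall x y, lend g a c <= x <= rend g a c -> lend g a c <= y <= rend g a c ->
    `|eder a c x - eder a c y| <= c0^-1 * `|x - y| `^ holder_exp).
Proof.
pose P (v : A * A) c0 := v \in B ->
  (forall t, lend g v.1 v.2 <= t <= rend g v.1 v.2 -> 1 + c0 <= `|eder v.1 v.2 t| <= c0^-1) /\
  (forall x y, lend g v.1 v.2 <= x <= rend g v.1 v.2 -> lend g v.1 v.2 <= y <= rend g v.1 v.2 ->
    `|eder v.1 v.2 x - eder v.1 v.2 y| <= c0^-1 * `|x - y| `^ holder_exp).
have [| |c0 c00 h] := @finite_uniform R _ P.
- move=> v c1 c2 c20 c21 h vB; have [h1 h2] := h vB.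
  have i12 : c1^-1 <= c2^-1 by rewrite lef_pV2 ?posrE // (lt_le_trans c20).
  split.
    move=> t ht; have /andP[a1 a2] := h1 t ht; rewrite (le_trans a2 i12) andbT.
    by apply: le_trans a1; rewrite lerD2l.
  by move=> x y hx hy; apply: le_trans (h2 x y hx hy) _; rewrite ler_wpM2r // powR_ge0.
- move=> [a c] /=; rewrite /P /=; have [ac|nac] := boolP ((a, c) \in B); last by exists 1.
  have cn : cont_on (edom a c) (fun t => `|eder a c t|).
    move=> x Dx e e0; have [d d0 hd] := edge_cont ac Dx e0; exists d => // y Dy yd.
    by apply: le_trans (ler_dist_dist _ _) _; apply: hd.
  have [t0 ht0 hmin] := cont_on_min (edge_le ac) cn.
  have [M hM] := cont_on_bounded (edge_le ac) (edge_cont ac).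
  have [H hH] := edge_holder ac.
  have m1 := edge_gt1 ac ht0.
  pose K := `|M| + `|H| + 1.
  have K0 : 0 < K by rewrite /K; have := normr_ge0 M; have := normr_ge0 H; lra.
  exists (Num.min (`|eder a c t0| - 1) K^-1).
    by rewrite lt_min subr_gt0 m1 invr_gt0.
  move=> _; have Kle : K <= (Num.min (`|eder a c t0| - 1) K^-1)^-1.
    rewrite -[leLHS]invrK lef_pV2 ?posrE ?invr_gt0 //; first by rewrite ge_min lexx orbT.
    by rewrite lt_min subr_gt0 m1 invr_gt0.
  split.
    move=> t ht; apply/andP; split.
      by apply: le_trans (hmin t ht); rewrite addrC -lerBrDr ge_min lexx.
    apply: le_trans (hM t ht) _; apply: le_trans Kle.
    by rewrite /K; have := ler_norm M; have := normr_ge0 H; lra.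
  move=> x y hx hy; apply: le_trans (hH x y hx hy) _; rewrite ler_wpM2r ?powR_ge0 //.
  by apply: le_trans Kle; rewrite /K; have := ler_norm H; have := normr_ge0 M; lra.
by exists c0 => // a c ac; apply: (h (a, c)).
Qed.

Lemma edge_gap : exists2 c0, 0 < c0 & forall a c c' x y, (a, c) \in B -> (a, c') \in B ->
  c != c' -> lend g a c <= x <= rend g a c -> lend g a c' <= y <= rend g a c' -> c0 <= `|x - y|.
Proof.
pose P (v : A * A * A) c0 := (v.1.1, v.1.2) \in B -> (v.1.1, v.2) \in B -> v.1.2 != v.2 ->
  forall x y, lend g v.1.1 v.1.2 <= x <= rend g v.1.1 v.1.2 ->
    lend g v.1.1 v.2 <= y <= rend g v.1.1 v.2 -> c0 <= `|x - y|.
have [| |c0 c00 h] := @finite_uniform R _ P.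
- by move=> v c1 c2 _ c21 h h1 h2 h3 x y hx hy; apply: le_trans c21 (h h1 h2 h3 x y hx hy).
- move=> [[a c] c']; rewrite /P /=.
  have [[ac [ac' cc']]|hn] := pselect ((a, c) \in B /\ (a, c') \in B /\ c != c'); last first.
    by exists 1 => // h1 h2 h3; case: hn.
  have dis := expanding_disj g ac ac' cc'; have le1 := edge_le ac; have le2 := edge_le ac'.
  have [h|h] := ltP (rend g a c) (lend g a c').
    exists (lend g a c' - rend g a c); first by rewrite subr_gt0.
    move=> _ _ _ x y /andP[x1 x2] /andP[y1 y2]; rewrite distrC ger0_norm; lra.
  have [h'|h'] := ltP (rend g a c') (lend g a c).
    exists (lend g a c - rend g a c'); first by rewrite subr_gt0.
    move=> _ _ _ x y /andP[x1 x2] /andP[y1 y2]; rewrite ger0_norm; lra.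
  exfalso; have : ((`[lend g a c, rend g a c] `&` `[lend g a c', rend g a c'])%classic : set R)
     (Num.max (lend g a c) (lend g a c')).
    by split; apply/itv_mem; rewrite ge_max le_max ?lexx ?orbT /= ?le1 ?le2 ?h ?h'.
  by rewrite dis.
by exists c0 => // a c c' x y ac ac' cc' hx hy; apply: (h (a, c, c')).
Qed.

Definition linked (b : branches R B) : Prop :=
  [/\ bal b = holder_exp,
   forall a c x, (a, c) \in B -> 0 <= x <= 1 ->
     lend g a c <= ibr b a c x <= rend g a c /\ efun a c (ibr b a c x) = x,
   forall a c t, (a, c) \in B -> lend g a c <= t <= rend g a c ->
     0 <= efun a c t <= 1 /\ ibr b a c (efun a c t) = t &
   forall a c x, ild b a c x = - ln `|eder a c (ibr b a c x)|].

Lemma expanding_branches : exists b : branches R B, linked b.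
Proof.
have hinv (v : A * A) : exists h : R -> R, v \in B ->
  (forall x, 0 <= x <= 1 -> lend g v.1 v.2 <= h x <= rend g v.1 v.2 /\ efun v.1 v.2 (h x) = x) /\
  (forall t, lend g v.1 v.2 <= t <= rend g v.1 v.2 -> 0 <= efun v.1 v.2 t <= 1 /\ h (efun v.1 v.2 t) = t).
  case: v => a c /=; have [ac|nac] := boolP ((a, c) \in B); last by exists id.
  by have [h hh] := edge_inverse ac; exists h.
have [hh hhP] := choice hinv.
have [c0 c00 hu] := edge_uniform; have [c1 c10 hg] := edge_gap.
pose h a c := hh (a, c).
have h1 a c x : (a, c) \in B -> 0 <= x <= 1 ->
  lend g a c <= h a c x <= rend g a c /\ efun a c (h a c x) = x.
  by move=> ac; have [+ _] := hhP _ ac; apply.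
have h2 a c t : (a, c) \in B -> lend g a c <= t <= rend g a c ->
     0 <= efun a c t <= 1 /\ h a c (efun a c t) = t.
  by move=> ac; have [_] := hhP _ ac; apply.
pose sg a c : R := if 0 < eder a c (lend g a c) then 1 else -1.
have sg1 a c : `|sg a c| = 1 by rewrite /sg; case: ifP; rewrite ?normrN normr1.
(* The mean value theorem for [efun] between two preimages: the inverse of the derivative at the
   intermediate point is the slope of the inverse branch, whose logarithm is the [r] of [dlog]. *)
have mv a c x y : (a, c) \in B -> 0 <= x <= 1 -> 0 <= y <= 1 -> exists t,
   [/\ lend g a c <= t <= rend g a c, `|t - h a c x| <= `|h a c y - h a c x|,
       `|t - h a c y| <= `|h a c y - h a c x| & y - x = eder a c t * (h a c y - h a c x)].
  move=> ac hx hy; have [x1 x2] := h1 a c x ac hx; have [y1 y2] := h1 a c y ac hy.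
  have [t ht e] := hasd_mvt_sym (fun t => edge_hasd ac (t := t)) x1 y1.
  exists t; split; first exact: (min_max_sub ht).
  - exact: min_max_dist.
  - by rewrite [leRHS]distrC; apply: min_max_dist; rewrite minC maxC.
  by rewrite -e x2 y2.
have lam0 : 0 < (1 + c0)^-1 by rewrite invr_gt0; lra.
have lam1 : (1 + c0)^-1 < 1 by rewrite invf_lt1; lra.
have C0 : 0 <= c0^-1 by rewrite invr_ge0 ltW.
have sube a c : (a, c) \in B -> 0 <= lend g a c /\ rend g a c <= 1.
  by move=> ac; have [? [_ ?]] := expanding_sub g ac.
have h01 a c x : (a, c) \in B -> 0 <= x <= 1 -> 0 <= h a c x <= 1.
  move=> ac hx; have [/andP[x1 x2] _] := h1 a c x ac hx; have [? ?] := sube a c ac.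
  by apply/andP; split; lra.
have hle a c x y : (a, c) \in B -> 0 <= x <= 1 -> 0 <= y <= 1 ->
  `|h a c x - h a c y| <= (1 + c0)^-1 * `|x - y|.
  move=> ac hx hy; have [t [t1 _ _ ->]] := mv a c y x ac hy hx.
  have [/(_ t t1) /andP[d1 _] _] := hu a c ac.
  by rewrite normrM ler_pdivlMl ?(lt_le_trans _ d1) //; [rewrite ler_wpM2r|lra].
have hge a c x y : (a, c) \in B -> 0 <= x <= 1 -> 0 <= y <= 1 ->
  c0 * `|x - y| <= `|h a c x - h a c y|.
  move=> ac hx hy; have [t [t1 _ _ ->]] := mv a c y x ac hy hx.
  have [/(_ t t1) /andP[_ d1] _] := hu a c ac.
  by rewrite normrM -ler_pdivlMl // ler_wpM2r.
have hdl a c : (a, c) \in B ->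
  dlog holder_exp c0^-1 (sg a c) (fun x => - ln `|eder a c (h a c x)|) (h a c).
  move=> ac x y hx hy; have [t [t1 t2 t3 e]] := mv a c x y ac hx hy.
  have [hd hH] := hu a c ac.
  have d1 u : lend g a c <= u <= rend g a c -> 1 <= `|eder a c u|.
    by move=> /hd /andP[+ _]; lra.
  have e0 : 0 < `|eder a c t| by have := d1 t t1; lra.
  have hyx : `|h a c y - h a c x| <= `|y - x|.
    apply: le_trans (hle a c y x ac hy hx) _; rewrite ler_piMl // ltW //.
  have bd u : lend g a c <= u <= rend g a c -> `|t - u| <= `|h a c y - h a c x| ->
      `| - ln `|eder a c t| - - ln `|eder a c u| | <= c0^-1 * `|y - x| `^ holder_exp.
    move=> hu' tu; rewrite -opprD normrN.
    apply: le_trans (ln_lip (d1 t t1) (d1 u hu')) _; apply: le_trans (ler_dist_dist _ _) _.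
    apply: le_trans (hH t u t1 hu') _; rewrite ler_wpM2l //.
    by rewrite ge0_ler_powR ?nnegrE // ?(ltW holder_exp_gt0) // (le_trans tu).
  exists (- ln `|eder a c t|); split.
  - rewrite e expRN lnK ?posrE //.
    (* The derivative does not vanish, so its sign on the whole interval is the one at the left
       end. *)
    have -> : eder a c t = sg a c * `|eder a c t|.
      have := cont_on_sign (edge_cont ac) _ t1 (y := lend g a c) _.
      rewrite /sg => <-; rewrite ?lexx ?edge_le //.
        case: ltP => h0; first by rewrite mul1r gtr0_norm.
        by rewrite mulN1r ler0_norm // opprK.
      by move=> u /d1 hu'; apply/eqP => z0; move: hu'; rewrite z0 normr0; lra.
    rewrite normrM sg1 mul1r normr_id.
    rewrite [RHS](_ : _ = (sg a c * sg a c) * (h a c y - h a c x)); last by field; rewrite gt_eqF.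
    by rewrite -expr2 -(real_normK (num_real _)) sg1 expr1n mul1r.
  - by apply: bd t2; case: (h1 a c x ac hx).
  by apply: bd t3; case: (h1 a c y ac hy).
have hgap a c c' x y : (a, c) \in B -> (a, c') \in B -> c != c' ->
    0 <= x <= 1 -> 0 <= y <= 1 -> c1 <= `|h a c x - h a c' y|.
  move=> ac ac' cc' hx hy; apply: (hg a c c') => //.
    by case: (h1 a c x ac hx).
  by case: (h1 a c' y ac' hy).
by exists (@Branches R A B h (fun a c x => - ln `|eder a c (h a c x)|) sg holder_exp c0^-1
  (1 + c0)^-1 c0 c1 holder_exp_gt0 C0 lam0 lam1 c00 c10 sg1 h01 hdl hle hge hgap).
Qed.

End FromExpandingMap.

(** * Cantor sets as sets of words *)

Lemma nested_intervals (R : realType) (l r : nat -> R) : (forall n, l n <= l n.+1) ->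
  (forall n, r n.+1 <= r n) -> (forall n, l n <= r n) -> exists t, forall n, l n <= t <= r n.
Proof.
move=> hl hr hlr.
have ml i j : (i <= j)%N -> l i <= l j.
  by move=> /subnK <-; elim: (j - i)%N => // k IH; apply: le_trans IH _; rewrite addSn.
have mr i j : (i <= j)%N -> r j <= r i.
  by move=> /subnK <-; elim: (j - i)%N => // k IH; apply: le_trans IH; rewrite addSn.
have ub i j : l i <= r j.
  apply: le_trans (ml _ _ (leq_addr j i)) _; apply: le_trans (hlr _) _.
  exact: mr (leq_addl i j).
exists (sup (range l)) => n; apply/andP; split.
  by apply: ub_le_sup; [exists (r 0%N) => _ [i _ <-]|exists n].
by apply: sup_le_ub => [|_ [i _ <-]]; [exists (l 0%N), 0%N|].
Qed.

Lemma geometric_limit (R : realType) (u : nat -> R) (K lam : R) : 0 <= K -> 0 < lam < 1 ->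
  (forall j, `|u j.+1 - u j| <= K * lam ^+ j) ->
  exists l, forall j, `|u j - l| <= K / (1 - lam) * lam ^+ j.
Proof.
move=> K0 /andP[l0 l1] hu; pose C := K / (1 - lam).
have lam1 : 0 < 1 - lam by rewrite subr_gt0.
have C0 : 0 <= C by rewrite divr_ge0 // ltW.
have CK : C * (1 - lam) = K by rewrite divfK // gt_eqF.
have st j : C * lam ^+ j = C * lam ^+ j.+1 + K * lam ^+ j by rewrite -CK exprS; ring.
have p0 j : 0 <= C * lam ^+ j by rewrite mulr_ge0 // exprn_ge0 // ltW.
have [| | |t ht] := @nested_intervals R (fun j => u j - C * lam ^+ j) (fun j => u j + C * lam ^+ j).
- by move=> j /=; have := hu j; have := st j; rewrite ler_norml => e /andP[h _]; lra.
- by move=> j /=; have := hu j; have := st j; rewrite ler_norml => e /andP[_ h]; lra.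
- by move=> j /=; have := p0 j; lra.
exists t => j; have /andP[h1 h2] := ht j; rewrite -/C ler_norml; apply/andP; split; lra.
Qed.

Section Symbolic.
Variables (A : finType) (B : {set A * A}).
Hypothesis hB : mixing_subshift B.

Lemma subshift_shift (x : full_shift A) (i : int) : subshift B x ->
  subshift B ((fun j => x (j + i)) : full_shift A).
Proof. by move=> h j; have := h (j + i); rewrite addrAC. Qed.

Lemma letter_pred c : exists a, (a, c) \in B.
Proof.
by have [x hx [i <-]] := hB.1 c; exists (x (i - 1)); have := hx (i - 1); rewrite subrK.
Qed.

Lemma open_letter (a : A) : open [set x : full_shift A | x 0 = a].
Proof.
have -> : [set x : full_shift A | x 0 = a] =
   (fun x : full_shift A => (x 0 : discrete_topology A)) @^-1` [set a] by [].
apply: open_comp; last exact: discrete_open.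
by move=> x _; apply: (@proj_continuous int (fun=> discrete_topology A) 0).
Qed.

Lemma subshift_path (x : full_shift A) n : subshift B x ->
  exists s, [/\ size s = n, adm B (x 0) s & last (x 0) s = x n%:Z].
Proof.
move=> hx; elim: n => [|n [s [h1 h2 h3]]]; first by exists [::].
exists (rcons s (x n.+1%:Z)); rewrite size_rcons h1 last_rcons; split => //.
rewrite /adm rcons_path -/(adm B (x 0) s) h2 h3 /=.
by have := hx n%:Z; rewrite -PoszD addn1.
Qed.

(** Mixing, applied to the open sets fixing the letter at time [0], gives words of every large
    length; the threshold is uniform since there are finitely many pairs of letters. *)
Lemma connecting_words : exists M, forall m a c, (M <= m)%N -> exists s : seq A,
  [/\ size s = m, adm B a s & last a s = c].
Proof.
have h1 (v : A * A) : exists M, forall m, (M <= m)%N -> exists s : seq A,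
    [/\ size s = m, adm B v.1 s & last v.1 s = v.2].
  case: v => a c /=.
  have ne d : (subshift B `&` [set x : full_shift A | x 0 = d]) !=set0.
    have [x hx [i xi]] := hB.1 d; exists ((fun j => x (j + i)) : full_shift A); split.
      exact: subshift_shift.
    by rewrite /= add0r.
  have [M hM] := hB.2 _ _ (open_letter a) (open_letter c) (ne a) (ne c).
  exists M => m /hM[x [[hx /= xa] xc]].
  have it n : iter n (@shift_map A) x = (fun j => x (j + n%:Z)) :> full_shift A.
    elim: n => [|n IH]; first by apply/funext => j; rewrite addr0.
    rewrite iterS IH; apply/funext => j; rewrite /shift_map; congr x.
    by rewrite -addrA -PoszD add1n.
  have [s [s1 s2 s3]] := subshift_path m hx.
  exists s; rewrite -xa; split => //; rewrite s3 -xc /= it /=.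
  by rewrite add0r.
have [f hf] := choice h1.
exists (\max_v f v) => m a c hm; apply: (hf (a, c)).
by apply: leq_trans hm; apply: leq_bigmax.
Qed.

End Symbolic.

Section Points.
Variables (R : realType) (A : finType) (B : {set A * A}) (b : branches R B).

(** Membership in [K] tested at each finite depth separately, which avoids infinite itineraries. It
    agrees with [cantor_of] by [cantor_Kpt] and [Kpt_cantor]. *)
Definition Kpt (a : A) (t : R) : Prop := forall q, exists s x,
  [/\ size s = q, adm B a s, 0 <= x <= 1 & t = hp b a s x].

Lemma Kpt01 a t : Kpt a t -> 0 <= t <= 1.
Proof. by move=> /(_ 0%N)[s [x [_ h hx ->]]]; apply: hp01. Qed.

Lemma hp_between a s t : adm B a s ->
  Num.min (hp b a s 0) (hp b a s 1) <= t <= Num.max (hp b a s 0) (hp b a s 1) ->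
  (forall a c t, (a, c) \in B ->
     Num.min (ibr b a c 0) (ibr b a c 1) <= t <= Num.max (ibr b a c 0) (ibr b a c 1) ->
     exists2 x, 0 <= x <= 1 & t = ibr b a c x) ->
  exists2 x, 0 <= x <= 1 & t = hp b a s x.
Proof.
move=> + + hon; elim: s a t => [|c s IH] a t /=.
  by move=> _; rewrite min_l ?max_r // => h; exists t.
move=> /andP[ac cs].
have m0 : 0 <= (0 : R) <= 1 by rewrite lexx ler01.
have m1 : 0 <= (1 : R) <= 1 by rewrite lexx ler01.
have u0 := hp01 b cs m0; have u1 := hp01 b cs m1.
have dk := ibr_dlog b ac; have e1 := isg1 b a c.
have mono x y : 0 <= x <= 1 -> 0 <= y <= 1 -> (0 < isg b a c * (ibr b a c y - ibr b a c x)) = (x < y).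
  move=> hx hy; have [r [-> _ _]] := dk x y hx hy.
  by rewrite !mulrA (sign_sqr e1) mul1r pmulr_rgt0 ?expR_gt0 // subr_gt0.
have sgE : isg b a c = 1 \/ isg b a c = -1.
  by move/eqP: e1; rewrite eqr_norml ler01 andbT => /orP[/eqP|/eqP] ->; [left|right].
have le2 x y : 0 <= x <= 1 -> 0 <= y <= 1 -> isg b a c * (ibr b a c y - ibr b a c x) <= 0 -> y <= x.
  by move=> hx hy h; rewrite leNgt -(mono x y) // -leNgt.
move=> ht; have [|x hx tx] := hon a c t ac.
  have bd z : 0 <= z <= 1 -> Num.min (ibr b a c 0) (ibr b a c 1) <= ibr b a c z <= Num.max (ibr b a c 0) (ibr b a c 1).
    move=> /andP[z0 z1]; have d0 := dlog_incr e1 dk (lexx 0) z0 z1.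
    have d1 := dlog_incr e1 dk z0 z1 (lexx 1).
    rewrite ge_min le_max; case: sgE d0 d1 => ->; rewrite ?mul1r ?mulN1r => d0 d1;
      apply/andP; split; apply/orP; [left|right|right|left]; lra.
  have /andP[b1 b2] := bd _ u0; have /andP[b3 b4] := bd _ u1.
  case/andP: ht => t1 t2; apply/andP; split.
    by apply: le_trans t1; rewrite le_min b1.
  by apply: le_trans t2 _; rewrite ge_max b2.
have [|y hy xy] := IH c x cs; last by exists y => //; rewrite tx xy.
move: ht; rewrite tx ge_min le_max ge_min le_max => /andP[/orP t1 /orP t2].
have q1 := le2 _ _ hx u0; have q2 := le2 _ _ hx u1; have q3 := le2 _ _ u0 hx; have q4 := le2 _ _ u1 hx.
clear - sgE q1 q2 q3 q4 t1 t2.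
by case: sgE q1 q2 q3 q4 => ->; rewrite ?mul1r ?mulN1r => q1 q2 q3 q4;
  case: t1 t2 => [t1|t1] [t2|t2]; apply/andP; split; apply/orP;
  solve [left; first [apply: q1; lra|apply: q3; lra]|right; first [apply: q2; lra|apply: q4; lra]
   |left; lra|right; lra].
Qed.

Lemma nested_words (p : nat -> seq A) a : (forall n, adm B a (p n)) ->
  (forall n, exists u, p n.+1 = p n ++ u) ->
  (forall a c t, (a, c) \in B ->
     Num.min (ibr b a c 0) (ibr b a c 1) <= t <= Num.max (ibr b a c 0) (ibr b a c 1) ->
     exists2 x, 0 <= x <= 1 & t = ibr b a c x) ->
  exists t, forall n, exists2 x, 0 <= x <= 1 & t = hp b a (p n) x.
Proof.
move=> hp1 hp2 hon.
have m0 : 0 <= (0 : R) <= 1 by rewrite lexx ler01.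
have m1 : 0 <= (1 : R) <= 1 by rewrite lexx ler01.
pose l n := Num.min (hp b a (p n) 0) (hp b a (p n) 1).
pose r n := Num.max (hp b a (p n) 0) (hp b a (p n) 1).
have inside n z : 0 <= z <= 1 -> l n <= hp b a (p n) z <= r n.
  move=> /andP[z0 z1]; have dk := dlog_hp b (hp1 n); have e1 := sp1 b a (p n).
  have d0 := dlog_incr e1 dk (lexx 0) z0 z1; have d1 := dlog_incr e1 dk z0 z1 (lexx 1).
  have sgE : sp b a (p n) = 1 \/ sp b a (p n) = -1.
    by move/eqP: e1; rewrite eqr_norml ler01 andbT => /orP[/eqP|/eqP] ->; [left|right].
  rewrite /l /r ge_min le_max; case: sgE d0 d1 => ->; rewrite ?mul1r ?mulN1r => d0 d1;
    apply/andP; split; apply/orP; [left|right|right|left]; lra.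
have step n : l n <= l n.+1 /\ r n.+1 <= r n.
  have [u pu] := hp2 n; have := hp1 n.+1; rewrite pu adm_cat => /andP[_ au].
  have /andP[a1 a2] := inside n _ (hp01 b au m0); have /andP[a3 a4] := inside n _ (hp01 b au m1).
  by rewrite {2}/l {1}/r pu !hp_cat le_min ge_max a1 a2 a3 a4.
have [| | |t ht] := @nested_intervals R l r.
- by move=> n; case: (step n).
- by move=> n; case: (step n).
- by move=> n; have /andP[h1 h2] := inside n 0 m0; apply: le_trans h1 h2.
by exists t => n; apply: hp_between (ht n) hon.
Qed.

Lemma Kpt_of_words a t (p : nat -> seq A) : (forall n, adm B a (p n)) ->
  (forall n, (n <= size (p n))%N) -> (forall n, exists2 x, 0 <= x <= 1 & t = hp b a (p n) x) ->
  Kpt a t.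
Proof.
move=> h1 h2 h3 q; have [x hx tx] := h3 q.
have := h1 q; rewrite -(cat_take_drop q (p q)) adm_cat => /andP[a1 a2].
exists (take q (p q)), (hp b (last a (take q (p q))) (drop q (p q)) x); split => //.
- by rewrite size_takel.
- exact: hp01.
by rewrite -hp_cat cat_take_drop.
Qed.

End Points.

Section Link.
Variables (R : realType) (A : finType) (B : {set A * A}) (r : \bar R) (g : expanding_map B r).
Variables (b : branches R B).
Hypothesis lk : linked g b.

Lemma linked_onto a c t : (a, c) \in B ->
     Num.min (ibr b a c 0) (ibr b a c 1) <= t <= Num.max (ibr b a c 0) (ibr b a c 1) ->
     exists2 x, 0 <= x <= 1 & t = ibr b a c x.
Proof.
move=> ac; have [_ h1 h2 _] := lk.
have m0 : 0 <= (0 : R) <= 1 by rewrite lexx ler01.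
have m1 : 0 <= (1 : R) <= 1 by rewrite lexx ler01.
have [/andP[a1 a2] _] := h1 a c 0 ac m0; have [/andP[a3 a4] _] := h1 a c 1 ac m1.
move=> /andP[t1 t2].
have ht : lend g a c <= t <= rend g a c.
  by apply/andP; split; [apply: le_trans t1; rewrite le_min a1|apply: le_trans t2 _; rewrite ge_max a2].
by have [hx e] := h2 a c t ac ht; exists (efun g a c t).
Qed.

Lemma emap_ibr a c x : (a, c) \in B -> 0 <= x <= 1 -> emap g (a, ibr b a c x) = (c, x).
Proof.
move=> ac hx; have [_ h1 _ _] := lk; have [h2 h3] := h1 a c x ac hx.
have h4 := expanding_letter (e := g) ac (t := ibr b a c x); rewrite in_itv /= in h4.
by rewrite [LHS]surjective_pairing (h4 h2); congr pair.
Qed.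

Lemma cantor_Kpt a t : cantor_of g (a, t) -> Kpt b a t.
Proof.
have [_ h1 h2 _] := lk; move=> h q; elim: q a t h => [|q IH] a t h.
  have [c /= ac ht] := h 0%N I; exists [::], t; split => //.
  have [? [_ ?]] := expanding_sub g ac; move: ht; rewrite in_itv /= => /andP[? ?].
  by apply/andP; split; lra.
have [c /= ac ht] := h 0%N I; rewrite in_itv /= in ht.
have [hx e] := h2 a c t ac ht.
have [|s [x [s1 s2 s3 s4]]] := IH c (efun g a c t).
  move=> n _; have : expanding_dom g (iter n.+1 (emap g) (a, t)) := h n.+1 I.
  rewrite iterSr.
  by rewrite -{1}e (emap_ibr ac hx).
by exists (c :: s), x; rewrite /= s1 ac s2 -s4 e.
Qed.

Lemma Kpt_cantor a t : Kpt b a t -> cantor_of g (a, t).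
Proof.
have [_ h1 h2 _] := lk; move=> h n _; have [s [x [s1 s2 s3 s4]]] := h n.+1.
rewrite /preimage /= {h}; elim: n a t s s1 s2 s4 => [|n IH] a t [|c s] //= [s1] /andP[ac cs] s4.
  exists c => //=; rewrite in_itv /= s4; by case: (h1 a c _ ac (hp01 b cs s3)).
rewrite -/(iter n.+1 _ _) iterSr s4 (emap_ibr ac (hp01 b cs s3)); exact: IH s1 cs erefl.
Qed.

Lemma Kpt_image a c t : (a, c) \in B -> lend g a c <= t <= rend g a c ->
  cantor_of g (a, t) -> Kpt b c (efun g a c t).
Proof.
move=> ac ht h; have [_ h1 h2 _] := lk; have [hx e] := h2 a c t ac ht.
apply: cantor_Kpt => n _; have : expanding_dom g (iter n.+1 (emap g) (a, t)) := h n.+1 I.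
  rewrite iterSr.
by rewrite -{1}e (emap_ibr ac hx).
Qed.

End Link.

(** * Nonlinearity along pasts *)

Section Continuity.
Variables (R : realType).
Implicit Types (D E : set R) (f h : R -> R).

Lemma cont_on_comp D E f h : (forall y, D y -> E (h y)) -> cont_on D h -> cont_on E f ->
  cont_on D (f \o h).
Proof.
move=> DE ch cf x Dx e e0; have [d d0 hd] := cf (h x) (DE x Dx) e e0.
have [d' d'0 hd'] := ch x Dx (d / 2) ltac:(by rewrite divr_gt0).
exists d' => // y Dy yd; apply: hd; first exact: DE.
by apply: le_lt_trans (hd' y Dy yd) _; lra.
Qed.

Lemma cont_onD D f h : cont_on D f -> cont_on D h -> cont_on D (fun x => f x + h x).
Proof.
move=> cf ch x Dx e e0; have e2 : 0 < e / 2 by rewrite divr_gt0.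
have [d1 d10 h1] := cf x Dx _ e2; have [d2 d20 h2] := ch x Dx _ e2.
exists (Num.min d1 d2); first by rewrite lt_min d10.
move=> y Dy; rewrite lt_min => /andP[y1 y2]; have := h1 y Dy y1; have := h2 y Dy y2.
rewrite (_ : f y + h y - _ = (f y - f x) + (h y - h x)); last by ring.
by have := ler_normD (f y - f x) (h y - h x); lra.
Qed.

Lemma cont_onM D f h : cont_on D f -> cont_on D h -> cont_on D (fun x => f x * h x).
Proof.
move=> cf ch x Dx e e0; pose K := `|f x| + `|h x| + 1.
have K1 : 1 <= K by rewrite /K; have := normr_ge0 (f x); have := normr_ge0 (h x); lra.
have K0 : 0 < K by lra.
pose e1 := Num.min 1 (e / (2 * K)); have e10 : 0 < e1 by rewrite lt_min ltr01 divr_gt0 // mulr_gt0.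
have [d1 d10 h1] := cf x Dx _ e10; have [d2 d20 h2] := ch x Dx _ e10.
exists (Num.min d1 d2); first by rewrite lt_min d10.
move=> y Dy; rewrite lt_min => /andP[y1 y2]; have a1 := h1 y Dy y1; have a2 := h2 y Dy y2.
rewrite (_ : f y * h y - _ = (f y - f x) * h y + f x * (h y - h x)); last by ring.
apply: le_trans (ler_normD _ _) _; rewrite !normrM.
have hy : `|h y| <= K.
  rewrite (_ : h y = (h y - h x) + h x); last by ring.
  apply: le_trans (ler_normD _ _) _; have : e1 <= 1 by rewrite ge_min lexx.
  by rewrite /K; have := normr_ge0 (f x); lra.
have fK : `|f x| <= K by rewrite /K; have := normr_ge0 (h x); lra.
have ee : e1 * K <= e / 2.
  apply: le_trans (_ : e / (2 * K) * K <= _); first by rewrite ler_wpM2r ?(ltW K0) // ge_min lexx orbT.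
  by rewrite le_eqVlt; apply/orP; left; apply/eqP; field; rewrite gt_eqF.
have b1 : `|f y - f x| * `|h y| <= e1 * K by apply: ler_pM.
have b2 : `|f x| * `|h y - h x| <= K * e1 by apply: ler_pM.
by lra.
Qed.

Lemma cont_on_cst D (k : R) : cont_on D (fun=> k).
Proof. by move=> x Dx e e0; exists 1 => // y _ _; rewrite subrr normr0 ltW. Qed.

Lemma cont_onV D f : (forall x, D x -> 1 <= `|f x|) -> cont_on D f -> cont_on D (fun x => (f x)^-1).
Proof.
move=> f1 cf x Dx e e0; have [d d0 hd] := cf x Dx e e0; exists d => // y Dy yd.
have a1 := f1 x Dx; have a2 := f1 y Dy.
have n1 : f x != 0 by rewrite -normr_gt0; lra.
have n2 : f y != 0 by rewrite -normr_gt0; lra.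
rewrite (_ : _ - _ = - ((f y - f x) / (f x * f y))); last by field; rewrite n1 n2.
rewrite normrN normrM normfV normrM ler_pdivrMr ?mulr_gt0 ?normr_gt0 //.
apply: le_trans (hd y Dy yd) _; rewrite ler_peMr ?(ltW e0) //.
by rewrite -[leLHS]mulr1 ler_pM.
Qed.

Lemma eq_cont_on D f h : (forall x, D x -> f x = h x) -> cont_on D f -> cont_on D h.
Proof.
move=> fh cf x Dx e e0; have [d d0 hd] := cf x Dx e e0; exists d => // y Dy yd.
by rewrite -!fh //; apply: hd.
Qed.

Lemma hasd_lip D h x l lam : limit_pt D x -> hasd D h x l ->
  (forall y, D y -> `|h y - h x| <= lam * `|y - x|) -> `|l| <= lam.
Proof.
move=> lp hd hl; apply/ler_addgt0Pr => e e0; have [d d0 hde] := hd e e0.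
have [y Dy [yx yd]] := lp d d0; have n0 : 0 < `|y - x| by rewrite normr_gt0 subr_eq0.
rewrite -(ler_pM2r n0) mulrDl -normrM.
rewrite (_ : l * (y - x) = (h y - h x) - (h y - h x - l * (y - x))); last by ring.
by apply: le_trans (ler_normB _ _) _; apply: lerD; [apply: hl|apply: hde].
Qed.

Lemma itv_limit_pt (a c x : R) : a < c -> a <= x <= c -> limit_pt `[a, c] x.
Proof.
move=> ac /andP[ax xc] d d0; have [h|h] := ltP x c.
  exists (Num.min c (x + d / 2)).
    by apply/itv_mem; rewrite ge_min le_min lexx /=; apply/andP; split => //; apply/andP; split; lra.
  have lt1 : x < Num.min c (x + d / 2) by rewrite lt_min h /=; lra.
  rewrite gt_eqF //; split => //; rewrite ger0_norm ?subr_ge0 ?ltW //.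
  by have : Num.min c (x + d / 2) <= x + d / 2 by [rewrite ge_min lexx orbT]; lra.
exists (Num.max a (x - d / 2)).
  by apply/itv_mem; rewrite le_max ge_max lexx /=; apply/andP; split; lra.
have lt1 : Num.max a (x - d / 2) < x by rewrite gt_max; apply/andP; split; lra.
rewrite lt_eqF //; split => //; rewrite ltr0_norm ?subr_lt0 //.
by have : x - d / 2 <= Num.max a (x - d / 2) by [rewrite le_max lexx orbT]; lra.
Qed.

End Continuity.

Lemma mk_loop (A : finType) (B : {set A * A}) o n s : size s = n -> adm B o s -> last o s = o ->
  exists v : loop B o n, loop_word v = s.
Proof.
move=> /eqP sn as_ ls; have h : adm B o (Tuple sn) && (last o (Tuple sn) == o).
  by rewrite /= as_ ls eqxx.
by exists (exist _ (Tuple sn) h).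
Qed.

Lemma between_near (R : realType) (u w c x rho : R) : Num.min u w <= c <= Num.max u w ->
  `|u - x| < rho -> `|w - x| < rho -> `|c - x| < rho.
Proof.
rewrite ge_min le_max !ltr_norml => /andP[/orP h1 /orP h2] /andP[a1 a2] /andP[c1 c2].
by apply/andP; split; [case: h1|case: h2]; lra.
Qed.

Lemma length_room (M j v n : nat) : (M + j.+1 + v <= n)%N ->
  [/\ (M <= n - (j + v))%N, (M <= n - (j.+1 + v))%N, (n - (j + v) + (j + v) = n)%N &
      (n - (j.+1 + v) + (j.+1 + v) = n)%N].
Proof. by move=> h; split; lia. Qed.

Section Twist.
Variables (R : realType) (A : finType) (B : {set A * A}) (g : expanding_map B (2%:E : \bar R)).
Variables (b : branches R B).
Hypothesis lk : linked g b.
Hypothesis hB : mixing_subshift B.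

Let r1 : (1%:E < 2%:E :> \bar R)%E. Proof. by rewrite lte_fin ltr1n. Qed.
Let r2 : (2%:E <= 2%:E :> \bar R)%E. Proof. exact: lexx. Qed.

Let I01 : set R := `[0, 1]%classic.

Lemma bal1 : bal b = 1.
Proof. by have [-> _ _ _] := lk; rewrite /holder_exp lexx. Qed.

Definition eder2 (a c : A) : R -> R := derive_in (edom g a c) (eder g a c).
Definition idr (a c : A) (x : R) : R := (eder g a c (ibr b a c x))^-1.
(** The nonlinearity [h'' / h'] of the inverse branch [h], that is, the derivative of [ild a c],
    written through the derivatives of the expanding map at [h x]. *)
Definition nonlin (a c : A) (x : R) : R := - eder2 a c (ibr b a c x) * (idr a c x * idr a c x).

Lemma ibr_dom a c x : (a, c) \in B -> 0 <= x <= 1 -> lend g a c <= ibr b a c x <= rend g a c.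
Proof. by have [_ h _ _] := lk; move=> ac hx; case: (h a c x ac hx). Qed.

Lemma ibrK a c x : (a, c) \in B -> 0 <= x <= 1 -> efun g a c (ibr b a c x) = x.
Proof. by have [_ h _ _] := lk; move=> ac hx; case: (h a c x ac hx). Qed.

Lemma ibr_lt a c x y : (a, c) \in B -> 0 <= x <= 1 -> 0 <= y <= 1 ->
  `|ibr b a c y - ibr b a c x| <= `|y - x|.
Proof.
move=> ac hx hy; apply: le_trans (ibr_le b ac hy hx) _.
by rewrite ler_piMl // ltW // blam_lt1.
Qed.

Lemma ibr_hasd a c x : (a, c) \in B -> 0 <= x <= 1 -> hasd I01 (ibr b a c) x (idr a c x).
Proof.
move=> ac hx e e0; have [d d0 hd] := edge_hasd r1 ac (ibr_dom ac hx) e0.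
exists d => // y /itv_mem hy yd; have := hd (ibr b a c y).
rewrite !ibrK // => /(_ _ _) h; have {}h := h ((itv_mem _ _ _).2 (ibr_dom ac hy)).
have {}h := h (le_lt_trans (ibr_lt ac hx hy) yd).
have g1 := edge_gt1 ac (ibr_dom ac hx); have n0 : eder g a c (ibr b a c x) != 0 by rewrite -normr_gt0; lra.
rewrite /idr (_ : _ - _ - _ = - ((y - x - eder g a c (ibr b a c x) * (ibr b a c y - ibr b a c x)) / eder g a c (ibr b a c x))); last by field.
rewrite normrN normrM normfV ler_pdivrMr ?normr_gt0 //; apply: le_trans h _.
apply: le_trans (_ : e * `|y - x| <= _); first by rewrite ler_pM2l // ibr_lt.
by rewrite ler_peMr ?mulr_ge0 ?(ltW e0) // ltW.
Qed.

Lemma ild_hasd a c x : (a, c) \in B -> 0 <= x <= 1 -> hasd I01 (ild b a c) x (nonlin a c x).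
Proof.
move=> ac hx; have [_ _ _ hL] := lk.
pose s : R := Num.sg (eder g a c (lend g a c)).
have le_ := edge_le g ac; have l1 : lend g a c <= lend g a c <= rend g a c by rewrite lexx.
have nz t : lend g a c <= t <= rend g a c -> eder g a c t != 0.
  by move=> ht; rewrite -normr_gt0; have := edge_gt1 ac ht; lra.
have s0 : s != 0 by rewrite sgr_eq0 nz.
have abs t : lend g a c <= t <= rend g a c -> `|eder g a c t| = s * eder g a c t.
  move=> ht; have := cont_on_sign (edge_cont r1 ac) nz ht l1.
  rewrite /s; have [h|h] := ltP 0 (eder g a c (lend g a c)) => h'.
    by rewrite (gtr0_sg h) mul1r gtr0_norm.
  have h0 : eder g a c (lend g a c) < 0 by rewrite lt_neqAle nz.
  by rewrite (ltr0_sg h0) mulN1r ler0_norm // leNgt h'.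
have hu := ibr_dom ac hx; set u := ibr b a c x in hu.
have pos : 0 < s * eder g a c u by rewrite -abs // normr_gt0 nz.
have d1 : hasd (edom g a c) (fun t => s * eder g a c t) u (s * eder2 a c u).
  by apply: hasdZ; apply: edge_hasd2.
have d2 : hasd setT (@ln R) (s * eder g a c u) (s * eder g a c u)^-1.
  by apply: is_derive_hasd; apply: is_derive1_ln.
have Du : edom g a c u by apply/itv_mem.
have d3 := hasd_comp Du (fun _ _ => I) d1 d2.
have Dx : I01 x by apply/itv_mem.
have d4 := hasd_comp Dx _ (ibr_hasd ac hx) d3.
have {}d4 := hasdZ (-1) (d4 _).
rewrite (_ : nonlin a c x = -1 * ((s * eder g a c u)^-1 * (s * eder2 a c u) * idr a c x)); last first.
  by rewrite /nonlin /idr -/u; field; rewrite nz // s0.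
apply: eq_hasd (d4 _) => //.
  by move=> y /itv_mem hy /=; rewrite hL abs ?mulN1r //; apply: ibr_dom.
by move=> y /itv_mem hy; apply/itv_mem; apply: ibr_dom.
Qed.

Lemma ibr_cont a c : (a, c) \in B -> cont_on I01 (ibr b a c).
Proof.
by move=> ac; apply: (@hasd_cont_on _ _ _ (idr a c)) => x /itv_mem hx; apply: ibr_hasd.
Qed.

Lemma idr_cont a c : (a, c) \in B -> cont_on I01 (idr a c).
Proof.
move=> ac; apply: cont_onV.
  by move=> x /itv_mem hx; rewrite ltW // edge_gt1 // ibr_dom.
apply: cont_on_comp (ibr_cont ac) (edge_cont r1 ac).
by move=> x /itv_mem hx; apply/itv_mem; apply: ibr_dom.
Qed.

Lemma nonlin_cont a c : (a, c) \in B -> cont_on I01 (nonlin a c).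
Proof.
move=> ac; apply: cont_onM; last by apply: cont_onM; apply: idr_cont.
apply: (@eq_cont_on _ _ (fun x => -1 * eder2 a c (ibr b a c x))); first by move=> x _; rewrite mulN1r.
apply: cont_onM; first exact: cont_on_cst.
apply: cont_on_comp (ibr_cont ac) (edge_cont2 ac r2).
by move=> x /itv_mem hx; apply/itv_mem; apply: ibr_dom.
Qed.

Lemma idr_le a c x : (a, c) \in B -> 0 <= x <= 1 -> `|idr a c x| <= blam b.
Proof.
move=> ac hx; apply: (hasd_lip (itv_limit_pt ltr01 hx) (ibr_hasd ac hx)) => y /itv_mem hy.
exact: ibr_le.
Qed.

Lemma nonlin_bounded : exists2 K, 0 < K & forall a c x, (a, c) \in B -> 0 <= x <= 1 ->
  `|nonlin a c x| <= K.
Proof.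
pose P (v : A * A) k := v \in B -> forall x, 0 <= x <= 1 -> `|nonlin v.1 v.2 x| <= k^-1.
have [| |k k0 hk] := @finite_uniform R _ P.
- move=> v k k' k'0 k'k h vB x hx; apply: le_trans (h vB x hx) _.
  by rewrite lef_pV2 ?posrE // (lt_le_trans k'0).
- move=> [a c]; rewrite /P /=; have [ac|nac] := boolP ((a, c) \in B); last by exists 1.
  have [M hM] := cont_on_bounded ler01 (nonlin_cont ac).
  exists (`|M| + 1)^-1; first by rewrite invr_gt0 ltr_wpDl.
  by move=> _ x hx; rewrite invrK; apply: le_trans (hM x hx) _; have := ler_norm M; lra.
by exists k^-1 => [|a c x ac hx]; [rewrite invr_gt0|apply: (hk (a, c))].
Qed.

Variable pr : A -> A.
Hypothesis prB : forall c, (pr c, c) \in B.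

(** One past for each letter is fixed by the predecessor map [pr]. Along its last [j] letters,
    [past_nl] is the nonlinearity given by the chain rule. *)
Fixpoint past_start (j : nat) (a : A) : A := if j is j'.+1 then past_start j' (pr a) else a.
Fixpoint past_word (j : nat) (a : A) : seq A :=
  if j is j'.+1 then rcons (past_word j' (pr a)) a else [::].
Fixpoint past_nl (j : nat) (a : A) (x : R) : R :=
  if j is j'.+1 then past_nl j' (pr a) (ibr b (pr a) a x) * idr (pr a) a x + nonlin (pr a) a x else 0.

Lemma past_wordP j a : [/\ size (past_word j a) = j, adm B (past_start j a) (past_word j a) &
  last (past_start j a) (past_word j a) = a].
Proof.
elim: j a => [|j IH] a //=; have [h1 h2 h3] := IH (pr a).
by rewrite size_rcons h1 last_rcons /adm rcons_path h3 prB andbT.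
Qed.

Lemma Lp_rcons a s c x : Lp b a (rcons s c) x = Lp b a s (ibr b (last a s) c x) + ild b (last a s) c x.
Proof. by rewrite -cats1 Lp_cat /= addr0. Qed.

Lemma Lp_rcons_hasd a s c x l : (last a s, c) \in B -> 0 <= x <= 1 ->
  hasd I01 (Lp b a s) (ibr b (last a s) c x) l ->
  hasd I01 (Lp b a (rcons s c)) x (l * idr (last a s) c x + nonlin (last a s) c x).
Proof.
move=> ac hx hd; have Dx : I01 x by apply/itv_mem.
have im y : I01 y -> I01 (ibr b (last a s) c y).
  by move=> /itv_mem hy; apply/itv_mem; apply: ibr01.
have h := hasdD (hasd_comp Dx im (ibr_hasd ac hx) hd) (ild_hasd ac hx).
by apply: eq_hasd h => // y _; rewrite Lp_rcons.
Qed.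

Lemma past_hasd j a x : 0 <= x <= 1 ->
  hasd I01 (Lp b (past_start j a) (past_word j a)) x (past_nl j a x).
Proof.
elim: j a x => [|j IH] a x hx /=.
  by move=> e e0; exists 1 => // y _ _; rewrite mul0r !subr0 normr0 mulr_ge0 // ltW.
have [_ _ hl] := past_wordP j (pr a).
have := @Lp_rcons_hasd (past_start j (pr a)) (past_word j (pr a)) a x
   (past_nl j (pr a) (ibr b (pr a) a x)); rewrite hl; apply => //.
by apply: IH; apply: ibr01.
Qed.

Lemma past_cont j a : cont_on I01 (past_nl j a).
Proof.
elim: j a => [|j IH] a /=; first exact: cont_on_cst.
apply: cont_onD; last exact: nonlin_cont.
apply: cont_onM; last exact: idr_cont.
apply: (cont_on_comp _ (ibr_cont (prB a)) (IH (pr a))).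
by move=> y /itv_mem hy; apply/itv_mem; apply: ibr01.
Qed.

(* [N a] is the nonlinearity [h'' / h'] of [h = hp (past_start j a) (past_word j a)]
   in the limit of an infinite past. *)
Lemma past_limit : exists (N : A -> R -> R) (C : R), [/\ 0 <= C,
  forall j a x, 0 <= x <= 1 -> `|past_nl j a x - N a x| <= C * blam b ^+ j &
  forall a, cont_on I01 (N a)].
Proof.
have [K K0 hK] := nonlin_bounded; have l0 := blam_gt0 b; have l1 := blam_lt1 b.
(* The increments in [j] obey a recursion with factor [idr], which is at most [blam b] in absolute
   value. *)
have step j a x : 0 <= x <= 1 -> `|past_nl j.+1 a x - past_nl j a x| <= K * blam b ^+ j.
  elim: j a x => [|j IH] a x hx.
    by rewrite /= mul0r add0r subr0 mulr1; apply: hK.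
  have pS i : past_nl i.+1 a x = past_nl i (pr a) (ibr b (pr a) a x) * idr (pr a) a x + nonlin (pr a) a x by [].
  rewrite (pS j.+1) (pS j); set u := past_nl j.+1 (pr a) _; set w := past_nl j (pr a) _.
  rewrite (_ : _ - _ = (u - w) * idr (pr a) a x); last by ring.
  rewrite normrM exprSr mulrA; apply: ler_pM => //; last exact: idr_le.
  by apply: IH; apply: ibr01.
have lam01 : 0 < blam b < 1 by rewrite l0.
have hN (v : A * R) : exists l, 0 <= v.2 <= 1 -> forall j,
    `|past_nl j v.1 v.2 - l| <= K / (1 - blam b) * blam b ^+ j.
  case: v => a x /=; case: (boolP (0 <= x <= 1)) => hx; last by exists 0.
  have [l hl] := geometric_limit (ltW K0) lam01 (fun j => step j a x hx).
  by exists l.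
have [N hN'] := choice hN; pose C := K / (1 - blam b).
have C0 : 0 <= C by rewrite divr_ge0 ?(ltW K0) // subr_ge0 ltW.
exists (fun a x => N (a, x)), C; split => //.
  by move=> j a x hx; apply: (hN' (a, x)).
move=> a x Dx e e0; have e3 : 0 < e / 3 by rewrite divr_gt0.
have [j hj] := @expr_small R (blam b) (e / 3 / (C + 1)) lam01 ltac:(by rewrite divr_gt0 // ltr_wpDl).
have Cj : C * blam b ^+ j <= e / 3.
  have := hj j (leqnn j); rewrite ler_pdivlMr ?ltr_wpDl // => h; apply: le_trans h.
  by rewrite mulrC ler_wpM2l ?exprn_ge0 ?(ltW l0) // lerDl.
have [d d0 hd] := past_cont j a Dx e3; exists d => // y Dy yd.
have c1 := hd y Dy yd; have c2 := hN' (a, x) ((itv_mem _ _ _).1 Dx) j; have c3 := hN' (a, y) ((itv_mem _ _ _).1 Dy) j.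
rewrite (_ : N (a, y) - _ = (past_nl j a y - past_nl j a x) + (past_nl j a x - N (a, x)) - (past_nl j a y - N (a, y))); last by ring.
apply: le_trans (ler_normB _ _) _.
have := ler_normD (past_nl j a y - past_nl j a x) (past_nl j a x - N (a, x)).
by move: c2 c3; rewrite /= -/C; lra.
Qed.

(** The letter [a1] has two pasts: the chosen one, and the chosen past of [a0] followed by [a1]. If
    their nonlinearities differ at a point of [K], they differ with constant sign nearby. A common
    continuation that maps [[0, 1]] near that point turns this into a monotone difference of
    log-derivatives, and prefixes close both words to loops. *)
Lemma twist_words (N : A -> R -> R) (C : R) a0 a1 x0 o : 0 <= C ->
  (forall j a x, 0 <= x <= 1 -> `|past_nl j a x - N a x| <= C * blam b ^+ j) ->
  (forall a, cont_on I01 (N a)) ->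
  (a0, a1) \in B -> Kpt b a1 x0 ->
  N a1 x0 != N a0 (ibr b a0 a1 x0) * idr a0 a1 x0 + nonlin a0 a1 x0 ->
  exists2 eta, 0 < eta & exists n1, forall n, (n1 <= n)%N -> exists v1 v2 : loop B o n,
    forall x y, 0 <= x -> x <= y -> y <= 1 ->
    eta * (y - x) <= (Lp b o (loop_word v1) y - Lp b o (loop_word v1) x) -
                     (Lp b o (loop_word v2) y - Lp b o (loop_word v2) x).
Proof.
move=> C0 hN cN a01 Kx0 neq; have l0 := blam_gt0 b; have l1 := blam_lt1 b.
have lam01 : 0 < blam b < 1 by rewrite l0.
pose Dl x := N a1 x - (N a0 (ibr b a0 a1 x) * idr a0 a1 x + nonlin a0 a1 x).
have im y : I01 y -> I01 (ibr b a0 a1 y).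
  by move=> /itv_mem hy; apply/itv_mem; apply: ibr01.
have cD : cont_on I01 Dl.
  apply: (@eq_cont_on _ _ (fun x => N a1 x + -1 * ((N a0 \o ibr b a0 a1) x * idr a0 a1 x + nonlin a0 a1 x))).
    by move=> x _; rewrite mulN1r.
  apply: cont_onD => //; apply: cont_onM; first exact: cont_on_cst.
  apply: cont_onD; last exact: nonlin_cont.
  by apply: cont_onM; [apply: cont_on_comp im (ibr_cont a01) (cN a0)|apply: idr_cont].
have Dn0 : Dl x0 != 0 by rewrite subr_eq0.
have Ix0 : I01 x0 by apply/itv_mem; apply: Kpt01 Kx0.
(* Of the gap [4 * eta0], one part pays for continuity near [x0], one for cutting the pasts at depth
   [j], one for the closing prefixes; one part remains. *)
pose eta0 := `|Dl x0| / 4.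
have eta00 : 0 < eta0 by rewrite divr_gt0 // normr_gt0 subr_eq0.
have [rho rho0 hrho] := cD x0 Ix0 eta0 eta00.
have Cs0 := bCs_ge0 b.
have K0 : 0 < 2 * C + 4 * bCs b + 1 by rewrite ltr_wpDl // addr_ge0 // mulr_ge0.
have [j hj] := @expr_small R (blam b) (eta0 / (2 * C + 4 * bCs b + 1)) lam01 ltac:(by rewrite divr_gt0).
have lj0 : 0 <= blam b ^+ j by rewrite exprn_ge0 // ltW.
have {hj} hj : (2 * C + 4 * bCs b + 1) * blam b ^+ j <= eta0.
  by have := hj j (leqnn j); rewrite ler_pdivlMr // mulrC.
have hjC : 2 * (C * blam b ^+ j) <= eta0.
  have : 0 <= (4 * bCs b + 1) * blam b ^+ j by rewrite mulr_ge0 // addr_ge0 // mulr_ge0.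
  by lra.
have hjS : 4 * (bCs b * blam b ^+ j) <= eta0.
  have : 0 <= (2 * C + 1) * blam b ^+ j by rewrite mulr_ge0 // addr_ge0 // mulr_ge0.
  by lra.
pose W1 := past_word j a1; pose s1 := past_start j a1.
pose W2 := rcons (past_word j a0) a1; pose s2 := past_start j a0.
have [z1 ad1 la1] : [/\ size W1 = j, adm B s1 W1 & last s1 W1 = a1] := past_wordP j a1.
have [z2 ad2 la2] := past_wordP j a0.
have ad2' : adm B s2 W2 by rewrite /adm rcons_path -/(adm B s2 _) ad2 la2 a01.
have la2' : last s2 W2 = a1 by rewrite last_rcons.
pose Dj x := past_nl j a1 x - (past_nl j a0 (ibr b a0 a1 x) * idr a0 a1 x + nonlin a0 a1 x).
pose D x := Lp b s1 W1 x - Lp b s2 W2 x.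
have hD x : 0 <= x <= 1 -> hasd I01 D x (Dj x).
  move=> hx; have h2 := @Lp_rcons_hasd s2 (past_word j a0) a1 x (past_nl j a0 (ibr b a0 a1 x)).
  rewrite la2 in h2; have {}h2 := h2 a01 hx (past_hasd j a0 (ibr01 b a01 hx)).
  have := hasdD (past_hasd j a1 hx) (hasdZ (-1) h2); rewrite mulN1r.
  by apply: eq_hasd => [y _|]; [rewrite mulN1r|apply/itv_mem].
have near x : 0 <= x <= 1 -> `|x - x0| < rho -> `|Dj x - Dl x0| <= 2 * eta0.
  move=> hx xr; have k1 := hrho x ((itv_mem _ _ _).2 hx) xr.
  have k2 := hN j a1 x hx; have k3 := hN j a0 _ (ibr01 b a01 hx).
  have k4 := idr_le a01 hx.
  have k5 : `|(past_nl j a0 (ibr b a0 a1 x) - N a0 (ibr b a0 a1 x)) * idr a0 a1 x| <= C * blam b ^+ j.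
    rewrite normrM -[leRHS]mulr1; apply: ler_pM => //; apply: le_trans k4 _; exact: ltW.
  rewrite (_ : Dj x - Dl x0 = (Dl x - Dl x0) + ((past_nl j a1 x - N a1 x) -
     (past_nl j a0 (ibr b a0 a1 x) - N a0 (ibr b a0 a1 x)) * idr a0 a1 x)); last by rewrite /Dj /Dl; ring.
  apply: le_trans (ler_normD _ _) _.
  have := ler_normB (past_nl j a1 x - N a1 x) ((past_nl j a0 (ibr b a0 a1 x) - N a0 (ibr b a0 a1 x)) * idr a0 a1 x).
  by lra.
have [q hq] := @expr_small R (blam b) (rho / 2) lam01 ltac:(by rewrite divr_gt0).
have {hq} hq : blam b ^+ q < rho by have := hq q (leqnn q); lra.
have [v0 [t0 [v0s v0a t0I x0E]]] := Kx0 q.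
have [M hM] := connecting_words hB.
have [v1 [v1s v1a v1l]] := hM M (last a1 v0) o (leqnn M).
(* The prefix [v0] of an itinerary of [x0] maps [[0, 1]] near [x0], and [v1] leads back to [o]. *)
pose v := v0 ++ v1.
have va : adm B a1 v by rewrite adm_cat v0a.
have vl : last a1 v = o by rewrite last_cat.
have inJ x : 0 <= x <= 1 -> `|hp b a1 v x - x0| < rho.
  move=> hx; rewrite hp_cat x0E; apply: le_lt_trans (hp_le b v0a (hp01 b v1a hx) t0I) _.
  rewrite v0s; apply: le_lt_trans hq; rewrite ler_piMr ?exprn_ge0 ?(ltW l0) //.
  have /andP[p1 p2] := hp01 b v1a hx; case/andP: t0I => p3 p4.
  by rewrite ler_norml; apply/andP; split; clear - p1 p2 p3 p4; lra.
pose eta := eta0 * blmin b ^+ size v.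
have eta_gt0 : 0 < eta by rewrite mulr_gt0 // exprn_gt0 // blmin_gt0.
exists eta => //; exists (M + j.+1 + size v)%N => n hn.
(* The second past is one letter longer, so its closing prefix is one letter shorter and both loops
   have length [n]. *)
have [m1 m2 m3 m4] := length_room hn.
have [u1 [u1s u1a u1l]] := hM (n - (j + size v))%N o s1 m1.
have [u2 [u2s u2a u2l]] := hM (n - (j.+1 + size v))%N o s2 m2.
have [c1 c1E] : exists c : loop B o n, loop_word c = u1 ++ W1 ++ v.
  apply: mk_loop.
  - by rewrite size_cat u1s size_cat z1.
  - by rewrite adm_cat u1a u1l adm_cat ad1 la1 va.
  - by rewrite last_cat u1l last_cat la1 vl.
have [c2 c2E] : exists c : loop B o n, loop_word c = u2 ++ W2 ++ v.
  apply: mk_loop.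
  - by rewrite size_cat u2s size_cat size_rcons z2.
  - by rewrite adm_cat u2a u2l adm_cat ad2' la2' va.
  - by rewrite last_cat u2l last_cat la2' vl.
(* Sign of the gap times the orientation of [v]; if it is negative, the two loops exchange their
   roles at the end. *)
pose s := Num.sg (Dl x0) * sp b a1 v.
have main x y : 0 <= x -> x <= y -> y <= 1 -> eta * (y - x) <= s *
   ((Lp b o (loop_word c1) y - Lp b o (loop_word c1) x) -
    (Lp b o (loop_word c2) y - Lp b o (loop_word c2) x)).
  move=> x0' xy y1'; have hx : 0 <= x <= 1 by rewrite x0' (le_trans xy).
  have hy : 0 <= y <= 1 by rewrite (le_trans x0').
  pose u := hp b a1 v x; pose w := hp b a1 v y.
  have hu : 0 <= u <= 1 by apply: hp01.
  have hw : 0 <= w <= 1 by apply: hp01.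
  have e1 := sp1 b a1 v; have dv := dlog_hp b va.
  have nE : `|w - u| = sp b a1 v * (w - u) by apply: (dlog_norm e1 dv).
  have n0 : 0 <= sp b a1 v * (w - u) by rewrite -nE.
  have low : blmin b ^+ size v * (y - x) <= `|w - u|.
    by have := hp_ge b va hy hx; rewrite ger0_norm // subr_ge0.
  have [c hc cE] := hasd_mvt_sym hD hu hw.
  have cJ : `|c - x0| < rho by apply: between_near hc (inJ x hx) (inJ y hy).
  have Dc : 2 * eta0 <= Num.sg (Dl x0) * Dj c.
    have := near c (min_max_sub hc hu hw) cJ; rewrite ler_norml => /andP[n1 n2].
    have e4 : 4 * eta0 = `|Dl x0| by rewrite /eta0 mulrC divfK.
    have [p|p|p] := ltgtP 0 (Dl x0).
    - by rewrite (gtr0_sg p) mul1r; rewrite gtr0_norm // in e4; clear - n1 n2 e4; lra.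
    - by rewrite (ltr0_sg p) mulN1r; rewrite ltr0_norm // in e4; clear - n1 n2 e4; lra.
    - by move: eta00 e4; rewrite -p normr0; clear; lra.
  have B1 : 2 * eta0 * `|w - u| <= s * (D w - D u).
    rewrite cE /s (_ : Num.sg (Dl x0) * sp b a1 v * (Dj c * (w - u)) =
      (Num.sg (Dl x0) * Dj c) * (sp b a1 v * (w - u))); last by ring.
    by rewrite -nE ler_wpM2r.
  have sn : `|s| = 1 by rewrite normrM e1 mulr1 normr_sg Dn0.
  have small (uu WW : seq A) ss : adm B o uu -> adm B ss WW -> last o uu = ss -> last ss WW = a1 ->
     (j <= size WW)%N -> `|Lp b o uu (hp b ss WW w) - Lp b o uu (hp b ss WW u)| <= eta0 / 2 * `|w - u|.
    move=> auu aWW luu lWW jW; apply: le_trans (dlog_osc (dlog_hp b auu) (hp01 b aWW hu) (hp01 b aWW hw)) _.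
    rewrite bal1 powRr1 //.
    have q1 : `|hp b ss WW w - hp b ss WW u| <= blam b ^+ j * `|w - u|.
      apply: le_trans (hp_le b aWW hw hu) _; rewrite ler_wpM2r //.
      by rewrite ler_wiXn2l // ltW.
    apply: le_trans (_ : 2 * bCs b * (blam b ^+ j * `|w - u|) <= _).
      by rewrite ler_wpM2l // mulr_ge0.
    by rewrite mulrA ler_wpM2r //; lra.
  have S1 := small u1 W1 s1 u1a ad1 u1l la1 ltac:(by rewrite z1).
  have S2 := small u2 W2 s2 u2a ad2' u2l la2' ltac:(by rewrite size_rcons z2).
  have Lx1 z : Lp b o (loop_word c1) z = Lp b o u1 (hp b s1 W1 (hp b a1 v z)) + Lp b s1 W1 (hp b a1 v z) + Lp b a1 v z.
    by rewrite c1E Lp_cat u1l Lp_cat hp_cat la1 addrA.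
  have Lx2 z : Lp b o (loop_word c2) z = Lp b o u2 (hp b s2 W2 (hp b a1 v z)) + Lp b s2 W2 (hp b a1 v z) + Lp b a1 v z.
    by rewrite c2E Lp_cat u2l Lp_cat hp_cat la2' addrA.
  rewrite !Lx1 !Lx2 -/u -/w.
  set E1 := Lp b o u1 _ - Lp b o u1 _ in S1; set E2 := Lp b o u2 _ - Lp b o u2 _ in S2.
  rewrite [leRHS](_ : _ = s * (D w - D u) + s * (E1 - E2)); last by rewrite /D /E1 /E2; ring.
  have B2 : `|s * (E1 - E2)| <= eta0 * `|w - u|.
    by rewrite normrM sn mul1r; apply: le_trans (ler_normB _ _) _; clear - S1 S2; lra.
  have : eta * (y - x) <= eta0 * `|w - u| by rewrite /eta -mulrA ler_wpM2l // ltW.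
  by move: B2; rewrite ler_norml => /andP[B2 _]; clear - B1 B2; lra.
have sE : s = 1 \/ s = -1.
  have : `|s| = 1 by rewrite normrM sp1 mulr1 normr_sg Dn0.
  by move/eqP; rewrite eqr_norml ler01 andbT => /orP[/eqP|/eqP] ->; [left|right].
case: sE => sE; [exists c1, c2|exists c2, c1] => x y h1 h2 h3; apply: le_trans (main x y h1 h2 h3) _.
  by rewrite sE mul1r.
by rewrite sE mulN1r opprB.
Qed.

End Twist.

(** * Essentially affine Cantor sets *)

Section SmoothChanges.
Variable R : realType.
Let I01 : set R := `[0, 1]%classic.

Lemma primitive_exists (f : R -> R) : cont_on I01 f ->
  exists F : R -> R, forall x, 0 <= x <= 1 -> hasd I01 F x (f x).
Proof.
(* Composition with [clamp] extends [f] continuously to the line, so the fundamental theorem applies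
   at [0] and [1] as well. *)
move=> cf; pose fc x := f (clamp x).
have clampE (z : R) : 0 <= z <= 1 -> clamp z = z.
  by move=> /andP[x0 x1]; rewrite /clamp min_r // max_r.
have cfc : continuous fc.
  move=> x; apply/cvgrPdist_le => e e0.
  have [d d0 hd] := cf (clamp x) ((itv_mem _ _ _).2 (clamp01 x)) e e0.
  apply/nbhs_ballP; exists d => //= y; rewrite /ball /= distrC => yd.
  rewrite distrC; apply: hd; first by apply/itv_mem; apply: clamp01.
  exact: le_lt_trans (clamp_lip _ _) yd.
pose F (x : R) := (\int[@lebesgue_measure R]_(t in `[(-1)%R, x]) fc t)%R.
exists F => x hx; case/andP: (hx) => x0 x1.
have x2 : x < 2 by lra.
have int2 : (@lebesgue_measure R).-integrable `[(-1)%R, 2%R] (EFin \o fc).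
  apply: continuous_compact_integrable; first exact: segment_compact.
  by apply: continuous_subspaceT => y; apply: cfc.
have xm : -1 < x by lra.
have [d1 d2] := continuous_FTC1_closed x2 int2 xm (cfc x).
apply: is_derive_hasd; split => //.
by rewrite -derive1E d2 /fc clampE.
Qed.

Lemma hasdM (D : set R) f h x l m : D x -> hasd D f x l -> hasd D h x m ->
  hasd D (fun y => f y * h y) x (l * h x + f x * m).
Proof.
move=> Dx hf hh e e0; pose K := `|f x| + `|h x| + `|m| + 1.
have K0 : 0 < K by rewrite ltr_wpDl // !addr_ge0.
have e3 : 0 < e / (3 * K) by rewrite divr_gt0 // mulr_gt0.
have [d1 d10 h1] := hf _ e3; have [d2 d20 h2] := hh _ e3.
have l0 : 0 < `|l| + 1 by rewrite ltr_wpDl.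
have [d3 d30 h3] := hasd_cont hh (e := Num.min 1 (e / (3 * (`|l| + 1)))) ltac:(by rewrite lt_min ltr01 divr_gt0 // mulr_gt0).
exists (Num.min d1 (Num.min d2 d3)); first by rewrite !lt_min d10 d20.
move=> y Dy; rewrite !lt_min => /andP[y1 /andP[y2 y3]].
have a1 := h1 y Dy y1; have a2 := h2 y Dy y2; have := h3 y Dy y3; rewrite le_min => /andP[a3 a4].
rewrite (_ : _ - _ = (f y - f x - l * (y - x)) * h y + f x * (h y - h x - m * (y - x)) +
   l * (h y - h x) * (y - x)); last by ring.
apply: le_trans (ler_normD _ _) _; have := ler_normD ((f y - f x - l * (y - x)) * h y) (f x * (h y - h x - m * (y - x))).
rewrite !normrM.
have hy : `|h y| <= K.
  rewrite (_ : h y = (h y - h x) + h x); last by ring.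
  apply: le_trans (ler_normD _ _) _.
  by rewrite /K; have := normr_ge0 (f x); have := normr_ge0 m; lra.
have fK : `|f x| <= K by rewrite /K; have := normr_ge0 (h x); have := normr_ge0 m; lra.
have q0 := normr_ge0 (y - x).
have eK : e / (3 * K) * K = e / 3 by field; rewrite gt_eqF.
have b1 : `|f y - f x - l * (y - x)| * `|h y| <= e / 3 * `|y - x|.
  apply: le_trans (_ : (e / (3 * K) * `|y - x|) * K <= _); first by apply: ler_pM.
  by rewrite mulrAC eK.
have b2 : `|f x| * `|h y - h x - m * (y - x)| <= e / 3 * `|y - x|.
  apply: le_trans (_ : K * (e / (3 * K) * `|y - x|) <= _); first by apply: ler_pM.
  by rewrite mulrA [K * _]mulrC eK.
have b3 : `|l| * `|h y - h x| * `|y - x| <= e / 3 * `|y - x|.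
  rewrite ler_wpM2r //; apply: le_trans (_ : (`|l| + 1) * (e / (3 * (`|l| + 1))) <= _).
    by apply: ler_pM => //; rewrite lerDl.
  by rewrite le_eqVlt; apply/orP; left; apply/eqP; field; rewrite gt_eqF.
by lra.
Qed.

Lemma hasd_inverse (D : set R) (phi psi : R -> R) x l m : D x -> (forall y, D y -> psi (phi y) = y) ->
  0 < m -> (forall y, D y -> m * `|y - x| <= `|phi y - phi x|) -> hasd D phi x l -> l != 0 ->
  hasd (phi @` D) psi (phi x) l^-1.
Proof.
move=> Dx inv m0 hm hd l0 e e0; have ln : 0 < `|l| by rewrite normr_gt0.
have [d d0 hde] := hd (e * `|l| * m) ltac:(by rewrite !mulr_gt0).
exists (m * d); first by rewrite mulr_gt0.
move=> _ [y Dy <-] yd; rewrite !inv //.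
have yx : `|y - x| < d by have := le_lt_trans (hm y Dy) yd; rewrite ltr_pM2l.
rewrite (_ : _ - _ - _ = - ((phi y - phi x - l * (y - x)) / l)); last by field.
rewrite normrN normrM normfV ler_pdivrMr //; apply: le_trans (hde y Dy yx) _.
rewrite -!mulrA ler_pM2l // [leRHS]mulrC ler_pM2l //; exact: hm.
Qed.

Lemma limit_pt_image (D : set R) (phi : R -> R) x l m : limit_pt D x -> 0 < m ->
  (forall y, D y -> m * `|y - x| <= `|phi y - phi x|) -> hasd D phi x l ->
  limit_pt (phi @` D) (phi x).
Proof.
move=> lp m0 hm hd d d0; have [d' d'0 hd'] := hasd_cont hd (e := d / 2) ltac:(by rewrite divr_gt0).
have [y Dy [yx yd]] := lp d' d'0; exists (phi y); first by exists y.
split; last by apply: le_lt_trans (hd' y Dy yd) _; lra.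
rewrite -subr_eq0 -normr_gt0; apply: lt_le_trans (hm y Dy).
by rewrite mulr_gt0 // normr_gt0 subr_eq0.
Qed.

Lemma derive_in_congr (D : set R) f f1 : (forall x, D x -> limit_pt D x) ->
  (forall x, D x -> hasd D f x (f1 x)) -> forall x, D x -> derive_in D f x = f1 x.
Proof. by move=> lp h x Dx; have [_] := hasd_derive_in (lp x Dx) (h x Dx). Qed.

Lemma C2_in (D : set R) (f0 f1 f2 : R -> R) : (forall x, D x -> limit_pt D x) ->
  (forall x, D x -> hasd D f0 x (f1 x)) -> (forall x, D x -> hasd D f1 x (f2 x)) ->
  cont_on D f2 -> Cr_in D (2%:E) f0.
Proof.
move=> lp h0 h1 c2; have e1 := derive_in_congr lp h0.
have h1' x : D x -> hasd D (derive_in D f0) x (f2 x).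
  by move=> Dx; apply: (@eq_hasd _ _ f1) => // [y Dy|]; [rewrite e1|apply: h1].
have e2 := derive_in_congr lp h1'.
split=> [n|n s /andP[s0 s1] [es]].
  rewrite lee_fin ler_nat => n2; split.
    move=> k x kn Dx; have : (k < 2)%N by apply: leq_trans kn n2.
    case: k kn => [|[|//]] kn _; first by case: (hasd_derive_in (lp x Dx) (h0 x Dx)).
    by case: (hasd_derive_in (lp x Dx) (h1' x Dx)).
  apply: cont_on_within; case: n n2 => [|[|[|//]]] _.
  - exact: hasd_cont_on h0.
  - by apply: (@eq_cont_on _ _ f1) => [x Dx|]; [rewrite /= e1|apply: hasd_cont_on h1].
  by apply: (@eq_cont_on _ _ f2) => // x Dx; rewrite /= e2.
(* The Hoelder clause is void, since [2 = n + s] has no solution with [0 < s < 1]. *)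
exfalso; have : (1 < n)%N by rewrite -(ltr_nat R); lra.
by have : (n < 2)%N by [rewrite -(ltr_nat R); lra]; lia.
Qed.

End SmoothChanges.

Section EssentiallyAffine.
Variables (R : realType) (A : finType) (B : {set A * A}) (g : expanding_map B (2%:E : \bar R)).
Variable N : A -> R -> R.
Let I01 : set R := `[0, 1]%classic.
Hypothesis cN : forall a, cont_on I01 (N a).
Hypothesis rel : forall a0 a1 t, (a0, a1) \in B -> lend g a0 a1 <= t <= rend g a0 a1 ->
  cantor_of g (a0, t) ->
  N a1 (efun g a0 a1 t) * (eder g a0 a1 t * eder g a0 a1 t) = N a0 t * eder g a0 a1 t - eder2 g a0 a1 t.

Let r1 : (1%:E < 2%:E :> \bar R)%E. Proof. by rewrite lte_fin ltr1n. Qed.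
Let r2 : (2%:E <= 2%:E :> \bar R)%E. Proof. exact: lexx. Qed.

Lemma edge_lt a c : (a, c) \in B -> lend g a c < rend g a c.
Proof.
move=> ac; have [h [h1 _]] := edge_inverse g ac.
have [/andP[a1 a2] e0] := h1 0 ltac:(by rewrite lexx ler01).
have [/andP[a3 a4] e1] := h1 1 ltac:(by rewrite lexx ler01).
rewrite lt_neqAle edge_le // andbT; apply/eqP => E.
have : h 0 = h 1 by lra.
by move=> E'; move: e0; rewrite E' e1 => ?; lra.
Qed.

(* The change of coordinates on [I(a)] has derivative [exp (int N a)], so that its own
   nonlinearity [N a] cancels the one of [g] on the Cantor set. *)
Lemma affine_of_cohomology : essentially_affine g.
Proof.
have [F hF] := choice (fun a => primitive_exists (cN a)).
pose E a x := expR (F a x).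
have hE a x : 0 <= x <= 1 -> hasd I01 (E a) x (E a x * N a x).
  move=> hx; exact: (hasd_comp ((itv_mem _ _ _).2 hx) (fun _ _ => I) (hF a x hx)
    (is_derive_hasd setT (is_derive_expR (F a x)))).
pose G a x := expR (- F a x).
have hG a x : 0 <= x <= 1 -> hasd I01 (G a) x (G a x * - N a x).
  move=> hx; have hN : hasd I01 (fun x => - F a x) x (- N a x).
    rewrite -mulN1r; apply: (@eq_hasd _ _ (fun x => -1 * F a x)) => [y _||].
    - by rewrite mulN1r.
    - by apply/itv_mem.
    by apply: hasdZ; apply: hF.
  exact: (hasd_comp ((itv_mem _ _ _).2 hx) (fun _ _ => I) hN
    (is_derive_hasd setT (is_derive_expR (- F a x)))).
have cE a : cont_on I01 (E a) by apply: hasd_cont_on => x /itv_mem; apply: hE.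
have cG a : cont_on I01 (G a) by apply: hasd_cont_on => x /itv_mem; apply: hG.
have [phi hphi] := choice (fun a => primitive_exists (cE a)).
have GE a x : (E a x)^-1 = G a x by rewrite /E /G expRN.
have E0 a x : E a x != 0 by rewrite gt_eqF // expR_gt0.
have bi a : exists2 m, 0 < m & forall x y, 0 <= x <= 1 -> 0 <= y <= 1 ->
    m * `|y - x| <= `|phi a y - phi a x|.
  have [c hc hmin] := cont_on_min ler01 (cE a).
  exists (E a c) => [|x y hx hy]; first exact: expR_gt0.
  have [z hz ->] := hasd_mvt_sym (hphi a) hx hy.
  rewrite normrM ler_wpM2r // ger0_norm ?expR_ge0 // hmin //.
  exact: min_max_sub hz hx hy.
(* The inverse of [phi] is first chosen pointwise; its smoothness follows from the lower bound [bi]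
   on the expansion of [phi]. *)
have hpsi (v : A * R) : exists x, (exists2 x', 0 <= x' <= 1 & phi v.1 x' = v.2) ->
    0 <= x <= 1 /\ phi v.1 x = v.2.
  have [[x' h1 h2]|nh] := pselect (exists2 x', 0 <= x' <= 1 & phi v.1 x' = v.2).
    by exists x'.
  by exists 0 => h; case: nh.
have [ps hps] := choice hpsi; pose psi a u := ps (a, u).
have psiK a x : 0 <= x <= 1 -> psi a (phi a x) = x.
  move=> hx; have [h1 h2] := hps (a, phi a x) (ex_intro2 _ _ x hx erefl).
  have [m m0 hm] := bi a; have := hm x (psi a (phi a x)) hx h1.
  have h2' : phi a (psi a (phi a x)) = phi a x := h2.
  rewrite h2' subrr normr0 => h.
  by apply/eqP; rewrite -subr_eq0 -normr_le0 -(pmulr_rle0 _ m0).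
have lpI x : I01 x -> limit_pt I01 x by move=> /itv_mem; apply: itv_limit_pt.
pose V a := phi a @` I01.
have hpsiV a x : 0 <= x <= 1 -> hasd (V a) (psi a) (phi a x) (G a x).
  move=> hx; have [m m0 hm] := bi a; rewrite -GE.
  apply: (hasd_inverse ((itv_mem _ _ _).2 hx) _ m0 _ (hphi a x hx) (E0 a x)).
    by move=> y /itv_mem; apply: psiK.
  by move=> y /itv_mem; apply: hm.
have psiV a u : V a u -> I01 (psi a u).
  by move=> [x /itv_mem hx <-]; rewrite psiK //; apply/itv_mem.
exists phi, psi; split.
  move=> a; split => //.
  - by move=> x /itv_mem; apply: psiK.
  - apply: (@C2_in R I01 (phi a) (E a) (fun x => E a x * N a x)) => //.
    + by move=> x /itv_mem; apply: hphi.
    + by move=> x /itv_mem; apply: hE.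
    by apply: cont_onM.
  apply: (@C2_in R (V a) (psi a) (fun u => G a (psi a u))
     (fun u => G a (psi a u) * - N a (psi a u) * G a (psi a u))).
  - move=> _ [x /itv_mem hx <-]; have [m m0 hm] := bi a.
    apply: (limit_pt_image _ m0 _ (hphi a x hx)); first by apply: itv_limit_pt.
    by move=> y /itv_mem; apply: hm.
  - by move=> _ [x /itv_mem hx <-]; rewrite psiK //; apply: hpsiV.
  - move=> _ [x /itv_mem hx <-]; rewrite psiK //.
    have Vx : V a (phi a x) by exists x => //; apply/itv_mem.
    by apply: (hasd_comp Vx (psiV a) (hpsiV a x hx)); rewrite psiK //; apply: hG.
  have cpsi : cont_on (V a) (psi a).
    by move=> _ [x /itv_mem hx <-]; apply: hasd_cont (hpsiV a x hx).
  apply: (@eq_cont_on _ _ ((fun x => G a x * (-1 * N a x) * G a x) \o psi a)).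
    by move=> u _; rewrite /= mulN1r.
  apply: cont_on_comp (psiV a) cpsi _; apply: cont_onM => //; apply: cont_onM => //.
  by apply: cont_onM => //; apply: cont_on_cst.
move=> a0 a1 t ac; rewrite in_itv /= => ht Kt.
pose D := phi a0 @` (edom g a0 a1).
have subI t' : lend g a0 a1 <= t' <= rend g a0 a1 -> 0 <= t' <= 1.
  by have [? [_ ?]] := expanding_sub g ac; move=> /andP[? ?]; apply/andP; split; lra.
have fI t' : lend g a0 a1 <= t' <= rend g a0 a1 -> 0 <= efun g a0 a1 t' <= 1.
  by move=> ht'; have [h [_ h2]] := edge_inverse g ac; case: (h2 t' ht').
have DV : D `<=` V a0.
  by move=> _ [t' /itv_mem ht' <-]; exists t' => //; apply/itv_mem; apply: subI.
have [m m0 hm] := bi a0.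
have lpD u : D u -> limit_pt D u.
  move=> [t' /itv_mem ht' <-].
  apply: (limit_pt_image (l := E a0 t') _ m0); first by apply: itv_limit_pt => //; apply: edge_lt.
    by move=> y /itv_mem hy; apply: hm; apply: subI.
  apply: (@hasdW _ I01); last by apply: hphi; apply: subI.
  by move=> y /itv_mem hy; apply/itv_mem; apply: subI.
(* Derivative of the conjugated map, written in the original coordinate. *)
pose P s := E a1 (efun g a0 a1 s) * eder g a0 a1 s * G a0 s.
pose f0 x := phi a1 (emap g (a0, psi a0 x)).2.
have hpsiD t' : lend g a0 a1 <= t' <= rend g a0 a1 -> hasd D (psi a0) (phi a0 t') (G a0 t').
  by move=> ht'; apply: hasdW DV _; apply: hpsiV; apply: subI.
have psiD u : D u -> edom g a0 a1 (psi a0 u).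
  by move=> [t' /itv_mem ht' <-]; rewrite psiK ?subI //; apply/itv_mem.
have hf0 u : D u -> hasd D f0 u (P (psi a0 u)).
  move=> [t' /itv_mem ht' <-]; rewrite psiK ?subI //.
  have h1 : hasd (edom g a0 a1) (phi a1 \o efun g a0 a1) t' (E a1 (efun g a0 a1 t') * eder g a0 a1 t').
    apply: (hasd_comp ((itv_mem _ _ _).2 ht') _ (edge_hasd r1 ac ht') (hphi a1 _ (fI t' ht'))).
    by move=> y /itv_mem hy; apply/itv_mem; apply: fI.
  have Dt' : D (phi a0 t') by exists t' => //; apply/itv_mem.
  apply: (hasd_comp (f := phi a1 \o efun g a0 a1) Dt' psiD (hpsiD t' ht')).
  by rewrite psiK ?subI.
(* By the product rule, this derivative is a multiple of the defect in the cohomological equation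
   [rel], hence zero at points of the Cantor set. *)
have hP : hasd (edom g a0 a1) P t 0.
  have Dt : edom g a0 a1 t by apply/itv_mem.
  have h1 : hasd (edom g a0 a1) (fun s => E a1 (efun g a0 a1 s)) t
     (E a1 (efun g a0 a1 t) * N a1 (efun g a0 a1 t) * eder g a0 a1 t).
    apply: (hasd_comp Dt _ (edge_hasd r1 ac ht) (hE a1 _ (fI t ht))).
    by move=> y /itv_mem hy; apply/itv_mem; apply: fI.
  have h2 : hasd (edom g a0 a1) (G a0) t (G a0 t * - N a0 t).
    apply: (@hasdW _ I01); last by apply: hG; apply: subI.
    by move=> y /itv_mem hy; apply/itv_mem; apply: subI.
  have h3 := hasdM Dt (hasdM Dt h1 (edge_hasd2 ac r2 ht)) h2.
  have r := rel ac ht Kt.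
  set l := (X in hasd _ _ _ X) in h3; suff l0 : l = 0 by rewrite -l0.
  rewrite /l -/(eder2 g a0 a1 t).
  rewrite (_ : _ + _ = E a1 (efun g a0 a1 t) * G a0 t * (N a1 (efun g a0 a1 t) *
    (eder g a0 a1 t * eder g a0 a1 t) + eder2 g a0 a1 t - N a0 t * eder g a0 a1 t)); last by ring.
  by rewrite r; ring.
have Dphi : D (phi a0 t) by exists t => //; apply/itv_mem.
have hfin : hasd D (derive_in D f0) (phi a0 t) 0.
  apply: (@eq_hasd _ _ (P \o psi a0)) => //.
    by move=> u Du; rewrite /= (derive_in_congr lpD hf0).
  rewrite -[X in hasd _ _ _ X](mul0r (G a0 t)).
  apply: (hasd_comp Dphi psiD (hpsiD t ht)).
  by rewrite psiK ?subI.
by have [_] := hasd_derive_in (lpD _ Dphi) hfin.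
Qed.

End EssentiallyAffine.

Section TwistExists.
Variables (R : realType) (A : finType) (B : {set A * A}) (g : expanding_map B (2%:E : \bar R)).
Variables (b : branches R B).
Hypothesis lk : linked g b.
Hypothesis hB : mixing_subshift B.
Hypothesis hg : ~ essentially_affine g.

(** If there is no twist, [twist_words] forces the nonlinearities of the chosen pasts to satisfy an
    invariance equation at all points of [K]. Read through [g] it is the cohomological equation,
    whose solution linearises [g] on [K] to second order. *)
Lemma twist_exists o :
  exists2 eta, 0 < eta & exists n1, forall n, (n1 <= n)%N -> exists v1 v2 : loop B o n,
    forall x y, 0 <= x -> x <= y -> y <= 1 ->
    eta * (y - x) <= (Lp b o (loop_word v1) y - Lp b o (loop_word v1) x) -
                     (Lp b o (loop_word v2) y - Lp b o (loop_word v2) x).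
Proof.
have [pr prB] := choice (letter_pred hB).
have [N [C [C0 hN cN]]] := past_limit lk prB.
apply: contrapT => hno; apply: hg; apply: (affine_of_cohomology cN) => a0 a1 t ac ht Kt.
have [_ h1 h2 _] := lk; have [hx e] := h2 a0 a1 t ac ht.
have Kx := Kpt_image lk ac ht Kt.
have [h|h] := eqVneq (N a1 (efun g a0 a1 t)) (N a0 (ibr b a0 a1 (efun g a0 a1 t)) *
   idr g b a0 a1 (efun g a0 a1 t) + nonlin g b a0 a1 (efun g a0 a1 t)); last first.
  by exfalso; apply: hno; apply: (twist_words lk hB prB o C0 hN cN ac Kx h).
have n0 : eder g a0 a1 t != 0.
  have r1 : (1%:E < 2%:E :> \bar R)%E by rewrite lte_fin ltr1n.
  by rewrite -normr_gt0; have := edge_gt1 ac ht; lra.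
by rewrite h /nonlin /idr e; field.
Qed.

End TwistExists.

(** * Critical exponents of cylinder sums *)

Section SystemDimension.
Variables (R : realType) (s : system R) (k0 : R -> R) (E : set R).
Hypothesis ck0 : ctx s k0.
Hypothesis s0 : 0 < sdim s.
Hypothesis limit_in : forall p : nat -> seq (letter s), p 0%N = [::] ->
  (forall n, exists v, p n.+1 = rcons (p n) v) ->
  exists2 z, E z & forall n, exists2 x, 0 <= x <= 1 & z = descend (p n) k0 x.

Lemma weight_le_width (w : seq (letter s)) k : ctx s k ->
  weight (@wt _ s) w * width k `^ sdim s <= width (descend w k) `^ sdim s.
Proof.
elim: w k => [|v w IH] k ck; first by rewrite /weight big_nil mul1r.
rewrite /weight big_cons mulrAC mulrC; apply: le_trans (IH _ (ctx_step v ck)).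
by rewrite ler_wpM2l ?(ltW (weight_gt0 (@wt_gt0 _ s) w)) // wt_le.
Qed.

(** Mass distribution with the weights of words as masses: [wt_le] bounds a weight by a power of the
    width, and [ctx_gap] separates siblings in proportion to that width. *)
Lemma system_dim : ((sdim s)%:E <= HD E)%E.
Proof.
have w0 := width_gt0 ck0; have g0 := cgap_gt0 s.
have W0 w := weight_gt0 (@wt_gt0 _ s) w.
have Wr w v : weight (@wt _ s) (rcons w v) = weight (@wt _ s) w * wt v.
  by rewrite /weight -cats1 big_cat big_seq1.
apply: (@tree_dim R _ (fun w => [seq rcons w v | v <- enum (letter s)]) (fun=> True)
  (fun w => [set descend w k0 x | x in `[0, 1]%classic]) (weight (@wt _ s)) E (sdim s)
  ((cgap s * width k0)^-1 `^ sdim s) (cmax s `^ sdim s) [::]) => //.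
- exact: powR_ge0.
- by rewrite powR_ge0 powR_lt1 // (ltW (cmax_gt0 s)) cmax_lt1.
- by move=> w _; rewrite map_inj_uniq ?enum_uniq // => u v /rcons_inj[].
- move=> w _; rewrite big_map big_enum /= (eq_bigr (fun v => weight (@wt _ s) w * wt v)) => [|v _]; last exact: Wr.
  by rewrite -mulr_sumr wt_sum mulr1.
- move=> w w' _ /mapP[v _ ->]; rewrite Wr mulrC; apply: ler_wpM2r; first exact: ltW (W0 w).
  have := wt_le v ck0; have := width_le v ck0 => h1 h2.
  have p0 : 0 < width k0 `^ sdim s by rewrite powR_gt0.
  rewrite -(ler_pM2r p0); apply: le_trans h2 _; rewrite -powRM ?(ltW (cmax_gt0 s)) ?(ltW w0) //.
  by rewrite ge0_ler_powR ?nnegrE ?(ltW s0) ?mulr_ge0 ?(ltW (cmax_gt0 s)) ?(ltW w0) // normr_ge0.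
- move=> w w' _ /mapP[v _ ->] _ [x /itv_mem hx <-]; exists (br v x).
    by apply/itv_mem; apply: br01.
  by rewrite descend_rcons.
- move=> w w1 w2 x y _ /mapP[v1 _ ->] /mapP[v2 _ ->] v12 [x1 /itv_mem hx1 <-] [x2 /itv_mem hx2 <-].
  have v12' : v1 != v2 by apply: contraNN v12 => /eqP ->.
  rewrite !descend_rcons; have cw := ctx_descend w ck0.
  have h1 := ctx_gap cw v12' hx1 hx2; have h2 := weight_le_width w ck0.
  have p0 : 0 < width k0 `^ sdim s by rewrite powR_gt0.
  rewrite -(ler_pM2r p0); apply: le_trans h2 _.
  rewrite -!powRM ?mulr_ge0 ?invr_ge0 ?mulr_ge0 ?(ltW g0) ?(ltW w0) ?normr_ge0 //.
  rewrite ge0_ler_powR ?nnegrE ?(ltW s0) ?mulr_ge0 ?invr_ge0 ?mulr_ge0 ?(ltW g0) ?(ltW w0) ?normr_ge0 //.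
  rewrite mulrAC.
  by rewrite invfM mulfVK ?gt_eqF // -/(step v1 _) mulrC ler_pdivlMr // mulrC.
move=> p p0 hp; have [|z Ez hz] := limit_in p0.
  by move=> n; have [_ /mapP[v _ ->]] := hp n; exists v.
by exists z => // n; have [x hx ->] := hz n; exists x => //; apply/itv_mem.
Qed.

End SystemDimension.

(** * Sums over cylinders and the Hausdorff dimension *)

Section CylinderSums.
Variables (R : realType) (A : finType) (B : {set A * A}) (r : \bar R) (g : expanding_map B r).
Variables (b : branches R B).
Hypothesis lk : linked g b.
Hypothesis hB : mixing_subshift B.
Variable (pl : placement R A).

Let l0 := blam_gt0 b.
Let l1 := blam_lt1 b.
Let m0 : 0 <= (0 : R) <= 1. Proof. by rewrite lexx ler01. Qed.
Let m1 : 0 <= (1 : R) <= 1. Proof. by rewrite lexx ler01. Qed.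

Lemma width_hp_gt0 a w : adm B a w -> 0 < width (hp b a w).
Proof. by move=> aw; apply: dlog_width_gt0 (sp1 b a w) (dlog_hp b aw). Qed.

Lemma width_hp_le a w : adm B a w -> width (hp b a w) <= blam b ^+ size w.
Proof. by move=> aw; have := hp_le b aw m1 m0; rewrite subr0 normr1 mulr1. Qed.

Lemma width_hp_ge a w : adm B a w -> blmin b ^+ size w <= width (hp b a w).
Proof. by move=> aw; have := hp_ge b aw m1 m0; rewrite subr0 normr1 mulr1. Qed.

Lemma place_ctx a s : adm B a s -> bctx b (fun t => place pl (a, hp b a s t)).
Proof. by move=> h; exact: (bctx_affine (offset pl a) (scale_neq0 pl a) (bctx_hp b h)). Qed.

(** Loops with sum at least one form a system of exponent [s] whose limit points lie in [K]. *)
Lemma HD_ge_loop_sum o n s (s0 : 0 <= s) (hc : expR (4 * bCs b) * blam b ^+ n < 1) :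
  1 <= loop_sum b o n s -> (s%:E <= HD (regular_cantor g pl))%E.
Proof.
move=> hs; have [->|sn0] := eqVneq s 0; first exact: HD_ge0.
have sp0 : 0 < s by rewrite lt_neqAle eq_sym sn0.
have n0 : (0 < n)%N.
  rewrite lt0n; apply/eqP => e; move: hc; rewrite e expr0 mulr1; apply/negP; rewrite -leNgt.
  by rewrite -[leLHS]expR0 ler_expR mulr_ge0 // bCs_ge0.
pose S := cantor_system s0 hc hs.
apply: (@system_dim R S (fun t => place pl (o, t))) => //; first exact: (@place_ctx o [::]).
move=> p p0 hp1; have sz j : size (p j) = j.
  by elim: j => [|j IH]; [rewrite p0|have [v ->] := hp1 j; rewrite size_rcons IH].
have ad j : adm B o (spell (p j)) by case: (spell_adm (p j)).
have szs (w : seq (loop B o n)) : (size w <= size (spell w))%N.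
  elim: w => // v w IH; rewrite /spell /= size_cat loop_size -/(spell w).
  by rewrite -addn1 addnC; apply: leq_add.
have [||t ht] := @nested_words R A B b (fun j => spell (p j)) o ad.
- move=> j; have [v ->] := hp1 j; exists (loop_word v).
  by rewrite /spell map_rcons flatten_rcons.
- exact: (linked_onto lk).
have Kt : Kpt b o t.
  by apply: (@Kpt_of_words _ _ _ _ _ _ (fun j => spell (p j))) => // j; rewrite -{1}(sz j) szs.
exists (place pl (o, t)).
  by exists (o, t) => //; apply: (Kpt_cantor lk).
by move=> j; have [x hx tx] := ht j; exists x => //; rewrite descend_spell -tx.
Qed.

Definition wsum a m s : R := \sum_(w : m.-tuple A | adm B a w) width (hp b a w) `^ s.

Lemma wsum_ge0 a m s : 0 <= wsum a m s.
Proof. by apply: sumr_ge0 => w _; apply: powR_ge0. Qed.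

(** A word extends to a loop at [o] by [M] letters on each side, at the cost of a bounded factor in
    the width. It can be read off from the loop, so no loop is used twice, and word sums are
    dominated by loop sums. The finitely many short lengths are simply added to the bound. *)
Lemma wsum_bounded o s n0 : 0 <= s -> (forall n, (n0 <= n)%N -> loop_sum b o n s < 1) ->
  exists2 D, 0 < D & forall a m, wsum a m s <= D.
Proof.
move=> s0 hs; have [M hM] := connecting_words hB.
pose q := distortion b * (distortion b * (blmin b ^+ M * blmin b ^+ M)).
have d0 : 0 < distortion b by apply: expR_gt0.
have lm0 : 0 < blmin b ^+ M by rewrite exprn_gt0 // blmin_gt0.
have q0 : 0 < q by rewrite !mulr_gt0.
have big a m : (n0 <= m)%N -> wsum a m s <= (q `^ s)^-1.
  move=> hm; have [u [us ua ul]] := hM M o a (leqnn M).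
  have [v hv] := choice (fun c => hM M c o (leqnn M)).
  rewrite -[leRHS]mul1r ler_pdivlMr ?powR_gt0 //.
  have hn : (n0 <= M + (m + M))%N by apply: leq_trans hm _; rewrite addnCA leq_addr.
  apply: le_trans (ltW (hs _ hn)).
  pose G (c : loop B o (M + (m + M))) := (distortion b * width (hp b o (loop_word c))) `^ s.
  pose P (c : loop B o (M + (m + M))) (w : m.-tuple A) := take m (drop M (loop_word c)) == w :> seq A.
  rewrite /wsum mulr_suml.
  apply: le_trans (_ : \sum_(w : m.-tuple A | adm B a w) \sum_(c | P c w) G c <= _).
    apply: ler_sum => w aw; have [vs va vl] := hv (last a w).
    have [|||c cE] := @mk_loop A B o (M + (m + M)) (u ++ w ++ v (last a w)).
    - by rewrite !size_cat us vs size_tuple.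
    - by rewrite !adm_cat ua ul aw va.
    - by rewrite !last_cat ul vl.
    rewrite (bigD1 c) /=; last first.
      by rewrite /P cE drop_size_cat // take_size_cat ?size_tuple.
    rewrite -[leLHS]addr0 lerD ?sumr_ge0 // => [|c' _]; last exact: powR_ge0.
    have w0 := width_hp_gt0 aw.
    rewrite -powRM ?(ltW q0) ?(ltW w0) //.
    have qw : 0 <= width (hp b a w) * q by rewrite mulr_ge0 ?(ltW q0) ?(ltW w0).
    have dn : 0 <= distortion b * width (hp b o (loop_word c)).
      by rewrite mulr_ge0 ?(ltW d0) ?normr_ge0.
    apply: ge0_ler_powR => //.
    rewrite /q cE mulrC -!mulrA ler_pM2l //.
    have e1 : width (hp b o (u ++ w ++ v (last a w))) =
        `|hp b o u (hp b a w (hp b (last a w) (v (last a w)) 1)) - hp b o u (hp b a w (hp b (last a w) (v (last a w)) 0))|.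
      by rewrite /width !hp_cat ul.
    rewrite e1; have i1 := hp01 b va m1; have i0 := hp01 b va m0.
    apply: le_trans (hp_ge b ua (hp01 b aw i1) (hp01 b aw i0)); rewrite us.
    have /andP[h1 _] := bctx_distortion (bctx_hp b aw) i1 i0.
    have h2 := width_hp_ge va; rewrite vs in h2.
    rewrite [leLHS](_ : _ = blmin b ^+ M * (distortion b * width (hp b a w) * blmin b ^+ M)); last by ring.
    rewrite ler_pM2l //; apply: le_trans h1; rewrite ler_wpM2l // mulr_ge0 ?(ltW d0) ?(ltW w0) //.
  rewrite (exchange_big_dep xpredT) //=; apply: ler_sum => c _.
  have [/existsP[w /andP[aw Pw]]|nex] := boolP [exists w : m.-tuple A, adm B a w && P c w].
    rewrite (bigD1 w) ?aw //= big1 ?addr0 // => w' /andP[/andP[_ Pw'] ww'].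
    case/eqP: ww'; apply: val_inj; move: Pw Pw'; rewrite /P => /eqP h1 /eqP h2.
    by rewrite /= -h1 -h2.
  rewrite big_pred0 ?powR_ge0 // => w; apply: contraNF nex => h.
  by apply/existsP; exists w.
exists ((q `^ s)^-1 + \sum_(m < n0) \sum_a wsum a m s).
  by rewrite ltr_wpDr ?invr_gt0 ?powR_gt0 // !sumr_ge0 // => m _; apply: sumr_ge0 => a _; apply: wsum_ge0.
move=> a m; have [h|h] := leqP n0 m.
  apply: le_trans (big a m h) _; rewrite lerDl sumr_ge0 // => i _.
  by apply: sumr_ge0 => c _; apply: wsum_ge0.
apply: le_trans (_ : \sum_(m < n0) \sum_a wsum a m s <= _); last first.
  by rewrite lerDr invr_ge0 powR_ge0.
rewrite (bigD1 (Ordinal h)) //= (bigD1 a) //= -addrA lerDl.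
rewrite addr_ge0 ?sumr_ge0 // => [c _|i _]; first exact: wsum_ge0.
by apply: sumr_ge0 => c _; apply: wsum_ge0.
Qed.

Lemma wsum_powR a m s e : 0 <= s -> 0 < e -> wsum a m (s + e) <= (blam b ^+ m) `^ e * wsum a m s.
Proof.
move=> s0 e0; rewrite /wsum mulr_sumr; apply: ler_sum => w aw; have w0 := width_hp_gt0 aw.
rewrite powRD ?(gt_eqF w0) ?implybT // mulrC ler_wpM2r ?powR_ge0 //.
apply: ge0_ler_powR; rewrite ?nnegrE ?(ltW e0) ?(ltW w0) ?exprn_ge0 ?(ltW l0) //.
by have := width_hp_le aw; rewrite size_tuple.
Qed.

(** Covers by all cylinders of order [m]: the extra exponent [e] gains the factor
    [(blam b ^ m) ^ e], which beats the bounded sums. *)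
Lemma HD_le_wsum s D e : 0 <= s -> 0 < e -> (forall a m, wsum a m s <= D) ->
  (HD (regular_cantor g pl) <= (s + e)%:E)%E.
Proof.
move=> s0 e0 hD; have [L L0 hL] : exists2 L : R, 0 < L & forall a, `|scale pl a| <= L.
  have hs a : 0 < `|scale pl a|^-1 by rewrite invr_gt0 normr_gt0 scale_neq0.
  have [c c0 hc] := finite_lbound hs.
  exists c^-1; first by rewrite invr_gt0.
  by move=> a; rewrite -[leLHS]invrK lef_pV2 ?posrE ?invr_gt0 ?normr_gt0 ?scale_neq0.
have se0 : 0 <= s + e by rewrite addr_ge0 // ltW.
apply: HD_le_covers => // d eps d0 eps0.
have lam01 : 0 < blam b < 1 by rewrite l0.
have lame : 0 < blam b `^ e < 1 by rewrite powR_gt0 // powR_lt1 // (ltW l0).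
pose K := L `^ (s + e) * (#|A|%:R * `|D|) + 1.
have K0 : 0 < K by rewrite ltr_wpDl // mulr_ge0 ?powR_ge0 // mulr_ge0.
have [n1 h1] := @expr_small R _ (d / L) lam01 ltac:(by rewrite divr_gt0).
have [n2 h2] := @expr_small R _ (eps / K) lame ltac:(by rewrite divr_gt0).
pose m := (n1 + n2)%N.
have mL : L * blam b ^+ m <= d by rewrite mulrC -ler_pdivlMr // h1 // leq_addr.
pose cyl (v : A * m.-tuple A) : set R * R :=
  ((fun t => place pl (v.1, hp b v.1 v.2 t)) @` `[0, 1]%classic, L * width (hp b v.1 v.2)).
exists [seq cyl v | v <- enum [pred v : A * m.-tuple A | adm B v.1 v.2]]; split.
- move=> u /mapP[[a w]]; rewrite mem_enum inE /= => aw -> /=.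
  have w0 := width_hp_gt0 aw; split.
    rewrite mulr_ge0 ?(ltW L0) ?(ltW w0) //=; apply: le_trans mL; rewrite ler_pM2l //.
    by have := width_hp_le aw; rewrite size_tuple.
  move=> x y [t /itv_mem ht <-] [t' /itv_mem ht' <-].
  rewrite /place /= (_ : _ - _ = scale pl a * (hp b a w t - hp b a w t')); last by ring.
  rewrite normrM; apply: ler_pM => //.
  exact: (dlog_width (sp1 b a w) (dlog_hp b aw)).
- move=> _ [[a t] Kt <-]; have [q [x [sq aq hx tx]]] := cantor_Kpt lk Kt m.
  exists (cyl (a, Tuple (introT eqP sq))).
    by apply: map_f; rewrite mem_enum inE.
  by exists x; [apply/itv_mem|rewrite /= tx].
rewrite big_map big_enum /=.
rewrite (eq_bigr (fun v : A * m.-tuple A => L `^ (s + e) * width (hp b v.1 v.2) `^ (s + e))) => [|v _]; last first.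
  by rewrite (powRM _ (ltW L0) (normr_ge0 _)).
rewrite (eq_bigl (fun v : A * m.-tuple A => xpredT v.1 && adm B v.1 v.2)) => [|v]; last by rewrite inE.
rewrite -mulr_sumr -(pair_big_dep xpredT (fun a (w : m.-tuple A) => adm B a w)
   (fun a (w : m.-tuple A) => width (hp b a w) `^ (s + e))) /=.
have hb : \sum_a \sum_(w : m.-tuple A | adm B a w) width (hp b a w) `^ (s + e) <=
   #|A|%:R * (`|D| * (blam b `^ e) ^+ m).
  apply: le_trans (_ : \sum_(a : A) (`|D| * (blam b `^ e) ^+ m) <= _); last first.
    by rewrite sumr_const mulr_natl.
  apply: ler_sum => a _; apply: le_trans (wsum_powR a m s0 e0) _.
  rewrite (_ : (blam b ^+ m) `^ e = (blam b `^ e) ^+ m); last first.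
    by rewrite -powR_mulrn ?(ltW l0) // -powRrM mulrC powRrM powR_mulrn // powR_ge0.
  rewrite mulrC ler_wpM2r ?exprn_ge0 ?powR_ge0 //; apply: le_trans (hD a m) _; exact: ler_norm.
apply: le_trans (ler_wpM2l (powR_ge0 _ _) hb) _.
have := h2 m (leq_addl n1 n2); rewrite ler_pdivlMr // => h3; apply: le_trans h3.
rewrite /K mulrDr mulr1 !mulrA ler_wpDr ?exprn_ge0 ?powR_ge0 //.
by rewrite le_eqVlt; apply/orP; left; apply/eqP; ring.
Qed.

End CylinderSums.

Section CriticalSums.
Variables (R : realType) (A : finType) (B : {set A * A}) (r : \bar R) (g : expanding_map B r).
Variables (b : branches R B).
Hypothesis lk : linked g b.
Hypothesis hB : mixing_subshift B.
Variable (pl : placement R A).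

Lemma eventually_small (c e : R) : 0 < c -> 0 < e ->
  exists n0, forall n, (n0 <= n)%N -> c * blam b ^+ n < e.
Proof.
move=> c0 e0; have l01 : 0 < blam b < 1 by rewrite blam_gt0 blam_lt1.
have [n0 h] := @expr_small R _ (e / c / 2) l01 ltac:(by rewrite !divr_gt0).
exists n0 => n hn; apply: (@le_lt_trans _ _ (e / 2)).
  by rewrite mulrC -ler_pdivlMr // mulrAC h.
by rewrite ltr_pdivrMr // ltr_pMr // ltr1n.
Qed.

(** By contraposition: if loop sums stay below one, word sums are bounded and the dimension is at
    most [s]. The alternative [s = 0] covers sets of dimension zero, below which there is no
    exponent. *)
Lemma loop_sum_large o s : 0 <= s -> s = 0 \/ (s%:E < HD (regular_cantor g pl))%E ->
  forall n0, exists2 n, (n0 <= n)%N & 1 <= loop_sum b o n s.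
Proof.
move=> s0 + n0 => -[->|hs].
  have [M hM] := connecting_words hB; exists (n0 + M)%N; first exact: leq_addr.
  have [w [sw aw lw]] := hM (n0 + M)%N o o (leq_addl _ _).
  have [v _] := mk_loop sw aw lw.
  rewrite /loop_sum (bigD1 v) //= powRr0 lerDl sumr_ge0 // => i _; exact: powR_ge0.
apply: contrapT => hno; have [|D D0 hD] := @wsum_bounded R A B b hB o s n0 s0.
  move=> n hn; rewrite ltNge; apply/negP => h; apply: hno; by exists n.
have : (HD (regular_cantor g pl) <= s%:E)%E.
  apply: HD_le_lim => s' ss'; rewrite (_ : s' = s + (s' - s)); last by rewrite addrC subrK.
  by apply: (HD_le_wsum lk pl s0 _ hD); rewrite subr_gt0.
by rewrite leNgt hs.
Qed.

Lemma wsum_small s : (HD (regular_cantor g pl) < s%:E)%E ->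
  0 <= s /\ exists2 D, 0 < D & forall a m, wsum b a m s <= D.
Proof.
move=> hs; have s0 : 0 <= s.
  by rewrite -lee_fin; apply: le_trans (HD_ge0 _) (ltW hs).
split=> //; have [a0 _|no] := pickP (@predT A); last first.
  exists 1 => // a; by have := no a.
have [n0 h0] := @eventually_small (expR (4 * bCs b)) 1 (expR_gt0 _) ltr01.
apply: (@wsum_bounded R A B b hB a0 s n0 s0) => n hn.
rewrite ltNge; apply/negP => h; have := HD_ge_loop_sum lk pl s0 (h0 n hn) h.
by rewrite leNgt hs.
Qed.

End CriticalSums.

(** * Strict differentiability *)

Section StrictDifferentiability.
Variables (R : realType) (f : R * R -> R) (U : set (R * R)).
Hypothesis hU : open U.
Hypothesis hf : C1_on_open U f.
Let f1 := 'D_((1, 0) : R * R) f.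
Let f2 := 'D_((0, 1) : R * R) f.

Lemma partial_hasd D (z : R * R) : U z ->
  hasd D (fun t => f (t, z.2)) z.1 (f1 z) /\ hasd D (fun t => f (z.1, t)) z.2 (f2 z).
Proof.
move=> Uz; have [h1 _] := hf.
have d1 := @diff_derivable _ _ _ _ _ ((1, 0) : R * R) (h1 z Uz).
have d2 := @diff_derivable _ _ _ _ _ ((0, 1) : R * R) (h1 z Uz).
have E1 : (fun h : R => h^-1 *: (f (h *: ((1, 0) : R * R) + z) - f z)) =
          (fun h : R => h^-1 *: (f (h *: (1 : R) + z.1, z.2) - f (z.1, z.2))).
  apply/funext => h; rewrite -surjective_pairing; congr (_ *: (f _ - _)).
  by case: z {Uz d1 d2} => z1 z2; congr pair; rewrite /= scaler0 add0r.
have E2 : (fun h : R => h^-1 *: (f (h *: ((0, 1) : R * R) + z) - f z)) =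
          (fun h : R => h^-1 *: (f (z.1, h *: (1 : R) + z.2) - f (z.1, z.2))).
  apply/funext => h; rewrite -surjective_pairing; congr (_ *: (f _ - _)).
  by case: z {Uz d1 d2} E1 => z1 z2 _; congr pair; rewrite /= scaler0 add0r.
have e1 : cvg ((fun h : R => h^-1 *: (f (h *: ((1, 0) : R * R) + z) - f z)) @ 0^') := d1.
have e2 : cvg ((fun h : R => h^-1 *: (f (h *: ((0, 1) : R * R) + z) - f z)) @ 0^') := d2.
rewrite E1 in e1; rewrite E2 in e2.
split; apply: is_derive_hasd; split.
- exact: e1.
- rewrite /f1 /derive -[RHS]/(lim ((fun h : R => h^-1 *: (f (h *: ((1, 0) : R * R) + z) - f z)) @ 0^')).
  by rewrite E1.
- exact: e2.
rewrite /f2 /derive -[RHS]/(lim ((fun h : R => h^-1 *: (f (h *: ((0, 1) : R * R) + z) - f z)) @ 0^')).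
by rewrite E2.
Qed.

(** Two mean value steps, one along each axis through the corner [(y1, x2)], with partial
    derivatives within [eta] of those at [z]. *)
Lemma strict_differentiable z eta : U z -> 0 < eta -> exists2 rho, 0 < rho &
  forall x1 x2 y1 y2, `|x1 - z.1| <= rho -> `|x2 - z.2| <= rho ->
    `|y1 - z.1| <= rho -> `|y2 - z.2| <= rho ->
  `|f (x1, x2) - f (y1, y2) - (f1 z * (x1 - y1) + f2 z * (x2 - y2))| <=
    eta * (`|x1 - y1| + `|x2 - y2|).
Proof.
move=> Uz e0; have [_ hc] := hf.
have c1 := hc (1, 0) z Uz; have c2 := hc (0, 1) z Uz.
have : \forall y \near z, [/\ U y, `|f1 z - f1 y| <= eta & `|f2 z - f2 y| <= eta].
  have n1 : \forall y \near z, U y by exact: open_nbhs_nbhs.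
  move/cvgrPdist_le: c1 => /(_ eta e0) n2; move/cvgrPdist_le: c2 => /(_ eta e0) n3.
  by apply: filterS3 n1 n2 n3 => y.
move=> /nbhs_ballP[d /= d0 hd]; exists (d / 2); first by rewrite divr_gt0.
have d2 : d / 2 < d by rewrite ltr_pdivrMr // ltr_pMr // ltr1n.
have near_z u v : `|u - z.1| <= d / 2 -> `|v - z.2| <= d / 2 ->
    [/\ U (u, v), `|f1 z - f1 (u, v)| <= eta & `|f2 z - f2 (u, v)| <= eta].
  by move=> hu hv; apply: hd; split; rewrite /ball /= distrC; apply: le_lt_trans d2.
move=> x1 x2 y1 y2 hx1 hx2 hy1 hy2.
have mvt1 : exists2 c, `|f1 z - f1 (c, x2)| <= eta & f (x1, x2) - f (y1, x2) = f1 (c, x2) * (x1 - y1).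
  have [||| c] := @hasd_mvt_sym R (z.1 - d / 2) (z.1 + d / 2) y1 x1 (fun t => f (t, x2)) (fun t => f1 (t, x2)).
  - move=> t ht; have [Ut _ _] : [/\ U (t, x2), `|f1 z - f1 (t, x2)| <= eta & `|f2 z - f2 (t, x2)| <= eta].
      by apply: near_z => //; rewrite ler_distl.
    by have [] := partial_hasd `[z.1 - d / 2, z.1 + d / 2] Ut.
  - by rewrite -ler_distl.
  - by rewrite -ler_distl.
  move=> hcc e; exists c => //; have [] // := near_z c x2 _ hx2.
  move: hcc hx1 hy1; rewrite !ler_distl ge_min le_max => /andP[/orP[p1|p1] /orP[p2|p2]] /andP[p3 p4] /andP[p5 p6];
  by apply/andP; split; [apply: le_trans p1|apply: le_trans p2 _].
have mvt2 : exists2 c, `|f2 z - f2 (y1, c)| <= eta & f (y1, x2) - f (y1, y2) = f2 (y1, c) * (x2 - y2).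
  have [||| c] := @hasd_mvt_sym R (z.2 - d / 2) (z.2 + d / 2) y2 x2 (fun t => f (y1, t)) (fun t => f2 (y1, t)).
  - move=> t ht; have [Ut _ _] : [/\ U (y1, t), `|f1 z - f1 (y1, t)| <= eta & `|f2 z - f2 (y1, t)| <= eta].
      by apply: near_z => //; rewrite ler_distl.
    by have [] := partial_hasd `[z.2 - d / 2, z.2 + d / 2] Ut.
  - by rewrite -ler_distl.
  - by rewrite -ler_distl.
  move=> hcc e; exists c => //; have [] // := near_z y1 c hy1 _.
  move: hcc hx2 hy2; rewrite !ler_distl ge_min le_max => /andP[/orP[p1|p1] /orP[p2|p2]] /andP[p3 p4] /andP[p5 p6];
  by apply/andP; split; [apply: le_trans p1|apply: le_trans p2 _].
have [u hu e1] := mvt1; have [v hv e2] := mvt2.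
rewrite (_ : f (x1, x2) - f (y1, y2) - _ = - ((f1 z - f1 (u, x2)) * (x1 - y1) + (f2 z - f2 (y1, v)) * (x2 - y2))); last first.
  rewrite (_ : f (x1, x2) - f (y1, y2) = f1 (u, x2) * (x1 - y1) + f2 (y1, v) * (x2 - y2)); first by ring.
  by rewrite -e1 -e2; ring.
rewrite normrN [eta * _]mulrDr; apply: le_trans (ler_normD _ _) _.
by apply: lerD; rewrite normrM; apply: ler_wpM2r.
Qed.

Lemma locally_lipschitz z : U z -> exists L rho : R, [/\ 0 < L, 0 < rho &
  forall x1 x2 y1 y2, `|x1 - z.1| <= rho -> `|x2 - z.2| <= rho ->
    `|y1 - z.1| <= rho -> `|y2 - z.2| <= rho ->
  `|f (x1, x2) - f (y1, y2)| <= L * (`|x1 - y1| + `|x2 - y2|)].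
Proof.
move=> Uz; have [rho r0 h] := strict_differentiable Uz ltr01.
exists (1 + `|f1 z| + `|f2 z|), rho; split => //.
move=> x1 x2 y1 y2 hx1 hx2 hy1 hy2; have := h _ _ _ _ hx1 hx2 hy1 hy2; rewrite mul1r => h1.
rewrite (_ : f (x1, x2) - f (y1, y2) = (f (x1, x2) - f (y1, y2) -
  (f1 z * (x1 - y1) + f2 z * (x2 - y2))) + (f1 z * (x1 - y1) + f2 z * (x2 - y2))); last by ring.
apply: le_trans (ler_normD _ _) _; apply: le_trans (lerD h1 (ler_normD _ _)) _.
rewrite !normrM -subr_ge0 (_ : _ - _ = `|f1 z| * `|x2 - y2| + `|f2 z| * `|x1 - y1|); last by ring.
by rewrite addr_ge0 // mulr_ge0.
Qed.

End StrictDifferentiability.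

(** * The upper bound *)

Section Coverable.
Variable R : realType.

Definition coverable (s : R) (E : set R) : Prop :=
  forall d e : R, 0 < d -> 0 < e -> exists r : seq (set R * R),
    [/\ forall u, u \in r -> 0 <= u.2 <= d /\ forall x y, u.1 x -> u.1 y -> `|x - y| <= u.2,
        forall x, E x -> exists2 u, u \in r & u.1 x &
        \sum_(u <- r) u.2 `^ s <= e].

Lemma coverable_union (I : finType) s (E : set R) (F : I -> set R) :
  (forall x, E x -> exists i, F i x) -> (forall i, coverable s (F i)) -> coverable s E.
Proof.
move=> EF hF d e d0 e0.
have n0 : 0 < e / (#|I|%:R + 1) by rewrite divr_gt0 // ltr_wpDl.
have [r hr] := choice (fun i => hF i d _ d0 n0).
exists (flatten [seq r i | i <- enum I]); split.
- by move=> u /flatten_mapP[i _ ui]; have [h _ _] := hr i; apply: h.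
- move=> x /EF[i Fx]; have [_ h _] := hr i; have [u ui ux] := h x Fx.
  by exists u => //; apply/flatten_mapP; exists i; rewrite ?mem_enum.
rewrite big_flatten big_map big_enum /=.
apply: le_trans (_ : \sum_(i : I) e / (#|I|%:R + 1) <= _).
  by apply: ler_sum => i _; have [] := hr i.
rewrite sumr_const -[leLHS]mulr_natl mulrCA ger_pMr // ler_pdivrMr ?ltr_wpDl //.
by rewrite mul1r lerDl.
Qed.

Lemma coverable0 s : coverable s set0.
Proof. by move=> d e d0 e0; exists [::]; split => //; rewrite big_nil ltW. Qed.

Definition lip2 (L : R) (F : R -> R -> R) : Prop :=
  forall t t' u u', 0 <= t <= 1 -> 0 <= t' <= 1 -> 0 <= u <= 1 -> 0 <= u' <= 1 ->
    `|F t t' - F u u'| <= L * (`|t - u| + `|t' - u'|).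

Lemma coverable_lip_gt1 s L F : 1 < s -> 0 < L -> lip2 L F ->
  coverable s [set y | exists t t', [/\ 0 <= t <= 1, 0 <= t' <= 1 & y = F t t']].
Proof.
move=> s1 L0 hF d e d0 e0; have ps : 0 < s - 1 by rewrite subr_gt0.
have [q0 q00 hq] := @powR_small R (4 * L / e) (s - 1) ps.
pose q := Num.min d q0; have qp : 0 < q by rewrite lt_min d0.
have [N hN] : exists N : nat, 4 * L / q < N.+1%:R.
  by exists (Num.truncn (4 * L / q)); rewrite truncnS_gt.
have N0 : 0 < N.+1%:R :> R by [].
pose x := 4 * L / N.+1%:R; have x0 : 0 < x by rewrite !mulr_gt0 // invr_gt0.
have xq : x <= q.
  by move: hN; rewrite ltr_pdivrMr // => /ltW h; rewrite /x ler_pdivrMr // [leRHS]mulrC.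
pose al := F 0 0 - 2 * L.
exists [seq ([set y | al + i%:R * x <= y <= al + i.+1%:R * x], x) | i <- index_iota 0 N.+1]; split.
- move=> u /mapP[i _ ->] /=; split; first by rewrite (ltW x0) (le_trans xq) // ge_min lexx.
  move=> y z /andP[h1 h2] /andP[h3 h4]; move: h2 h4; rewrite -natr1 mulrDl mul1r => h2 h4.
  by rewrite ler_norml; apply/andP; split; lra.
- move=> _ [t [t' [ht ht' ->]]].
  have := hF t t' 0 0 ht ht'; rewrite !lexx !ler01 !subr0 => /(_ isT isT) h.
  have h2 : `|t| + `|t'| <= 2.
    by case/andP: ht => a1 a2; case/andP: ht' => a3 a4; rewrite !ger0_norm //; lra.
  have h3 := le_trans h (ler_wpM2l (ltW L0) h2); rewrite ler_distl in h3; case/andP: h3 => h3 h4.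
  have y0 : 0 <= F t t' - al by rewrite /al; lra.
  (* Only the right end [al + 4 * L] falls here. Truncation would assign it to a piece beyond the
     list, so it is put into the last one. *)
  have [|lt] := leP (al + N.+1%:R * x) (F t t').
    move=> hle; exists ([set y | al + N%:R * x <= y <= al + N.+1%:R * x], x).
      by apply/mapP; exists N => //; rewrite mem_index_iota leq0n ltnSn.
    rewrite /=; apply/andP; split.
      by apply: le_trans hle; rewrite lerD2l ler_pM2r // ler_nat.
    by rewrite /x mulrC mulfVK ?gt_eqF // /al; lra.
  pose i := Num.truncn ((F t t' - al) / x).
  have /andP[i1 i2] : i%:R <= (F t t' - al) / x < i.+1%:R.
    by rewrite truncn_itv // divr_ge0 // ltW.
  exists ([set y | al + i%:R * x <= y <= al + i.+1%:R * x], x).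
    apply/mapP; exists i => //; rewrite mem_index_iota leq0n /= -(ltr_nat R).
    by apply: le_lt_trans i1 _; rewrite ltr_pdivrMr // ltrBlDl.
  move: i1 i2; rewrite ler_pdivlMr // ltr_pdivrMr // => i1 i2.
  by rewrite /= -lerBrDl i1 -lerBlDl ltW.
rewrite big_map (eq_bigr (fun=> x `^ s)) // sumr_const_nat subn0 -[leLHS]mulr_natl.
rewrite (_ : x `^ s = x * x `^ (s - 1)); last first.
  by rewrite -{2}[x]powRr1 ?(ltW x0) // -powRD ?(gt_eqF x0) ?implybT // addrC subrK.
have := hq x; rewrite x0 (le_trans xq) ?ge_min ?lexx ?orbT // => /(_ isT).
rewrite mulrAC ler_pdivrMr // mul1r => h; apply: le_trans h.
by rewrite mulrA [_ * x]mulrC /x mulfVK ?gt_eqF.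
Qed.

(** With [p ^ 2 = q], one factor [p ^ n] absorbs the linear term by a Bernoulli inequality, and the
    other one tends to zero. *)
Lemma linear_geometric_small (q e : R) (c n0 : nat) : 0 < q < 1 -> 0 < e ->
  exists2 n, (n0 <= n)%N & (c * n).+1%:R * q ^+ n <= e.
Proof.
move=> /andP[q0 q1] e0; pose p := Num.sqrt q.
have p0 : 0 < p by rewrite sqrtr_gt0.
have p1 : p < 1 by rewrite -sqrtr1 ltr_sqrt.
have qE : q = p * p by rewrite -expr2 sqr_sqrtr // ltW.
pose K := c%:R * (1 - p)^-1 + 1.
have p10 : 0 < 1 - p by rewrite subr_gt0.
have K0 : 0 < K by rewrite ltr_wpDl // mulr_ge0 // invr_ge0 ltW.
have hK n : (c * n).+1%:R * p ^+ n <= K.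
  have bern : n%:R * ((1 - p) * p ^+ n) <= 1 - p ^+ n.
    elim: n => [|n IH]; first by rewrite mul0r expr0 subrr.
    have pn : 0 <= p ^+ n by rewrite exprn_ge0 // ltW.
    have h1 : n%:R * ((1 - p) * p ^+ n) * p <= n%:R * ((1 - p) * p ^+ n).
      have h0 : 0 <= n%:R * ((1 - p) * p ^+ n) by rewrite !mulr_ge0 ?(ltW p10).
      by rewrite -[leRHS]mulr1 ler_wpM2l // (ltW p1).
    have h2 : p ^+ n * p <= p ^+ n * 1 by rewrite ler_wpM2l // (ltW p1).
    rewrite exprSr -natr1; nra.
  have pn0 : 0 <= p ^+ n by rewrite exprn_ge0 // ltW.
  rewrite -natr1 mulrDl mul1r natrM; apply: lerD; last by rewrite exprn_ile1 ?(ltW p0) ?(ltW p1).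
  rewrite -mulrA ler_wpM2l // -[leRHS]mul1r ler_pdivlMr // mulrAC -mulrA.
  by apply: le_trans bern _; rewrite gerBl.
have [m hm] := @expr_small R p (e / K) ltac:(by rewrite p0) ltac:(by rewrite divr_gt0).
exists (n0 + m)%N; first exact: leq_addr.
have := hm (n0 + m)%N (leq_addl _ _); rewrite ler_pdivlMr // => h.
rewrite qE exprMn mulrA mulrC; apply: le_trans h; rewrite ler_wpM2l //.
by rewrite exprn_ge0 // ltW.
Qed.

End Coverable.

Section WordLists.
Variables (R : realType) (A : finType) (B : {set A * A}) (b : branches R B).

Definition wlist a j : seq (seq A) := [seq tval w | w <- enum [pred w : j.-tuple A | adm B a w]].

Lemma mem_wlist a j w : w \in wlist a j -> size w = j /\ adm B a w.
Proof. by move=> /mapP[v]; rewrite mem_enum inE => av ->; rewrite size_tuple. Qed.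

Lemma wlist_mem a j w : size w = j -> adm B a w -> w \in wlist a j.
Proof.
move=> /eqP sw aw; apply/mapP; exists (Tuple sw) => //; by rewrite mem_enum inE.
Qed.

Lemma sum_wlist a j (F : seq A -> R) :
  \sum_(w <- wlist a j) F w = \sum_(w : j.-tuple A | adm B a w) F w.
Proof. by rewrite /wlist big_map big_enum. Qed.

(* Without admissible edges [blmin b] is unconstrained, whence the minimum. *)
Definition drop_ratio : R := distortion b * Num.min 1 (blmin b).

Lemma drop_ratio_gt0 : 0 < drop_ratio.
Proof. by rewrite mulr_gt0 ?expR_gt0 // lt_min ltr01 blmin_gt0. Qed.

Lemma stop_prefix a q rho : rho <= 1 -> 0 < rho -> adm B a q -> width (hp b a q) <= rho ->
  exists2 j, (j <= size q)%N & drop_ratio * rho <= width (hp b a (take j q)) <= rho.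
Proof.
move=> r1 r0 aq hq; have m0 : 0 <= (0 : R) <= 1 by rewrite lexx ler01.
have m1 : 0 <= (1 : R) <= 1 by rewrite lexx ler01.
have d0 : 0 < distortion b by apply: expR_gt0.
have d1 : distortion b <= 1.
  by rewrite -expR0 ler_expR oppr_le0 mulr_ge0 // bCs_ge0.
have ex : exists j, width (hp b a (take j q)) <= rho by exists (size q); rewrite take_size.
have [j hj jmin] := ex_minnP ex.
have jq : (j <= size q)%N by apply: jmin; rewrite take_size.
exists j => //; rewrite hj andbT.
case: j hj jmin jq => [|i] hj jmin jq.
  have r1' : drop_ratio <= 1.
    rewrite -[leRHS]mul1r; apply: ler_pM; rewrite ?(ltW d0) // ?ge_min ?lexx //.
    by rewrite le_min ler01 (ltW (blmin_gt0 b)).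
  rewrite take0 /= /width subr0 normr1 -[leRHS]mul1r.
  by apply: ler_pM => //; apply: ltW => //; apply: drop_ratio_gt0.
have hi : rho <= width (hp b a (take i q)).
  by rewrite leNgt; apply/negP => /ltW /jmin; rewrite ltnn.
have : adm B a (take i q ++ drop i q) by rewrite cat_take_drop.
rewrite adm_cat (drop_nth a jq) /= => /andP[ai /andP[ac _]].
rewrite (take_nth a jq) -cats1; set c := nth a q i in ac *.
have /andP[h1 _] := bctx_distortion (bctx_hp b ai) (ibr01 b ac m1) (ibr01 b ac m0).
have h2 := ibr_ge b ac m1 m0; rewrite subr0 normr1 mulr1 in h2.
rewrite /width !hp_cat; apply: le_trans h1; rewrite /drop_ratio mulrAC.
apply: ler_pM; rewrite ?mulr_ge0 ?(ltW d0) ?(ltW r0) // ?le_min ?ler01 ?(ltW (blmin_gt0 b)) //.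
  by rewrite ler_pM2l.
by apply: le_trans h2; rewrite ge_min lexx orbT.
Qed.

End WordLists.

Section ProductCover.
Variables (R : realType) (A A' : finType) (B : {set A * A}) (B' : {set A' * A'}).
Variables (b : branches R B) (b' : branches R B').

(* A cylinder of the first Cantor set of length [rho] is paired with the cylinders of the
   second one of length comparable to [rho].  Their words have length at most linear in
   that of the first word, so there are [O(m * rho ^ (- s'))] of them. *)
Lemma coverable_lip_sum s s' e D D' L F a a' : 0 <= s -> 0 <= s' -> 0 < e -> 0 < L ->
  (forall c m, wsum b c m s <= D) -> (forall c m, wsum b' c m s' <= D') -> lip2 L F ->
  coverable (s + s' + e) [set y | exists t t', [/\ Kpt b a t, Kpt b' a' t' & y = F t t']].
Proof.
move=> s0 s0' e0 L0 hD hD' hF d eps d0 eps0.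
have D0 : 0 <= D := le_trans (wsum_ge0 b a 0 s) (hD a 0%N).
have D0' : 0 <= D' := le_trans (wsum_ge0 b' a' 0 s') (hD' a' 0%N).
have k0 := drop_ratio_gt0 b'; pose k := drop_ratio b'.
have l01 : 0 < blam b < 1 by rewrite blam_gt0 blam_lt1.
have l01' : 0 < blam b' < 1 by rewrite blam_gt0 blam_lt1.
have l0 : 0 <= blam b by case/andP: l01 => /ltW.
(* With this [c], a cylinder of order [c * m] of the second set is no longer than any cylinder of
   order [m] of the first. *)
have [c hc] := expr_small l01' (blmin_gt0 b).
have q01 : 0 < blam b `^ e < 1 by case/andP: (l01) => h1 h2; rewrite powR_gt0 //= powR_lt1 // (ltW h1).
pose T := D' * (k `^ s')^-1 * (2 * L) `^ (s + s' + e) * D + 1.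
have T0 : 0 < T by rewrite ltr_wpDl // !mulr_ge0 ?invr_ge0 ?powR_ge0.
have [n0 hn0] := @expr_small R _ (d / (2 * L)) l01 ltac:(by rewrite divr_gt0 // mulr_gt0).
have [m mn0 hm] := @linear_geometric_small R _ (eps / T) c n0 q01 ltac:(by rewrite divr_gt0).
pose stops rho j := [seq w <- wlist B' a' j | k * rho <= width (hp b' a' w) <= rho].
pose cell (w : seq A) (w' : seq A') : set R * R :=
  ([set F (hp b a w v.1) (hp b' a' w' v.2) | v in [set v : R * R | 0 <= v.1 <= 1 /\ 0 <= v.2 <= 1]],
   2 * L * width (hp b a w)).
pose row w := flatten [seq [seq cell w w' | w' <- stops (width (hp b a w)) j] | j <- index_iota 0 (c * m).+1].
exists (flatten [seq row w | w <- wlist B a m]); split.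
- move=> u /flatten_mapP[w /mem_wlist[sw aw] /flatten_mapP[j _ /mapP[w' + ->]]].
  rewrite mem_filter => /andP[/andP[_ ww] /mem_wlist[_ aw']]; have w0 := width_hp_gt0 b aw.
  split => /=.
    rewrite mulr_ge0 ?(ltW w0) ?mulr_ge0 ?(ltW L0) //= mulrC -ler_pdivlMr ?mulr_gt0 //.
    by apply: le_trans (width_hp_le b aw) _; rewrite sw; apply: hn0.
  move=> _ _ [[t t'] /= [ht ht'] <-] [[u1 u2] /= [hu hu'] <-].
  apply: le_trans (hF _ _ _ _ (hp01 b aw ht) (hp01 b' aw' ht') (hp01 b aw hu) (hp01 b' aw' hu')) _.
  rewrite [2 * L]mulrC -mulrA ler_pM2l // mulrDl mul1r; apply: lerD.
    exact: (dlog_width (sp1 b a w) (dlog_hp b aw)).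
  by apply: le_trans ww; apply: (dlog_width (sp1 b' a' w') (dlog_hp b' aw')).
- move=> _ [t [t' [Kt Kt' ->]]]; have [w [x [sw aw hx ->]]] := Kt m.
  have [q [x' [sq aq hx' ->]]] := Kt' (c * m)%N.
  have w0 := width_hp_gt0 b aw.
  have w1 : width (hp b a w) <= 1.
    apply: le_trans (width_hp_le b aw) _; by rewrite exprn_ile1 // ltW // blam_lt1.
  have wq : width (hp b' a' q) <= width (hp b a w).
    apply: le_trans (width_hp_le b' aq) _; apply: le_trans (width_hp_ge b aw).
    rewrite sq sw exprM; apply: lerXn2r; rewrite ?nnegrE ?exprn_ge0 ?(ltW (blmin_gt0 b)) //.
      by rewrite ltW // blam_gt0.
    exact: hc.
  have [j jq hj] := stop_prefix w1 w0 aq wq.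
  have : adm B' a' (take j q ++ drop j q) by rewrite cat_take_drop.
  rewrite adm_cat => /andP[a1 a2].
  exists (cell w (take j q)).
    apply/flatten_mapP; exists w; first exact: wlist_mem.
    apply/flatten_mapP; exists j; first by rewrite mem_index_iota leq0n ltnS -sq.
    by apply: map_f; rewrite mem_filter hj wlist_mem // size_takel.
  exists (x, hp b' (last a' (take j q)) (drop j q) x') => /=; first by split => //; apply: hp01.
  by rewrite -hp_cat cat_take_drop.
(* For each word length [j], the selected [w'] have [s']-powers of widths at least [(k * rho) ^ s']
   and of total at most [D'], which bounds their number; the count of lengths gives the linear
   factor. *)
have row_le w : adm B a w -> \sum_(u <- row w) u.2 `^ (s + s' + e) <=
    (c * m).+1%:R * (D' * (k `^ s')^-1 * (2 * L) `^ (s + s' + e)) * width (hp b a w) `^ (s + e).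
  move=> aw; have w0 := width_hp_gt0 b aw; set rho := width (hp b a w) in w0 *.
  rewrite /row big_flatten big_map.
  apply: le_trans (_ : \sum_(0 <= j < (c * m).+1)
     D' * (k `^ s')^-1 * (2 * L) `^ (s + s' + e) * rho `^ (s + e) <= _); last first.
    by rewrite sumr_const_nat subn0 -[leLHS]mulr_natl !mulrA.
  apply: ler_sum => j _; rewrite big_map /= -/rho.
  rewrite powRM ?mulr_ge0 ?(ltW L0) ?(ltW w0) // (_ : rho `^ (s + s' + e) = rho `^ s' * rho `^ (s + e)); last first.
    by rewrite -powRD ?(gt_eqF w0) ?implybT //; congr (_ `^ _); ring.
  apply: le_trans (_ : \sum_(w' <- wlist B' a' j) (width (hp b' a' w') `^ s' *
     ((k `^ s')^-1 * (2 * L) `^ (s + s' + e) * rho `^ (s + e))) <= _); last first.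
    rewrite -mulr_suml sum_wlist -!mulrA ler_wpM2r //; last exact: hD'.
    by rewrite !mulr_ge0 ?invr_ge0 ?powR_ge0.
  rewrite /stops big_filter; apply: le_trans (_ : \sum_(w' <- wlist B' a' j | k * rho <= width (hp b' a' w') <= rho)
     (width (hp b' a' w') `^ s' * ((k `^ s')^-1 * (2 * L) `^ (s + s' + e) * rho `^ (s + e))) <= _).
    apply: ler_sum => w' /andP[kw _].
    have h1 : k `^ s' * rho `^ s' <= width (hp b' a' w') `^ s'.
      rewrite -powRM ?(ltW k0) ?(ltW w0) //; apply: ge0_ler_powR; rewrite ?nnegrE ?normr_ge0 //.
      by rewrite mulr_ge0 ?(ltW k0) ?(ltW w0).
    rewrite -mulrA in h1 *; rewrite !mulrA ler_wpM2r ?powR_ge0 //.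
    rewrite [leLHS]mulrC ler_wpM2r ?powR_ge0 //.
    by rewrite ler_pdivlMr ?powR_gt0 // mulrC.
  rewrite big_mkcond /=; apply: ler_sum => w' _; case: ifP => // _.
  by rewrite !mulr_ge0 ?invr_ge0 ?powR_ge0.
rewrite big_flatten big_map /=.
apply: le_trans (_ : \sum_(w <- wlist B a m) (c * m).+1%:R * (D' * (k `^ s')^-1 * (2 * L) `^ (s + s' + e)) *
   width (hp b a w) `^ (s + e) <= _).
  by rewrite !big_seq; apply: ler_sum => w /mem_wlist[_ aw]; apply: row_le.
rewrite -mulr_sumr sum_wlist -/(wsum b a m (s + e)).
have h1 : wsum b a m (s + e) <= (blam b `^ e) ^+ m * D.
  apply: le_trans (wsum_powR b a m s0 e0) _.
  rewrite (_ : (blam b ^+ m) `^ e = (blam b `^ e) ^+ m); last first.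
    by rewrite -powR_mulrn // -powRrM mulrC powRrM powR_mulrn // powR_ge0.
  by rewrite ler_wpM2l ?exprn_ge0 ?powR_ge0.
apply: le_trans (ler_wpM2l _ h1) _; first by rewrite !mulr_ge0 ?invr_ge0 ?powR_ge0.
move: hm; rewrite ler_pdivlMr // => hm; apply: le_trans hm.
rewrite /T mulrDr mulr1 ler_wpDr ?mulr_ge0 ?exprn_ge0 ?powR_ge0 //.
by rewrite le_eqVlt; apply/orP; left; apply/eqP; ring.
Qed.

End ProductCover.

Lemma Kpt_split (R : realType) (A : finType) (B : {set A * A}) (r : \bar R) (g : expanding_map B r)
    (b : branches R B) a t : linked g b -> Kpt b a t ->
  exists c x, [/\ (a, c) \in B, Kpt b c x & t = ibr b a c x].
Proof.
move=> lk Kt; have Ct := Kpt_cantor lk Kt; have [c /= ac ht] := Ct 0%N I; rewrite in_itv /= in ht.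
have [_ _ h2 _] := lk; have [_ e] := h2 a c t ac ht.
by exists c, (efun g a c t); split => //; apply: (Kpt_image lk ac ht Ct).
Qed.

Lemma hp_small (R : realType) (A : finType) (B : {set A * A}) (b : branches R B) (sc rho : R) :
  0 < rho -> exists n0, forall a w x y, (n0 <= size w)%N -> adm B a w -> 0 <= x <= 1 -> 0 <= y <= 1 ->
    `|sc * hp b a w x - sc * hp b a w y| <= rho.
Proof.
move=> r0; have s0 : 0 < `|sc| + 1 by rewrite ltr_wpDl.
have [n0 h] := eventually_small b s0 r0; exists n0 => a w x y hn aw hx hy.
rewrite -mulrBr normrM; apply: le_trans (ltW (h _ hn)).
apply: ler_pM => //; first by rewrite lerDl.
apply: le_trans (hp_le b aw hx hy) _; rewrite -[leRHS]mulr1 ler_wpM2l ?exprn_ge0 ?(ltW (blam_gt0 b)) //.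
by case/andP: hx => ? ?; case/andP: hy => ? ?; rewrite ler_norml; apply/andP; split; lra.
Qed.

Section UpperBound.
Variables (R : realType) (A A' : finType) (B : {set A * A}) (B' : {set A' * A'}) (r r' : \bar R).
Variables (g : expanding_map B r) (g' : expanding_map B' r') (b : branches R B) (b' : branches R B').
Hypotheses (lk : linked g b) (lk' : linked g' b').
Variables (pl : placement R A) (pl' : placement R A').
Variables (f : R * R -> R) (U : set (R * R)).
Hypothesis hU : open U.
Hypothesis hf : C1_on_open U f.
Hypothesis hKU : regular_cantor g pl `*` regular_cantor g' pl' `<=` U.

Definition rect_image a a' (v : seq A * seq A') : set R :=
  [set y | exists t t', [/\ Kpt b (last a v.1) t, Kpt b' (last a' v.2) t' &
     y = f (place pl (a, hp b a v.1 t), place pl' (a', hp b' a' v.2 t'))]].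

Lemma rect_limit a a' (p : nat -> seq A * seq A') : p 0%N = ([::], [::]) ->
  (forall n, adm B a (p n).1 /\ adm B' a' (p n).2) ->
  (forall n, exists c c', p n.+1 = (rcons (p n).1 c, rcons (p n).2 c')) ->
  exists z, U z /\ forall rho : R, 0 < rho -> exists n, forall t t', 0 <= t <= 1 -> 0 <= t' <= 1 ->
    `|place pl (a, hp b a (p n).1 t) - z.1| <= rho /\
    `|place pl' (a', hp b' a' (p n).2 t') - z.2| <= rho.
Proof.
move=> p0 pa ps.
have sz n : size (p n).1 = n /\ size (p n).2 = n.
  elim: n => [|n [IH1 IH2]]; first by rewrite p0.
  by have [c [c' ->]] := ps n; rewrite /= !size_rcons IH1 IH2.
have [||t ht] := @nested_words R A B b (fun n => (p n).1) a (fun n => (pa n).1).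
- by move=> n; have [c [c' ->]] := ps n; exists [:: c]; rewrite cats1.
- exact: (linked_onto lk).
have [||t' ht'] := @nested_words R A' B' b' (fun n => (p n).2) a' (fun n => (pa n).2).
- by move=> n; have [c [c' ->]] := ps n; exists [:: c']; rewrite cats1.
- exact: (linked_onto lk').
exists (place pl (a, t), place pl' (a', t')); split.
  apply: hKU; split => /=.
    exists (a, t) => //; apply: (Kpt_cantor lk).
    by apply: (@Kpt_of_words _ _ _ _ _ _ (fun n => (p n).1)) => [n|n|n]; [case: (pa n)|case: (sz n) => ->|].
  exists (a', t') => //; apply: (Kpt_cantor lk').
  by apply: (@Kpt_of_words _ _ _ _ _ _ (fun n => (p n).2)) => [n|n|n]; [case: (pa n)|case: (sz n) => _ ->|].
move=> rho r0; have [n1 h1] := hp_small b (scale pl a) r0.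
have [n2 h2] := hp_small b' (scale pl' a') r0; exists (n1 + n2)%N => u u' hu hu'.
have [x hx tx] := ht (n1 + n2)%N; have [x' hx' tx'] := ht' (n1 + n2)%N.
have [s1 s2] := sz (n1 + n2)%N; have [q1 q2] := pa (n1 + n2)%N.
split; rewrite /place /=.
  rewrite tx opprD addrACA subrr add0r; apply: h1 => //; by rewrite s1 leq_addr.
by rewrite tx' opprD addrACA subrr add0r; apply: h2 => //; rewrite s2 leq_addl.
Qed.

Lemma HD_image_le s : 0 <= s ->
  (forall L F c c', 0 < L -> lip2 L F ->
     coverable s [set y | exists t t', [/\ Kpt b c t, Kpt b' c' t' & y = F t t']]) ->
  (HD (f @` (regular_cantor g pl `*` regular_cantor g' pl')) <= s%:E)%E.
Proof.
move=> s0 hs; apply: HD_le_covers => //.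
apply: (@coverable_union R (A * A')%type s _ (fun v => rect_image v.1 v.2 ([::], [::]))) => [x|[a a'] /=].
  move=> [[y y'] /= [[[a t] Kt <-] [[a' t'] Kt' <-]] <-]; exists (a, a'), t, t'.
  by split => //; [apply: (cantor_Kpt lk)|apply: (cantor_Kpt lk')].
apply: contrapT => hno.
pose G (v : seq A * seq A') := [/\ adm B a v.1, adm B' a' v.2 & ~ coverable s (rect_image a a' v)].
pose S (v v' : seq A * seq A') := exists c c', v' = (rcons v.1 c, rcons v.2 c').
have [||p [p0 hpn]] := @dependent_path _ G S ([::], [::]).
- by split.
- move=> v [v1 v2 hv]; apply: contrapT => hno'; apply: hv.
  pose ok (c : A * A') := ((last a v.1, c.1) \in B) && ((last a' v.2, c.2) \in B').
  apply: (@coverable_union R (A * A')%type s _ (fun c =>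
     if ok c then rect_image a a' (rcons v.1 c.1, rcons v.2 c.2) else set0)) => [y|[c c']].
    move=> [t [t' [Kt Kt' ->]]].
    have [c [x [ac Kx ->]]] := Kpt_split lk Kt; have [c' [x' [ac' Kx' ->]]] := Kpt_split lk' Kt'.
    exists (c, c'); rewrite /ok /= ac ac' /=; exists x, x' => /=; rewrite !last_rcons; split => //.
    by rewrite -!cats1 !hp_cat.
  case: ifP => [/andP[/= ac ac']|_]; last exact: coverable0.
  apply: contrapT => hc; apply: hno'; exists (rcons v.1 c, rcons v.2 c'); split; first by exists c, c'.
  by split => //=; rewrite -cats1 adm_cat ?v1 ?v2 /= ?ac ?ac'.
have [|n|n|z [Uz hz]] := @rect_limit a a' p.
- exact: p0.
- by have [[]] := hpn n.
- by have [] := hpn n.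
have [L [rho [L0 r0 hL]]] := locally_lipschitz hU hf Uz.
have [n hn] := hz rho r0; have [[q1 q2]] := (hpn n).1; apply.
pose M := L * (1 + `|scale pl a| + `|scale pl' a'|).
have M0 : 0 < M by rewrite mulr_gt0 // -addrA ltr_pwDl // addr_ge0.
apply: (hs M (fun t t' => f (place pl (a, hp b a (p n).1 t), place pl' (a', hp b' a' (p n).2 t'))) _ _ M0).
move=> t t' u u' ht ht' hu hu'; have [z1 z2] := hn t t' ht ht'; have [z3 z4] := hn u u' hu hu'.
apply: le_trans (hL _ _ _ _ z1 z2 z3 z4) _; rewrite /M -mulrA ler_pM2l //.
have sc (X : finType) (pX : placement R X) x (BX : {set X * X}) (bX : branches R BX) w y y' : adm BX x w -> 0 <= y <= 1 -> 0 <= y' <= 1 ->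
    `|place pX (x, hp bX x w y) - place pX (x, hp bX x w y')| <= `|scale pX x| * `|y - y'|.
  move=> xw hy hy'; rewrite /place /= opprD addrACA subrr add0r -mulrBr normrM ler_wpM2l //.
  apply: le_trans (hp_le bX xw hy hy') _; rewrite -[leRHS]mul1r ler_wpM2r //.
  by rewrite exprn_ile1 ?(ltW (blam_lt1 bX)) // (ltW (blam_gt0 bX)).
apply: le_trans (lerD (sc _ pl a _ b _ _ _ q1 ht hu) (sc _ pl' a' _ b' _ _ _ q2 ht' hu')) _.
rewrite -subr_ge0 (_ : _ - _ = (1 + `|scale pl' a'|) * `|t - u| + (1 + `|scale pl a|) * `|t' - u'|); last by ring.
by rewrite addr_ge0 // mulr_ge0 // addr_ge0.
Qed.

Hypotheses (hB : mixing_subshift B) (hB' : mixing_subshift B').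

Lemma HD_image_le1 : (HD (f @` (regular_cantor g pl `*` regular_cantor g' pl')) <= 1%:E)%E.
Proof.
apply: HD_le_lim => s s1; apply: HD_image_le; first by rewrite ltW // (lt_trans ltr01).
move=> L F c c' L0 hF d e d0 e0; have [u [h1 h2 h3]] := coverable_lip_gt1 s1 L0 hF d0 e0.
exists u; split => // x [t [t' [Kt Kt' ->]]]; apply: h2; exists t, t'; split => //.
  exact: Kpt01 Kt.
exact: Kpt01 Kt'.
Qed.

Lemma HD_image_le_sum : (HD (f @` (regular_cantor g pl `*` regular_cantor g' pl')) <=
  HD (regular_cantor g pl) + HD (regular_cantor g' pl'))%E.
Proof.
have h0 := HD_ge0 (regular_cantor g pl); have h0' := HD_ge0 (regular_cantor g' pl').
have : exists x, HD (regular_cantor g pl) = x by exists (HD (regular_cantor g pl)).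
have : exists x, HD (regular_cantor g' pl') = x by exists (HD (regular_cantor g' pl')).
move=> [[y| |] Ey] [[x| |] Ex]; rewrite Ex Ey in h0 h0' * => //; rewrite ?leey //.
apply: HD_le_lim => s' hs'; pose e := (s' - (x + y)) / 3.
have e0 : 0 < e by rewrite divr_gt0 // subr_gt0.
have [|x0 [D D0 hD]] := @wsum_small R A B r g b lk hB pl (x + e).
  by rewrite Ex lte_fin ltrDl.
have [|y0 [D' D0' hD']] := @wsum_small R A' B' r' g' b' lk' hB' pl' (y + e).
  by rewrite Ey lte_fin ltrDl.
have -> : s' = (x + e) + (y + e) + e by rewrite /e; field.
apply: HD_image_le; first by rewrite !addr_ge0 // ltW.
by move=> L F c c' L0 hF; apply: (coverable_lip_sum c c' x0 y0 e0 L0 hD hD' hF).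
Qed.

End UpperBound.

(** * The lower bound *)

Lemma shrink (R : realType) (s : system R) k x : ctx s k -> 0 < x -> x <= width k ->
  exists w : seq (letter s), cmin s * x <= width (descend w k) <= x.
Proof.
move=> ck x0 xk; have [v _|no] := pickP (@predT (letter s)); last first.
  have := wt_sum s; rewrite big_pred0 // => /eqP; by rewrite eq_sym oner_eq0.
have c01 : 0 < cmax s < 1 by rewrite cmax_gt0 cmax_lt1.
have w0 := width_gt0 ck.
have [n hn] := @expr_small R _ (x / width k) c01 ltac:(by rewrite divr_gt0).
have ex : exists j, width (descend (nseq j v) k) <= x.
  exists n; apply: le_trans (width_descend_le _ ck) _; rewrite size_nseq -ler_pdivlMr //.
  exact: hn.
have [j hj jmin] := ex_minnP ex; exists (nseq j v); rewrite hj andbT.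
case: j hj jmin => [|i] hj jmin.
  apply: le_trans xk; rewrite -[leRHS]mul1r ler_wpM2r ?(ltW x0) //; exact: cmin_le1.
rewrite -addn1 nseqD descend_cat /=.
apply: le_trans (width_ge v (ctx_descend (nseq i v) ck)); rewrite ler_pM2l ?cmin_gt0 //.
by rewrite leNgt; apply/negP => /ltW /jmin; rewrite ltnn.
Qed.

Lemma descend_factor (R : realType) (s : system R) (w : seq (letter s)) (k : R -> R) : exists h : R -> R,
  (forall t, 0 <= t <= 1 -> 0 <= h t <= 1) /\ forall t, descend w k t = k (h t).
Proof.
elim: w k => [|v w IH] k; first by exists id.
have [h [h01 e]] := IH (step v k); exists (fun t => br v (h t)); split.
  by move=> t ht; apply: br01; apply: h01.
by move=> t; exact: (e t).
Qed.

(** * The tree of selected pairs of cylinders *)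

Section HorizonDimension.
Variables (R : realType) (s1 s2 : system R) (A B t0 theta : R) (M : nat).
Variables (k0 k0' : R -> R) (x0 : R) (f : R * R -> R) (E : set R).
Hypothesis t00 : 0 < t0.
Hypothesis theta0 : 0 < theta.
Hypothesis theta_c : theta < cmin2 s1 s2.
Hypothesis hM : 1 <= M%:R * theta `^ t0.
Hypothesis hor : horizon s1 s2 A B t0 theta M.
Hypothesis ck0 : ctx s1 k0.
Hypothesis ck0' : ctx s2 k0'.
Hypothesis x00 : 0 < x0.
Hypothesis wk0 : cmin2 s1 s2 * x0 <= width k0 <= x0.
Hypothesis wk0' : cmin2 s1 s2 * x0 <= width k0' <= x0.
Hypothesis almost_linear : forall t1 t2 u1 u2, 0 <= t1 <= 1 -> 0 <= t2 <= 1 ->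
  0 <= u1 <= 1 -> 0 <= u2 <= 1 ->
  `|f (k0 t1, k0' u1) - f (k0 t2, k0' u2) - (A * (k0 t1 - k0 t2) + B * (k0' u1 - k0' u2))|
    <= theta / 4 * (`|k0 t1 - k0 t2| + `|k0' u1 - k0' u2|).
Hypothesis limit_in : forall p : nat -> seq (letter s1) * seq (letter s2),
  p 0%N = ([::], [::]) ->
  (forall n, exists u u', [/\ (0 < size u)%N, (0 < size u')%N &
     p n.+1 = ((p n).1 ++ u, (p n).2 ++ u')]) ->
  exists2 y, E y & forall n, exists t u, [/\ 0 <= t <= 1, 0 <= u <= 1 &
    y = f (descend (p n).1 k0 t, descend (p n).2 k0' u)].

Let node := (nat * (seq (letter s1) * seq (letter s2)))%type.
Let x_ (n : nat) : R := theta ^+ n * x0.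
Let fits (v : node) := cmin2 s1 s2 * x_ v.1 <= width (descend v.2.1 k0) <= x_ v.1 /\
  cmin2 s1 s2 * x_ v.1 <= width (descend v.2.2 k0') <= x_ v.1.
Let img (v : node) : set R := [set y | exists t u, [/\ 0 <= t <= 1, 0 <= u <= 1 &
    y = f (descend v.2.1 k0 t, descend v.2.2 k0' u)]].

Let x_gt0 n : 0 < x_ n.
Proof. by rewrite mulr_gt0 // exprn_gt0. Qed.

Let xS n : x_ n.+1 = theta * x_ n.
Proof. by rewrite /x_ exprS mulrA. Qed.

(** A node of level [n] gets the weight [(theta ^ n * x0) ^ t0]. By [hM] its children carry at least
    this weight together, and the separation of their images gives the gap condition. *)
Lemma horizon_dim : (t0%:E <= HD E)%E.
Proof.
have theta1 : theta < 1.
  by apply: lt_le_trans theta_c _; rewrite ge_min cmin_le1.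
have hr (v : node) : exists r : seq (seq (letter s1) * seq (letter s2)), fits v ->
  [/\ uniq r, size r = M,
    forall w, w \in r -> [/\ (0 < size w.1)%N, (0 < size w.2)%N & fits (v.1.+1, (v.2.1 ++ w.1, v.2.2 ++ w.2))] &
    {in r &, forall w w', w != w' -> forall y1 y2 z1 z2, 0 <= y1 <= 1 -> 0 <= y2 <= 1 ->
      0 <= z1 <= 1 -> 0 <= z2 <= 1 ->
      theta * x_ v.1 <= `|A * (descend (v.2.1 ++ w.1) k0 y1 - descend (v.2.1 ++ w'.1) k0 y2) +
                     B * (descend (v.2.2 ++ w.2) k0' z1 - descend (v.2.2 ++ w'.2) k0' z2)|}].
  have [fv|nfv] := pselect (fits v); last by exists [::].
  have [h1 h2] := fv.
  have [r [r1 r2 r3 r4]] := hor (ctx_descend v.2.1 ck0) (ctx_descend v.2.2 ck0') (x_gt0 v.1) h1 h2.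
  exists r => _; split => //.
    move=> w wr; have [g1 g2] := r3 w wr.
    (* As [theta < cmin2], no width fits both scales [x] and [theta * x]; hence the selected words
       are nonempty and paths shrink to points. *)
    have small (W : R) : cmin2 s1 s2 * x_ v.1 <= W -> W <= theta * x_ v.1 -> False.
      move=> a1 a2; have := le_trans a1 a2; rewrite ler_pM2r ?x_gt0 //.
      by rewrite leNgt theta_c.
    split; last by split; rewrite /= xS descend_cat.
      rewrite lt0n size_eq0; apply/eqP => e; move: g1; rewrite e => /andP[_ g1].
      by apply: (small _ _ g1); case/andP: h1.
    rewrite lt0n size_eq0; apply/eqP => e; move: g2; rewrite e => /andP[_ g2].
    by apply: (small _ _ g2); case/andP: h2.
  move=> w w' wr wr' ww' y1 y2 z1 z2 hy1 hy2 hz1 hz2.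
  by rewrite !descend_cat; apply: r4.
have [r {}hr] := choice hr.
pose glue (v : node) (w : seq (letter s1) * seq (letter s2)) : node := (v.1.+1, (v.2.1 ++ w.1, v.2.2 ++ w.2)).
have glue_inj v : injective (glue v).
  move=> [w1 w2] [u1 u2] [/eqP + /eqP]; rewrite !eqseq_cat // !eqxx /=.
  by move=> /eqP -> /eqP ->.
pose W (v : node) := x_ v.1 `^ t0.
have WS v n : W (n.+1, v) = theta `^ t0 * x_ n `^ t0.
  by rewrite /W xS powRM // ltW.
apply: (@tree_dim R _ (fun v : node => [seq glue v w | w <- r v]) fits img W E t0
  ((2 / theta) `^ t0) (theta `^ t0) (0%N, ([::], [::]))).
- exact: powR_ge0.
- by rewrite powR_ge0 powR_lt1 // (ltW theta0).
- by rewrite /fits /x_ /= expr0 mul1r.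
- move=> v v' fv /mapP[w wr ->]; have [_ _ h _] := hr v fv.
  by have [] := h w wr.
- by move=> v fv; rewrite (map_inj_uniq (glue_inj v)); case: (hr v fv).
- by move=> v _; rewrite powR_gt0.
- move=> v fv; have [_ sr _ _] := hr v fv.
  rewrite big_map (eq_bigr (fun=> theta `^ t0 * x_ v.1 `^ t0)) => [|w _]; last exact: WS.
  rewrite big_const_seq count_predT sr iter_addr_0 -[leRHS]mulr_natl mulrA.
  by rewrite -[leLHS]mul1r ler_wpM2r ?powR_ge0.
- by move=> v v' fv /mapP[w wr ->]; rewrite WS.
- move=> v v' fv /mapP[w wr ->] y [t [u [ht hu ->]]] /=.
  have [h [h1 e]] := descend_factor w.1 (descend v.2.1 k0).
  have [h' [h1' e']] := descend_factor w.2 (descend v.2.2 k0').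
  exists (h t), (h' u); split; [exact: h1|exact: h1'|].
  by rewrite /= !descend_cat e e'.
- move=> v v1 v2 x y fv /mapP[w wr ->] /mapP[w' wr' ->] ww' [t1 [u1 [ht1 hu1 ->]]] [t2 [u2 [ht2 hu2 ->]]] /=.
  have [_ _ _ sep] := hr v fv.
  have wn : w != w' by apply: contraNN ww' => /eqP ->.
  have := sep w w' wr wr' wn t1 t2 u1 u2 ht1 ht2 hu1 hu2.
  have xv := x_gt0 v.1; have [/andP[_ f1] /andP[_ f2]] := fv.
  have d1 : `|descend (v.2.1 ++ w.1) k0 t1 - descend (v.2.1 ++ w'.1) k0 t2| <= x_ v.1.
    rewrite !descend_cat; have [h [h1 ->]] := descend_factor w.1 (descend v.2.1 k0).
    have [h' [h1' ->]] := descend_factor w'.1 (descend v.2.1 k0).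
    apply: le_trans f1; apply: (ctx_width (ctx_descend v.2.1 ck0)); [exact: h1|exact: h1'].
  have d2 : `|descend (v.2.2 ++ w.2) k0' u1 - descend (v.2.2 ++ w'.2) k0' u2| <= x_ v.1.
    rewrite !descend_cat; have [h [h1 ->]] := descend_factor w.2 (descend v.2.2 k0').
    have [h' [h1' ->]] := descend_factor w'.2 (descend v.2.2 k0').
    apply: le_trans f2; apply: (ctx_width (ctx_descend v.2.2 ck0')); [exact: h1|exact: h1'].
  have := almost_linear.
  have [g1 [g01 e1]] := descend_factor (v.2.1 ++ w.1) k0.
  have [g2 [g02 e2]] := descend_factor (v.2.1 ++ w'.1) k0.
  have [g3 [g03 e3]] := descend_factor (v.2.2 ++ w.2) k0'.
  have [g4 [g04 e4]] := descend_factor (v.2.2 ++ w'.2) k0'.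
  move=> /(_ _ _ _ _ (g01 t1 ht1) (g02 t2 ht2) (g03 u1 hu1) (g04 u2 hu2)).
  rewrite -e1 -e2 -e3 -e4.
  set d := f _ - f _; set l := A * _ + B * _ => al sepl.
  (* The deviation from linearity is at most [theta / 4] times two widths, half of the
     separation. *)
  have hd : theta * x_ v.1 <= `|d| + theta / 4 * (x_ v.1 + x_ v.1).
    apply: le_trans sepl _; rewrite -[l](subKr d) -[X in `|X|]/(d - (d - l)).
    apply: le_trans (ler_normB _ _) _; rewrite lerD2l; apply: le_trans al _.
    by rewrite ler_wpM2l ?lerD // divr_ge0 // ltW.
  have hd2 : x_ v.1 <= 2 / theta * `|d|.
    rewrite mulrAC ler_pdivlMr //; move: hd; lra.
  rewrite /W -powRM ?divr_ge0 ?(ltW theta0) //.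
  by apply: ge0_ler_powR; rewrite ?nnegrE ?(ltW t00) ?(ltW xv) // mulr_ge0 // divr_ge0 // ltW.
move=> p p0 hp; have [|n|y Ey hy] := limit_in (p := fun n => (p n).2).
- by rewrite p0.
- have [fn /mapP[w wr ->]] := hp n; have [_ _ h _] := hr _ fn; have [a1 a2 _] := h w wr.
  by exists w.1, w.2.
by exists y.
Qed.

End HorizonDimension.

(** The exponents must have sum below [1] even when [d + d'] exceeds [1]. The value [0] is allowed
    separately because a dimension may vanish. *)
Lemma split_dim (R : realType) (d d' : \bar R) (t0 : R) : 0 < t0 -> t0 < 1 ->
  (0 <= d)%E -> (0 <= d')%E -> (t0%:E < d + d')%E ->
  exists s s' : R, [/\ 0 <= s, 0 <= s', s = 0 \/ (s%:E < d)%E, s' = 0 \/ (s'%:E < d')%E &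
    t0 < s + s' < 1].
Proof.
move=> t00 t01; case: d => [x| |] //; case: d' => [y| |] //; rewrite ?lee_fin ?lte_fin.
- move=> x0 y0 hxy; pose t1 := (t0 + Num.min 1 (x + y)) / 2.
  have m1 : t0 < Num.min 1 (x + y) by rewrite lt_min t01.
  have m2 : Num.min 1 (x + y) <= 1 by rewrite ge_min lexx.
  have m3 : Num.min 1 (x + y) <= x + y by rewrite ge_min lexx orbT.
  have e1 : t0 < t1 by rewrite /t1; lra.
  have e2 : t1 < 1 by rewrite /t1; lra.
  have e3 : t1 < x + y by rewrite /t1; lra.
  have [lt|ge] := ltP t1 x.
    exists t1, 0; rewrite addr0 e1 e2 lte_fin; split => //; [lra|by right|by left].
  have [x00|xn0] := eqVneq x 0.
    exists 0, t1; rewrite add0r e1 e2 !lte_fin; split => //; [lra|by left|right; lra].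
  have xp : 0 < x by rewrite lt_neqAle eq_sym xn0.
  pose e := Num.min x (x + y - t1) / 2.
  have n0 : 0 < Num.min x (x + y - t1) by rewrite lt_min xp subr_gt0.
  have n1 : Num.min x (x + y - t1) <= x by rewrite ge_min lexx.
  have n2 : Num.min x (x + y - t1) <= x + y - t1 by rewrite ge_min lexx orbT.
  exists (x - e), (t1 - (x - e)); rewrite !lte_fin; split; rewrite /e; [lra|lra|right; lra|right; lra|].
  by apply/andP; split; lra.
- move=> x0 _ _; exists 0, ((t0 + 1) / 2); split => //; [lra|by left|right; exact: ltry|].
  by apply/andP; split; lra.
- move=> _ y0 _; exists ((t0 + 1) / 2), 0; split => //; [lra|right; exact: ltry|by left|].
  by apply/andP; split; lra.
move=> _ _ _; exists ((t0 + 1) / 2), 0; split => //; [lra|right; exact: ltry|by left|].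
by apply/andP; split; lra.
Qed.

Section StartingCylinder.
Variables (R : realType) (A : finType) (B : {set A * A}) (r : \bar R) (g : expanding_map B r).
Variables (b : branches R B).
Hypothesis lk : linked g b.
Hypothesis hB : mixing_subshift B.
Variable (pl : placement R A).
Variables (a : A) (t : R).
Hypothesis Kt : cantor_of g (a, t).

Lemma starting_word rho : 0 < rho -> exists w, [/\ adm B a w, last a w = a &
  forall x, 0 <= x <= 1 -> `|place pl (a, hp b a w x) - place pl (a, t)| <= rho].
Proof.
move=> r0; have [n hn] := hp_small b (scale pl a) r0.
have [q [x [sq aq hx tx]]] := cantor_Kpt lk Kt n.
have [M hM] := connecting_words hB; have [u [su au lu]] := hM M (last a q) a (leqnn M).
exists (q ++ u); split; first by rewrite adm_cat aq.
  by rewrite last_cat.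
move=> y hy; rewrite /place /= tx hp_cat opprD addrACA subrr add0r.
by apply: hn => //; [rewrite sq|apply: hp01].
Qed.

Variables (n : nat) (s : R).
Hypotheses (s0 : 0 <= s) (hc : expR (4 * bCs b) * blam b ^+ n < 1) (hs : 1 <= loop_sum b a n s).
Let S := cantor_system s0 hc hs.
Variable w : seq A.
Hypotheses (aw : adm B a w) (lw : last a w = a).
Let k := fun x => place pl (a, hp b a w x).

Lemma starting_limit (u : seq (letter S)) (p : nat -> seq (letter S)) : p 0%N = [::] ->
  (forall j, exists2 v, (0 < size v)%N & p j.+1 = p j ++ v) ->
  exists2 x, cantor_of g (a, x) & forall j, exists2 y, 0 <= y <= 1 &
    place pl (a, x) = descend (p j) (descend u k) y.
Proof.
move=> p0 hp1; pose q j := w ++ spell (u ++ p j).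
have n0 : (0 < n)%N.
  rewrite lt0n; apply/eqP => e; move: hc; rewrite e expr0 mulr1; apply/negP; rewrite -leNgt.
  by rewrite -[leLHS]expR0 ler_expR mulr_ge0 // bCs_ge0.
have szs (v : seq (loop B a n)) : (size v <= size (spell v))%N.
  elim: v => // v v' IH; rewrite /spell /= size_cat loop_size -/(spell v').
  by rewrite -addn1 addnC; apply: leq_add.
have sz j : (j <= size (p j))%N.
  elim: j => // j IH; have [v v0 ->] := hp1 j; rewrite size_cat -addn1; exact: leq_add.
have aq j : adm B a (q j) by rewrite /q adm_cat aw lw; case: (spell_adm (u ++ p j)).
have [||x hx] := @nested_words R A B b q a aq.
- move=> j; have [v _ e] := hp1 j; exists (spell v).
  by rewrite /q e -catA; congr (_ ++ _); rewrite /spell !map_cat !flatten_cat catA.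
- exact: (linked_onto lk).
have Kx : Kpt b a x.
  apply: (@Kpt_of_words _ _ _ _ _ _ q) => // j; apply: leq_trans (sz j) _.
  by rewrite /q size_cat; apply: leq_trans (leq_addl _ _); apply: leq_trans (szs _); rewrite size_cat leq_addl.
exists x; first exact: (Kpt_cantor lk).
move=> j; have [y hy e] := hx j; exists y => //.
by rewrite -descend_cat descend_spell /k e /q hp_cat lw.
Qed.

End StartingCylinder.

Section LowerBound.
Variables (R : realType) (A A' : finType) (B : {set A * A}) (B' : {set A' * A'}).
Variables (hB : mixing_subshift B) (hB' : mixing_subshift B').
Variables (g : expanding_map B (2%:E : \bar R)) (hg : ~ essentially_affine g).
Variables (r' : \bar R) (g' : expanding_map B' r').
Variables (pl : placement R A) (pl' : placement R A').
Variables (b : branches R B) (b' : branches R B').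
Hypotheses (lk : linked g b) (lk' : linked g' b').
Variables (f : R * R -> R) (U : set (R * R)).
Hypothesis hU : open U.
Hypothesis hf : C1_on_open U f.

Lemma HD_image_ge z t0 : U z -> (regular_cantor g pl `*` regular_cantor g' pl') z ->
  'D_((1, 0) : R * R) f z != 0 -> 'D_((0, 1) : R * R) f z != 0 -> 0 < t0 -> t0 < 1 ->
  (t0%:E < HD (regular_cantor g pl) + HD (regular_cantor g' pl'))%E ->
  (t0%:E <= HD (f @` (regular_cantor g pl `*` regular_cantor g' pl')))%E.
Proof.
move=> Uz [/= [[a t] Kt ez1] [[a' t'] Kt' ez2]] hA hB1 t00 t01 ht0.
have [s [s' [s0 s0' sd sd' /andP[ss1 ss2]]]] := split_dim t00 t01 (HD_ge0 _) (HD_ge0 _) ht0.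
have [eta e0 [n1 htw]] := twist_exists lk hB hg a.
have [n2 hn2] := eventually_small b (expR_gt0 (4 * bCs b)) (ltr01).
have C80 : 0 < 8 * bCs b + 1 by rewrite ltr_wpDl // mulr_ge0 // bCs_ge0.
have [n3 hn3] := eventually_small b C80 e0.
(* Loop sums are known to be large for arbitrarily large [n] only, which is why the other
   requirements on [n] were obtained for all large [n]. *)
have [n hn hs] := loop_sum_large lk hB a s0 sd (n1 + (n2 + n3))%N.
have [v1 [v2 tw]] := htw n (leq_trans (leq_addr _ _) hn).
have hc := hn2 n (leq_trans (leq_trans (leq_addr n3 n2) (leq_addl n1 _)) hn).
have hst : steerable (cantor_system s0 hc hs).
  apply: (cantor_steerable s0 hc hs (bal1 lk) e0 _ tw).
  have h3 := hn3 n (leq_trans (leq_trans (leq_addl n2 n3) (leq_addl n1 _)) hn).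
  apply: le_trans (ltW h3); rewrite ler_wpM2r ?exprn_ge0 ?(ltW (blam_gt0 b)) //.
  by rewrite lerDl.
have [n4 hn4] := eventually_small b' (expR_gt0 (4 * bCs b')) (ltr01).
have [n' hn' hs'] := loop_sum_large lk' hB' a' s0' sd' n4.
have hc' := hn4 n' hn'.
pose S := cantor_system s0 hc hs; pose S' := cantor_system s0' hc' hs'.
have c0 : 0 < cmin2 S S' by apply: cmin2_gt0.
(* [theta] comes before the starting cylinders: the tolerance [theta / 4] decides how small they
   must be, and this is harmless because [horizon] holds at all scales. *)
have [theta [M [/andP[th0 thc] hM hor]]] := horizon_exists hA hB1 (ss2 : sdim S + sdim S' < 1) hst t00 ss1 c0.
have [rho r0 hrho] := strict_differentiable hU hf Uz (divr_gt0 th0 (ltr0Sn _ 3) : 0 < theta / 4).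
have [w [aw lw near_w]] := starting_word lk hB pl Kt r0.
have [w' [aw' lw' near_w']] := starting_word lk' hB' pl' Kt' r0.
pose k := fun x => place pl (a, hp b a w x); pose k' := fun x => place pl' (a', hp b' a' w' x).
have ck : ctx S k by apply: place_ctx.
have ck' : ctx S' k' by apply: place_ctx.
(* The starting cylinders are shortened to a common scale, as [horizon] requires comparable
   widths. *)
pose x := Num.min (width k) (width k').
have x0 : 0 < x by rewrite lt_min (width_gt0 ck) (width_gt0 ck').
have [u hu] := @shrink R S k x ck x0 ltac:(by rewrite ge_min lexx).
have [u' hu'] := @shrink R S' k' x ck' x0 ltac:(by rewrite ge_min lexx orbT).
have near_k y : 0 <= y <= 1 -> `|descend u k y - z.1| <= rho.
  move=> hy; have [h [h01 ->]] := descend_factor u k; rewrite -ez1; apply: near_w; exact: h01.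
have near_k' y : 0 <= y <= 1 -> `|descend u' k' y - z.2| <= rho.
  move=> hy; have [h [h01 ->]] := descend_factor u' k'; rewrite -ez2; apply: near_w'; exact: h01.
apply: (@horizon_dim R S S' _ _ t0 theta M (descend u k) (descend u' k') x f _ t00 th0 thc hM hor) => //.
- exact: ctx_descend.
- exact: ctx_descend.
- case/andP: hu => q1 ->; rewrite andbT; apply: le_trans q1.
  by rewrite ler_wpM2r ?(ltW x0) // ge_min lexx.
- case/andP: hu' => q1 ->; rewrite andbT; apply: le_trans q1.
  by rewrite ler_wpM2r ?(ltW x0) // ge_min lexx orbT.
- move=> t1 t2 u1 u2 ht1 ht2 hu1 hu2; apply: hrho; by [apply: near_k|apply: near_k'].
move=> p p0 hp1.
have [||y Ky hy] := @starting_limit R A B _ g b lk pl a n s s0 hc hs w aw lw u (fun j => (p j).1).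
- by rewrite p0.
- by move=> j; have [v [v' [h1 h2 ->]]] := hp1 j; exists v.
have [||y' Ky' hy'] := @starting_limit R A' B' _ g' b' lk' pl' a' n' s' s0' hc' hs' w' aw' lw' u' (fun j => (p j).2).
- by rewrite p0.
- by move=> j; have [v [v' [h1 h2 ->]]] := hp1 j; exists v'.
exists (f (place pl (a, y), place pl' (a', y'))).
  by exists (place pl (a, y), place pl' (a', y')) => //; split; [exists (a, y)|exists (a', y')].
move=> j; have [e he ->] := hy j; have [e' he' ->] := hy' j.
by exists e, e'.
Qed.

End LowerBound.

Unset Implicit Arguments.
Set Strict Implicit.
Set Printing Implicit Defensive.

Theorem theorem1 (R : realType)
  (A : finType) (B : {set A * A}) (hB : mixing_subshift B)
  (g : expanding_map B (2%:E : \bar R)) (hg : ~ essentially_affine g)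
  (p : placement R A)
  (A' : finType) (B' : {set A' * A'}) (hB' : mixing_subshift B')
  (r' : \bar R) (hr' : (1%:E < r')%E) (g' : expanding_map B' r')
  (p' : placement R A')
  (f : R * R -> R) (U : set (R * R)) (hU : open U)
  (hKU : regular_cantor g p `*` regular_cantor g' p' `<=` U)
  (hf : C1_on_open U f)
  (hgrad : exists2 z : R * R, (regular_cantor g p `*` regular_cantor g' p') z &
     'D_((1, 0) : R * R) f z != 0 /\ 'D_((0, 1) : R * R) f z != 0) :
  HD (f @` (regular_cantor g p `*` regular_cantor g' p')) =
  mine 1%:E (HD (regular_cantor g p) + HD (regular_cantor g' p'))%E.
Proof.
have h12 : ((1%:E : \bar R) < 2%:E)%E by rewrite lte_fin ltr1n.
have [b lk] := expanding_branches g h12; have [b' lk'] := expanding_branches g' hr'.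
apply/eqP; rewrite eq_le; apply/andP; split.
  rewrite le_min (HD_image_le1 lk lk' hU hf hKU).
  exact: (HD_image_le_sum lk lk' hU hf hKU hB hB').
have [z Kz [hA hB1]] := hgrad.
have h0 : (0 <= mine 1%:E (HD (regular_cantor g p) + HD (regular_cantor g' p')))%E.
  by rewrite le_min lee_fin ler01 adde_ge0 ?HD_ge0.
rewrite leNgt; apply/negP => hlt.
(* A real exponent strictly between the two sides; the minimum is finite because it is at most [1]
   and nonnegative. *)
have [t0 [t1 t2]] : exists t0 : R, (HD (f @` (regular_cantor g p `*` regular_cantor g' p')) < t0%:E)%E /\
    (t0%:E < mine 1%:E (HD (regular_cantor g p) + HD (regular_cantor g' p')))%E.
  move: hlt h0; case: (mine _ _) (ge_min 1%:E 1%:E (HD (regular_cantor g p) + HD (regular_cantor g' p'))%E) => [m| |] hm.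
  - have := HD_ge0 (f @` (regular_cantor g p `*` regular_cantor g' p')).
    case: (HD _) => [x| |] //; rewrite !lee_fin !lte_fin => x0 xm m0.
    by exists ((x + m) / 2); rewrite !lte_fin; split; lra.
  - by rewrite lexx in hm.
  by [].
move: t2; rewrite lt_min lte_fin => /andP[t01 t2].
have t00 : 0 < t0 by rewrite -lte_fin; apply: le_lt_trans t1; apply: HD_ge0.
have := HD_image_ge hB hB' hg lk lk' hU hf (hKU z Kz) Kz hA hB1 t00 t01 t2.
by rewrite leNgt t1.
Qed.
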